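(* Let $n\ge 2$, $T>0$, $a_{ij}^{\alpha\beta}\in L_\infty(0,T;L_{\infty\#})$ satisfy the relaxed ellipticity condition, $\mathbf f\in L_2(0,T;\dot{\mathbf H}_\#^{-1})$ and $\mathbf u^0\in\dot{\mathbf H}_{\#\sigma}^{0}$. Let $\mathbf u$ be a Serrin-type solution on $[0,T]$ of the anisotropic Navier-Stokes initial value problem with data $\mathbf f,\mathbf u^0$, and let $\mathbf v$ be any weak solution on $[0,T]$ of the same problem (same data) satisfying the energy inequality $$\frac12\|\mathbf v(\cdot,t)\|_{\mathbf L_{2\#}}^2+\int_{0}^{t}a_{\mathbb T}(\tau;\mathbf v(\cdot,\tau),\mathbf v(\cdot,\tau))\,d\tau\le\frac12\|\mathbf u^0\|_{\mathbf L_{2\#}}^2+\int_{0}^{t}\langle\mathbf f(\cdot,\tau),\mathbf v(\cdot,\tau)\rangle_{\mathbb T}\,d\tau\quad\forall\,t\in[0,T].$$ Then $\mathbf u=\mathbf v$ on $[0,T]$.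
   Context: Spaces. $\mathbb T$ is the $n$-dimensional torus (unit cube $[0,1)^n$ with periodicity); functions/distributions on $\mathbb T$ are identified with 1-periodic ones on $\mathbb R^n$ (subscript $\#$). $\hat g(\xi)=\int_{\mathbb T}e^{-2\pi i x\cdot\xi}g(x)\,dx$, $\xi\in\mathbb Z^n$ (extended to distributions). With $\varrho(\xi)=2\pi(1+|\xi|^2)^{1/2}$ and $s\in\mathbb R$, $H^s_\#$ is the space of periodic distributions with $\|g\|_{H^s_\#}^2=\sum_{\xi\in\mathbb Z^n}\varrho(\xi)^{2s}|\hat g(\xi)|^2<\infty$; $\dot H^s_\#=\{g\in H^s_\#:\hat g(0)=0\}$. Bold letters denote $n$-component vector versions; $\dot{\mathbf H}^s_{\#\sigma}=\{\mathbf w\in\dot{\mathbf H}^s_\#:\operatorname{div}\mathbf w=0\}$. $L_{q\#}$ is the periodic Lebesgue space and $\mathbf L_{2\#}=\mathbf H^0_\#$. The dual product is $\langle g,f\rangle_{\mathbb T}=\sum_\xi\hat g(\xi)\hat f(-\xi)$ (equal to $\int_{\mathbb T}gf$ for $L_2$ functions), summed over components for vectors/matrices. $\mathbb P_\sigma:\dot{\mathbf H}^s_\#\to\dot{\mathbf H}^s_{\#\sigma}$ is the Leray (orthogonal) projector. All functions are real-valued; $'$ is the distributional time derivative; repeated indices are summed from $1$ to $n$. Operator. The viscosity tensor $\mathbb A=\{a_{kj}^{\alpha\beta}(\mathbf x,t)\}$ is real, 1-periodic in $\mathbf x$, and satisfies the symmetry conditions $a_{kj}^{\alpha\beta}=a_{\alpha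 j}^{k\beta}=a_{k\beta}^{\alpha j}$. Relaxed ellipticity condition: there is a constant $C_{\mathbb A}>0$ such that $C_{\mathbb A}\,a_{kj}^{\alpha\beta}(\mathbf x,t)\zeta_{k\alpha}\zeta_{j\beta}\ge|\zeta|^2=\zeta_{k\alpha}\zeta_{k\alpha}$ for a.e. $\mathbf x,t$ and all symmetric $\zeta\in\mathbb R^{n\times n}$ with zero trace. $E_{j\beta}(\mathbf u)=\frac12(\partial_ju_\beta+\partial_\beta u_j)$, $(\boldsymbol{\mathfrak L}\mathbf u)_k=\partial_\alpha(a_{kj}^{\alpha\beta}E_{j\beta}(\mathbf u))$, and $a_{\mathbb T}(t;\mathbf u,\mathbf v)=\langle a_{ij}^{\alpha\beta}(\cdot,t)E_{j\beta}(\mathbf u),E_{i\alpha}(\mathbf v)\rangle_{\mathbb T}$. Problem: $\mathbf u'-\boldsymbol{\mathfrak L}\mathbf u+\nabla p+(\mathbf u\cdot\nabla)\mathbf u=\mathbf f$, $\operatorname{div}\mathbf u=0$ in $\mathbb T\times(0,T)$, $\mathbf u(\cdot,0)=\mathbf u^0$. Weak solution on $[0,T]$ (for $\mathbf f\in L_2(0,T;\dot{\mathbf H}^{-1}_\#)$, $\mathbf u^0\in\dot{\mathbf H}^0_{\#\sigma}$): $\mathbf u\in L_\infty(0,T;\dot{\mathbf H}^0_{\#\sigma})\cap L_2(0,T;\dot{\mathbf H}^1_{\#\sigma})$ such that $\langle\mathbf u'(\cdot,t)+\mathbb P_\sigma[(\mathbf u(\cdot,t)\cdot\nabla)\mathbf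 u(\cdot,t)],\mathbf w\rangle_{\mathbb T}+a_{\mathbb T}(t;\mathbf u(\cdot,t),\mathbf w)=\langle\mathbf f(\cdot,t),\mathbf w\rangle_{\mathbb T}$ for a.e. $t\in(0,T)$ and all $\mathbf w\in\dot{\mathbf H}^1_{\#\sigma}$, and $\langle\mathbf u(\cdot,0),\mathbf w\rangle_{\mathbb T}=\langle\mathbf u^0,\mathbf w\rangle_{\mathbb T}$ for all $\mathbf w\in\dot{\mathbf H}^0_{\#\sigma}$. (Here $\mathbf u$ is identified with its $\dot{\mathbf H}^0_{\#\sigma}$-weakly continuous in time representative on $[0,T]$, which exists.) A Serrin-type solution is a weak solution that belongs to $L_2(0,T;\dot{\mathbf H}^{n/2}_{\#\sigma})$. *)

(* Defs.v *)
From HB Require Import structures.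
From mathcomp Require Import all_boot all_order all_algebra.
From mathcomp Require Import complex.
From mathcomp Require Import all_classical all_reals all_analysis.

Set Implicit Arguments.
Unset Strict Implicit.
Unset Printing Implicit Defensive.
Import Order.TTheory GRing.Theory Num.Theory.
Import numFieldNormedType.Exports.

Local Open Scope classical_set_scope.
Local Open Scope ring_scope.

(* MathComp-Analysis equips n.-tuple R, but not 'rV[R]_n, with the product
   sigma-algebra: measures live on tuples, calculus on row vectors, and
   [row_of] is the bridge. *)
Definition row_of (R : Type) (n : nat) (x : n.-tuple R) : 'rV[R]_n :=
  \row_i tnth x i.

Section Cube.
Context {R : realType}.

Definition cons_pair (n : nat) (p : measurableTypeR R * n.-tuple (measurableTypeR R)) :
    n.+1.-tuple (measurableTypeR R) := [the n.+1.-tuple _ of p.1 :: p.2].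

Lemma measurable_cons_pair (n : nat) : measurable_fun setT (@cons_pair n).
Proof. by apply: measurable_cons; [exact: measurable_fst|exact: measurable_snd]. Qed.

HB.instance Definition _ (n : nat) :=
  isMeasurableFun.Build _ _ _ _ (@cons_pair n) (@measurable_cons_pair n).

(* The n-fold product of Lebesgue measure on [0, 1]; the faces of the cube are
   null, so this is also the measure of the periodicity cell [0, 1)^n. *)
Fixpoint torus (n : nat) : probability (n.-tuple (measurableTypeR R)) R :=
  if n is n'.+1 then
    distribution ((uniform_prob (@ltr01 R) \x torus n')%E) (@cons_pair n')
  else \d_([tuple] : 0.-tuple (measurableTypeR R)).

End Cube.

Section Torus.
Context {R : realType} {n : nat}.

Implicit Types (x : 'rV[R]_n) (phi psi : 'rV[R]_n -> R) (xi : 'rV[int]_n).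

Definition periodic phi : Prop :=
  forall x (i : 'I_n), phi (x + delta_mx 0 i) = phi x.

Definition partial (i : 'I_n) phi : 'rV[R]_n -> R :=
  fun x => 'D_(delta_mx 0 i) phi x.

Definition partials (s : seq 'I_n) phi : 'rV[R]_n -> R := foldr partial phi s.

Definition smooth phi : Prop := forall s : seq 'I_n,
  continuous (partials s phi) /\
  forall x (i : 'I_n), derivable (partials s phi) x (delta_mx 0 i).

Definition test_fun phi : Prop := smooth phi /\ periodic phi.

Definition torus_int phi : R := \int[torus n]_(x in setT) phi (row_of x).

(* A distribution is a functional on functions that is only ever looked at on
   test functions; equality is [eq_distr]. *)
Definition pdistr : Type := ('rV[R]_n -> R) -> R.

Implicit Types g h : pdistr.

Definition is_pdistr g : Prop :=
  (forall (c : R) phi psi, test_fun phi -> test_fun psi ->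
     g (fun x => c * phi x + psi x) = c * g phi + g psi) /\
  exists (C : R) (N : nat), forall phi (M : R), test_fun phi ->
    (forall (s : seq 'I_n) x, (size s <= N)%N -> `|partials s phi x| <= M) ->
    `|g phi| <= C * M.

Definition eq_distr g h : Prop := forall phi, test_fun phi -> g phi = h phi.

Definition dpartial (i : 'I_n) g : pdistr := fun phi => - g (partial i phi).

Definition distr_of (b : 'rV[R]_n -> R) : pdistr :=
  fun phi => torus_int (fun x => b x * phi x).

Definition measurable_per (b : 'rV[R]_n -> R) : Prop :=
  periodic b /\
  measurable_fun setT (fun x : n.-tuple (measurableTypeR R) => b (row_of x)).

Definition L2per (b : 'rV[R]_n -> R) : Prop :=
  measurable_per b /\
  (\int[torus n]_(x in setT) ((b (row_of x)) ^+ 2)%:E < +oo)%E.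

(* The L_2 function with which a distribution is identified (0 if none). *)
Definition L2fun g : 'rV[R]_n -> R :=
  xget (fun=> 0) [set b | L2per b /\ eq_distr g (distr_of b)].

Definition phase xi x : R := 2 * pi * \sum_i (xi 0 i)%:~R * x 0 i.

Definition fourier g xi : R[i] :=
  (g (fun x => cos (phase xi x)) +i* - g (fun x => sin (phase xi x)))%C.

Definition rho xi : R :=
  2 * pi * Num.sqrt (1 + \sum_i ((xi 0 i)%:~R : R) ^+ 2).

Definition vdistr : Type := 'I_n -> pdistr.

Implicit Types u v w F G : vdistr.

Definition eq_vdistr u v : Prop := forall i, eq_distr (u i) (v i).
Definition vadd u v : vdistr := fun i phi => u i phi + v i phi.
Definition vsub u v : vdistr := fun i phi => u i phi - v i phi.

Definition hnorm2 (s : R) w : \bar R :=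
  (\sum_(i < n) \esum_(xi in [set: 'rV[int]_n])
     (rho xi `^ (2 * s) * Normc.normc (fourier (w i) xi) ^+ 2)%:E)%E.

Definition hnorm (s : R) w : \bar R := (hnorm2 s w `^ 2^-1)%E.

Definition Hs (s : R) : set vdistr :=
  [set w | (forall i, is_pdistr (w i)) /\ (hnorm2 s w < +oo)%E].

Definition Hdot (s : R) : set vdistr :=
  [set w | Hs s w /\ forall i, fourier (w i) 0 = 0].

Definition div_free w : Prop :=
  forall phi, test_fun phi -> \sum_i dpartial i (w i) phi = 0.

Definition Hdot_sigma (s : R) : set vdistr := [set w | Hdot s w /\ div_free w].

(* Meaningful only for absolutely summable families. *)
Definition zsum (c : 'rV[int]_n -> R) : R :=
  fine (\esum_(xi in [set: 'rV[int]_n]) (Num.max (c xi) 0)%:E) -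
  fine (\esum_(xi in [set: 'rV[int]_n]) (Num.max (- c xi) 0)%:E).

(* Distributions are real-valued, so the terms of index xi and -xi are complex
   conjugate and the sum of the series is the sum of the real parts.  The same
   applies to [hinner]. *)
Definition dual g h : R :=
  zsum (fun xi => complex.Re (fourier g xi * fourier h (- xi))).

Definition vdual u w : R := \sum_i dual (u i) (w i).

Definition hinner (s : R) u w : R :=
  \sum_i zsum (fun xi => rho xi `^ (2 * s) *
    complex.Re (fourier (u i) xi * conjc (fourier (w i) xi))).

(* The image of F under the orthogonal projection of Hdot s onto Hdot_sigma s;
   it does not depend on the s with F in Hdot s. *)
Definition is_leray F G : Prop := exists s : R,
  [/\ Hdot s F, Hdot_sigma s G &
      forall w, Hdot_sigma s w -> hinner s (vsub F G) w = 0].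

Definition leray F : vdistr := xget (fun _ _ => 0) [set G | is_leray F G].

Definition simple_in (X : set vdistr) (S : R -> vdistr) : Prop :=
  exists (m : nat) (A : 'I_m -> set (measurableTypeR R)) (c : 'I_m -> vdistr),
    (forall l, measurable (A l) /\ X (c l)) /\
    forall t i phi, S t i phi = \sum_l \1_(A l) t * c l i phi.

(* Bochner space L_q(0, T; X), where X is a subspace of H^s with the norm of
   H^s; the middle clause is strong measurability. *)
Definition Lq_time (q : \bar R) (T : R) (s : R) (X : set vdistr)
    (u : R -> vdistr) : Prop :=
  [/\ {ae @lebesgue_measure R, forall t, t \in `]0, T[ -> X (u t)},
      exists S : nat -> R -> vdistr, (forall k, simple_in X (S k)) /\
        {ae @lebesgue_measure R, forall t, t \in `]0, T[ ->
           (fun k => hnorm s (vsub (S k t) (u t))) @ \oo --> 0%E} &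
      (Lnorm (@lebesgue_measure R) q
         ((fun t => hnorm s (u t)) \_ `]0%R, T[) < +oo)%E].

Definition time_test (T : R) (psi : R -> R) : Prop :=
  (forall k t, derivable (derive1n k psi) t 1) /\
  exists c d : R, [/\ 0 < c, d < T & forall t, t \notin `[c, d] -> psi t = 0].

Definition is_time_deriv (T : R) (u D : R -> vdistr) : Prop :=
  forall psi : R -> R, time_test T psi -> forall i phi, test_fun phi ->
    \int[lebesgue_measure]_(t in `]0, T[) (D t i phi * psi t) =
    - \int[lebesgue_measure]_(t in `]0, T[) (u t i phi * derive1 psi t).

(* a k j alpha beta x t is a_{kj}^{alpha beta}(x, t). *)
Definition viscosity : Type :=
  'I_n -> 'I_n -> 'I_n -> 'I_n -> 'rV[R]_n -> R -> R.

Implicit Types a : viscosity.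

Definition ae_xt (T : R) (P : 'rV[R]_n -> R -> Prop) : Prop :=
  {ae (torus n \x @lebesgue_measure R)%E,
    forall p, p.2 \in `]0, T[ -> P (row_of p.1) p.2}.

Definition visc_Linf (T : R) a : Prop := forall k j al be,
  [/\ forall t, periodic (fun x => a k j al be x t),
      measurable_fun
        ([set: n.-tuple (measurableTypeR R)] `*`
         (`]0, T[%classic : set (measurableTypeR R)))
        (fun p => a k j al be (row_of p.1) p.2) &
      exists M : R, ae_xt T (fun x t => `|a k j al be x t| <= M)].

Definition visc_symmetric (T : R) a : Prop := forall k j al be,
  ae_xt T (fun x t => a k j al be x t = a al j k be x t /\
                      a k j al be x t = a k be al j x t).

Definition relaxed_elliptic (T : R) a : Prop := exists2 C : R, 0 < C &
  ae_xt T (fun x t => forall z : 'M[R]_n, z^T = z -> \tr z = 0 ->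
    \sum_k \sum_al z k al ^+ 2 <=
    C * \sum_k \sum_j \sum_al \sum_be a k j al be x t * z k al * z j be).

Definition strain (j be : 'I_n) u : pdistr :=
  fun phi => 2^-1 * (dpartial j (u be) phi + dpartial be (u j) phi).

Definition a_form a (t : R) u v : R :=
  \sum_i \sum_j \sum_al \sum_be
    dual (distr_of (fun x => a i j al be x t * L2fun (strain j be u) x))
         (strain i al v).

(* Component k is u_j d_j u_k, a product of two L_2 functions when u is in H^1. *)
Definition convection u : vdistr := fun k =>
  distr_of (fun x => \sum_j L2fun (u j) x * L2fun (dpartial j (u k)) x).

(* Weak solutions are represented by their weakly continuous representative,
   which is what gives u(., t) a meaning for every t in [0, T]. *)
Definition weakly_continuous (T : R) (u : R -> vdistr) : Prop :=
  (forall t, t \in `[0, T] -> Hdot_sigma 0 (u t)) /\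
  forall w, Hdot_sigma 0 w ->
    {within `[0, T], continuous (fun t => vdual (u t) w)}.

(* D is the distributional time derivative u'. The sum of the two distributions
   paired with w is the one that lies in H^-1; the two terms need not. *)
Definition weak_solution (T : R) a (f : R -> vdistr) (u0 : vdistr)
    (u : R -> vdistr) : Prop :=
  [/\ Lq_time +oo%E T 0 (Hdot_sigma 0) u,
      Lq_time 2%:E T 1 (Hdot_sigma 1) u,
      weakly_continuous T u,
      (exists (s : R) (D : R -> vdistr),
         [/\ Lq_time 1%:E T s (Hs s) D,
             is_time_deriv T u D &
             {ae @lebesgue_measure R, forall t, t \in `]0, T[ ->
                forall w, Hdot_sigma 1 w ->
                  vdual (vadd (D t) (leray (convection (u t)))) w
                    + a_form a t (u t) w
                  = vdual (f t) w}]) &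
      forall w, Hdot_sigma 0 w -> vdual (u 0) w = vdual u0 w].

Definition Serrin_solution (T : R) a (f : R -> vdistr) (u0 : vdistr)
    (u : R -> vdistr) : Prop :=
  weak_solution T a f u0 u /\
  Lq_time 2%:E T (n%:R / 2) (Hdot_sigma (n%:R / 2)) u.

Definition energy_inequality (T : R) a (f : R -> vdistr) (u0 : vdistr)
    (v : R -> vdistr) : Prop :=
  forall t, t \in `[0, T] ->
    2^-1 * fine (hnorm2 0 (v t))
      + \int[lebesgue_measure]_(tau in `[0, t]) a_form a tau (v tau) (v tau)
    <= 2^-1 * fine (hnorm2 0 u0)
      + \int[lebesgue_measure]_(tau in `[0, t]) vdual (f tau) (v tau).

End Torus.

Arguments pdistr R n : clear implicits.
Arguments vdistr R n : clear implicits.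
Arguments viscosity R n : clear implicits.

(* Main.v *)
(* Put w = v - u.  The energy inequality for v and the weak formulations of u and
   v, each tested with the Fourier truncations of the other solution, formally give
     1/2 |w(t)|^2 + int_0^t a(w, w) <= - int_0^t <(w . grad) u, w>.
   By the ellipticity condition and Korn's identity for solenoidal fields, a(w, w)
   controls |w|_{H^1}^2.  A convolution estimate for Fourier coefficients bounds the
   right-hand side by |u|_{H^{n/2}} |w|_{L_2} |w|_{H^1}, and Young's inequality
   absorbs the last factor, leaving
     |w(t)|^2 <= K int_0^t |u|_{H^{n/2}}^2 |w|^2,
   so that w = 0 by Gronwall.  As u' need not be in the dual of the space of v, the
   computation is done with truncations, for which t |-> <P_N u, P_N v> is absolutely
   continuous; the resulting errors vanish by dominated convergence. *)

(* For fields of the energy class the product [vfun u j * grad u j k] is in general only integrable,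
   so the convective term can be paired with trigonometric polynomials but not with another weak
   solution; every trilinear form below keeps one smooth factor, and the cancellations are used only
   there. The exponent n/2 is critical: that space does not embed into the bounded functions. The
   estimate rests instead on the fact that the sum of (1 + |eta|)^(2 - n) over a ball of radius r
   grows like r^2, the square of one derivative. Real modes cos and sin are indexed by all of Z^n,
   so each nonzero frequency occurs twice up to sign and Fourier expansions carry no factor 2.
   Exceptional null sets are collected in a measurable set [E] of full measure on which all
   coefficients are measurable in time, and integrals over intervals are moved to [E]. The
   completeness of the trigonometric system comes from an algebra of bounded multipliers, the
   absolute continuity of each Fourier coefficient in time from cutoffs built out of exp(-1/x). *)
From HB Require Import structures.
From mathcomp Require Import all_boot all_order all_algebra.
From mathcomp Require Import complex ring lra zify.
From mathcomp Require Import all_classical all_reals all_analysis measurable_realfun ess_sup_inf.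
(* Last, because MathComp-Analysis has its own [periodic]. *)
Require Import Defs.

Set Implicit Arguments.
Unset Strict Implicit.
Unset Printing Implicit Defensive.
Import Order.TTheory GRing.Theory Num.Theory.
Import numFieldNormedType.Exports.
Local Open Scope classical_set_scope.
Local Open Scope ring_scope.

(** * Integration *)

Section Integrals.
Context d (T : measurableType d) (R : realType) (mu : {measure set T -> \bar R}).
Variables (D : set T) (mD : measurable D).
Implicit Types f g h : T -> R.

Local Notation itg f := (mu.-integrable D (EFin \o f)).
Local Notation RI f := (Rintegral mu D f).

Lemma itg_measurable f : itg f -> measurable_fun D f.
Proof. by move=> /measurable_int /measurable_EFinP. Qed.

Lemma itgD f g : itg f -> itg g -> itg (fun x => f x + g x).
Proof. by move=> h1 h2; have := integrableD mD h1 h2. Qed.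

Lemma itgB f g : itg f -> itg g -> itg (fun x => f x - g x).
Proof. by move=> h1 h2; have := integrableB mD h1 h2. Qed.

Lemma itgZl c f : itg f -> itg (fun x => c * f x).
Proof. by move=> h1; have := integrableZl mD c h1. Qed.

Lemma itg0 : itg (fun=> 0).
Proof. exact: integrable0. Qed.

Lemma itg_eq f g : (forall x, D x -> f x = g x) -> itg f -> itg g.
Proof. by move=> fg; apply: eq_integrable => // x /set_mem Dx; rewrite /= fg. Qed.

Lemma itg_sum I (r : seq I) (P : pred I) (F : I -> T -> R) :
  (forall i, P i -> itg (F i)) -> itg (fun x => \sum_(i <- r | P i) F i x).
Proof.
move=> h; elim: r => [|i r IH].
  by apply: itg_eq itg0 => x _; rewrite big_nil.
case Pi : (P i).
  apply: itg_eq (itgD (h i Pi) IH) => x _; by rewrite big_cons Pi.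
by apply: itg_eq IH => x _; rewrite big_cons Pi.
Qed.

Lemma itg_le f g : measurable_fun D f -> (forall x, D x -> `|f x| <= g x) ->
  itg g -> itg f.
Proof.
move=> mf fg ig; apply: (le_integrable mD _ _ ig); first exact/measurable_EFinP.
move=> x Dx; rewrite /= lee_fin; apply: le_trans (fg x Dx) _; exact: ler_norm.
Qed.

Lemma itg_bddM f g (M : R) : itg f -> measurable_fun D g ->
  (forall x, D x -> `|g x| <= M) -> itg (fun x => g x * f x).
Proof.
move=> If mg gM.
apply: (@itg_le _ (fun x => M * `|f x|)).
- apply: measurable_funM => //; exact: itg_measurable.
- by move=> x Dx; rewrite normrM ler_wpM2r ?gM.
- apply: itgZl; exact: (integrable_abse If).
Qed.

Lemma RI_eq f g : (forall x, D x -> f x = g x) -> RI f = RI g.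
Proof. by move=> fg; apply: eq_Rintegral => x /set_mem; exact: fg. Qed.

Lemma RID f g : itg f -> itg g -> RI (fun x => f x + g x) = RI f + RI g.
Proof. exact: RintegralD. Qed.

Lemma RIB f g : itg f -> itg g -> RI (fun x => f x - g x) = RI f - RI g.
Proof. exact: RintegralB. Qed.

Lemma RIZl c f : itg f -> RI (fun x => c * f x) = c * RI f.
Proof. by move=> If; rewrite RintegralZl. Qed.

Lemma RI0 : RI (fun=> 0) = 0.
Proof. by rewrite /Rintegral integral0. Qed.

Lemma RI_sum I (r : seq I) (P : pred I) (F : I -> T -> R) :
  (forall i, P i -> itg (F i)) ->
  RI (fun x => \sum_(i <- r | P i) F i x) = \sum_(i <- r | P i) RI (F i).
Proof.
move=> h; elim: r => [|i r IH].
  by rewrite big_nil -[RHS]RI0; apply: RI_eq => x _; rewrite big_nil.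
rewrite big_cons -IH; case Pi : (P i).
  rewrite -RID; [|exact: h|exact: itg_sum].
  by apply: RI_eq => x _; rewrite big_cons Pi.
by apply: RI_eq => x _; rewrite big_cons Pi.
Qed.

Lemma RI_le f g : itg f -> itg g -> (forall x, D x -> f x <= g x) -> RI f <= RI g.
Proof. by move=> If Ig fg; apply: le_Rintegral. Qed.

Lemma RI_ge0 f : (forall x, D x -> 0 <= f x) -> 0 <= RI f.
Proof. exact: Rintegral_ge0. Qed.

Lemma RI_norm f : itg f -> `|RI f| <= RI (fun x => `|f x|).
Proof. exact: le_normr_Rintegral. Qed.

Lemma RI_EFin f : itg f -> (RI f)%:E = (\int[mu]_(x in D) (f x)%:E)%E.
Proof. by move=> If; rewrite /Rintegral fineK//; exact: integrable_fin_num. Qed.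

Lemma RI_dct (f_ : nat -> T -> R) f g :
  (forall n, measurable_fun D (f_ n)) -> measurable_fun D f ->
  {ae mu, forall x, D x -> (fun n => f_ n x) @ \oo --> f x} ->
  itg g -> {ae mu, forall x, forall n, D x -> `|f_ n x| <= g x} ->
  itg f /\ (fun n => RI (f_ n)) @ \oo --> RI f.
Proof.
move=> mf_ mf cf Ig fg.
have [] := @dominated_convergence _ _ _ mu D mD (fun n x => (f_ n x)%:E)
  (EFin \o f) (EFin \o g).
- by move=> n; exact/measurable_EFinP.
- exact/measurable_EFinP.
- by apply: filterS cf => x h Dx; apply: cvg_EFin; [near=> n|exact: h].
- exact: Ig.
- by apply: filterS fg => x h n Dx; rewrite /= lee_fin; exact: h.
move=> If _ h; split => //.
rewrite /Rintegral; apply: fine_cvg; rewrite fineK ?integrable_fin_num//.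
Unshelve. all: end_near. Qed.

Definition sqi f := measurable_fun D f /\ itg (fun x => f x ^+ 2).

Lemma sqi_ltP f : measurable_fun D f ->
  (\int[mu]_(x in D) ((f x) ^+ 2)%:E < +oo)%E -> sqi f.
Proof.
move=> mf h; split => //; apply/integrableP; split.
  apply/measurable_EFinP; exact: measurable_funX.
by under eq_integral => x _ do rewrite /= ger0_norm ?sqr_ge0//.
Qed.

Lemma sqi_lt f : sqi f -> (\int[mu]_(x in D) ((f x) ^+ 2)%:E < +oo)%E.
Proof. by move=> [mf If]; rewrite -RI_EFin// ltry. Qed.

Lemma sqi_eq f g : (forall x, D x -> f x = g x) -> sqi f -> sqi g.
Proof.
move=> fg [mf If]; split; last by apply: itg_eq If => x Dx; rewrite fg.
by apply: eq_measurable_fun mf => x /set_mem; exact: fg.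
Qed.

Lemma sqiM f g : sqi f -> sqi g -> itg (fun x => f x * g x).
Proof.
move=> [mf If] [mg Ig].
apply: (@itg_le _ (fun x => f x ^+ 2 + g x ^+ 2)); last exact: itgD.
  exact: measurable_funM.
move=> x Dx; rewrite normrM -(real_normK (num_real (f x))) -(real_normK (num_real (g x))).
have := sqr_ge0 (`|f x| - `|g x|); have := normr_ge0 (f x); have := normr_ge0 (g x).
nra.
Qed.

Lemma sqi_bddM f g (M : R) : sqi f -> measurable_fun D g ->
  (forall x, D x -> `|g x| <= M) -> sqi (fun x => g x * f x).
Proof.
move=> [mf If] mg gM; split; first exact: measurable_funM.
have := @itg_bddM _ (fun x => g x ^+ 2) (M ^+ 2) If.
move=> h; apply: itg_eq (h _ _); first by move=> x _; rewrite /= exprMn.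
- exact: measurable_funX.
- move=> x Dx; rewrite normrX; have := gM x Dx; have := normr_ge0 (g x); nra.
Qed.

Lemma sqiZl c f : sqi f -> sqi (fun x => c * f x).
Proof. by move=> h; apply: (@sqi_bddM _ (cst c) `|c|). Qed.

Lemma sqiD f g : sqi f -> sqi g -> sqi (fun x => f x + g x).
Proof.
move=> [mf If] [mg Ig]; split; first exact: measurable_funD.
apply: (@itg_le _ (fun x => 2 * (f x ^+ 2 + g x ^+ 2))).
- by apply: measurable_funX; exact: measurable_funD.
- move=> x _; rewrite ger0_norm ?sqr_ge0//.
  have := sqr_ge0 (f x - g x); nra.
- by apply: itgZl; exact: itgD.
Qed.

Lemma sqiN f : sqi f -> sqi (fun x => - f x).
Proof. by move=> /(sqiZl (-1)); apply: sqi_eq => x _; rewrite mulN1r. Qed.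

Lemma sqiB f g : sqi f -> sqi g -> sqi (fun x => f x - g x).
Proof. by move=> h1 h2; exact: (sqiD h1 (sqiN h2)). Qed.

Lemma CS f g : sqi f -> sqi g ->
  (RI (fun x => f x * g x)) ^+ 2 <= RI (fun x => f x ^+ 2) * RI (fun x => g x ^+ 2).
Proof.
move=> Lf Lg; set B := RI _; set A := RI _; set C := RI _.
have pos (s t : R) : 0 <= s ^+ 2 * A + 2 * s * t * B + t ^+ 2 * C.
  have : 0 <= RI (fun x => (s * f x + t * g x) ^+ 2).
    by apply: RI_ge0 => x _; exact: sqr_ge0.
  suff -> : RI (fun x => (s * f x + t * g x) ^+ 2) =
    s ^+ 2 * A + 2 * s * t * B + t ^+ 2 * C by [].
  rewrite /A /B /C -!RIZl ?Lf.2 ?Lg.2 ?sqiM//.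
  have I1 := itgZl (s ^+ 2) Lf.2.
  have I2 := itgZl (2 * s * t) (sqiM Lf Lg).
  have I3 := itgZl (t ^+ 2) Lg.2.
  have I12 := itgD I1 I2.
  rewrite -(RID I1 I2) -(RID I12 I3).
  by apply: RI_eq => x _; ring.
have A0 : 0 <= A by apply: RI_ge0 => x _; exact: sqr_ge0.
(* [pos] is a nonnegative quadratic form in [s] and [t]. If its leading coefficient vanishes, a
   nonzero [B] would give it the value -1 at the point chosen here; otherwise its value at
   [(- B, A)] is [A * (A * C - B ^+ 2)]. *)
have [A_0|A_neq0] := eqVneq A 0.
  have [->|B0] := eqVneq B 0; first by rewrite A_0 mul0r expr0n.
  have := pos (- (C + 1) / (2 * B)) 1; rewrite A_0 mulr0 add0r.
  have -> : 2 * (- (C + 1) / (2 * B)) * 1 * B + 1 ^+ 2 * C = -1.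
    by field.
  by rewrite ler0N1.
have := pos (- B) A.
have -> : (- B) ^+ 2 * A + 2 * - B * A * B + A ^+ 2 * C = A * (A * C - B ^+ 2) by ring.
rewrite pmulr_rge0 ?lt_def ?A_neq0//; lra.
Qed.

Lemma RI_sq_le1 f : sqi f -> mu D = 1%E -> itg f /\ (RI f) ^+ 2 <= RI (fun x => f x ^+ 2).
Proof.
move=> Lf mu1.
have L1 : sqi (cst 1).
  split => //; apply: (@itg_eq (cst 1)); first by move=> x _; rewrite expr1n.
  apply/integrableP; split; first exact/measurable_EFinP.
  under eq_integral do rewrite /= normr1.
  by rewrite integral_cst// mu1 mule1 ltry.
have := CS Lf L1.
have e1 : (fun x => f x * cst 1 x) = f by apply/funext => x; rewrite mulr1.
have := sqiM Lf L1; rewrite e1 => If; rewrite ?e1.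
have -> : RI (fun x => cst 1 x ^+ 2) = 1.
  rewrite (@RI_eq _ (cst 1)); last by move=> x _; rewrite expr1n.
  by rewrite Rintegral_cst// mu1 /= mulr1.
by rewrite mulr1.
Qed.

Lemma cvg0_sq (x : nat -> R) : (fun n => x n ^+ 2) @ \oo --> 0 -> x @ \oo --> 0.
Proof.
move=> /cvgrPdist_lt h; apply/cvgrPdist_lt => e e0.
have e20 : 0 < e ^+ 2 by rewrite exprn_gt0.
have := h _ e20; apply: filterS => n; rewrite !sub0r !normrN normrX.
by rewrite ltr_sqr // nnegrE ?normr_ge0 // ltW.
Qed.

Lemma squeeze0 (x y : nat -> R) : (forall n, `|x n| <= y n) -> y @ \oo --> 0 -> x @ \oo --> 0.
Proof.
move=> xy y0; apply: norm_cvg0; apply: (@squeeze_cvgr _ _ _ _ (cst 0) y) => //.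
  by near=> n; rewrite normr_ge0 xy.
exact: cvg_cst.
Unshelve. all: end_near. Qed.

(** The difference of the products splits into (f_n - f)(g_n - g) + (f_n - f) g + f (g_n - g), and
    Cauchy-Schwarz sends each term to 0. The bounded factor [h] makes the lemma usable for trilinear
    integrals with one smooth factor. *)
Lemma RI_cvgM (f_ g_ : nat -> T -> R) f g h (M : R) :
  (forall n, sqi (f_ n)) -> (forall n, sqi (g_ n)) -> sqi f -> sqi g ->
  measurable_fun D h -> (forall x, D x -> `|h x| <= M) ->
  (fun n => RI (fun x => (f_ n x - f x) ^+ 2)) @ \oo --> 0 ->
  (fun n => RI (fun x => (g_ n x - g x) ^+ 2)) @ \oo --> 0 ->
  (fun n => RI (fun x => f_ n x * g_ n x * h x)) @ \oo --> RI (fun x => f x * g x * h x).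
Proof.
move=> Lf_ Lg_ Lf Lg mh hM cf cg.
have key (p_ q_ : nat -> T -> R) : (forall n, sqi (p_ n)) -> (forall n, sqi (q_ n)) ->
    (fun n => RI (fun x => (p_ n x) ^+ 2) * RI (fun x => (q_ n x) ^+ 2)) @ \oo --> 0 ->
    (fun n => RI (fun x => p_ n x * q_ n x * h x)) @ \oo --> 0.
  move=> Lp Lq cpq; apply: cvg0_sq.
  apply: (@squeeze0 _ (fun n => RI (fun x => (p_ n x) ^+ 2) *
     (M ^+ 2 * RI (fun x => (q_ n x) ^+ 2)))).
    move=> n; rewrite ger0_norm ?sqr_ge0//.
    have Lqh : sqi (fun x => q_ n x * h x).
      apply: sqi_eq (sqi_bddM (Lq n) mh hM) => x _; by rewrite mulrC.
    have := CS (Lp n) Lqh.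
    under RI_eq do rewrite mulrA.
    move=> /le_trans; apply; apply: ler_wpM2l.
      by apply: RI_ge0 => x _; exact: sqr_ge0.
    rewrite -RIZl ?(Lq n).2//; apply: RI_le.
    - exact: Lqh.2.
    - apply: itgZl; exact: (Lq n).2.
    - move=> x Dx; rewrite exprMn mulrC; apply: ler_wpM2r; first exact: sqr_ge0.
      rewrite -(real_normK (num_real (h x))) ler_sqr ?nnegrE//; last exact: le_trans (hM x Dx).
      exact: hM.
  rewrite [X in X @ _ --> _](_ : _ = fun n => M ^+ 2 * (RI (fun x => (p_ n x) ^+ 2) *
     RI (fun x => (q_ n x) ^+ 2))); last by apply/funext => n; ring.
  rewrite -(mulr0 (M ^+ 2)); exact: cvgM (cvg_cst _) cpq.
pose fd n x := f_ n x - f x; pose gd n x := g_ n x - g x.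
have Lfd n : sqi (fd n) by exact: sqiB.
have Lgd n : sqi (gd n) by exact: sqiB.
have c1 : (fun n => RI (fun x => fd n x * gd n x * h x)) @ \oo --> 0.
  by apply: key => //; rewrite -(mulr0 0); exact: cvgM cf cg.
have c2 : (fun n => RI (fun x => fd n x * g x * h x)) @ \oo --> 0.
  apply: (key _ (fun=> g)) => //.
  by rewrite -(mul0r (RI (fun x => g x ^+ 2))); exact: cvgM cf (cvg_cst _).
have c3 : (fun n => RI (fun x => f x * gd n x * h x)) @ \oo --> 0.
  apply: (key (fun=> f)) => //.
  by rewrite -(mulr0 (RI (fun x => f x ^+ 2))); exact: cvgM (cvg_cst _) cg.
have Ih p q : sqi p -> sqi q -> itg (fun x => p x * q x * h x).
  move=> Lp Lq; apply: itg_eq (itg_bddM (sqiM Lp Lq) mh hM) => x _; exact: mulrC.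
rewrite [X in X @ _ --> _](_ : _ = fun n => RI (fun x => fd n x * gd n x * h x)
   + RI (fun x => fd n x * g x * h x) + RI (fun x => f x * gd n x * h x)
   + RI (fun x => f x * g x * h x)); last first.
  apply/funext => n.
  have I1 := Ih _ _ (Lfd n) (Lgd n).
  have I2 := Ih _ _ (Lfd n) Lg.
  have I3 := Ih _ _ Lf (Lgd n).
  have I4 := Ih _ _ Lf Lg.
  rewrite -(RID I1 I2) -(RID (itgD I1 I2) I3) -(RID (itgD (itgD I1 I2) I3) I4).
  by apply: RI_eq => x _; rewrite /fd /gd; ring.
rewrite -[X in _ --> X]add0r; apply: cvgD; last exact: cvg_cst.
rewrite -[X in _ --> X]add0r; apply: cvgD => //.
by rewrite -[X in _ --> X]add0r; apply: cvgD.
Qed.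

End Integrals.

(** * Completeness of L_2 *)

Section RieszFischer.
Context d (T : measurableType d) (R : realType) (mu : {measure set T -> \bar R}).
Implicit Types f g h : T -> R.
Local Notation D := [set: T].
Local Notation RI f := (Rintegral mu D f).

Lemma fast_subsequence (a : nat -> nat -> R) :
  (forall e, 0 < e -> exists N, forall m k, (N <= m)%N -> (N <= k)%N -> a m k <= e) ->
  forall e : nat -> R, (forall k, 0 < e k) ->
  exists phi : nat -> nat, (forall k, (phi k <= phi k.+1)%N) /\ (forall k, (k <= phi k)%N) /\
    forall k m l, (phi k <= m)%N -> (phi k <= l)%N -> a m l <= e k.
Proof.
move=> h e e0.
have /choice[N hN] : forall k, exists N, forall m l, (N <= m)%N -> (N <= l)%N -> a m l <= e k.
  by move=> k; exact: h.
(* Summing the thresholds makes the index nondecreasing and at least [N k]; the summand [k] makes it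
   at least [k]. *)
exists (fun k => k + \sum_(i < k.+1) N i)%N; split; last split.
- by move=> k; rewrite leq_add// [leqRHS]big_ord_recr/= leq_addr.
- by move=> k; rewrite leq_addr.
- move=> k m l km kl; apply: hN.
  + by rewrite (leq_trans _ km)// big_ord_recr/= addnA leq_addl.
  + by rewrite (leq_trans _ kl)// big_ord_recr/= addnA leq_addl.
Qed.

Lemma geometric_diff_cvg (x : nat -> R) (M : R) :
  (forall k, `|x k.+1 - x k| <= M * 2^-1 ^+ k) -> cvgn x.
Proof.
move=> h.
have -> : x = (fun n => x 0%N + series (fun k => x k.+1 - x k) n).
  apply/funext => n; rewrite /series /= telescope_sumr//; by rewrite addrC subrK.
apply: is_cvgD; first exact: is_cvg_cst.
apply: normed_cvg.
apply: (@series_le_cvg _ _ (geometric M 2^-1)) => //.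
- by move=> n /=.
- move=> n; rewrite /= mulr_ge0 ?exprn_ge0//.
  by have := le_trans (normr_ge0 _) (h 0%N); rewrite expr0 mulr1.
- by apply: is_cvg_geometric_series; rewrite ger0_norm//; lra.
Qed.

Lemma limn_einf_le (u : nat -> \bar R) (l : \bar R) :
  (\forall k \near \oo, (u k <= l)%E) -> (limn_einf u <= l)%E.
Proof.
move=> [K _ hK]; rewrite limn_einf_lim; apply: lime_le.
  by apply: is_cvg_einfs.
near=> n; apply: (@le_trans _ _ (u (maxn n K))).
  by apply: ereal_inf_lbound; exists (maxn n K) => //=; rewrite leq_maxl.
by apply: hK; rewrite /= leq_maxr.
Unshelve. all: end_near. Qed.

(** With the weights 4^k the integrals of 4^k (G_{k+1} - G_k)^2 are at most 2^-k, so the sum of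
    these functions is finite almost everywhere; at such a point the increments are at most a
    constant times 2^-k. *)
Lemma ae_cvg_fast (G : nat -> T -> R) :
  (forall n, sqi mu D (G n)) ->
  (forall k, RI (fun x => (G k.+1 x - G k x) ^+ 2) <= 8^-1 ^+ k) ->
  {ae mu, forall x, cvgn (fun k => G k x)}.
Proof.
move=> LG hG.
pose q k x := 4 ^+ k * (G k.+1 x - G k x) ^+ 2.
have Ld k : sqi mu D (fun x => G k.+1 x - G k x) by apply: sqiB.
have Iq k : mu.-integrable D (EFin \o q k) by apply: itgZl => //; exact: (Ld k).2.
have q0 k x : 0 <= q k x by rewrite mulr_ge0 ?sqr_ge0// exprn_ge0.
have mq k : measurable_fun D (EFin \o q k) by exact: measurable_int (Iq k).
have fin : (\int[mu]_(x in D) \big[+%E/0%R]_(0 <= k <oo) (q k x)%:E < +oo)%E.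
  rewrite (@integral_nneseries _ _ _ mu D measurableT (fun k => EFin \o q k))//; last first.
    by move=> k x _; rewrite lee_fin.
  apply: (@le_lt_trans _ _ (\big[+%E/0]_(0 <= k <oo) (geometric 1 (2^-1 : R) k)%:E)%E).
    apply: lee_nneseries => //.
      by move=> k _; move=> _; apply: integral_ge0 => x _; rewrite lee_fin.
    move=> k _; rewrite -RI_EFin// lee_fin /q RIZl//; last exact: (Ld k).2.
    apply: (@le_trans _ _ (4 ^+ k * 8^-1 ^+ k)).
      by apply: ler_wpM2l; rewrite ?exprn_ge0.
    by rewrite -exprMn /= mul1r (_ : 4 * 8^-1 = 2^-1)//; field.
  have h12 : `|2^-1 : R| < 1 by rewrite ger0_norm//; lra.
  have := @cvg_geometric_series R 1 _ h12 => hc.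
  have -> : (\big[+%E/0]_(0 <= k <oo) (geometric 1 (2^-1 : R) k)%:E)%E =
    (1 * (1 - 2^-1)^-1)%:E :> \bar R.
    apply/cvg_lim => //.
    under eq_fun do rewrite sumEFin.
    by apply: cvg_EFin; [exact: nearW | exact: hc].
  exact: ltry.
have I : mu.-integrable D (fun x => \big[+%E/0%R]_(0 <= k <oo) (q k x)%:E)%E.
  apply/integrableP; split.
    by apply: (@ge0_emeasurable_sum _ _ R D (fun k x => (q k x)%:E) xpredT) => [k x _ _|k _]; [rewrite lee_fin|exact: mq].
  rewrite (eq_integral (fun x => \big[+%E/0%R]_(0 <= k <oo) (q k x)%:E))//.
  by move=> x _; rewrite gee0_abs// nneseries_ge0// => k _ _; rewrite lee_fin.
have := integrable_ae measurableT I.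
apply: filterS => x /(_ Logic.I) hx.
pose M := fine (\big[+%E/0%R]_(0 <= k <oo) (q k x)%:E)%E.
have qM k : q k x <= M.
  rewrite -lee_fin /M fineK//.
  apply: le_trans (nneseries_lim_ge k.+1 _); last by move=> j _; rewrite lee_fin.
  by rewrite big_nat_recr//= leeDr// sume_ge0// => j _; rewrite lee_fin.
have M0 : 0 <= M by exact: le_trans (q0 0%N x) (qM 0%N).
apply: (@geometric_diff_cvg _ (Num.sqrt M)) => k.
rewrite -(@ler_pXn2r _ 2)// ?nnegrE ?mulr_ge0 ?sqrtr_ge0 ?exprn_ge0//.
rewrite real_normK ?num_real// exprMn sqr_sqrtr// -exprM mulnC exprM.

have := qM k; rewrite /q => h.
rewrite -(ler_pM2l (_ : 0 < 4 ^+ k)) ?exprn_gt0//.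
by rewrite [leRHS]mulrCA -exprMn (_ : 4 * 2^-1 ^+ 2 = 1) ?expr1n ?mulr1//; field.
Unshelve. all: end_near. Qed.

(** The limit is an explicit pointwise limes superior, so that periodicity of all [F n] will pass to
    it at every point and not just almost everywhere. Fatou's lemma bounds its distance to [F N] by
    the Cauchy modulus. *)
Lemma sqi_complete (F : nat -> T -> R) :
  (forall n, sqi mu D (F n)) ->
  (forall e, 0 < e -> exists N, forall m k, (N <= m)%N -> (N <= k)%N ->
     RI (fun x => (F m x - F k x) ^+ 2) <= e) ->
  exists phi : nat -> nat,
  let f := fun x => fine (limn_esup (fun k => (F (phi k) x)%:E)) in
  sqi mu D f /\ (fun n => RI (fun x => (F n x - f x) ^+ 2)) @ \oo --> 0.
Proof.
move=> LF hF.
have e80 k : (0 : R) < 8^-1 ^+ k by rewrite exprn_gt0.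
have [phi [phi1 [phi2 phiP]]] := fast_subsequence hF e80.
exists phi => f.
have cG : {ae mu, forall x, cvgn (fun k => F (phi k) x)}.
  apply: ae_cvg_fast => [n|k]; first exact: LF.
  by apply: phiP.
have cf : {ae mu, forall x, (fun k => F (phi k) x) @ \oo --> f x}.
  apply: filterS cG => x cx; rewrite /f.
  have : (fun k => (F (phi k) x)%:E) @ \oo --> (limn (fun k => F (phi k) x))%:E.
    by apply: cvg_EFin => //; exact: nearW.
  by move=> /cvg_limn_einf_sup[_ ->].
have mf : measurable_fun D f.
  apply: measurableT_comp => //; apply: measurable_fun_limn_esup => n.
  by apply/measurable_EFinP; exact: (LF _).1.
have key e N : (forall k, (N <= k)%N -> RI (fun x => (F N x - F k x) ^+ 2) <= e) ->
   (\int[mu]_(x in D) ((F N x - f x) ^+ 2)%:E <= e%:E)%E.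
  move=> hN.
  have Lk k : sqi mu D (fun x => F N x - F (phi k) x) by exact: sqiB.
  have mk k : measurable_fun D (fun x => ((F N x - F (phi k) x) ^+ 2)%:E).
    by apply/measurable_EFinP; apply: measurable_funX; exact: (Lk k).1.
  have := @fatou _ _ _ mu D measurableT (fun k x => ((F N x - F (phi k) x) ^+ 2)%:E) mk.
  have pos : forall (n : nat) x, D x -> (0 <= ((F N x - F (phi n) x) ^+ 2)%:E)%E.
    by move=> k x _; rewrite lee_fin sqr_ge0.
  move=> /(_ pos) fat.
  apply: le_trans (le_trans fat _).
    apply: ae_ge0_le_integral => //.
    - by move=> x _; rewrite lee_fin sqr_ge0.
    - apply/measurable_EFinP; apply: measurable_funX; apply: measurable_funB => //.
      exact: (LF N).1.
    - move=> x _; rewrite limn_einf_lim; apply: lime_ge; first exact: is_cvg_einfs.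
      by near=> n; apply: le_ereal_inf_tmp => _ [k _ <-]; rewrite lee_fin sqr_ge0.
    - under eq_fun do rewrite -[limn_einf _]oppeK -limn_esupN.
      apply: measurableT_comp => //; apply: measurable_fun_limn_esup => k.
      by apply: measurableT_comp => //; exact: mk.
    - apply: filterS cf => x cx _.
      suff -> : limn_einf (fun k => ((F N x - F (phi k) x) ^+ 2)%:E) = ((F N x - f x) ^+ 2)%:E by [].
      have hc : (fun k => ((F N x - F (phi k) x) ^+ 2)%:E) @ \oo --> ((F N x - f x) ^+ 2)%:E.
        have hd : (fun k => F N x - F (phi k) x) @ \oo --> F N x - f x.
          exact: (cvgB (cvg_cst _) cx).
        by apply: cvg_EFin; [exact: nearW|exact: (cvgM hd hd)].
      by have [-> _] := cvg_limn_einf_sup hc.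
  apply: limn_einf_le; exists N => //= k Nk.
  rewrite -RI_EFin ?lee_fin//; last exact: (Lk k).2.
  by apply: hN; rewrite (leq_trans Nk).
have Ld N e : (forall k, (N <= k)%N -> RI (fun x => (F N x - F k x) ^+ 2) <= e) ->
    sqi mu D (fun x => F N x - f x).
  move=> /key h; apply: sqi_ltP; last exact: le_lt_trans h (ltry _).
  by apply: measurable_funB => //; exact: (LF N).1.
have Lf : sqi mu D f.
  have [N hN] := hF 1 ltr01.
  have := Ld N 1 (fun k Nk => hN N k (leqnn _) Nk).
  by move=> h; apply: sqi_eq (sqiB _ (LF N) h) => // x _; rewrite opprB addrC subrK.
split => //; apply/cvgrPdist_le => e e0.
have [N hN] := hF e e0; exists N => //= n Nn.
rewrite sub0r normrN ger0_norm; last by apply: RI_ge0 => x _; exact: sqr_ge0.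
rewrite -lee_fin RI_EFin//; last exact: (sqiB _ (LF n) Lf).2.
by apply: key => k nk; apply: hN => //; exact: leq_trans Nn nk.
Unshelve. all: end_near. Qed.

End RieszFischer.

(** * Smooth functions and trigonometric monomials *)

Lemma cvg_sumr (R : realType) (T : Type) (F : set_system T) {FF : Filter F} I (r : seq I)
  (f : I -> T -> R) (a : I -> R) : (forall i, f i @ F --> a i) ->
  (fun x => \sum_(i <- r) f i x) @ F --> \sum_(i <- r) a i.
Proof.
move=> h; elim: r => [|i r IH].
  rewrite big_nil (_ : (fun x => _) = cst 0); first exact: cvg_cst.
  by apply/funext => x; rewrite big_nil.
rewrite big_cons (_ : (fun x => _) = fun x => f i x + \sum_(j <- r) f j x).
  exact: cvgD.
by apply/funext => x; rewrite big_cons.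
Qed.

Lemma is_derive_affine (R : realType) (c d : R) : is_derive (0 : R) 1 (fun h : R => h * c + d) c.
Proof.
have L : (fun h : R => h^-1 *: (((fun h : R => h * c + d) \o shift 0) (h *: (1 : R)) -
      (0 * c + d))) @ 0^' --> c.
  apply: (@cvg_trans _ (cst c @ 0^')); last exact: cvg_cst.
  apply: near_eq_cvg; near=> h => /=.
  rewrite [h *: 1]mulr1 addr0 mul0r add0r addrK /GRing.scale/= mulKf//.
  by near: h; exact: nbhs_dnbhs_neq.
by split; [apply: cvgP; exact: L|apply/cvg_lim => //; exact: L].
Unshelve. all: end_near. Qed.

Section Calculus.
Context {R : realType} {n : nat}.
Implicit Types (x y v : 'rV[R]_n) (phi psi : 'rV[R]_n -> R) (xi : 'rV[int]_n).

Local Notation e_ i := (delta_mx 0 i : 'rV[R]_n).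

Lemma is_derive_line phi x v (df : R) :
  is_derive (0 : R) 1 (fun h : R => phi (h *: v + x)) df -> is_derive x v phi df.
Proof.
have E : (fun h : R => h^-1 *: ((phi \o shift x) (h *: v) - phi x)) =
   (fun h : R => h^-1 *: (((fun h : R => phi (h *: v + x)) \o shift 0) (h *: (1 : R)) -
      phi (0 *: v + x))).
  by apply/funext => h /=; rewrite addr0 scale0r add0r [h *: 1]mulr1.
move=> [dh D]; split; last by rewrite -D /derive E.
by move: dh; rewrite /derivable E.
Qed.

(** The vectors that leave [phi] invariant form a group, so the unit vectors generate all integer
    ones. *)
Lemma periodicD (v : 'rV[int]_n) phi : periodic phi ->
  forall x, phi (x + \row_i (v 0 i)%:~R) = phi x.
Proof.
move=> pp; pose P (w : 'rV[R]_n) := forall x, phi (x + w) = phi x.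
have PN w : P w -> P (- w) by move=> Pw x; rewrite -(Pw (x - w)) subrK.
have PD w1 w2 : P w1 -> P w2 -> P (w1 + w2).
  by move=> P1 P2 x; rewrite addrA P2 P1.
have P0 : P 0 by move=> x; rewrite addr0.
have Pn w k : P w -> P (w *+ k).
  by move=> Pw; elim: k => [|k IH]; rewrite ?mulr0n// mulrS; exact: PD.
have Pz w (z : int) : P w -> P (w *~ z).
  by move=> Pw; case: z => k; [exact: Pn | apply: PN; exact: Pn].
suff : P (\sum_(i < n) e_ i *~ v 0 i).
  move=> h x; rewrite -(h x); congr (phi (x + _)).
  apply/rowP => j; rewrite !mxE summxE (bigD1 j)//= big1 ?addr0.
    by rewrite -[delta_mx _ _ *~ _]scaler_int !mxE !eqxx mulr1.
  move=> i ij; rewrite -[delta_mx _ _ *~ _]scaler_int !mxE eqxx /= [j == i]eq_sym (negbTE ij) mulr0//.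
by elim/big_ind : _ => // i _; apply: Pz => x; exact: pp.
Qed.

Lemma periodic_unit_cube phi : periodic phi -> forall x,
  exists2 y : 'rV[R]_n, (forall i, 0 <= y 0 i <= 1) & phi x = phi y.
Proof.
move=> pp x; pose z := \row_i (- Num.floor (x 0 i)) : 'rV[int]_n.
exists (x + \row_i (z 0 i)%:~R); last by rewrite periodicD.
move=> i; rewrite !mxE rmorphN/=.
by have := floor_itv (x 0 i); rewrite rmorphD/=; lra.
Qed.

Lemma periodic_bounded phi : continuous phi -> periodic phi ->
  exists M : R, forall x, `|phi x| <= M.
Proof.
move=> cp pp; pose A := [set x : 'rV[R]_n | forall i, `[0, 1]%classic (x 0 i)].
have cA : compact A by apply: (@rV_compact R n (fun=> `[0, 1]%classic)) => i; exact: segment_compact.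
have A0 : A !=set0.
  by exists 0 => i /=; rewrite mxE in_itv /= lexx ler01.
have [|c _ hc] := @EVT_max_rV R n (fun x => `|phi x|) A A0 cA.
  apply: continuous_subspaceT => x; exact: (cvg_norm (cp x)).
exists `|phi c| => x; have [y hy ->] := periodic_unit_cube pp x.
by apply: hc; rewrite inE => i /=; rewrite in_itv /= hy.
Qed.

Lemma periodic_partial i phi : periodic phi -> periodic (partial i phi).
Proof.
move=> pp x j; rewrite /partial /derive; suff -> : (fun h : R => h^-1 *: ((phi \o shift (x + e_ j)) (h *: e_ i) - phi (x + e_ j))) =
  (fun h : R => h^-1 *: ((phi \o shift x) (h *: e_ i) - phi x)) by [].
by apply/funext => h /=; rewrite pp addrA pp.
Qed.

Definition tr (b : bool) xi x : R := if b then sin (phase xi x) else cos (phase xi x).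

(** The sign produced by differentiation, which exchanges the two kinds of modes: sin' = cos and
    cos' = - sin. *)
Definition sgb (b : bool) : R := if b then 1 else -1.

Lemma phaseD xi x y : phase xi (x + y) = phase xi x + phase xi y.
Proof.
rewrite /phase -mulrDr -big_split/=; congr (_ * _); apply: eq_bigr => i _.
by rewrite mxE mulrDr.
Qed.

Lemma phaseZ xi (h : R) x : phase xi (h *: x) = h * phase xi x.
Proof.
rewrite /phase mulrCA; congr (_ * _); rewrite mulr_sumr; apply: eq_bigr => i _.
by rewrite mxE mulrCA.
Qed.

Lemma phase_delta xi i : phase xi (e_ i) = 2 * pi * (xi 0 i)%:~R.
Proof.
rewrite /phase (bigD1 i)//= mxE !eqxx mulr1 big1 ?addr0// => j ji.
by rewrite mxE eqxx /= (negbTE ji) mulr0.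
Qed.

Lemma phaseDl xi eta x : phase (xi + eta) x = phase xi x + phase eta x.
Proof.
rewrite /phase -mulrDr -big_split/=; congr (_ * _); apply: eq_bigr => i _.
by rewrite mxE rmorphD/= mulrDl.
Qed.

Lemma phaseN xi x : phase (- xi) x = - phase xi x.
Proof.
rewrite /phase -mulrN -sumrN; congr (_ * _); apply: eq_bigr => i _.
by rewrite mxE rmorphN mulNr.
Qed.

Lemma phase0 x : phase 0 x = 0.
Proof. by rewrite /phase big1 ?mulr0// => i _; rewrite mxE mul0r. Qed.

Lemma phase_continuous xi : continuous (phase xi : 'rV[R]_n -> R).
Proof.
move=> x; rewrite /phase.
suff h : (fun y : 'rV[R]_n => \sum_(i < n) (xi 0 i)%:~R * y 0 i) @ x -->
    \sum_(i < n) (xi 0 i)%:~R * x 0 i by exact: (cvgM (cvg_cst _) h).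
apply: (@cvg_sumr _ _ (nbhs x)) => i.
exact: (cvgM (cvg_cst _) (@coord_continuous R 1 n 0 i x)).
Qed.

Lemma tr_continuous b xi : continuous (tr b xi).
Proof.
move=> x; case: b; rewrite /tr.
  by apply: (@continuous_comp _ _ _ (phase xi) sin); [exact: phase_continuous|exact: continuous_sin].
by apply: (@continuous_comp _ _ _ (phase xi) cos); [exact: phase_continuous|exact: continuous_cos].
Qed.

Lemma tr_periodic b xi : periodic (tr b xi).
Proof.
move=> x i; rewrite /tr phaseD phase_delta.
have -> : 2 * pi * (xi 0 i)%:~R = (pi *+ 2) *~ (xi 0 i) :> R.
  by rewrite mulr_natl -[RHS]mulrzr.
have S k t : sin (t + (pi *+ 2) *~ k) = sin t :> R.
  case: k => k; first by rewrite (periodicn (@sinD2pi R)).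
  by rewrite -[LHS](periodicn (@sinD2pi R) k.+1) NegzE mulrNz subrK.
have C k t : cos (t + (pi *+ 2) *~ k) = cos t :> R.
  case: k => k; first by rewrite (periodicn (@cosD2pi R)).
  by rewrite -[LHS](periodicn (@cosD2pi R) k.+1) NegzE mulrNz subrK.
by case: b; rewrite ?S ?C.
Qed.

Lemma is_derive_tr b xi x i :
  is_derive x (e_ i) (tr b xi) (sgb b * (2 * pi * (xi 0 i)%:~R) * tr (~~ b) xi x).
Proof.
apply: is_derive_line; set c := 2 * pi * _.
have E : (fun h : R => tr b xi (h *: e_ i + x)) =
  (fun h : R => (if b then sin else cos) (h * c + phase xi x)).
  by apply/funext => h; rewrite /tr phaseD phaseZ phase_delta; case: b.
rewrite E.
have D1 : is_derive (0 : R) 1 (fun h : R => h * c + phase xi x) c.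
  exact: is_derive_affine.
case: b {E}; rewrite /tr /sgb /=.
- have := @is_derive1_comp R sin (fun h => h * c + phase xi x) 0 _ _ (is_derive_sin _) D1.
  by move=> h; apply: is_derive_eq h _; rewrite mul0r add0r mul1r mulrC.
- have := @is_derive1_comp R cos (fun h => h * c + phase xi x) 0 _ _ (is_derive_cos _) D1.
  by move=> h; apply: is_derive_eq h _; rewrite mul0r add0r mulN1r mulNr mulrC mulNr.
Qed.

Lemma partial_tr b xi i :
  partial i (tr b xi) = fun x => sgb b * (2 * pi * (xi 0 i)%:~R) * tr (~~ b) xi x.
Proof. by apply/funext => x; rewrite /partial; have [_ ->] := is_derive_tr b xi x i. Qed.

Lemma smooth_continuous phi : smooth phi -> continuous phi.
Proof. by move=> /(_ [::])[]. Qed.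

Lemma smooth_derivable phi : smooth phi -> forall x i, derivable phi x (e_ i).
Proof. by move=> /(_ [::])[]. Qed.

Lemma partials_rcons s i phi : partials (rcons s i) phi = partials s (partial i phi).
Proof. by rewrite /partials -cats1 foldr_cat. Qed.

Lemma smooth_partial i phi : smooth phi -> smooth (partial i phi).
Proof. by move=> h s; rewrite -partials_rcons; exact: h. Qed.

(* Coinduction for [smooth]. *)
Lemma smooth_class (K : ('rV[R]_n -> R) -> Prop) :
  (forall phi, K phi -> continuous phi /\ (forall x i, derivable phi x (e_ i))
     /\ forall i, K (partial i phi)) ->
  forall phi, K phi -> smooth phi.
Proof.
move=> hK phi Kphi s; suff : K (partials s phi) by move=> /hK[? []].
by elim: s => [//|i s /hK[_ [_ h]]]; exact: h.
Qed.

Lemma partialD i phi psi : (forall x, derivable phi x (e_ i)) ->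
  (forall x, derivable psi x (e_ i)) ->
  partial i (fun x => phi x + psi x) = fun x => partial i phi x + partial i psi x.
Proof. by move=> h1 h2; apply/funext => x; rewrite /partial; exact: deriveD. Qed.

Lemma partialM i phi psi : (forall x, derivable phi x (e_ i)) ->
  (forall x, derivable psi x (e_ i)) ->
  partial i (fun x => phi x * psi x) =
  fun x => phi x * partial i psi x + partial i phi x * psi x.
Proof.
move=> h1 h2; apply/funext => x; rewrite /partial.
have := @deriveM R _ phi psi x (e_ i) (h1 x) (h2 x).
by rewrite /GRing.scale /= [psi x * _]mulrC => <-.
Qed.

Lemma partialZ i (c : R) phi : (forall x, derivable phi x (e_ i)) ->
  partial i (fun x => c * phi x) = fun x => c * partial i phi x.
Proof. by move=> h1; apply/funext => x; rewrite /partial; exact: (@deriveZ R _ _ phi c x (e_ i) (h1 x)). Qed.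

Lemma partial0 i : partial i (fun=> 0) = (fun=> 0) :> ('rV[R]_n -> R).
Proof. by apply/funext => x; rewrite /partial; exact: derive_cst. Qed.

Lemma smoothD phi psi : smooth phi -> smooth psi -> smooth (fun x => phi x + psi x).
Proof.
move=> h1 h2; apply: (@smooth_class (fun f => exists p q, [/\ smooth p, smooth q & f = fun x => p x + q x])); last first.
  by exists phi, psi.
move=> _ [p [q [sp sq ->]]]; split; last split.
- by move=> x; exact: (cvgD (smooth_continuous sp (x:=x)) (smooth_continuous sq (x:=x))).
- by move=> x i; apply: derivableD; exact: smooth_derivable.
- move=> i; exists (partial i p), (partial i q); split; try exact: smooth_partial.
  by rewrite partialD => // x; apply: smooth_derivable.
Qed.

Lemma smoothZ (c : R) phi : smooth phi -> smooth (fun x => c * phi x).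
Proof.
move=> h1; apply: (@smooth_class (fun f => exists2 p, smooth p & f = fun x => c * p x)); last first.
  by exists phi.
move=> _ [p sp ->]; split; last split.
- by move=> x; exact: (cvgM (cvg_cst _) (smooth_continuous sp (x:=x))).
- by move=> x i; apply: derivableZ; exact: smooth_derivable.
- move=> i; exists (partial i p); first exact: smooth_partial.
  by rewrite partialZ => // x; apply: smooth_derivable.
Qed.

Lemma smooth0 : smooth ((fun=> 0) : 'rV[R]_n -> R).
Proof.
apply: (@smooth_class (fun f => f = fun=> 0)) => // _ ->; split; last split.
- exact: cst_continuous.
- move=> x i; exact: derivable_cst.
- move=> i; exact: partial0.
Qed.

Lemma smooth_sum I (r : seq I) (F : I -> 'rV[R]_n -> R) :
  (forall i, smooth (F i)) -> smooth (fun x => \sum_(i <- r) F i x).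
Proof.
move=> h; elim: r => [|i r IH].
  by rewrite (_ : (fun x => _) = fun=> 0); [exact: smooth0|apply/funext => x; rewrite big_nil].
rewrite (_ : (fun x => _) = fun x => F i x + \sum_(j <- r) F j x); first exact: smoothD.
by apply/funext => x; rewrite big_cons.
Qed.

Lemma smooth_tr b xi : smooth (tr b xi).
Proof.
apply: (@smooth_class (fun f => exists c b xi, f = fun x => c * tr b xi x)); last first.
  by exists 1, b, xi; apply/funext => x; rewrite mul1r.
move=> _ [c [b' [xi' ->]]]; split; last split.
- by move=> x; exact: (cvgM (cvg_cst _) (@tr_continuous _ _ x)).
- by move=> x i; apply: derivableZ; have [] := is_derive_tr b' xi' x i.
- move=> i; rewrite partialZ; last by move=> x; have [] := is_derive_tr b' xi' x i.
  exists (c * (sgb b' * (2 * pi * (xi' 0 i)%:~R))), (~~ b'), xi'.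
  by apply/funext => x; rewrite partial_tr mulrA.
Qed.

(** Single products are not stable under differentiation, but finite sums of products of smooth
    functions are, by Leibniz' rule; the coinduction runs over that class. *)
Lemma smoothM phi psi : smooth phi -> smooth psi -> smooth (fun x => phi x * psi x).
Proof.
move=> h1 h2.
pose K f := exists r : seq (('rV[R]_n -> R) * ('rV[R]_n -> R)),
  (forall p, List.In p r -> smooth p.1 /\ smooth p.2) /\
  f = fun x => \sum_(p <- r) p.1 x * p.2 x.
apply: (@smooth_class K); last first.
  exists [:: (phi, psi)]; split; first by move=> p /= [<-|[]]; split.
  by apply/funext => x; rewrite big_seq1.
move=> _ [r [hr ->]].
elim: r hr => [|[p q] r IH] hr.
  have -> : (fun x => \sum_(p <- ([::] : seq (('rV[R]_n -> R) * ('rV[R]_n -> R)))) p.1 x * p.2 x) = fun=> 0.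
    by apply/funext => x; rewrite big_nil.
  split; last split.
  - exact: cst_continuous.
  - move=> x i; exact: derivable_cst.
  - move=> i; exists [::]; split => //; rewrite partial0.
    by apply/funext => x; rewrite big_nil.
have [|ch [dh Kh]] := IH; first by move=> p' hp'; apply: hr; right.
have [sp sq] : smooth p /\ smooth q by apply: (hr (p, q)); left.
have -> : (fun x => \sum_(p <- (p, q) :: r) p.1 x * p.2 x) =
   fun x => p x * q x + \sum_(p <- r) p.1 x * p.2 x.
  by apply/funext => x; rewrite big_cons.
split; last split.
- move=> x; apply: (cvgD _ (ch x)).
  by exact: (cvgM (smooth_continuous sp (x:=x)) (smooth_continuous sq (x:=x))).
- move=> x i; apply: derivableD; last exact: dh.
  by apply: derivableM; exact: smooth_derivable.
- move=> i; have [r' [hr' E]] := Kh i.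
  exists [:: (p, partial i q), (partial i p, q) & r']; split.
    move=> a /= [<-|[<-|]] /=; [| |exact: hr'].
      by split; [exact: sp|exact: smooth_partial].
    by split; [exact: smooth_partial|exact: sq].
  rewrite partialD; [|by move=> x; apply: derivableM; exact: smooth_derivable|by move=> x; exact: dh].
  rewrite E partialM; try by move=> x; exact: smooth_derivable.
  by apply/funext => x; rewrite !big_cons /= addrA.
Qed.

Lemma test_tr b xi : test_fun (tr b xi).
Proof. by split; [exact: smooth_tr|exact: tr_periodic]. Qed.

Lemma testD phi psi : test_fun phi -> test_fun psi -> test_fun (fun x => phi x + psi x).
Proof.
move=> [s1 p1] [s2 p2]; split; first exact: smoothD.
by move=> x i; rewrite p1 p2.
Qed.

Lemma testM phi psi : test_fun phi -> test_fun psi -> test_fun (fun x => phi x * psi x).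
Proof.
move=> [s1 p1] [s2 p2]; split; first exact: smoothM.
by move=> x i; rewrite p1 p2.
Qed.

Lemma testZ (c : R) phi : test_fun phi -> test_fun (fun x => c * phi x).
Proof.
move=> [s1 p1]; split; first exact: smoothZ.
by move=> x i; rewrite p1.
Qed.

Lemma test0 : test_fun ((fun=> 0) : 'rV[R]_n -> R).
Proof. by split; first exact: smooth0. Qed.

Lemma test_sum I (r : seq I) (F : I -> 'rV[R]_n -> R) :
  (forall i, test_fun (F i)) -> test_fun (fun x => \sum_(i <- r) F i x).
Proof.
move=> h; split; first by apply: smooth_sum => i; have [] := h i.
by move=> x i; apply: eq_bigr => j _; have [_ ->] := h j.
Qed.

Lemma test_partial i phi : test_fun phi -> test_fun (partial i phi).
Proof. by move=> [s p]; split; [exact: smooth_partial|exact: periodic_partial]. Qed.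

Lemma test_continuous phi : test_fun phi -> continuous phi.
Proof. by move=> [/smooth_continuous]. Qed.

Lemma test_derivable phi : test_fun phi -> forall i x, derivable phi x (e_ i).
Proof. by move=> [/smooth_derivable h _ i x]; exact: h. Qed.

Lemma partial_sum I (r : seq I) (F : I -> 'rV[R]_n -> R) i :
  (forall j, test_fun (F j)) ->
  partial i (fun x => \sum_(j <- r) F j x) = fun x => \sum_(j <- r) partial i (F j) x.
Proof.
move=> h; elim: r => [|j r IH].
  transitivity (partial i ((fun=> 0) : 'rV[R]_n -> R)).
    by congr partial; apply/funext => x; rewrite big_nil.
  by rewrite partial0; apply/funext => x; rewrite big_nil.
transitivity (partial i (fun x => F j x + \sum_(k <- r) F k x)).
  by congr partial; apply/funext => x; rewrite big_cons.
rewrite partialD; [|exact: test_derivable|by apply: test_derivable; exact: test_sum].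
by rewrite IH; apply/funext => x; rewrite big_cons.
Qed.

End Calculus.

(** * Integration over the torus *)

Section TorusMeasure.
Context {R : realType}.
Local Notation TT n := (n.-tuple (measurableTypeR R)).
Local Notation U := (uniform_prob (@ltr01 R)).

Lemma row_cvgP n (V : Type) (F : set_system V) {FF : Filter F} (f : V -> 'rV[R]_n) (l : 'rV[R]_n) :
  (forall i, (fun v => f v 0 i) @ F --> l 0 i) -> f @ F --> l.
Proof.
move=> h; apply/cvg_ballP => e e0.
have : \forall v \near F, forall i, ball (l 0 i) e (f v 0 i).
  by apply: filter_forall => i; have /cvg_ballP := h i; apply.
apply: filterS => v hv; split => // i j.
by rewrite (ord1 i); exact: hv.
Qed.

(** Only countably many grid points occur as arguments, so this holds for any [phi] whatever; a
    continuous [phi] is then reached as the limit of finer and finer grids. *)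
Lemma measurable_grid n (phi : 'rV[R]_n -> R) (k : nat) :
  measurable_fun setT (fun x : TT n =>
    phi (\row_i ((Num.floor (k.+1%:R * tnth x i))%:~R / k.+1%:R))).
Proof.
move=> _ B mB; rewrite setTI.
pose fl (x : TT n) : 'rV[int]_n := \row_i Num.floor (k.+1%:R * tnth x i).
pose h (z : 'rV[int]_n) := phi (\row_i ((z 0 i)%:~R / k.+1%:R)).
have -> : (fun x : TT n => phi (\row_i ((Num.floor (k.+1%:R * tnth x i))%:~R / k.+1%:R))) @^-1` B
   = \bigcup_z ([set x : TT n | B (h z)] `&` [set x : TT n | fl x = z]).
  apply/seteqP; split => x /=.
    move=> Bx; exists (fl x) => //; split => //=.
    by move: Bx; congr (B (phi _)); apply/rowP => i; rewrite !mxE.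
  move=> [z _ [/= + fz]]; rewrite /h -fz.
  by congr (B (phi _)); apply/rowP => i; rewrite !mxE.
apply: countable_bigcupT_measurable => [|z]; first exact: countableP.
apply: measurableI.
  by have [?|?] := pselect (B (h z)); [rewrite (_ : [set _ | _] = setT)|rewrite (_ : [set _ | _] = set0)] => //;
   apply/seteqP; split.
have -> : [set x : TT n | fl x = z] =
   \bigcap_(i in [set: 'I_n]) [set x : TT n | Num.floor (k.+1%:R * tnth x i) = z 0 i].
  apply/seteqP; split => x /=.
    by move=> <- i _ /=; rewrite mxE.
  by move=> hx; apply/rowP => i; rewrite mxE; exact: hx.
apply: fin_bigcap_measurable => // i _.
have -> : [set x : TT n | Num.floor (k.+1%:R * tnth x i) = z 0 i] =
  (fun x : TT n => k.+1%:R * tnth x i : measurableTypeR R) @^-1` `[(z 0 i)%:~R, (z 0 i + 1)%:~R[.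
  apply/seteqP; split => x /=.
    by move=> <-; rewrite in_itv /= floor_le floorD1_gt.
  by rewrite in_itv /= => /andP[a b]; apply: floor_def; rewrite a b.
have mc : measurable_fun setT (fun x : TT n => k.+1%:R * tnth x i : R).
  by apply: measurable_funM => //; exact: measurable_tnth.
by rewrite -[X in measurable X]setTI; apply: mc.
Qed.

Lemma continuous_measurable_row n (phi : 'rV[R]_n -> R) : continuous phi ->
  measurable_fun setT (fun x : TT n => phi (row_of x)).
Proof.
move=> cp.
apply: (@measurable_fun_cvg _ _ _ setT (fun k (x : TT n) =>
    phi (\row_i ((Num.floor (k.+1%:R * tnth x i))%:~R / k.+1%:R)))).
  by move=> k; exact: measurable_grid.
move=> x _.
suff : (fun k : nat => \row_i ((Num.floor (k.+1%:R * tnth x i))%:~R / k.+1%:R)) @ \oo -->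
    (row_of x : 'rV[R]_n).
  by move=> h; apply: (cvg_comp _ phi h); exact: cp.
apply: row_cvgP => i; rewrite mxE.
have -> : (fun k : nat => (\row_i0 ((Num.floor (k.+1%:R * tnth x i0))%:~R / k.+1%:R) : 'rV[R]_n) 0 i) =
   (fun k : nat => (Num.floor (k.+1%:R * tnth x i))%:~R / k.+1%:R).
  by apply/funext => k; rewrite mxE.
apply/subr_cvg0; apply: (@squeeze0 _ _ (fun k => k.+1%:R^-1)); last exact: cvg_harmonic.
move=> k; set y := tnth x i.
have k0 : (0 : R) < k.+1%:R by rewrite ltr0n.
have -> : (Num.floor (k.+1%:R * y))%:~R / k.+1%:R - y =
  ((Num.floor (k.+1%:R * y))%:~R - k.+1%:R * y) / k.+1%:R.
  by field; rewrite lt0r_neq0.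
rewrite normrM [`|k.+1%:R^-1|]ger0_norm ?invr_ge0 ?ler0n// ler_piMl ?invr_ge0//.
have := floor_itv (k.+1%:R * y); rewrite rmorphD/=; set F := (_)%:~R.
by move=> h; rewrite ler_norml; lra.
Qed.

Definition cons_row n (x : R) (r : 'rV[R]_n) : 'rV[R]_n.+1 :=
  \row_i (if unlift ord0 i is Some j then r 0 j else x).

Lemma row_of_cons n (x : R) (y : TT n) :
  row_of (cons_pair (x, y)) = cons_row x (row_of y).
Proof.
apply/rowP => i; rewrite !mxE; case: unliftP => [j ->|->]; last by rewrite tnth0.
by rewrite mxE tnthS.
Qed.

Lemma cons_rowDl n (h x : R) (r : 'rV[R]_n) :
  cons_row (h + x) r = h *: delta_mx 0 ord0 + cons_row x r.
Proof.
apply/rowP => i; rewrite !mxE; case: unliftP => [j ->|->].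
  by rewrite eqxx /= mulr0 add0r.
by rewrite !eqxx mulr1.
Qed.

Lemma cons_rowDr n (x : R) (v r : 'rV[R]_n) :
  cons_row x (v + r) = cons_row 0 v + cons_row x r.
Proof.
apply/rowP => i; rewrite !mxE; case: unlift => [j|]; first by rewrite mxE.
by rewrite add0r.
Qed.

Lemma cons_row_delta n (h : R) (i : 'I_n) :
  cons_row 0 (h *: delta_mx 0 i) = h *: delta_mx 0 (lift ord0 i).
Proof.
apply/rowP => j; rewrite !mxE; case: unliftP => [k ->|->].
  by rewrite !mxE eqxx /= (inj_eq lift_inj).
by rewrite eqxx /= mulr0.
Qed.

Lemma cons_row_continuousl n (r : 'rV[R]_n) : continuous (fun x => cons_row x r).
Proof.
move=> x; apply: (@row_cvgP n.+1 _ (nbhs x)) => i; rewrite mxE; case: unliftP => [j ->|->].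
  rewrite (_ : (fun v => _) = cst (r 0 j)); first exact: cvg_cst.
  by apply/funext => v; rewrite mxE liftK.
rewrite (_ : (fun v => _) = id); first exact: cvg_id.
by apply/funext => v; rewrite mxE unlift_none.
Qed.

Lemma cons_row_continuousr n (x : R) : continuous (cons_row x : 'rV[R]_n -> _).
Proof.
move=> r; apply: (@row_cvgP n.+1 _ (nbhs r)) => i; rewrite mxE; case: unliftP => [j ->|->].
  rewrite (_ : (fun v => _) = fun v : 'rV[R]_n => v 0 j); first exact: coord_continuous.
  by apply/funext => v; rewrite mxE liftK.
rewrite (_ : (fun v => _) = cst x); first exact: cvg_cst.
by apply/funext => v; rewrite mxE unlift_none.
Qed.

Lemma torus_integrable_bounded n (F : TT n -> R) (M : R) :
  measurable_fun setT F -> (forall x, `|F x| <= M) -> (torus n).-integrable setT (EFin \o F).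
Proof.
move=> mF FM; apply: (@itg_le _ _ _ _ _ measurableT _ (cst M)) => //.
apply/integrableP; split; first exact/measurable_EFinP.
by rewrite /= integral_cst//= probability_setT mule1 ltry.
Qed.

Lemma product_torus1 n : ((U \x torus n)%E setT = 1%E :> \bar R).
Proof.
have E := @product_measure1E _ _ _ _ R U (torus n) setT setT measurableT measurableT.
have E2 : U setT = 1%E := probability_setT U.
have E3 : torus n setT = 1%E :> \bar R := probability_setT (torus n).
have := eq_trans E (eq_trans (f_equal2 mule E2 E3) (mule1 1%E)).
move=> <-; congr (_ _); by apply/seteqP; split.
Qed.

Lemma Rint_fubini1 n (phi : 'rV[R]_n.+1 -> R) (M : R) :
  measurable_fun setT (fun x : TT n.+1 => phi (row_of x)) -> (forall x, `|phi x| <= M) ->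
  torus_int phi = \int[U]_x torus_int (fun r => phi (cons_row x r)).
Proof.
move=> mp pM; rewrite /torus_int /Rintegral /=.
have mc : measurable_fun setT (fun p : measurableTypeR R * TT n => phi (row_of (cons_pair p))).
  exact: (measurableT_comp mp (@measurable_cons_pair R n)).
have I : (U \x torus n)%E.-integrable setT (EFin \o fun p => phi (row_of (cons_pair p))).
  apply: (@itg_le _ _ _ _ _ measurableT _ (cst M)) => //.
  apply/integrableP; split; first exact/measurable_EFinP.
  rewrite /= integral_cst//=.
  by rewrite product_torus1 mule1 ltry.
rewrite integral_distribution//; last exact/measurable_EFinP.
rewrite -integral12_prod_meas1//; congr fine; apply: eq_integral => x _.
rewrite /fubini_F fineK.
  by apply: eq_integral => y _; rewrite /= row_of_cons.
apply: integrable_fin_num => //.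
apply: (@torus_integrable_bounded _ _ M); last by move=> y.
have := measurableT_comp mc (@pair1_measurable _ _ (measurableTypeR R) (TT n) x).
by apply: eq_measurable_fun => y _ /=; rewrite row_of_cons.
Qed.

Lemma Rint_fubini2 n (phi : 'rV[R]_n.+1 -> R) (M : R) :
  measurable_fun setT (fun x : TT n.+1 => phi (row_of x)) -> (forall x, `|phi x| <= M) ->
  torus_int phi = torus_int (fun r => \int[U]_x phi (cons_row x r)).
Proof.
move=> mp pM; rewrite /torus_int /Rintegral /=.
have mc : measurable_fun setT (fun p : measurableTypeR R * TT n => phi (row_of (cons_pair p))).
  exact: (measurableT_comp mp (@measurable_cons_pair R n)).
have I : (U \x torus n)%E.-integrable setT (EFin \o fun p => phi (row_of (cons_pair p))).
  apply: (@itg_le _ _ _ _ _ measurableT _ (cst M)) => //.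
  apply/integrableP; split; first exact/measurable_EFinP.
  rewrite /= integral_cst//=.
  by rewrite product_torus1 mule1 ltry.
rewrite integral_distribution//; last exact/measurable_EFinP.
rewrite -integral21_prod_meas1//; congr fine; apply: eq_integral => y _.
rewrite /fubini_G fineK.
  by apply: eq_integral => x _; rewrite /= row_of_cons.
apply: integrable_fin_num => //.
apply: (@itg_le _ _ _ _ _ measurableT _ (cst M)) => //.
  have := measurableT_comp mc (@pair2_measurable _ _ (measurableTypeR R) (TT n) y).
  by apply: eq_measurable_fun => x _ /=; rewrite row_of_cons.
apply/integrableP; split; first exact/measurable_EFinP.
by rewrite /= integral_cst//= probability_setT mule1 ltry.
Qed.

Lemma Rint_uniform (g : R -> R) (M : R) : measurable_fun setT g -> (forall x, `|g x| <= M) ->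
  \int[U]_x g x = \int[lebesgue_measure]_(x in `[0, 1]) g x.
Proof.
move=> mg gM.
have UI (f : R -> R) K : measurable_fun setT f -> (forall x, `|f x| <= K) ->
    U.-integrable setT (EFin \o f).
  move=> mf fK; apply: (@itg_le _ _ _ _ _ measurableT _ (cst K)) => //.
  apply/integrableP; split; first exact/measurable_EFinP.
  by rewrite /= integral_cst//= probability_setT mule1 ltry.
have m01 : lebesgue_measure (`[0, 1]%classic : set R) = 1%E.
  by rewrite lebesgue_measure_itv /= lte_fin ltr01 oppr0 adde0.
have LI (f : R -> R) K : measurable_fun setT f -> (forall x, `|f x| <= K) ->
    lebesgue_measure.-integrable `[0, 1] (EFin \o f).
  move=> mf fK; apply: (@itg_le _ _ _ _ _ _ _ (cst K)) => //.
    exact: measurable_funTS.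
  apply/integrableP; split; first exact/measurable_EFinP.
  by rewrite /= integral_cst//= m01 mule1 ltry.
have mgM : measurable_fun setT (fun x => g x + M) by exact: measurable_funD.
(* Adding [M] makes the integrand nonnegative, as the formula for the uniform law asks; the constant
   is cancelled at the end. *)
have h : \int[U]_x (g x + M) = \int[lebesgue_measure]_(x in `[0, 1]) (g x + M).
  rewrite /Rintegral integral_uniform.
  - by rewrite subr0 invr1 mul1e.
  - exact/measurable_EFinP.
  - by move=> x; rewrite lee_fin; have := gM x; rewrite ler_norml; lra.
have iM : U.-integrable setT (EFin \o cst M) by exact: (UI _ `|M|).
have iM' : lebesgue_measure.-integrable `[0, 1] (EFin \o (cst M : R -> R)) by exact: (LI _ `|M|).
move: h; rewrite (RID measurableT (UI g M mg gM) iM) (RID _ (LI g M mg gM) iM')//.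
by rewrite !Rintegral_cst//= probability_setT m01 => /addIr.
Qed.

Lemma torus_int0 n : torus_int ((fun=> 0) : 'rV[R]_n -> R) = 0.
Proof. exact: (@RI0 _ _ _ (torus n)). Qed.

(* The fundamental theorem of calculus in the differentiated coordinate, Fubini in the others. *)
Lemma torus_int_partial n (i : 'I_n) (phi : 'rV[R]_n -> R) :
  continuous phi -> (forall x, derivable phi x (delta_mx 0 i)) ->
  continuous (partial i phi) -> periodic phi -> torus_int (partial i phi) = 0.
Proof.
elim: n i phi => [[]//|n IH] i phi cphi dphi cd pp.
have [M hM] := periodic_bounded cd (periodic_partial i pp).
have mp := continuous_measurable_row cd.
case: (unliftP ord0 i) => [j ij|i0].
- rewrite (Rint_fubini1 mp hM) -[RHS](@RI0 _ _ _ U setT); apply: RI_eq => x _.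
  have E r : partial i phi (cons_row x r) = partial j (fun r => phi (cons_row x r)) r.
    rewrite /partial /derive.
    suff -> : (fun h : R => h^-1 *: ((phi \o shift (cons_row x r)) (h *: delta_mx 0 i) - phi (cons_row x r))) =
      (fun h : R => h^-1 *: (((fun r => phi (cons_row x r)) \o shift r) (h *: delta_mx 0 j) - phi (cons_row x r))) by [].
    by apply/funext => h /=; rewrite cons_rowDr cons_row_delta ij.
  rewrite (_ : (fun r => _) = partial j (fun r => phi (cons_row x r))); last exact/funext.
  apply: IH.
  + by move=> r; apply: (cvg_comp _ phi (@cons_row_continuousr n x r)); exact: cphi.
  + move=> r; have := dphi (cons_row x r); rewrite /derivable.
    suff -> : (fun h : R => h^-1 *: ((phi \o shift (cons_row x r)) (h *: delta_mx 0 i) - phi (cons_row x r))) =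
      (fun h : R => h^-1 *: (((fun r => phi (cons_row x r)) \o shift r) (h *: delta_mx 0 j) - phi (cons_row x r))) by [].
    by apply/funext => h /=; rewrite cons_rowDr cons_row_delta ij.
  + rewrite (_ : partial j _ = fun r => partial i phi (cons_row x r)); last by apply/funext => r; rewrite E.
    by move=> r; apply: (cvg_comp _ (partial i phi) (@cons_row_continuousr n x r)); exact: cd.
  + by move=> r k; rewrite addrC cons_rowDr -[delta_mx 0 k]scale1r cons_row_delta scale1r addrC pp.
- rewrite (Rint_fubini2 mp hM) -[RHS](@torus_int0 n); congr torus_int; apply/funext => r.
  pose g x := phi (cons_row x r); pose g' x := partial i phi (cons_row x r).
  have E x : (fun h : R => h^-1 *: ((phi \o shift (cons_row x r)) (h *: delta_mx 0 i) - phi (cons_row x r))) =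
      (fun h : R => h^-1 *: ((g \o shift x) (h *: 1) - g x)).
    by apply/funext => h /=; rewrite /g [h *: 1]mulr1 cons_rowDl i0.
  have dg x : derivable g x 1 by have := dphi (cons_row x r); rewrite /derivable E.
  have g'E x : derive1 g x = g' x by rewrite derive1E /derive /g' /partial /derive E.
  have cg' : continuous g'.
    by move=> x; apply: (cvg_comp _ (partial i phi) (@cons_row_continuousl n r x)); exact: cd.
  have cg : continuous g.
    by move=> x; apply: (cvg_comp _ phi (@cons_row_continuousl n r x)); exact: cphi.
  rewrite (@Rint_uniform g' M); last 2 first.
  + exact: measurable_realfun.continuous_measurable_fun.
  + by move=> x; exact: hM.
  rewrite /Rintegral (@continuous_FTC2 R g' g 0 1 ltr01).
  + have -> : g 1 = g 0.
      by rewrite /g -{1}[1]addr0 cons_rowDl scale1r [delta_mx _ _ + _]addrC -i0 pp.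
    by rewrite -EFinB /= subrr.
  + exact: continuous_subspaceT.
  + split; first by move=> x _; exact: dg.
      exact: cvg_at_right_filter (cg 0).
    exact: cvg_at_left_filter (cg 1).
  + by move=> x _; exact: g'E.
Qed.

End TorusMeasure.

(** * Boxes in the torus and their measures *)

Section TorusSets.
Context {R : realType}.
Local Notation TT n := (n.-tuple (measurableTypeR R)).
Local Notation U := (uniform_prob (@ltr01 R)).

Lemma uniform_measure (A : set R) : measurable A -> U A = lebesgue_measure (A `&` `[0, 1]).
Proof.
move=> mA; have E : (\int[U]_x (\1_A x)%:E = U A)%E by rewrite integral_indic// setIT.
rewrite -E integral_uniform; first by rewrite subr0 invr1 mul1e integral_indic.
- exact/measurable_EFinP.
- by move=> x; rewrite lee_fin.
Qed.

Lemma measurable_boxset n (A : 'I_n -> set R) : (forall i, measurable (A i)) ->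
  measurable [set y : TT n | forall i, A i (tnth y i)].
Proof.
move=> mA.
have -> : [set y : TT n | forall i, A i (tnth y i)] =
  \bigcap_(i in [set: 'I_n]) [set y : TT n | A i (tnth y i)].
  by apply/seteqP; split => y /= h i; [move=> _; exact: h|exact: h].
apply: fin_bigcap_measurable => // i _.
have := @measurable_tnth _ (measurableTypeR R) n i measurableT (A i) (mA i).
by rewrite setTI.
Qed.

(** An arbitrary multiplicative predicate, because two are needed: being equal to 1 gives the full
    measure of the open cube, being positive gives mass to every small box around a point. *)
Lemma torus_boxset_ind (P : \bar R -> Prop) : P 1%E -> (forall x y, P x -> P y -> P (x * y)%E) ->
  forall n (A : 'I_n -> set R), (forall i, measurable (A i)) -> (forall i, P (U (A i))) ->
  P (torus n [set y : TT n | forall i, A i (tnth y i)]).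
Proof.
move=> P1 PM; elim => [|n IH] A mA PA.
  rewrite (_ : [set _ | _] = setT); last by apply/seteqP; split => // y _ [].
  by rewrite probability_setT.
have mB := @measurable_boxset n (fun i => A (lift ord0 i)) (fun i => mA (lift ord0 i)).
have E : torus n.+1 [set y : TT n.+1 | forall i, A i (tnth y i)] =
   (U (A ord0) * torus n [set y : TT n | forall i, A (lift ord0 i) (tnth y i)])%E.
  rewrite /= /distribution /pushforward.
  rewrite -(@product_measure1E _ _ _ _ R U (torus n) _ _ (mA ord0) mB).
  congr (_ _); apply/seteqP; split => -[x y] /=.
    move=> h; split; first by have := h ord0; rewrite tnth0.
    by move=> i; have := h (lift ord0 i); rewrite tnthS.
  move=> [h0 h] i; case: (unliftP ord0 i) => [j ->|->]; last by rewrite tnth0.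
  by rewrite tnthS; exact: h.
by rewrite E; apply: PM => //; apply: (IH (fun i => A (lift ord0 i))) => i //.
Qed.

Lemma ae_open_cube n : {ae torus n, forall y : TT n, forall i, 0 < tnth y i < 1}.
Proof.
pose A := fun _ : 'I_n => `]0, 1[%classic : set R.
have mA i : measurable (A i) by exact: measurable_itv.
have h1 : torus n [set y : TT n | forall i, A i (tnth y i)] = 1%E :> \bar R.
  apply: (@torus_boxset_ind (fun x => x = 1%E)) => //.
    by move=> x y -> ->; rewrite mule1.
  move=> i; rewrite uniform_measure// (_ : A i `&` _ = A i).
    by rewrite /A lebesgue_measure_itv /= lte_fin ltr01 oppr0 adde0.
  apply/setIidl => x /=; rewrite !in_itv /= => /andP[a b].
  by rewrite !ltW.
have mB := measurable_boxset mA.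
exists (~` [set y : TT n | forall i, A i (tnth y i)]); split.
- exact: measurableC.
- rewrite probability_setC//.
  rewrite h1; exact: subee.
- move=> y /= h hA; apply: h => i; have := hA i.
  by rewrite /A /= in_itv.
Qed.

(** A nonzero value at a point of the cube would persist on a box around that point, and such a box
    has positive measure. *)
Lemma continuous_ae0 n (phi : 'rV[R]_n -> R) : continuous phi -> periodic phi ->
  {ae torus n, forall y : TT n, phi (row_of y) = 0} -> forall x, phi x = 0.
Proof.
move=> cp pp [N [mN N0 hN]].
suff main (x : 'rV[R]_n) : (forall i, 0 <= x 0 i <= 1) -> phi x = 0.
  by move=> x; have [y hy ->] := periodic_unit_cube pp x; exact: main.
move=> hx; apply: contrapT => phix0.
have [e /= e0 he] : exists2 e : R, 0 < e & ball x e `<=` [set y | phi y <> 0].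
  apply/nbhs_ballP; have := cp x => /(_ [set z | z != 0]).
  have : nbhs (phi x) [set z | z != 0].
    by apply: open_nbhs_nbhs; split; [exact: open_neq|exact/eqP].
  move=> h /(_ h) hh; apply: (@filterS _ (nbhs x) _ (phi @^-1` [set z | z != 0]) _ _ hh) => z.
  by move=> /= /eqP.
pose A i := ball (x 0 i) e : set R.
have mA i : measurable (A i) by exact: measurable_ball.
have : (0 < torus n [set y : TT n | forall i, A i (tnth y i)])%E.
  apply: (@torus_boxset_ind (fun x => (0 < x)%E)) => //.
    by move=> a b; exact: mule_gt0.
  move=> i; rewrite uniform_measure//.
  (* The point may lie on a face of the cube, so each side of the box is cut to the unit interval;
     it keeps a positive length. *)
  pose lo := Num.max 0 (x 0 i - e / 2); pose hi := Num.min 1 (x 0 i + e / 2).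
  have lohi : lo < hi.
    by rewrite /lo /hi; have := hx i; rewrite gt_max !lt_min ltr01 /=; lra.
  apply: (@lt_le_trans _ _ (lebesgue_measure (`[lo, hi]%classic : set R))).
    by rewrite lebesgue_measure_itv /= lte_fin lohi -EFinB lte_fin subr_gt0.
  apply: le_measure; rewrite ?inE//.
    by apply: measurableI; [exact: mA|exact: measurable_itv].
  move=> z; rewrite /= !in_itv /= /lo /hi ge_max le_min => /andP[/andP[z0 z1] /andP[z2 z3]].
  split; last by rewrite z0.
  by rewrite /A /ball /= ltr_norml; lra.
rewrite ltNge => /negP; apply; rewrite -N0; apply: le_measure; rewrite ?inE//.
  exact: measurable_boxset.
move=> y hy; apply: hN => /= y0.
apply: (he (row_of y)) => //; split => // i j.
by rewrite (ord1 i) mxE; exact: hy.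
Qed.

End TorusSets.

(** * Functions are determined by their Fourier coefficients *)

Section FourierModes.
Context {R : realType} {n : nat}.
Local Notation TT := (n.-tuple (measurableTypeR R)).
Local Notation mode := ('rV[int]_n * bool)%type.
Implicit Types (p q : mode) (phi psi : 'rV[R]_n -> R).

Definition trp p (x : 'rV[R]_n) : R := tr p.2 p.1 x.
(** The sign under reflection of the frequency: sines are odd, cosines even. The values are opposite
    to those of [sgb], which belongs to differentiation. *)
Definition sgs (s : bool) : R := if s then -1 else 1.
Definition negm p : mode := (- p.1, p.2).

Lemma trp_test p : test_fun (trp p).
Proof. exact: test_tr. Qed.

Lemma trp_bound p x : `|trp p x| <= 1.
Proof. by rewrite /trp /tr; case: p.2; rewrite ?sin_max ?cos_max. Qed.

Lemma trp_neg p : trp (negm p) = fun x => sgs p.2 * trp p x.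
Proof.
apply/funext => x; rewrite /trp /tr /= phaseN /sgs; case: p.2.
  by rewrite sinN mulN1r.
by rewrite cosN mul1r.
Qed.

Lemma negmK : involutive negm.
Proof. by move=> [xi s]; rewrite /negm /= opprK. Qed.

Lemma trp_mul p q : forall x, trp p x * trp q x =
  2^-1 * ((if p.2 && q.2 then -1 else 1) * trp (p.1 + q.1, p.2 (+) q.2) x +
          (if ~~ p.2 && q.2 then -1 else 1) * trp (p.1 - q.1, p.2 (+) q.2) x).
Proof.
move=> x; rewrite /trp /tr /= !phaseDl phaseN; case: p.2; case: q.2 => /=;
  rewrite ?sinD ?cosD ?sinN ?cosN; by field.
Qed.

Lemma trp0 : trp (0, false) = fun=> 1.
Proof. by apply/funext => x; rewrite /trp /tr /= phase0 cos0. Qed.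

Lemma test_bounded phi : test_fun phi -> exists M, forall x, `|phi x| <= M.
Proof. by move=> tp; apply: periodic_bounded tp.2; exact: test_continuous. Qed.

Lemma test_measurable phi : test_fun phi -> measurable_fun setT (fun y : TT => phi (row_of y)).
Proof. by move=> tp; apply: continuous_measurable_row; exact: test_continuous. Qed.

Lemma test_int_partial i phi : test_fun phi -> torus_int (partial i phi) = 0.
Proof.
move=> tp; apply: torus_int_partial.
- exact: test_continuous.
- exact: test_derivable.
- by apply: test_continuous; exact: test_partial.
- exact: tp.2.
Qed.

Lemma test_integrable phi : test_fun phi -> (torus n).-integrable setT (EFin \o fun y : TT => phi (row_of y)).
Proof.
move=> tp; have [M hM] := test_bounded tp.
by apply: (@torus_integrable_bounded _ _ _ M) => //; exact: test_measurable.
Qed.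

(** A mode of nonzero frequency is, up to a nonzero factor, a partial derivative of the other mode
    of that frequency, and partial derivatives integrate to 0. *)
Lemma torus_int_trp p : torus_int (trp p) = (p == (0, false))%:R.
Proof.
case: p => xi s; have [->|xi0] := eqVneq xi 0.
  case: s; last by rewrite trp0 eqxx /torus_int Rintegral_cst//= probability_setT mulr1.
  rewrite (_ : trp _ = fun=> 0).
    by rewrite torus_int0; case: eqP => // -[].
  by apply/funext => x; rewrite /trp /tr /= phase0 sin0.
rewrite (_ : _ == _ = false); last by apply/eqP => -[/eqP]; rewrite (negbTE xi0).
have [i xii0] : exists i, xi 0 i != 0.
  apply: contrapT => h; move/eqP: xi0; apply; apply/rowP => i; rewrite mxE.
  by apply/eqP; apply: contrapT => /negP hi; apply: h; exists i.
have c0 : 2 * pi * (xi 0 i)%:~R != 0 :> R.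
  by rewrite mulf_neq0 ?intr_eq0// mulf_neq0 ?pnatr_eq0// gt_eqF ?pi_gt0.
have := test_int_partial i (trp_test (xi, ~~ s)).
rewrite /trp /= partial_tr negbK /torus_int RIZl//; last first.
  exact: test_integrable (trp_test (xi, s)).
move/eqP; rewrite mulf_eq0 => /orP[|/eqP//].
by case: s => /=; rewrite mulf_eq0 (negbTE c0) ?oner_eq0 ?oppr_eq0 ?oner_eq0.
Qed.

(** The product formula leaves modes of frequency [p.1 + q.1] and [p.1 - q.1], of which only the
    constant one has a nonzero integral. Two terms arise because xi and - xi carry the same function
    up to sign. *)
Lemma torus_int_trp2 p q : torus_int (fun x => trp p x * trp q x) =
  2^-1 * ((p == q)%:R + sgs p.2 * (p == negm q)%:R).
Proof.
have E : (fun x => trp p x * trp q x) = fun x =>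
   2^-1 * ((if p.2 && q.2 then -1 else 1) * trp (p.1 + q.1, p.2 (+) q.2) x +
          (if ~~ p.2 && q.2 then -1 else 1) * trp (p.1 - q.1, p.2 (+) q.2) x).
  by apply/funext => x; exact: trp_mul.
have I p' : (torus n).-integrable setT (EFin \o fun y : TT => trp p' (row_of y)).
  by apply: test_integrable; exact: trp_test.
rewrite E /torus_int RIZl//; last by apply: itgD => //; apply: itgZl.
rewrite RID//; [|by apply: itgZl|by apply: itgZl].
rewrite !RIZl//.
have J p' : \int[torus n]_y trp p' (row_of y) = (p' == (0, false))%:R by exact: torus_int_trp.
rewrite !J; case: p q {E} => xi s [eta t] /=; congr (_ * _).
rewrite /negm !xpair_eqE /= [xi - eta == 0]subr_eq0 [xi + eta == 0]addr_eq0 /sgs.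
case: s; case: t => /=; rewrite ?andbT ?andbF ?mulr0 ?add0r ?addr0 ?mul1r//.
by rewrite addrC. by rewrite addrC.
Qed.

End FourierModes.

(** * Integrable functions without Fourier coefficients *)

Section Uniqueness.
Context {R : realType} {n : nat}.
Local Notation TT := (n.-tuple (measurableTypeR R)).
Local Notation mode := ('rV[int]_n * bool)%type.
Variable b : TT -> R.
Hypothesis Ib : (torus n).-integrable setT (EFin \o b).
Hypothesis b0 : forall p : mode, \int[torus n]_y (b y * trp p (row_of y)) = 0.

Local Notation mf h := (measurable_fun [set: TT] h).
Local Notation bd h := (exists M : R, forall y, `|h y| <= M).

Definition ortho_class (h : TT -> R) := [/\ mf h, bd h &
  forall p : mode, \int[torus n]_y (b y * h y * trp p (row_of y)) = 0].

(* When all Fourier coefficients of [b] vanish, the multipliers form an algebra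
   that contains the trigonometric polynomials and is closed under bounded
   limits; it then contains all indicators, so that b = 0 almost everywhere. *)
Definition multiplier (q : TT -> R) := [/\ mf q, bd q &
  forall h, ortho_class h -> ortho_class (fun y => h y * q y)].

Lemma bdM (h k : TT -> R) : bd h -> bd k -> bd (fun y => h y * k y).
Proof.
move=> [M hM] [K kK]; exists (M * K) => y; rewrite normrM.
by apply: ler_pM => //; exact: normr_ge0.
Qed.

Lemma ortho_int (h : TT -> R) (p : mode) : mf h -> bd h ->
  (torus n).-integrable setT (EFin \o fun y => b y * h y * trp p (row_of y)).
Proof.
move=> mh [M hM].
have mt : mf (fun y : TT => trp p (row_of y)) by apply: test_measurable; exact: trp_test.
have := itg_bddM measurableT (itg_bddM measurableT Ib mh (fun y _ => hM y)) mt
  (fun y _ => trp_bound p (row_of y)).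
by apply: itg_eq => // y _; ring.
Qed.

Lemma ortho1 : ortho_class (fun=> 1).
Proof.
split => //; first by exists 1 => y; rewrite normr1.
by move=> p; rewrite -[RHS](b0 p); apply: RI_eq => y _; rewrite mulr1.
Qed.

Lemma ortho_lin (c : R) (h k : TT -> R) : ortho_class h -> ortho_class k ->
  ortho_class (fun y => c * h y + k y).
Proof.
move=> [mh [M hM] h0] [mk [K kK] k0]; split.
- by apply: measurable_funD => //; apply: measurable_funM.
- exists (`|c| * M + K) => y; apply: le_trans (ler_normD _ _) _.
  by apply: lerD => //; rewrite normrM ler_wpM2l.
- move=> p.
  have I1 : (torus n).-integrable setT (EFin \o fun y => b y * h y * trp p (row_of y)).
    by apply: ortho_int => //; exists M.
  have I2 : (torus n).-integrable setT (EFin \o fun y => b y * k y * trp p (row_of y)).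
    by apply: ortho_int => //; exists K.
  transitivity (\int[torus n]_y (c * (b y * h y * trp p (row_of y)) + b y * k y * trp p (row_of y))).
    by apply: RI_eq => y _; ring.
  by rewrite RID//; [rewrite RIZl// h0 k0 mulr0 addr0|exact: itgZl].
Qed.

Lemma multiplier_lin (c : R) (h k : TT -> R) : multiplier h -> multiplier k ->
  multiplier (fun y => c * h y + k y).
Proof.
move=> [mh [M hM] h0] [mk [K kK] k0]; split.
- by apply: measurable_funD => //; apply: measurable_funM.
- exists (`|c| * M + K) => y; apply: le_trans (ler_normD _ _) _.
  by apply: lerD => //; rewrite normrM ler_wpM2l.
- move=> g Og; have := ortho_lin c (h0 _ Og) (k0 _ Og).
  by congr ortho_class; apply/funext => y; ring.
Qed.

Lemma multiplierM (h k : TT -> R) : multiplier h -> multiplier k ->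
  multiplier (fun y => h y * k y).
Proof.
move=> [mh hM h0] [mk kK k0]; split; [exact: measurable_funM|exact: bdM|].
move=> g Og; have := k0 _ (h0 _ Og).
by congr ortho_class; apply/funext => y; ring.
Qed.

Lemma multiplier1 : multiplier (fun=> 1).
Proof.
split => //; first by exists 1 => y; rewrite normr1.
by move=> h; congr ortho_class; apply/funext => y; rewrite mulr1.
Qed.

Lemma multiplierD (h k : TT -> R) : multiplier h -> multiplier k ->
  multiplier (fun y => h y + k y).
Proof.
by move=> mh mk; have := multiplier_lin 1 mh mk; congr multiplier; apply/funext => y; rewrite mul1r.
Qed.

Lemma multiplierZ (c : R) (h : TT -> R) : multiplier h -> multiplier (fun y => c * h y).
Proof.
move=> mh; have := multiplier_lin (-1) (multiplier_lin (1 - c) mh mh) (multiplier_lin 1 mh mh).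
by congr multiplier; apply/funext => y; ring.
Qed.

Lemma multiplier_cst (c : R) : multiplier (fun=> c).
Proof.
by have := multiplierZ c multiplier1; congr multiplier; apply/funext => y; rewrite mulr1.
Qed.

Lemma multiplierX (h : TT -> R) k : multiplier h -> multiplier (fun y => h y ^+ k).
Proof.
move=> mh; elim: k => [|k IH]; first exact: multiplier1.
by have := multiplierM mh IH; congr multiplier; apply/funext => y; rewrite exprS.
Qed.

(** The product of two modes is a combination of two modes, so orthogonality to all modes survives
    multiplication by one of them. *)
Lemma multiplier_trp (q : mode) : multiplier (fun y => trp q (row_of y)).
Proof.
have mt p : mf (fun y : TT => trp p (row_of y)) by apply: test_measurable; exact: trp_test.
have bt p : bd (fun y : TT => trp p (row_of y)) by exists 1 => y; exact: trp_bound.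
split=> // h [mh bh h0]; split; [exact: measurable_funM|exact: bdM|] => p.
have I p' := ortho_int p' mh bh.
pose c1 : R := if q.2 && p.2 then -1 else 1; pose c2 : R := if ~~ q.2 && p.2 then -1 else 1.
transitivity (\int[torus n]_y (2^-1 * (c1 * (b y * h y * trp (q.1 + p.1, q.2 (+) p.2) (row_of y)) +
   c2 * (b y * h y * trp (q.1 - p.1, q.2 (+) p.2) (row_of y))))).
  by apply: RI_eq => y _; rewrite -mulrA -[h y * _ * _]mulrA trp_mul /c1 /c2; ring.
rewrite RIZl//; last by apply: itgD => //; apply: itgZl.
rewrite RID//; [|by apply: itgZl|by apply: itgZl].
by rewrite !RIZl// !h0 !mulr0 addr0 mulr0.
Qed.

Lemma multiplier_ae_limit (q_ : nat -> TT -> R) (q : TT -> R) (M : R) :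
  (forall k, multiplier (q_ k)) -> mf q -> (forall k y, `|q_ k y| <= M) ->
  (forall y, `|q y| <= M) ->
  {ae torus n, forall y, (fun k => q_ k y) @ \oo --> q y} -> multiplier q.
Proof.
move=> mq_ mq q_M qM cq; split => //; first by exists M.
move=> h Oh; have [mh [K hK] h0] := Oh.
split; [exact: measurable_funM|by apply: bdM; [exists K|exists M]|] => p.
have mt : mf (fun y : TT => trp p (row_of y)) by apply: test_measurable; exact: trp_test.
have mb := itg_measurable Ib.
have := @RI_dct _ _ _ (torus n) setT measurableT
  (fun k y => b y * (h y * q_ k y) * trp p (row_of y))
  (fun y => b y * (h y * q y) * trp p (row_of y)) (fun y => K * M * `|b y|).
case.
- move=> k; have [mk _ _] := mq_ k.
  by apply: measurable_funM => //; apply: measurable_funM => //; exact: measurable_funM.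
- by apply: measurable_funM => //; apply: measurable_funM => //; exact: measurable_funM.
- apply: filterS cq => y cy _.
  exact: (cvgM (cvgM (cvg_cst _) (cvgM (cvg_cst _) cy)) (cvg_cst _)).
- by apply: itgZl => //; exact: integrable_abse Ib.
- apply: aeW => y k _.
  rewrite !normrM [`|b y| * _]mulrC -[leLHS]mulrA [_ * `|trp _ _|]mulrC mulrA.
  apply: ler_wpM2r => //; rewrite -[leRHS]mulr1.
  by apply: ler_pM; rewrite ?trp_bound ?mulr_ge0//; exact: ler_pM.
move=> _; rewrite (_ : (fun k => _) = cst 0).
  by move=> hc; apply/esym; exact: (cvg_unique _ (cvg_cst _) hc).
apply/funext => k; have [_ _ hk] := mq_ k; by have [_ _ ->] := hk _ Oh.
Qed.

(** The partial sums of the exponential series are polynomials in [q] and are uniformly bounded by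
    [expR M], so the theorem on bounded limits applies. *)
Lemma multiplier_expR (q : TT -> R) : multiplier q -> multiplier (fun y => expR (q y)).
Proof.
move=> mq; have [mfq [M qM] _] := mq.
have M0 (y : TT) : 0 <= M by exact: le_trans (normr_ge0 _) (qM y).
pose s k y : R := series (exp_coeff (q y)) k.
have ms k : multiplier (s k).
  elim: k => [|k IH].
    by have := multiplier_cst 0; congr multiplier; apply/funext => y; rewrite /s /series /= big_geq.
  have := multiplierD IH (multiplierZ (k`!%:R^-1) (multiplierX k mq)).
  congr multiplier; apply/funext => y; rewrite /s /series /= big_nat_recr//=; congr (_ + _).
  by rewrite /exp_coeff /= mulrC.
have bs k y : `|s k y| <= expR M.
  rewrite /s; apply: (@le_trans _ _ (series (exp_coeff M) k)).
    rewrite /series /=; apply: le_trans (ler_norm_sum _ _ _) _.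
    apply: ler_sum => i _; rewrite /exp_coeff /= normrM normrX [`|_^-1|]ger0_norm ?invr_ge0 ?ler0n//.
    by apply: ler_wpM2r; rewrite ?invr_ge0 ?ler0n// lerXn2r ?nnegrE// (M0 y).
  rewrite /expR; apply: nondecreasing_cvgn_le; last exact: is_cvg_series_exp_coeff.
  apply/nondecreasing_seqP => j; rewrite /series /= big_nat_recr//= lerDl.
  by rewrite /exp_coeff /= divr_ge0 ?exprn_ge0// ?ler0n// M0.
have mexp : mf (fun y => expR (q y)) by exact: measurableT_comp.
apply: (multiplier_ae_limit ms mexp bs).
- by move=> y; rewrite ger0_norm ?expR_ge0// ler_expR; exact: le_trans (ler_norm _) (qM y).
- by apply: aeW => y; exact: is_cvg_series_exp_coeff.
Qed.

(** An approximation of the indicator of positive numbers that stays among the multipliers. The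
    factor [k] in front serves t <= 0, where the inner exponential is at least 1, and sends t = 0 to
    the value 0; the square in the inner exponent beats that factor for t > 0. *)
Lemma sigmoid_limit (t : R) :
  (fun k : nat => expR (- (k%:R * expR (- (k%:R ^+ 2 * t))))) @ \oo --> ((0 < t)%R%:R : R).
Proof.
have [t0|t0] := ltP 0 t; last first.
  apply: (@squeeze0 _ _ (fun k => (k.+1%:R)^-1)); last exact: cvg_harmonic.
  move=> k; rewrite ger0_norm ?expR_ge0// expRN lef_pV2 ?posrE ?expR_gt0 ?ltr0n//.
  apply: (@le_trans _ _ (expR k%:R)); first by have := expR_ge1Dx (k%:R : R); rewrite -natr1; lra.
  rewrite ler_expR -[leLHS]mulr1 ler_wpM2l ?ler0n//.
  rewrite -[leLHS]expR0 ler_expR oppr_ge0 mulr_ge0_le0//; exact: sqr_ge0.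
rewrite -[true%:R](@expR0 R).
suff h : (fun k : nat => k%:R * expR (- (k%:R ^+ 2 * t)) : R) @ \oo --> (0 : R).
  have hN : (fun k : nat => - (k%:R * expR (- (k%:R ^+ 2 * t))) : R) @ \oo --> (0 : R).
    by rewrite -oppr0; exact: cvgN.
  exact: (cvg_comp _ expR hN (@continuous_expR R 0)).
rewrite -cvg_shiftS /=.
apply: (@squeeze0 _ _ (fun k => t^-1 * (k.+1%:R)^-1)); last first.
  by rewrite -(mulr0 t^-1); apply: cvgM; [exact: cvg_cst|exact: cvg_harmonic].
move=> k; have k0 : (0 : R) < k.+1%:R by rewrite ltr0n.
rewrite ger0_norm ?mulr_ge0 ?expR_ge0// expRN.
rewrite -invfM -[leLHS]invrK lef_pV2 ?posrE ?invr_gt0 ?mulr_gt0 ?invr_gt0 ?expR_gt0//.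
rewrite invfM invrK.
have := expR_ge1Dx (k.+1%:R ^+ 2 * t); set E := expR _ => hE.
rewrite ler_pdivlMl//; apply: le_trans hE.
by rewrite [k.+1%:R * _]mulrCA -expr2 mulrC ler_wpDl.
Qed.

Lemma multiplier_pos_set (q : TT -> R) : multiplier q ->
  multiplier (fun y => (0 < q y)%R%:R).
Proof.
move=> mq; have [mfq [M qM] _] := mq.
apply: (@multiplier_ae_limit (fun k y => expR (- (k%:R * expR (- (k%:R ^+ 2 * q y))))) _ 1).
- move=> k; apply: multiplier_expR.
  have := multiplierZ (- k%:R) (multiplier_expR (multiplierZ (- k%:R ^+ 2) mq)).
  by congr multiplier; apply/funext => y; rewrite !mulNr.
- rewrite (_ : (fun y => _) = \1_(q @^-1` `]0, +oo[)); last first.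
    by apply/funext => y; rewrite indicE; congr ((nat_of_bool _)%:R); apply/idP/idP; rewrite inE /= in_itv /= andbT.
  by apply: measurable_indic; rewrite -[X in measurable X]setTI; apply: mfq.
- by move=> k y; rewrite ger0_norm ?expR_ge0// expR_le1 oppr_le0 mulr_ge0// expR_ge0.
- by move=> y; case: (0 < q y); rewrite ?normr1 ?normr0.
- by apply: aeW => y; exact: sigmoid_limit.
Qed.

Lemma multiplier_ae (q q' : TT -> R) : multiplier q -> mf q' -> bd q' ->
  {ae torus n, forall y, q y = q' y} -> multiplier q'.
Proof.
move=> mq mq' [M' qM'] qq'; have [_ [M qM] _] := mq.
apply: (@multiplier_ae_limit (fun=> q) _ (Num.max M M')) => //.
- by move=> _ y; rewrite le_max qM.
- by move=> y; rewrite le_max qM' orbT.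
- by apply: filterS qq' => y ->; exact: cvg_cst.
Qed.

Definition multiplier_set (A : set TT) := measurable A /\ multiplier (\1_A).

(** On indicators, complement and intersection are 1 - q and q q', which stay in the algebra; a
    countable union is the bounded limit of finite ones. *)
Lemma multiplier_set_sigma : sigma_algebra setT multiplier_set.
Proof.
have C (A : set TT) : multiplier_set A -> multiplier_set (~` A).
  move=> [mA qA]; split; first exact: measurableC.
  have := multiplierD (multiplier_cst 1) (multiplierZ (-1) qA).
  by congr multiplier; apply/funext => y; rewrite !indicE in_setC; case: (y \in A) => /=;
    rewrite ?mulr1 ?subrr ?mulr0 ?addr0.
have I (A B : set TT) : multiplier_set A -> multiplier_set B -> multiplier_set (A `&` B).
  move=> [mA qA] [mB qB]; split; first exact: measurableI.
  by have := multiplierM qA qB; congr multiplier; apply/funext => y; rewrite !indicE in_setI -natrM mulnb.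
have Z : multiplier_set set0.
  split => //; have := multiplier_cst 0; congr multiplier.
  by apply/funext => y; rewrite indicE in_set0.
split => //; first by move=> A hA; rewrite setTD; exact: C.
move=> F hF.
have hU k : multiplier_set (\bigcup_(i < k) F i).
  elim: k => [|k IH]; first by rewrite (_ : \bigcup_(i < 0) F i = set0)//; apply/seteqP; split => // y [].
  rewrite (_ : \bigcup_(i < k.+1) F i = ~` (~` (\bigcup_(i < k) F i) `&` ~` F k)).
    by exact: (C _ (I _ _ (C _ IH) (C _ (hF k)))).
  rewrite setCI !setCK; apply/seteqP; split => y /=.
    move=> [i /= ik Fi]; case: (ltnP i k) => hik; first by left; exists i.
    by right; have -> : k = i by apply/eqP; rewrite eqn_leq hik -ltnS ik.
  move=> [[i /= ik Fi]|Fk]; first by exists i => //=; exact: ltnW.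
  by exists k => /=.
have mU : measurable (\bigcup_i F i) by apply: bigcup_measurable => i _; exact: (hF i).1.
split => //.
apply: (@multiplier_ae_limit (fun k => \1_(\bigcup_(i < k) F i)) _ 1).
- by move=> k; exact: (hU k).2.
- exact: measurable_indic.
- by move=> k y; rewrite indicE; case: (_ \in _); rewrite ?normr1 ?normr0.
- by move=> y; rewrite indicE; case: (_ \in _); rewrite ?normr1 ?normr0.
- apply: aeW => y; have [[i _ Fi]|nF] := pselect ((\bigcup_i F i) y).
    apply: (@cvg_trans _ (cst (\1_(\bigcup_i F i) y : R) @ \oo)); last exact: cvg_cst.
    apply: near_eq_cvg; exists i.+1 => // k /= ik.
    by rewrite !indicE !mem_set//; [exists i|exists i].
  rewrite (_ : (fun k => _) = cst (\1_(\bigcup_i F i) y)); first exact: cvg_cst.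
  apply/funext => k; rewrite /= !indicE !memNset// => -[i ik Fi]; apply: nF; exists i => //.
Qed.

Lemma multiplier_set_ae (A B : set TT) : multiplier_set A -> measurable B ->
  {ae torus n, forall y, A y <-> B y} -> multiplier_set B.
Proof.
move=> [mA qA] mB AB; split => //; apply: (multiplier_ae qA) => //.
- by exists 1 => y; rewrite indicE; case: (_ \in _); rewrite ?normr1 ?normr0.
- apply: filterS AB => y h; rewrite !indicE; congr ((nat_of_bool _)%:R).
  by apply/idP/idP => /set_mem/h/mem_set.
Qed.

Lemma multiplier_set_pos (q : TT -> R) : multiplier q -> multiplier_set [set y | 0 < q y].
Proof.
move=> mq; have [mfq _ _] := mq; split.
  have := mfq measurableT `]0, +oo[%classic (measurable_itv _); rewrite setTI.
  by congr measurable; apply/seteqP; split => y /=; rewrite in_itv /= andbT.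
have := multiplier_pos_set mq; congr multiplier; apply/funext => y; rewrite indicE; congr ((nat_of_bool _)%:R).
by apply/idP/idP; rewrite inE.
Qed.

(* On the open cube, [y_i < c] iff [2 sin (pi y_i) sin (pi (c - y_i)) > 0], a trigonometric polynomial. *)
Lemma multiplier_set_ray (i : 'I_n) (c : R) : multiplier_set [set y : TT | tnth y i < c].
Proof.
have mB : measurable [set y : TT | tnth y i < c].
  have := @measurable_tnth _ (measurableTypeR R) n i measurableT `]-oo, c[%classic (measurable_itv _).
  by rewrite setTI; congr measurable; apply/seteqP; split => y /=; rewrite in_itv.
have [sT sC sU] := multiplier_set_sigma.
have [c0|c0] := leP c 0.
  apply: (multiplier_set_ae sT mB); apply: filterS (ae_open_cube n) => y hy; split => // /= h.
  by have := hy i; lra.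
have [c1|c1] := leP 1 c.
  apply: (multiplier_set_ae (sC _ sT) mB); apply: filterS (ae_open_cube n) => y hy; split => [_ /=|_].
    by have := hy i; lra.
  by split.
pose e : mode := (delta_mx 0 i, false); pose e' : mode := (delta_mx 0 i, true).
have mq : multiplier (fun y => cos (pi * c) * trp e (row_of y) + (sin (pi * c) * trp e' (row_of y)
   + - cos (pi * c))).
  apply: multiplierD; first by apply: multiplierZ; exact: multiplier_trp.
  by apply: multiplierD; [apply: multiplierZ; exact: multiplier_trp|exact: multiplier_cst].
apply: (multiplier_set_ae (multiplier_set_pos mq) mB).
apply: filterS (ae_open_cube n) => y hy /=.
have ph : phase (delta_mx 0 i) (row_of y) = 2 * pi * tnth y i.
  rewrite /phase (bigD1 i)//= !mxE !eqxx mul1r big1 ?addr0// => j ji.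
  by rewrite !mxE eqxx /= (negbTE ji) mul0r.
rewrite /trp /tr /= ph; set t := tnth y i; have := hy i; rewrite -/t => ht.
have -> : cos (pi * c) * cos (2 * pi * t) + (sin (pi * c) * sin (2 * pi * t) + - cos (pi * c)) =
   2 * sin (pi * t) * sin (pi * (c - t)).
  have -> : pi * (c - t) = pi * c - pi * t by ring.
  have -> : 2 * pi * t = (pi * t) *+ 2 by ring.
  rewrite sinB cos_mulr2n sin_mulr2n.
  have := cos2Dsin2 (pi * t); set C := cos (pi * t); set S := sin (pi * t).
  move=> h; have -> : C ^+ 2 = 1 - S ^+ 2 by lra.
  ring.
have p0 := @pi_gt0 R.
have sp (z : R) : 0 < z < 1 -> 0 < sin (pi * z).
  move=> /andP[z0 z1]; apply: sin_gt0_pi; rewrite mulr_gt0//=.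
  by rewrite gtr_pMr.
rewrite pmulr_rgt0; last by rewrite mulr_gt0// sp.
split; last by move=> tc; apply: sp; lra.
move=> h; rewrite ltNge; apply/negP => ct.
have [ct'|ct'] := eqVneq c t; first by move: h; rewrite ct' subrr mulr0 sin0 ltxx.
have := sp (t - c); have -> : pi * (t - c) = - (pi * (c - t)) by ring.
rewrite sinN oppr_gt0 => h'.
have : 0 < t - c < 1 by rewrite subr_gt0 lt_neqAle ct' ct /=; lra.
by move=> /h'; move: h; lra.
Qed.

(** The rays generate the Borel sets of the line, and preimages of Borel sets under the coordinates
    generate the sigma-algebra of tuples. *)
Lemma multiplier_set_measurable (A : set TT) : measurable A -> multiplier_set A.
Proof.
have [sT sC sU] := multiplier_set_sigma.
have coord (i : 'I_n) (B : set R) : measurable B -> multiplier_set [set y : TT | B (tnth y i)].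
  move=> mB; have mB' : (@RGenInftyO.G R).-sigma.-measurable B by rewrite -RGenInftyO.measurableE.
  apply: (smallest_sub (X := [set B | multiplier_set [set y : TT | B (tnth y i)]]) _ _ mB').
    split => /=.
    - exact: sT.
    - move=> C /sC; congr multiplier_set; by apply/seteqP; split => y /=.
    - by move=> F hF; apply: sU.
  move=> _ [c ->] /=.
  have -> : [set y : TT | `]-oo, c[%classic (tnth y i)] = [set y | tnth y i < c].
    by apply/seteqP; split => y /=; rewrite in_itv.
  exact: multiplier_set_ray.
apply: smallest_sub; first exact: multiplier_set_sigma.
move=> B; rewrite -bigcup_seq => -[/= i _ [C mC <-]]; rewrite setTI.
exact: (coord i C mC).
Qed.

Lemma uniqueness : {ae torus n, forall y, b y = 0}.
Proof.
have : ae_eq (torus n) setT (EFin \o b) (cst 0%E).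
  apply: integral_ae_eq => //.
  move=> E _ mE; rewrite integral0.
  have [_ mul1] := multiplier_set_measurable mE.
  have [_ _ mul1'] := mul1; have [_ _ h] := mul1' _ ortho1.
  (* At the constant mode, the vanishing coefficient of [b] times the indicator of [E] is the
     integral of [b] over [E]. *)
  have := h (0, false); rewrite trp0 => h0.
  rewrite integral_mkcond.
  have IE : (torus n).-integrable setT (EFin \o (fun y => b y * \1_E y)).
    have := itg_bddM measurableT Ib (@measurable_indic _ _ R setT E mE) (M := 1).
    move=> hh; apply: itg_eq (hh _) => [//|y _|y _]; first by rewrite mulrC.
    by rewrite indicE; case: (_ \in _); rewrite ?normr1 ?normr0.
  transitivity (\int[torus n]_y (b y * \1_E y)%:E)%E.
    apply: eq_integral => y _; rewrite patchE indicE; case: (y \in E) => /=.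
      by rewrite mulr1.
    by rewrite mulr0.
  rewrite -RI_EFin//; congr (_%:E); rewrite -[RHS]h0; apply: RI_eq => y _.
  by rewrite mul1r mulr1.
by apply: filterS => y /= /(_ Logic.I) [].
Qed.

End Uniqueness.

(** * Sums over the lattice *)

Section Lattice.
Context {R : realType} {n : nat}.
Local Notation mode := ('rV[int]_n * bool)%type.
Implicit Types (xi : 'rV[int]_n) (p q : mode).

(** The maximum norm is chosen because its balls are cubes, whose lattice points can be counted
    exactly. *)
Definition xnorm xi : nat := (\max_(i < n) absz (xi 0%R i))%N.

Definition box (N : nat) : seq 'rV[int]_n :=
  [seq (\row_i ((m i : nat)%:Z - N%:Z)) | m : {ffun 'I_n -> 'I_((N + N).+1)}].

Lemma xnorm_leP xi N : reflect (forall i, (absz (xi 0%R i) <= N)%N) (xnorm xi <= N)%N.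
Proof.
rewrite /xnorm; apply: (iffP (@bigmax_leqP _ xpredT N (fun i : 'I_n => absz (xi 0%R i)))) => h i; first exact: h.
by move=> _; exact: h.
Qed.

Lemma mem_box N xi : (xi \in box N) = (xnorm xi <= N)%N.
Proof.
apply/mapP/xnorm_leP => [[m _ ->] i|h].
  by rewrite mxE; have := ltn_ord (m i); move: (m i : nat) => k; lia.
have hi i : (absz (xi 0 i + N%:Z)%R < (N + N).+1)%N by have := h i; lia.
exists [ffun i => Ordinal (hi i)]; first by rewrite mem_enum.
by apply/rowP => i; rewrite mxE ffunE /=; have := h i; lia.
Qed.

Lemma box_uniq N : uniq (box N).
Proof.
rewrite map_inj_uniq ?enum_uniq// => m1 m2 /rowP h; apply/ffunP => i.
by apply/val_inj; have := h i; rewrite !mxE /=; lia.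
Qed.

Lemma size_box N : size (box N) = ((N + N).+1 ^ n)%N.
Proof. by rewrite size_map -cardE card_ffun !card_ord. Qed.

Lemma xnormN xi : xnorm (- xi) = xnorm xi.
Proof. by apply: eq_bigr => i _; rewrite mxE abszN. Qed.

Lemma box_le N M : (N <= M)%N -> {subset box N <= box M}.
Proof. by move=> NM xi; rewrite !mem_box => /leq_trans; exact. Qed.

Lemma ler_sum_subset (I : eqType) (s t : seq I) (F : I -> R) : uniq s -> uniq t ->
  {subset s <= t} -> (forall i, 0 <= F i) -> \sum_(i <- s) F i <= \sum_(i <- t) F i.
Proof.
move=> us ut st F0.
have h : perm_eq t (s ++ [seq x <- t | x \notin s]).
  apply: uniq_perm => //.
    rewrite cat_uniq us filter_uniq// andbT; apply/hasPn => x.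
    by rewrite mem_filter => /andP[].
  move=> x; rewrite mem_cat mem_filter; case xs : (x \in s) => //=.
  exact: st.
by rewrite (perm_big _ h)/= big_cat/= lerDl sumr_ge0.
Qed.

Lemma box_sum_le N M (F : 'rV[int]_n -> R) : (forall xi, 0 <= F xi) -> (N <= M)%N ->
  \sum_(xi <- box N) F xi <= \sum_(xi <- box M) F xi.
Proof.
move=> F0 NM; apply: ler_sum_subset => //; [exact: box_uniq|exact: box_uniq|exact: box_le].
Qed.

Lemma box_sum_neg N (F : 'rV[int]_n -> R) :
  \sum_(xi <- box N) F (- xi) = \sum_(xi <- box N) F xi.
Proof.
rewrite -(big_map (fun xi => - xi) xpredT F); apply: perm_big.
apply: uniq_perm; rewrite ?box_uniq//.
  by rewrite map_inj_uniq ?box_uniq//; exact: oppr_inj.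
move=> xi; apply/mapP/idP => [[eta + ->]|h]; first by rewrite !mem_box xnormN.
by exists (- xi); rewrite ?opprK// mem_box xnormN -mem_box.
Qed.

(** Every finite set of frequencies lies in some box, so the boxes exhaust the unordered sum of a
    nonnegative family. *)
Lemma box_sum_cvg (F : 'rV[int]_n -> R) : (forall xi, 0 <= F xi) ->
  (fun N => (\sum_(xi <- box N) F xi)%:E) @ \oo --> \esum_(xi in [set: 'rV[int]_n]) (F xi)%:E.
Proof.
move=> F0.
have nd : nondecreasing_seq (fun N => (\sum_(xi <- box N) F xi)%:E).
  by move=> N M NM; rewrite lee_fin; exact: box_sum_le.
suff -> : \esum_(xi in [set: 'rV[int]_n]) (F xi)%:E = ereal_sup (range (fun N => (\sum_(xi <- box N) F xi)%:E)).
  exact: ereal_nondecreasing_cvgn.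
apply/eqP; rewrite eq_le; apply/andP; split.
- apply: ge_ereal_sup => _ [X [fX _] <-].
  rewrite fsbig_finite//=.
  pose s : seq 'rV[int]_n := finmap.enum_fset (fset_set X); pose N := (\max_(x <- s) xnorm x)%N.
  apply: (@le_trans _ _ (\sum_(xi <- box N) F xi)%:E); last first.
    by apply: ereal_sup_ubound; exists N.
  rewrite sumEFin lee_fin; apply: ler_sum_subset => //.
  + exact: finmap.fset_uniq.
  + exact: box_uniq.
  + by move=> xi xis; rewrite mem_box /N; exact: (@leq_bigmax_seq _ s xpredT xnorm xi xis).
- apply: ge_ereal_sup => _ [N _ <-].
  apply: esum_ge; exists [set` box N]; first by split => //; exact: finite_seq.
  by rewrite -sumEFin -fsbig_seq ?box_uniq.
Qed.

Lemma esum_le_bound (F : 'rV[int]_n -> R) (K : \bar R) : (forall xi, 0 <= F xi) ->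
  (forall N, ((\sum_(xi <- box N) F xi)%:E <= K)%E) ->
  (\esum_(xi in [set: 'rV[int]_n]) (F xi)%:E <= K)%E.
Proof.
move=> F0 hK; have h := box_sum_cvg F0.
rewrite -(cvg_lim _ h)//; apply: lime_le; first by apply/cvg_ex; eexists; exact: h.
exact: nearW.
Qed.

Lemma esum_fin_cvg (F : 'rV[int]_n -> R) : (forall xi, 0 <= F xi) ->
  (\esum_(xi in [set: 'rV[int]_n]) (F xi)%:E < +oo)%E ->
  (fun N => \sum_(xi <- box N) F xi) @ \oo --> fine (\esum_(xi in [set: 'rV[int]_n]) (F xi)%:E).
Proof.
move=> F0 hF; have := box_sum_cvg F0.
have fn : \esum_(xi in [set: 'rV[int]_n]) (F xi)%:E \is a fin_num.
  by rewrite ge0_fin_numE// esum_ge0// => xi _; rewrite lee_fin.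
rewrite -{1}(fineK fn) => h.
exact: (fine_cvg h).
Qed.

Lemma zsum_cvg (c : 'rV[int]_n -> R) (K : R) :
  (forall N, \sum_(xi <- box N) `|c xi| <= K) ->
  (fun N => \sum_(xi <- box N) c xi) @ \oo --> zsum c.
Proof.
move=> hK; rewrite /zsum.
have pos (e : R -> R) : (forall x, 0 <= e x <= `|x|) ->
  (fun N => \sum_(xi <- box N) e (c xi)) @ \oo -->
  fine (\esum_(xi in [set: 'rV[int]_n]) (e (c xi))%:E).
  move=> he; apply: esum_fin_cvg; first by move=> xi; have /andP[] := he (c xi).
  apply: (@le_lt_trans _ _ K%:E); last exact: ltry.
  apply: esum_le_bound; first by move=> xi; have /andP[] := he (c xi).
  move=> N; rewrite lee_fin; apply: le_trans (hK N); apply: ler_sum => xi _.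
  by have /andP[] := he (c xi).
have h1 := pos (fun x => Num.max x 0) _; have h2 := pos (fun x => Num.max (- x) 0) _.
have := cvgB (h1 _) (h2 _).
rewrite (_ : (fun N => _) - (fun N => _) = fun N => \sum_(xi <- box N) c xi).
  apply => x.
    by rewrite le_max lexx orbT ge_max ler_norm normr_ge0.
  by rewrite le_max lexx orbT ge_max -[leRHS]normrN ler_norm normr_ge0.
apply/funext => N /=; rewrite -[LHS]sumrB; apply: eq_bigr => xi _.
have [h|h] := leP 0 (c xi).
  by rewrite max_r ?subr0// oppr_le0.
by rewrite max_l ?oppr_ge0 ?ltW// sub0r opprK.
Qed.

(** The shell has (2N+3)^n - (2N+1)^n points, at most 2n (2N+3)^(n-1), and 2N+3 <= 3 (N+1). *)
Lemma size_shell N : (0 < n)%N ->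
  (size (box N.+1) <= size (box N) + 2 * n * 3 ^ n.-1 * N.+1 ^ n.-1)%N.
Proof.
move=> n0; rewrite !size_box.
have key k (a : nat) : ((a.+2) ^ k.+1 <= a ^ k.+1 + 2 * k.+1 * a.+2 ^ k)%N.
  elim: k => [|k IH]; first by rewrite !expn1 expn0; lia.
  rewrite [in leqLHS]expnS; have : (a.+2 * a.+2 ^ k.+1 <= a.+2 * (a ^ k.+1) + a.+2 * (2 * k.+1 * a.+2 ^ k))%N.
    by rewrite -mulnDr leq_mul2l IH orbT.
  have h1 : (a.+2 * (2 * k.+1 * a.+2 ^ k) = 2 * k.+1 * a.+2 ^ k.+1)%N by rewrite [(a.+2 ^ k.+1)%N]expnS; lia.
  have h2 : (a ^ k.+1 <= a.+2 ^ k.+1)%N by rewrite leq_exp2r//; lia.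
  rewrite h1 [(a ^ k.+2)%N]expnS; move: h2.
  set A := (a ^ k.+1)%N; set B := (a.+2 ^ k.+1)%N; nia.
case: n n0 => // k _; have := key k (N + N).+1; rewrite (_ : ((N + N).+1.+2 = (N.+1 + N.+1).+1)%N); last lia.
move=> /leq_trans; apply.
rewrite leq_add2l -!mulnA !leq_mul2l -expnMn /=.
by case: k => // k; rewrite leq_exp2r//; lia.
Qed.

Lemma box_sum_radial (f : nat -> R) N : (0 < n)%N -> (forall m, 0 <= f m) ->
  \sum_(xi <- box N) f (xnorm xi) <=
  f 0%N + \sum_(m < N) f m.+1 * ((2 * n * 3 ^ n.-1) %:R * m.+1%:R ^+ n.-1).
Proof.
move=> n0 f0; elim: N => [|N IH].
  rewrite big_ord0 addr0; have : size (box 0) = 1%N by rewrite size_box exp1n.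
  case E : (box 0) => [|xi [|]]// _; rewrite big_seq1.
  have : xi \in box 0 by rewrite E inE.
  by rewrite mem_box leqn0 => /eqP ->.
rewrite big_ord_recr /= addrA.
have h : perm_eq (box N.+1) (box N ++ [seq x <- box N.+1 | x \notin box N]).
  apply: uniq_perm; first exact: box_uniq.
    rewrite cat_uniq box_uniq filter_uniq ?box_uniq// andbT; apply/hasPn => x.
    by rewrite mem_filter => /andP[].
  move=> x; rewrite mem_cat mem_filter; case xs : (x \in box N) => //=.
  exact: (box_le (leqnSn N)).
rewrite (perm_big _ h)/= big_cat/=; apply: lerD => //.
set t := [seq _ <- _ | _].
have -> : \sum_(xi <- t) f (xnorm xi) = (size t)%:R * f N.+1.
  rewrite big_seq (eq_bigr (fun=> f N.+1)); last first.
    move=> xi; rewrite mem_filter !mem_box -ltnNge => /andP[a b].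
    by congr f; apply/eqP; rewrite eqn_leq b a.
  by rewrite -big_seq big_const_seq count_predT iter_addr_0 mulr_natl.
rewrite mulrC ler_wpM2l//.
have := perm_size h; rewrite size_cat => hs.
by rewrite -natrX -natrM ler_nat; have := size_shell N n0; rewrite hs leq_add2l -!mulnA.
Qed.

(** The summand 1 accounts for the origin, the other one is the constant in the count of a shell. *)
Definition lattC : R := 1 + (2 * n * 3 ^ n.-1)%:R.

Lemma lattC_ge1 : 1 <= lattC.
Proof. by rewrite /lattC lerDl ler0n. Qed.

Lemma box_sum_decay N : (0 < n)%N ->
  \sum_(xi <- box N) (1 + (xnorm xi)%:R) ^- n.+1 <= lattC.
Proof.
move=> n0.
have f0 (m : nat) : 0 <= (1 + m%:R : R) ^- n.+1 by rewrite invr_ge0 exprn_ge0// addr_ge0.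
apply: le_trans (@box_sum_radial (fun m => (1 + m%:R) ^- n.+1) N n0 f0) _.
rewrite addr0 expr1n invr1 /lattC lerD2l.
set C := (2 * _ * _)%:R.
(* A shell of radius r has O(r^(n-1)) points of weight (1+r)^-(n+1), which contribute at most a
   constant times 1/(r (r+1)); this telescopes. *)
apply: (@le_trans _ _ (C * \sum_(m < N) (m.+1%:R^-1 - m.+2%:R^-1))).
  rewrite mulr_sumr; apply: ler_sum => m _.
  rewrite mulrCA ler_wpM2l ?ler0n//.
  have m0 : (0 : R) < m.+1%:R by rewrite ltr0n.
  have m10 : (0 : R) < m.+2%:R by rewrite ltr0n.
  have -> : m.+1%:R^-1 - m.+2%:R^-1 = (m.+1%:R * m.+2%:R)^-1 :> R.
    have e : m.+2%:R = m.+1%:R + 1 :> R by rewrite natr1.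
    move: m0 m10; rewrite e; set a := m.+1%:R => a0 a1.
    by field; rewrite !lt0r_neq0.
  have -> : 1 + m.+1%:R = m.+2%:R :> R by rewrite -[m.+2%:R]natr1 addrC.
  rewrite (_ : n.+1 = n.-1.+2); last by rewrite prednK.
  rewrite exprS exprS invfM.
  apply: (@le_trans _ _ (m.+2%:R^-1 * m.+2%:R^-1)).
    rewrite invfM -!mulrA ler_wpM2l ?invr_ge0// -[leRHS]mulr1 ler_wpM2l ?invr_ge0//.
    rewrite ler_pdivrMl ?exprn_gt0// mulr1 lerXn2r ?nnegrE ?ler0n// ler_nat//.
  by rewrite invfM ler_wpM2r ?invr_ge0// lef_pV2 ?posrE// ler_nat.
rewrite -[leRHS]mulr1 ler_wpM2l ?ler0n//.
rewrite -(big_mkord xpredT (fun m => m.+1%:R^-1 - m.+2%:R^-1)).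
rewrite (eq_bigr (fun m => - (m.+2%:R^-1) - - (m.+1%:R^-1))); last first.
  by move=> m _; rewrite opprK addrC.
by rewrite (@telescope_sumr _ 0 N (fun m => - m.+1%:R^-1))// opprK addrC invr1 lerBlDl lerDr invr_ge0.
Qed.

(** Each of the [N] shells contributes at most a constant times [1 + N]. This quadratic growth is
    what makes the order n/2 sufficient in the trilinear estimate. *)
Lemma box_sum_growth N : (2 <= n)%N ->
  \sum_(xi <- box N) (1 + (xnorm xi)%:R) ^- (n - 2) <= lattC * (1 + N%:R) ^+ 2.
Proof.
move=> n2; have n0 : (0 < n)%N by exact: ltn_trans n2.
have f0 (m : nat) : 0 <= (1 + m%:R : R) ^- (n - 2) by rewrite invr_ge0 exprn_ge0// addr_ge0.
apply: le_trans (@box_sum_radial (fun m => (1 + m%:R) ^- (n - 2)) N n0 f0) _.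
rewrite addr0 expr1n invr1 /lattC mulrDl mul1r.
set C := (2 * _ * _)%:R.
have N0 : (0 : R) <= N%:R by [].
apply: lerD; first by rewrite -[leLHS](expr1n _ 2) lerXn2r ?nnegrE ?addr_ge0//; lra.
apply: (@le_trans _ _ (\sum_(m < N) C * (1 + N%:R))).
  apply: ler_sum => m _; rewrite mulrCA ler_wpM2l ?ler0n//.
  have m0 : (0 : R) < m.+1%:R by rewrite ltr0n.
  rewrite ler_pdivrMl ?exprn_gt0 ?addr_gt0//.
  apply: (@le_trans _ _ ((1 + m.+1%:R) ^+ n.-1)).
    by rewrite lerXn2r ?nnegrE ?ler0n ?addr_ge0//; lra.
  have -> : n.-1 = (n - 2).+1 by lia.
  rewrite exprSr ler_wpM2l ?exprn_ge0// ?addr_ge0// lerD2l ler_nat; exact: ltn_ord.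
rewrite sumr_const card_ord -[leLHS]mulr_natl [leLHS]mulrCA.
apply: ler_wpM2l; first exact: ler0n.
by rewrite expr2 ler_wpM2r ?addr_ge0//; lra.
Qed.

Lemma box_count N : (size (box N))%:R <= 2 ^+ n * (1 + N%:R) ^+ n :> R.
Proof.
rewrite size_box -exprMn natrX lerXn2r ?nnegrE ?ler0n ?mulr_ge0 ?addr_ge0//.
by rewrite -natr1 natrD; have : (0 : R) <= N%:R by []; lra.
Qed.

(** Squaring reduces this to (1 + m)^2 <= 4 (1 + m^2). It allows the lattice sums, weighted by
    powers of [1 + xnorm xi], to be compared with Sobolev norms. *)
Lemma rho_ge xi : 1 + (xnorm xi)%:R <= rho xi :> R.
Proof.
have S (m : nat) : (m <= xnorm xi)%N -> m%:R ^+ 2 <= \sum_(i < n) ((xi 0 i)%:~R : R) ^+ 2.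
  case: m => [_|m hm]; first by rewrite expr0n /= sumr_ge0// => i _; exact: sqr_ge0.
  have [i hi] : exists i : 'I_n, (m.+1 <= absz (xi 0%R i))%N.
    apply: contrapT => h; move: hm; rewrite leqNgt => /negP; apply; rewrite ltnS.
    apply/xnorm_leP => i; rewrite leqNgt; apply/negP => hi; apply: h; exists i; exact: hi.
  rewrite (bigD1 i)//= -[leLHS]addr0 lerD ?sumr_ge0//; last by move=> j _; exact: sqr_ge0.
  rewrite -[leRHS](real_normK (num_real _)) lerXn2r ?nnegrE// -intr_norm.
  by rewrite -[m.+1%:R]/((m.+1%:Z)%:~R) ler_int; lia.
have m0 : (0 : R) <= (xnorm xi)%:R by [].
rewrite /rho; set m := (xnorm xi)%:R in m0 *.
have h : m ^+ 2 <= \sum_(i < n) ((xi 0 i)%:~R : R) ^+ 2 by exact: S.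
set s := \sum_(i < n) _ in h *.
have p2 := @pi_ge2 R.
have s0 : 0 <= s by exact: le_trans (sqr_ge0 m) h.
have q0 : 0 <= Num.sqrt (1 + s) by exact: sqrtr_ge0.
have q2 : Num.sqrt (1 + s) ^+ 2 = 1 + s by rewrite sqr_sqrtr; lra.
apply: (@le_trans _ _ (2 * Num.sqrt (1 + s))); last first.
  by rewrite ler_wpM2r//; lra.
rewrite -(@ler_pXn2r _ 2)// ?nnegrE ?addr_ge0// ?mulr_ge0// exprMn q2.
have := sqr_ge0 (m - 1); nra.
Qed.

Lemma rho_gt0 xi : 0 < rho xi :> R.
Proof. by apply: lt_le_trans (rho_ge xi); have : (0 : R) <= (xnorm xi)%:R by []; lra. Qed.

Lemma rho_ge1 xi : 1 <= rho xi :> R.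
Proof. by apply: le_trans (rho_ge xi); have : (0 : R) <= (xnorm xi)%:R by []; lra. Qed.

Lemma rho_sq xi : rho xi ^+ 2 = (2 * pi) ^+ 2 * (1 + \sum_(i < n) ((xi 0 i)%:~R : R) ^+ 2) :> R.
Proof.
by rewrite /rho exprMn sqr_sqrtr// addr_ge0// sumr_ge0// => i _; exact: sqr_ge0.
Qed.

End Lattice.

(** * Fourier series in L_2 *)

Lemma cvg_ext (R : realType) (x y : nat -> R) (l : R) : (forall N, x N = y N) ->
  x @ \oo --> l -> y @ \oo --> l.
Proof. by move=> /funext ->. Qed.

Section TorusL2.
Context {R : realType} {n : nat}.
Local Notation TT := (n.-tuple (measurableTypeR R)).
Local Notation mode := ('rV[int]_n * bool)%type.
Implicit Types (p q : mode) (phi psi b c : 'rV[R]_n -> R) (k : mode -> R).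

Definition tL1 b := (torus n).-integrable setT (EFin \o fun y : TT => b (row_of y)).
Definition tL2 b := sqi (torus n) setT (fun y : TT => b (row_of y)).

Lemma tL1D b c : tL1 b -> tL1 c -> tL1 (fun x => b x + c x).
Proof. exact: itgD. Qed.
Lemma tL1B b c : tL1 b -> tL1 c -> tL1 (fun x => b x - c x).
Proof. exact: itgB. Qed.
Lemma tL1Z (r : R) b : tL1 b -> tL1 (fun x => r * b x).
Proof. exact: itgZl. Qed.
Lemma tL1_sum I (s : seq I) (F : I -> 'rV[R]_n -> R) : (forall i, tL1 (F i)) ->
  tL1 (fun x => \sum_(i <- s) F i x).
Proof. by move=> h; exact: (@itg_sum _ _ _ (torus n) setT measurableT I s xpredT (fun i y => F i (row_of y)) (fun i _ => h i)). Qed.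
Lemma tL2D b c : tL2 b -> tL2 c -> tL2 (fun x => b x + c x).
Proof. exact: sqiD. Qed.
Lemma tL2B b c : tL2 b -> tL2 c -> tL2 (fun x => b x - c x).
Proof. exact: sqiB. Qed.
Lemma tL2Z (r : R) b : tL2 b -> tL2 (fun x => r * b x).
Proof. exact: sqiZl. Qed.
Lemma tL2M b c : tL2 b -> tL2 c -> tL1 (fun x => b x * c x).
Proof. exact: sqiM. Qed.
Lemma tL2_L1 b : tL2 b -> tL1 b.
Proof. by move=> h; have [] := RI_sq_le1 measurableT h (probability_setT _). Qed.

Lemma torus_intD b c : tL1 b -> tL1 c ->
  torus_int (fun x => b x + c x) = torus_int b + torus_int c.
Proof. exact: RID. Qed.
Lemma torus_intB b c : tL1 b -> tL1 c ->
  torus_int (fun x => b x - c x) = torus_int b - torus_int c.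
Proof. exact: RIB. Qed.
Lemma torus_intZ (r : R) b : tL1 b -> torus_int (fun x => r * b x) = r * torus_int b.
Proof. exact: RIZl. Qed.
Lemma torus_int_sum I (s : seq I) (F : I -> 'rV[R]_n -> R) : (forall i, tL1 (F i)) ->
  torus_int (fun x => \sum_(i <- s) F i x) = \sum_(i <- s) torus_int (F i).
Proof. by move=> h; exact: (@RI_sum _ _ _ (torus n) setT measurableT I s xpredT (fun i y => F i (row_of y)) (fun i _ => h i)). Qed.
Lemma torus_int_ge0 b : (forall x, 0 <= b x) -> 0 <= torus_int b.
Proof. by move=> h; apply: RI_ge0. Qed.
Lemma torus_int_norm b (M : R) : (forall x, `|b x| <= M) -> tL1 b -> `|torus_int b| <= M.
Proof.
move=> bM Ib; apply: le_trans (RI_norm measurableT Ib) _.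
have IM : (torus n).-integrable setT (EFin \o cst M).
  by apply: (@torus_integrable_bounded _ _ _ `|M|).
apply: (@le_trans _ _ (\int[torus n]_y cst M y)).
  by apply: RI_le => //; exact: integrable_abse Ib.
by rewrite Rintegral_cst//= probability_setT mulr1.
Qed.

Lemma torus_int_eqae b c : tL1 b -> tL1 c ->
  {ae torus n, forall y : TT, b (row_of y) = c (row_of y)} -> torus_int b = torus_int c.
Proof.
move=> Ib Ic bc; rewrite /torus_int /Rintegral; congr fine; apply: ae_eq_integral => //.
- exact: measurable_int Ib.
- exact: measurable_int Ic.
- by apply: filterS bc => y h _; rewrite /= h.
Qed.

Lemma tL1_bddM b c (M : R) : tL1 b -> measurable_fun setT (fun y : TT => c (row_of y)) ->
  (forall x, `|c x| <= M) -> tL1 (fun x => c x * b x).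
Proof. by move=> Ib mc cM; apply: (itg_bddM measurableT Ib mc (fun y _ => cM (row_of y))). Qed.

Lemma tL1_testM b phi : tL1 b -> test_fun phi -> tL1 (fun x => b x * phi x).
Proof.
move=> Ib tp; have [M hM] := test_bounded tp.
have := tL1_bddM Ib (test_measurable tp) hM.
by congr tL1; apply/funext => x; rewrite mulrC.
Qed.

Lemma tL2_test phi : test_fun phi -> tL2 phi.
Proof.
move=> tp; have h := sqi_lt; split; first exact: test_measurable.
have := test_integrable (testM tp tp).
by apply: itg_eq => // y _; rewrite expr2.
Qed.

Lemma tL1_test phi : test_fun phi -> tL1 phi.
Proof. exact: test_integrable. Qed.

Lemma torus_CS b c : tL2 b -> tL2 c ->
  (torus_int (fun x => b x * c x)) ^+ 2 <=
  torus_int (fun x => b x ^+ 2) * torus_int (fun x => c x ^+ 2).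
Proof. exact: CS. Qed.

Lemma L2per_tL2 b : L2per b -> tL2 b.
Proof. by move=> [[_ mb] h]; apply: sqi_ltP. Qed.

Lemma tL2_L2per b : periodic b -> tL2 b -> L2per b.
Proof. by move=> pb Lb; split; [split => //; exact: Lb.1|exact: sqi_lt Lb]. Qed.

Definition modes (N : nat) : seq mode := [seq (xi, s) | xi <- box N, s <- [:: false; true]].

Lemma mem_modes N p : (p \in modes N) = (xnorm p.1 <= N)%N.
Proof.
case: p => xi s; rewrite -mem_box /=; apply/allpairsP/idP => [[[xi' s'] [/= h _ [-> _]]]//|h].
by exists (xi, s); split => //=; case: s.
Qed.

Lemma modes_uniq N : uniq (modes N).
Proof.
apply: allpairs_uniq => //; first exact: box_uniq.
by move=> [x1 s1] [x2 s2] _ _ /= [-> ->].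
Qed.

Lemma modes_sum N (F : mode -> R) :
  \sum_(p <- modes N) F p = \sum_(xi <- box N) (F (xi, false) + F (xi, true)).
Proof.
rewrite big_allpairs; apply: eq_bigr => xi _.
by rewrite big_cons big_seq1.
Qed.

Lemma modes_sum_le N M (F : mode -> R) : (forall p, 0 <= F p) -> (N <= M)%N ->
  \sum_(p <- modes N) F p <= \sum_(p <- modes M) F p.
Proof. by move=> F0 NM; rewrite !modes_sum; apply: box_sum_le => // xi; exact: addr_ge0. Qed.

Lemma negm_in N p : (negm p \in modes N) = (p \in modes N).
Proof. by rewrite !mem_modes /= xnormN. Qed.

(* The coefficient families of real distributions: even for cosines, odd for sines. *)
Definition symc k := forall p, k (negm p) = sgs p.2 * k p.

Definition tp (N : nat) k : 'rV[R]_n -> R := fun x => \sum_(p <- modes N) k p * trp p x.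

Lemma tp_test N k : test_fun (tp N k).
Proof. by apply: test_sum => p; apply: testZ; exact: trp_test. Qed.

Lemma distr_tp b N k : tL1 b ->
  torus_int (fun x => b x * tp N k x) = \sum_(p <- modes N) k p * distr_of b (trp p).
Proof.
move=> Ib; transitivity (torus_int (fun x => \sum_(p <- modes N) (k p * (b x * trp p x)))).
  congr torus_int; apply/funext => x; rewrite /tp mulr_sumr; apply: eq_bigr => p _.
  by rewrite mulrCA.
rewrite torus_int_sum; last by move=> p; apply: tL1Z; apply: tL1_testM => //; exact: trp_test.
apply: eq_bigr => p _; rewrite torus_intZ//; apply: tL1_testM => //; exact: trp_test.
Qed.

Lemma sgs_sq (s : bool) : sgs s * sgs s = 1 :> R.
Proof. by case: s; rewrite /sgs ?mulr1 ?mulrNN ?mulr1. Qed.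

Lemma sum_modes_eq N (F : mode -> R) q : \sum_(p <- modes N) F p * (p == q)%:R = if q \in modes N then F q else 0.
Proof.
case: ifP => [qN|qN].
  rewrite (bigD1_seq q)//= ?modes_uniq// eqxx mulr1 big1_seq ?addr0// => p /andP[/negbTE -> _].
  by rewrite mulr0.
rewrite big1_seq// => p /andP[_ pN]; case: eqP => [pq|_]; last by rewrite mulr0.
by move: pN; rewrite pq qN.
Qed.

(** The modes [q] and [negm q] both meet [trp q], and by the symmetry of [k] each contributes half
    of [k q]; hence no normalising factor. *)
Lemma coef_tp N k q : symc k -> distr_of (tp N k) (trp q) = if q \in modes N then k q else 0.
Proof.
move=> sk; rewrite /distr_of (_ : (fun x => _) = (fun x => trp q x * tp N k x)); last first.
  by apply/funext => x; rewrite mulrC.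
rewrite distr_tp; last by apply: tL1_test; exact: trp_test.
rewrite (eq_bigr (fun p => 2^-1 * (k p * (p == q)%:R) + 2^-1 * sgs q.2 * (k p * (p == negm q)%:R))).
  rewrite big_split/= -!mulr_sumr !sum_modes_eq negm_in; case: ifP => _; last by rewrite !mulr0 addr0.
  by rewrite sk -mulrA [_ * (_ * k q)]mulrA sgs_sq mul1r; field.
move=> p _; rewrite /distr_of torus_int_trp2 [q == p]eq_sym.
rewrite (_ : (q == negm p) = (p == negm q)); first by ring.
by apply/eqP/eqP => ->; rewrite negmK.
Qed.

Lemma symc_distr b : tL1 b -> symc (fun p => distr_of b (trp p)).
Proof.
move=> Ib p; rewrite /distr_of trp_neg.
rewrite -torus_intZ; last by apply: tL1_testM => //; exact: trp_test.
by congr torus_int; apply/funext => x; rewrite mulrCA.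
Qed.

Definition proj (N : nat) (g : pdistr R n) := tp N (fun p => g (trp p)).

Lemma torus_int_sqB b c : tL2 b -> tL2 c ->
  torus_int (fun x => (b x - c x) ^+ 2) =
  torus_int (fun x => b x ^+ 2) - 2 * torus_int (fun x => b x * c x) + torus_int (fun x => c x ^+ 2).
Proof.
move=> Lb Lc.
transitivity (torus_int (fun x => b x ^+ 2 - 2 * (b x * c x) + c x ^+ 2)).
  by congr torus_int; apply/funext => x; ring.
rewrite torus_intD ?torus_intB ?torus_intZ//; try exact: tL2M; try exact: Lb.2; try exact: Lc.2.
- by apply: tL1Z; exact: tL2M.
- by apply: tL1B; [exact: Lb.2|apply: tL1Z; exact: tL2M].
Qed.

Lemma torus_int_tpM N M k : symc k -> (N <= M)%N ->
  torus_int (fun x => tp M k x * tp N k x) = \sum_(p <- modes N) k p ^+ 2.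
Proof.
move=> sk NM; rewrite distr_tp; last by apply: tL1_test; exact: tp_test.
rewrite big_seq [RHS]big_seq; apply: eq_bigr => p pN; rewrite coef_tp// expr2.
by rewrite (_ : p \in modes M)// mem_modes (leq_trans _ NM)// -mem_modes.
Qed.

Lemma torus_int_tp2 N k : symc k -> torus_int (fun x => tp N k x ^+ 2) = \sum_(p <- modes N) k p ^+ 2.
Proof.
by move=> sk; rewrite -(torus_int_tpM sk (leqnn N)).
Qed.

Lemma tp_sqB N M k : symc k -> (N <= M)%N ->
  torus_int (fun x => (tp M k x - tp N k x) ^+ 2) =
  \sum_(p <- modes M) k p ^+ 2 - \sum_(p <- modes N) k p ^+ 2.
Proof.
move=> sk NM; rewrite torus_int_sqB; [|by apply: tL2_test; exact: tp_test|by apply: tL2_test; exact: tp_test].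
by rewrite !torus_int_tp2// torus_int_tpM//; ring.
Qed.

Lemma proj_sqB N b : tL2 b -> torus_int (fun x => (b x - proj N (distr_of b) x) ^+ 2) =
  torus_int (fun x => b x ^+ 2) - \sum_(p <- modes N) distr_of b (trp p) ^+ 2.
Proof.
move=> Lb; have sb := symc_distr (tL2_L1 Lb).
rewrite torus_int_sqB//; last by apply: tL2_test; exact: tp_test.
rewrite /proj torus_int_tp2// distr_tp; last exact: tL2_L1.
rewrite (eq_bigr (fun p => distr_of b (trp p) ^+ 2)); first by ring.
by move=> p _; rewrite expr2.
Qed.

Lemma bessel N b : tL2 b -> \sum_(p <- modes N) distr_of b (trp p) ^+ 2 <= torus_int (fun x => b x ^+ 2).
Proof.
move=> Lb; rewrite -subr_ge0 -proj_sqB//; apply: torus_int_ge0 => x; exact: sqr_ge0.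
Qed.

Lemma torus_uniqueness b : tL1 b -> (forall p, distr_of b (trp p) = 0) ->
  {ae torus n, forall y : TT, b (row_of y) = 0}.
Proof. by move=> Ib b0; exact: (@uniqueness R n (fun y => b (row_of y)) Ib b0). Qed.

Lemma bounded_sum_cauchy (x : nat -> R) (K : R) : (forall N M, (N <= M)%N -> x N <= x M) ->
  (forall N, x N <= K) -> forall e, 0 < e -> exists N, forall m l, (N <= m)%N -> (N <= l)%N ->
  `|x m - x l| <= e.
Proof.
move=> nd xK e e0.
have cx : cvgn x.
  apply: nondecreasing_is_cvgn; first by move=> N M; exact: nd.
  by exists K => _ [N _ <-].
have /cvgrPdist_le/(_ (e / 2)) := cx; case; first by lra.
move=> N _ hN; exists N => m j Nm Nj.
have := hN m Nm; have := hN j Nj; set l := limn _ => h1 h2.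
have -> : x m - x j = (l - x j) - (l - x m) by ring.
by apply: le_trans (ler_normB _ _) _; lra.
Qed.

(** For trigonometric polynomials the distance of two partial sums is the difference of their sums
    of squares, which increase and are bounded; hence the Cauchy property. Continuity of the pairing
    with a fixed mode then recovers the coefficients. *)
Lemma riesz_fischer k (K : R) : symc k -> (forall N, \sum_(p <- modes N) k p ^+ 2 <= K) ->
  exists b, [/\ periodic b, tL2 b, forall p, distr_of b (trp p) = k p &
    (fun N => torus_int (fun x => (tp N k x - b x) ^+ 2)) @ \oo --> 0].
Proof.
move=> sk hK.
have Ltp N : tL2 (tp N k) by apply: tL2_test; exact: tp_test.
have nd N M : (N <= M)%N -> \sum_(p <- modes N) k p ^+ 2 <= \sum_(p <- modes M) k p ^+ 2.
  by apply: modes_sum_le => p; exact: sqr_ge0.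
have cau : forall e, 0 < e -> exists N, forall m l, (N <= m)%N -> (N <= l)%N ->
    \int[torus n]_(y in setT) (tp m k (row_of y) - tp l k (row_of y)) ^+ 2 <= e.
  move=> e e0; have [N hN] := bounded_sum_cauchy nd hK e0.
  exists N => m l Nm Nl; have := hN m l Nm Nl.
  suff : \int[torus n]_(y in setT) (tp m k (row_of y) - tp l k (row_of y)) ^+ 2 =
     `|\sum_(p <- modes m) k p ^+ 2 - \sum_(p <- modes l) k p ^+ 2| by move=> ->.
  have [ml|lm] := leqP m l.
    rewrite distrC ger0_norm ?subr_ge0 ?nd// -tp_sqB//; apply: RI_eq => y _.
    by rewrite -sqrrN opprB.
  by rewrite ger0_norm ?subr_ge0 ?nd ?(ltnW lm)// -tp_sqB ?(ltnW lm).
have [phi] := sqi_complete (fun N => Ltp N) cau.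
set f := fun y : TT => _ => -[Lf cf].
pose b x := fine (limn_esup (fun j => (tp (phi j) k x)%:E)).
exists b.
have Lb : tL2 b := Lf.
have cb : (fun N => torus_int (fun x => (tp N k x - b x) ^+ 2)) @ \oo --> 0 by exact: cf.
split => //.
- move=> x i; rewrite /b; congr (fine (limn_esup _)); apply/funext => j.
  by have [_ ->] := tp_test (phi j) k.
- move=> p.
  have Lp : tL2 (trp p) by apply: tL2_test; exact: trp_test.
  have h : (fun N => distr_of (tp N k) (trp p) - distr_of b (trp p)) @ \oo --> (0 : R).
    apply: cvg0_sq.
    apply: (@squeeze0 _ _ (fun N => torus_int (fun x => (tp N k x - b x) ^+ 2) *
      torus_int (fun x => trp p x ^+ 2))); last first.
      rewrite -(mul0r (torus_int (fun x => trp p x ^+ 2))); exact: (cvgM cb (cvg_cst _)).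
    move=> N; rewrite ger0_norm ?sqr_ge0//.
    have := torus_CS (tL2B (Ltp N) Lb) Lp; congr (_ ^+ 2 <= _).
    rewrite /distr_of -torus_intB; try exact: tL2M.
    by congr torus_int; apply/funext => x; rewrite mulrBl.
  have h2 : (fun N => distr_of (tp N k) (trp p)) @ \oo --> k p.
    apply: (@cvg_trans _ (cst (k p) @ \oo)); last exact: cvg_cst.
    apply: near_eq_cvg; exists (xnorm p.1) => // N /= pN.
    by rewrite coef_tp// mem_modes pN.
  have h3 : (fun N => distr_of (tp N k) (trp p) - (distr_of (tp N k) (trp p) - distr_of b (trp p)))
      @ \oo --> k p - 0 by exact: (cvgB h2 h).
  rewrite subr0 (_ : (fun N => _) = cst (distr_of b (trp p))) in h3; last first.
    by apply/funext => N; rewrite opprB addrC subrK.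
  have h4 : cst (distr_of b (trp p)) @ \oo --> distr_of b (trp p) by exact: cvg_cst.
  by rewrite -(cvg_lim _ h4)// (cvg_lim _ h3).
Qed.

Lemma ae0_torus_int_sq b c d : tL2 b -> tL2 c -> tL2 d ->
  {ae torus n, forall y : TT, b (row_of y) - c (row_of y) = 0} ->
  torus_int (fun x => (d x - b x) ^+ 2) = torus_int (fun x => (d x - c x) ^+ 2).
Proof.
move=> Lb Lc Ld bc; apply: torus_int_eqae; try exact: (tL2B Ld _).2.
by apply: filterS bc => y /subr0_eq ->.
Qed.

(** Bessel's inequality lets [riesz_fischer] produce a limit with the coefficients of [b]; by
    uniqueness this limit is [b] almost everywhere. *)
Lemma proj_cvg b : tL2 b ->
  (fun N => torus_int (fun x => (proj N (distr_of b) x - b x) ^+ 2)) @ \oo --> 0.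
Proof.
move=> Lb; have sb := symc_distr (tL2_L1 Lb).
have [b' [pb' Lb' cb' hb']] := riesz_fischer sb (fun N => bessel N Lb).
have h : {ae torus n, forall y : TT, b' (row_of y) - b (row_of y) = 0}.
  apply: (@torus_uniqueness (fun x => b' x - b x)); first by apply: tL1B; exact: tL2_L1.
  move=> p; rewrite -[RHS](subrr (distr_of b (trp p))) -{1}cb' /distr_of -torus_intB.
  - by congr torus_int; apply/funext => x; rewrite mulrBl.
  - by apply: tL2M => //; apply: tL2_test; exact: trp_test.
  - by apply: tL2M => //; apply: tL2_test; exact: trp_test.
rewrite (_ : (fun N => _) = fun N => torus_int (fun x => (tp N (fun p => distr_of b (trp p)) x - b' x) ^+ 2))//.
apply/funext => N; apply/esym; apply: ae0_torus_int_sq => //.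
by apply: tL2_test; exact: tp_test.
Qed.

Lemma parseval_cvg b : tL2 b ->
  (fun N => \sum_(p <- modes N) distr_of b (trp p) ^+ 2) @ \oo --> torus_int (fun x => b x ^+ 2).
Proof.
move=> Lb; have h := proj_cvg Lb.
have h3 : (fun N => torus_int (fun x => b x ^+ 2) - torus_int (fun x => (proj N (distr_of b) x - b x) ^+ 2))
  @ \oo --> torus_int (fun x => b x ^+ 2) - 0 by exact: (cvgB (cvg_cst _) h).
rewrite subr0 in h3; apply: cvg_ext h3 => N.
have -> : torus_int (fun x => (proj N (distr_of b) x - b x) ^+ 2) =
  torus_int (fun x => (b x - proj N (distr_of b) x) ^+ 2).
  by congr torus_int; apply/funext => x; rewrite -sqrrN opprB.
by rewrite proj_sqB//; ring.
Qed.

Lemma torus_int_cvgM (b_ c_ : nat -> 'rV[R]_n -> R) b c (d : 'rV[R]_n -> R) (M : R) :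
  (forall N, tL2 (b_ N)) -> (forall N, tL2 (c_ N)) -> tL2 b -> tL2 c ->
  measurable_fun setT (fun y : TT => d (row_of y)) -> (forall x, `|d x| <= M) ->
  (fun N => torus_int (fun x => (b_ N x - b x) ^+ 2)) @ \oo --> 0 ->
  (fun N => torus_int (fun x => (c_ N x - c x) ^+ 2)) @ \oo --> 0 ->
  (fun N => torus_int (fun x => b_ N x * c_ N x * d x)) @ \oo --> torus_int (fun x => b x * c x * d x).
Proof.
move=> Lb_ Lc_ Lb Lc md dM cb cc.
exact: (@RI_cvgM _ _ _ (torus n) setT measurableT (fun N y => b_ N (row_of y))
  (fun N y => c_ N (row_of y)) (fun y => b (row_of y)) (fun y => c (row_of y))
  (fun y => d (row_of y)) M).
Qed.

Lemma parseval2 b c : tL2 b -> tL2 c ->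
  (fun N => \sum_(p <- modes N) distr_of b (trp p) * distr_of c (trp p)) @ \oo -->
  torus_int (fun x => b x * c x).
Proof.
move=> Lb Lc.
have := @torus_int_cvgM (fun N => proj N (distr_of b)) (fun=> c) b c (fun=> 1) 1
  (fun N => tL2_test (tp_test N _)) (fun=> Lc) Lb Lc.
move=> /(_ (@measurable_cst _ _ _ _ _ _)) h.
have : (fun N => torus_int (fun x => proj N (distr_of b) x * c x * 1)) @ \oo --> torus_int (fun x => b x * c x * 1).
  apply: h.
  - by move=> x; rewrite normr1.
  - exact: proj_cvg.
  - rewrite (_ : (fun N => _) = cst 0); first exact: cvg_cst.
    apply/funext => N /=; rewrite -[RHS](@torus_int0 R n); congr torus_int.
    by apply/funext => x; rewrite subrr expr0n.
rewrite (_ : (fun x => b x * c x * 1) = fun x => b x * c x); last by apply/funext => x; rewrite mulr1.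
apply: cvg_ext => N.
transitivity (torus_int (fun x => c x * proj N (distr_of b) x)).
  by congr torus_int; apply/funext => x; rewrite mulr1 mulrC.
by rewrite distr_tp//; exact: tL2_L1.
Qed.

End TorusL2.

(** * Periodic distributions *)

Lemma real_cauchy (R : realType) (x : nat -> R) :
  (forall e : R, 0 < e -> exists N, forall m l, (N <= m)%N -> (N <= l)%N -> `|x m - x l| <= e) -> cvgn x.
Proof.
move=> h; apply/cauchy_cvgP; apply: cauchy_exP => e e0.
have e20 : 0 < e / 2 by rewrite divr_gt0.
have [N hN] := h _ e20.
exists (x N); exists N => // l /= Nl; rewrite /ball /=.
by apply: le_lt_trans (hN N l (leqnn _) Nl) _; lra.
Qed.

Section Distributions.
Context {R : realType} {n : nat}.
Local Notation TT := (n.-tuple (measurableTypeR R)).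
Local Notation mode := ('rV[int]_n * bool)%type.
Implicit Types (p q : mode) (phi psi : 'rV[R]_n -> R) (k : mode -> R) (g h : pdistr R n).

Lemma pd0 g : is_pdistr g -> g (fun=> 0) = 0.
Proof.
move=> [lin _]; have := lin 1 _ _ test0 test0.
rewrite (_ : (fun x : 'rV[R]_n => 1 * 0 + 0) = fun=> 0); last by apply/funext => x; rewrite mulr0 addr0.
by rewrite mul1r => /eqP; rewrite -subr_eq0 opprD addrA subrr add0r oppr_eq0 => /eqP.
Qed.

Lemma pdD g phi psi : is_pdistr g -> test_fun phi -> test_fun psi ->
  g (fun x => phi x + psi x) = g phi + g psi.
Proof.
move=> [lin _] t1 t2; have := lin 1 _ _ t1 t2; rewrite mul1r => <-.
by congr g; apply/funext => x; rewrite mul1r.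
Qed.

Lemma pdZ g (c : R) phi : is_pdistr g -> test_fun phi -> g (fun x => c * phi x) = c * g phi.
Proof.
move=> pg t1; have [lin _] := pg; have := lin c _ _ t1 test0; rewrite (pd0 pg) addr0 => <-.
by congr g; apply/funext => x; rewrite addr0.
Qed.

Lemma pd_sum g I (s : seq I) (F : I -> 'rV[R]_n -> R) : is_pdistr g -> (forall i, test_fun (F i)) ->
  g (fun x => \sum_(i <- s) F i x) = \sum_(i <- s) g (F i).
Proof.
move=> pg tF; elim: s => [|i s IH].
  by rewrite big_nil -[RHS](pd0 pg); congr g; apply/funext => x; rewrite big_nil.
rewrite big_cons -IH -pdD//; last exact: test_sum.
by congr g; apply/funext => x; rewrite big_cons.
Qed.

Lemma pd_tp g N k : is_pdistr g -> g (tp N k) = \sum_(p <- modes N) k p * g (trp p).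
Proof.
move=> pg; rewrite /tp pd_sum//; last by move=> p; apply: testZ; exact: trp_test.
by apply: eq_bigr => p _; rewrite pdZ//; exact: trp_test.
Qed.

Lemma symc_pd g : is_pdistr g -> symc (fun p => g (trp p)).
Proof. by move=> pg p; rewrite trp_neg pdZ//; exact: trp_test. Qed.

Lemma is_pdistrD g h : is_pdistr g -> is_pdistr h -> is_pdistr (fun phi => g phi + h phi).
Proof.
move=> [lg [C [N hg]]] [lh [C' [N' hh]]]; split.
  by move=> c phi psi t1 t2; rewrite lg// lh//; ring.
exists (C + C'), (N + N')%N => phi M tp hM.
rewrite mulrDl; apply: le_trans (ler_normD _ _) _; apply: lerD.
  by apply: hg => // s x sN; apply: hM; rewrite (leq_trans sN)// leq_addr.
by apply: hh => // s x sN; apply: hM; rewrite (leq_trans sN)// leq_addl.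
Qed.

Lemma is_pdistrZ g (r : R) : is_pdistr g -> is_pdistr (fun phi => r * g phi).
Proof.
move=> [lg [C [N hg]]]; split.
  by move=> c phi psi t1 t2; rewrite lg//; ring.
exists (`|r| * C), N => phi M tp hM.
by rewrite normrM -mulrA ler_wpM2l//; exact: hg.
Qed.

Lemma is_pdistrB g h : is_pdistr g -> is_pdistr h -> is_pdistr (fun phi => g phi - h phi).
Proof.
move=> pg ph; have := is_pdistrD pg (is_pdistrZ (-1) ph).
by congr is_pdistr; apply/funext => phi; rewrite mulN1r.
Qed.

Lemma is_pdistr_dpartial i g : is_pdistr g -> is_pdistr (dpartial i g).
Proof.
move=> [lg [C [N hg]]]; split.
  move=> c phi psi t1 t2; rewrite /dpartial partialD; last 2 first.
  - by apply: test_derivable; exact: testZ.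
  - exact: test_derivable.
  by rewrite partialZ ?lg; [ring|exact: test_partial|exact: test_partial|exact: test_derivable].
exists C, N.+1 => phi M tp hM; rewrite /dpartial normrN; apply: hg; first exact: test_partial.
by move=> s x sN; rewrite -partials_rcons; apply: hM; rewrite size_rcons.
Qed.

Lemma is_pdistr_distr_of b : tL1 b -> is_pdistr (distr_of b : pdistr R n).
Proof.
move=> Ib; split.
  move=> c phi psi t1 t2.
  have I1 := tL1_testM Ib t1; have I2 := tL1_testM Ib t2.
  rewrite /distr_of -torus_intZ// -torus_intD//; last exact: tL1Z.
  by congr torus_int; apply/funext => x; ring.
exists (torus_int (fun x => `|b x|)), 0%N => phi M tp hM.
have Ia : tL1 (fun x => `|b x|) by exact: integrable_abse Ib.
rewrite mulrC -torus_intZ//; apply: le_trans (RI_norm measurableT (tL1_testM Ib tp)) _.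
apply: RI_le => //.
- exact: integrable_abse (tL1_testM Ib tp).
- exact: (tL1Z M Ia).
- move=> y _; rewrite normrM mulrC; apply: ler_wpM2r => //.
  exact: (hM [::]).
Qed.

Lemma dpartial_coef i g xi s : is_pdistr g ->
  dpartial i g (trp (xi, s)) = - (sgb s * (2 * pi * (xi 0 i)%:~R)) * g (trp (xi, ~~ s)).
Proof.
move=> pg; rewrite /dpartial {1}/trp /= partial_tr.
by rewrite (pdZ _ pg (trp_test (xi, ~~ s))) mulNr.
Qed.

Lemma partial_coef i phi xi s : test_fun phi ->
  distr_of (partial i phi) (trp (xi, s)) =
  - (sgb s * (2 * pi * (xi 0 i)%:~R)) * distr_of phi (trp (xi, ~~ s)).
Proof.
move=> tphi; have tt : test_fun (trp (xi, s) : 'rV[R]_n -> R) := trp_test (xi, s).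
have := test_int_partial i (testM tphi tt).
rewrite partialM; [|exact: test_derivable|exact: test_derivable].
rewrite torus_intD; last 2 first.
- by apply: tL1_testM; [exact: tL1_test|exact: test_partial].
- by apply: tL1_testM; [apply: tL1_test; exact: test_partial|].
rewrite /distr_of => /eqP; rewrite addrC addr_eq0 => /eqP ->.
rewrite mulNr -torus_intZ; last by apply: tL1_testM; [exact: tL1_test|exact: trp_test].
congr (- _); congr torus_int; apply/funext => x.
by rewrite {1}/trp /= partial_tr mulrCA.
Qed.

Lemma partial_proj i N phi : test_fun phi ->
  partial i (proj N (distr_of phi)) = proj N (distr_of (partial i phi)).
Proof.
move=> tphi; rewrite /proj /tp partial_sum; last by move=> p; apply: testZ; exact: trp_test.
apply/funext => x; rewrite !modes_sum; apply: eq_bigr => xi _.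
have E s : partial i (fun x => distr_of phi (trp (xi, s)) * trp (xi, s) x) x =
   distr_of (partial i phi) (trp (xi, ~~ s)) * trp (xi, ~~ s) x.
  rewrite partialZ; last by apply: test_derivable; exact: trp_test.
  rewrite partial_coef// negbK {2}/trp /= partial_tr /trp /=.
  by case: s; rewrite /sgb /=; ring.
by rewrite !E addrC.
Qed.

Lemma partials_bounded K phi : test_fun phi ->
  exists M : R, forall s x, (size s <= K)%N -> `|partials s phi x| <= M.
Proof.
elim: K phi => [|K IH] phi tphi.
  have [M hM] := test_bounded tphi; exists M => s x; rewrite leqn0 size_eq0 => /eqP ->; exact: hM.
have /choice[M hM] : forall i : 'I_n, exists M : R, forall s x, (size s <= K)%N -> `|partials s (partial i phi) x| <= M.
  by move=> i; apply: IH; exact: test_partial.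
have [M0 hM0] := test_bounded tphi.
exists (`|M0| + \sum_i `|M i|) => s x; case/lastP: s => [_|s i].
  apply: (@le_trans _ _ `|M0|); first exact: le_trans (hM0 x) (ler_norm _).
  by rewrite lerDl sumr_ge0.
rewrite size_rcons ltnS partials_rcons => sK.
apply: le_trans (hM i s x sK) _; apply: le_trans (ler_norm _) _.
by rewrite (bigD1 i)//= addrCA lerDl addr_ge0// sumr_ge0.
Qed.

Lemma coef_le phi (M : R) p : (forall x, `|phi x| <= M) -> test_fun phi -> `|distr_of phi (trp p)| <= M.
Proof.
move=> hM tphi; apply: torus_int_norm; last by apply: tL1_testM; [exact: tL1_test|exact: trp_test].
move=> x; rewrite normrM -[leRHS]mulr1; apply: ler_pM => //; exact: trp_bound.
Qed.

Lemma coef_decay_dir i K phi (M : R) (xi : 'rV[int]_n) s : test_fun phi ->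
  (forall x, `|partials (nseq K i) phi x| <= M) ->
  (2 * pi * `|(xi 0 i)%:~R|) ^+ K * `|distr_of phi (trp (xi, s))| <= M.
Proof.
elim: K phi s => [|K IH] phi s tphi hM.
  by rewrite mul1r; apply: coef_le.
have := IH (partial i phi) (~~ s) (test_partial i tphi).
rewrite partial_coef// negbK normrM normrN normrM.
have -> : `|sgb (~~ s)| = 1 :> R by case: s; rewrite /sgb ?normrN ?normr1.
have p0 := @pi_gt0 R.
have -> : `|2 * pi * (xi 0 i)%:~R| = 2 * pi * `|(xi 0 i)%:~R| :> R.
  by rewrite normrM ger0_norm// mulr_ge0// ltW.
rewrite mul1r => h; rewrite exprSr -[leLHS]mulrA; apply: h => x.
by rewrite -partials_rcons -cats1 -[[:: i]]/(nseq 1 i) -nseqD addn1; exact: hM.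
Qed.

(** Differentiating [K] times in the coordinate where the frequency is largest gains the factor (2
    pi xnorm)^K; the constant 2^K absorbs the passage to [1 + xnorm] and the frequency 0. *)
Lemma coef_decay K phi (M : R) p : test_fun phi ->
  (forall s x, (size s <= K)%N -> `|partials s phi x| <= M) ->
  `|distr_of phi (trp p)| <= 2 ^+ K * M * (1 + (xnorm p.1)%:R) ^- K.
Proof.
case: p => xi s tphi hM /=.
have p2 := @pi_ge2 R.
have M0 : 0 <= M by exact: le_trans (normr_ge0 _) (hM [::] 0 (leq0n K)).
rewrite ler_pdivlMr; last by rewrite exprn_gt0// ltr_wpDr.
have [x0|x0] := posnP (xnorm xi).
  rewrite x0 addr0 expr1n mulr1; apply: le_trans (coef_le _ (hM [::]^~ (leq0n K)) tphi) _.
  by rewrite ler_peMl// exprn_ege1//; lra.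
have [i hi] : exists i, xnorm xi = absz (xi 0 i).
  have [|i hi] := @bigop.eq_bigmax 'I_n (fun i => absz (xi 0%R i)); last by exists i.
  by rewrite card_ord lt0n; apply: contraTneq x0 => n0; rewrite -leqNgt; apply/xnorm_leP => i;
    have := ltn_ord i; rewrite [X in (_ < X)%N]n0.
have h := @coef_decay_dir i K phi M xi s tphi _.
apply: (@le_trans _ _ (2 ^+ K * ((2 * pi * `|(xi 0 i)%:~R|) ^+ K * `|distr_of phi (trp (xi, s))|))); last first.
  by rewrite ler_wpM2l ?exprn_ge0//; apply: h => x; apply: hM; rewrite size_nseq.
rewrite mulrC mulrA -exprMn ler_wpM2r//.
have e : `|(xi 0 i)%:~R| = (xnorm xi)%:R :> R by rewrite hi natr_absz intr_norm.
rewrite e lerXn2r ?nnegrE ?addr_ge0 ?mulr_ge0//; try lra.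
have : (1 : R) <= (xnorm xi)%:R by rewrite ler1n.
by nra.
Qed.

Lemma modes_sum_decay N : (0 < n)%N ->
  \sum_(p <- modes N) (1 + (xnorm (p.1 : 'rV[int]_n))%:R) ^- n.+1 <= 2 * @lattC R n.
Proof.
move=> n0; rewrite modes_sum /= (eq_bigr (fun xi => 2 * (1 + (xnorm xi)%:R) ^- n.+1)).
  by rewrite -mulr_sumr ler_wpM2l//; exact: box_sum_decay.
by move=> xi _; rewrite [RHS]mulr_natl mulr2n.
Qed.

Hypothesis n0 : (0 < n)%N.

Lemma coef_summable phi (M : R) N : test_fun phi ->
  (forall s x, (size s <= n.+1)%N -> `|partials s phi x| <= M) ->
  \sum_(p <- modes N) `|distr_of phi (trp p)| <= 2 ^+ n.+2 * @lattC R n * M.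
Proof.
move=> tphi hM.
have M0 : 0 <= M by exact: le_trans (normr_ge0 _) (hM [::] 0 (leq0n _)).
apply: (@le_trans _ _ (\sum_(p <- modes N) 2 ^+ n.+1 * M * (1 + (xnorm p.1)%:R) ^- n.+1)).
  by apply: ler_sum => p _; exact: coef_decay.
rewrite -mulr_sumr; apply: le_trans (ler_wpM2l _ (modes_sum_decay N n0)) _.
  by rewrite mulr_ge0// exprn_ge0.
by rewrite [2 ^+ n.+2]exprSr le_eqVlt; apply/orP; left; apply/eqP; ring.
Qed.

Lemma tp_diff N M k x : (N <= M)%N -> `|tp M k x - tp N k x| <=
  \sum_(p <- modes M) `|k p| - \sum_(p <- modes N) `|k p|.
Proof.
move=> NM.
have h : perm_eq (modes M : seq mode) (modes N ++ [seq p <- modes M | p \notin modes N]).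
  apply: uniq_perm; first exact: modes_uniq.
    rewrite cat_uniq modes_uniq filter_uniq ?modes_uniq// andbT; apply/hasPn => p.
    by rewrite mem_filter => /andP[].
  move=> p; rewrite mem_cat mem_filter; case pN : (p \in modes N) => //=.
  by move: pN; rewrite !mem_modes => /leq_trans; apply.
rewrite /tp !(perm_big _ h)/= !big_cat/= [X in `|X|]addrC addKr [leRHS]addrC addKr.
apply: le_trans (ler_norm_sum _ _ _) _; apply: ler_sum => p _.
by rewrite normrM -[leRHS]mulr1 ler_wpM2l// trp_bound.
Qed.

(** Summable coefficients make the Fourier series converge uniformly to a continuous [psi]. It has
    the coefficients of [phi], so both agree almost everywhere, and everywhere by continuity. *)
Lemma proj_uniform phi : test_fun phi -> forall e : R, 0 < e -> exists N0, forall N x, (N0 <= N)%N ->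
  `|phi x - proj N (distr_of phi) x| <= e.
Proof.
move=> tphi.
have [M hM] := partials_bounded n.+1 tphi.
pose k p := distr_of phi (trp p).
have sk : symc k by apply: symc_distr; exact: tL1_test.
have nd N L : (N <= L)%N -> \sum_(p <- modes N) `|k p| <= \sum_(p <- modes L) `|k p|.
  exact: modes_sum_le.
have cau := bounded_sum_cauchy nd (fun N => coef_summable N tphi hM).
have cau2 e : 0 < e -> exists N, forall m l x, (N <= m)%N -> (N <= l)%N -> `|tp m k x - tp l k x| <= e.
  move=> e0; have [N hN] := cau e e0; exists N => m l x Nm Nl.
  have := hN m l Nm Nl; have [ml|lm] := leqP m l.
    by rewrite distrC [leLHS]ger0_norm ?subr_ge0 ?nd// distrC; apply: le_trans; exact: tp_diff.
  by rewrite ger0_norm ?subr_ge0 ?nd ?(ltnW lm)//; apply: le_trans; apply: tp_diff; exact: ltnW.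
pose psi x := limn (fun N => tp N k x).
have cpsi x : (fun N => tp N k x) @ \oo --> psi x.
  by apply: real_cauchy => e e0; have [N hN] := cau2 e e0; exists N => m l; exact: hN.
have upsi e : 0 < e -> exists N, forall m x, (N <= m)%N -> `|psi x - tp m k x| <= e.
  move=> e0; have [N hN] := cau2 e e0; exists N => m x Nm.
  have hc : (fun l => `|tp l k x - tp m k x|) @ \oo --> `|psi x - tp m k x|.
    by apply: cvg_norm; exact: (cvgB (cpsi x) (cvg_cst _)).
  rewrite -(cvg_lim _ hc)//; apply: limr_le; first by apply/cvg_ex; eexists; exact: hc.
  by exists N => // l /= Nl; exact: hN.
have psi_cont : continuous psi.
  move=> x; have FF : Filter (nbhs x) := _; apply/cvgrPdist_le => e e0.
  have e3 : 0 < e / 3 by rewrite divr_gt0.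
  have [N hN] := upsi _ e3.
  have /cvgrPdist_le/(_ _ e3) := test_continuous (tp_test N k) (x:=x).
  apply: (@filterS _ (nbhs x)) => y hy.
  have := hN N x (leqnn _); have := hN N y (leqnn _); move: hy.
  set a := psi x; set b := psi y; set c := tp N k x; set d := tp N k y => h1 h2 h3.
  have -> : a - b = (a - c) + (c - d) - (b - d) by ring.
  apply: le_trans (ler_normB _ _) _; apply: le_trans (lerD (ler_normD _ _) (lexx _)) _.
  lra.
have psi_per : periodic psi.
  by move=> x i; rewrite /psi; congr (lim (_ @ \oo)); apply/funext => N; have [_ ->] := tp_test N k.
have mpsi := continuous_measurable_row psi_cont.
have [B hB] := periodic_bounded psi_cont psi_per.
have Ipsi : tL1 psi by exact: (torus_integrable_bounded mpsi (fun y => hB (row_of y))).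
have Iphi : tL1 phi by exact: tL1_test.
have coef_psi p : distr_of psi (trp p) = k p.
  apply/eqP; rewrite -subr_eq0 -normr_eq0 eq_le normr_ge0 andbT; apply/ler_addgt0Pl => e e0.
  rewrite addr0; have [N hN] := upsi e e0.
  pose m := maxn N (xnorm p.1).
  have <- : distr_of (tp m k) (trp p) = k p by rewrite coef_tp// mem_modes leq_maxr.
  rewrite /distr_of -torus_intB; last 2 first.
  - by apply: tL1_testM => //; exact: trp_test.
  - by apply: tL1_testM; [apply: tL1_test; exact: tp_test|exact: trp_test].
  apply: torus_int_norm => [x|].
    rewrite -mulrBl normrM -[leRHS]mulr1; apply: ler_pM => //; last exact: trp_bound.
    by apply: hN; exact: leq_maxl.
  apply: tL1B; first by apply: tL1_testM => //; exact: trp_test.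
  by apply: tL1_testM; [apply: tL1_test; exact: tp_test|exact: trp_test].
have phipsi x : phi x - psi x = 0.
  apply: (@continuous_ae0 R n (fun x => phi x - psi x)).
  - by move=> y; exact: (cvgB (test_continuous tphi (x:=y)) (psi_cont y)).
  - by move=> y i; rewrite psi_per tphi.2.
  - apply: (@torus_uniqueness R n (fun x => phi x - psi x)); first exact: tL1B.
    move=> p; rewrite -[RHS](subrr (k p)) -{2}coef_psi /k /distr_of -torus_intB.
    + by congr torus_int; apply/funext => y; rewrite mulrBl.
    + by apply: tL1_testM => //; exact: trp_test.
    + by apply: tL1_testM => //; exact: trp_test.
move=> e e0; have [N hN] := upsi e e0; exists N => m x Nm.
by rewrite (subr0_eq (phipsi x)); exact: hN.
Qed.

(** Truncation commutes with partial derivatives, so the uniform convergence extends to them.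
    Distributions are continuous for exactly this convergence. *)
Lemma proj_uniform_partials K phi : test_fun phi -> forall e : R, 0 < e -> exists N0, forall N s x,
  (N0 <= N)%N -> (size s <= K)%N ->
  `|partials s (fun x => phi x - proj N (distr_of phi) x) x| <= e.
Proof.
elim: K phi => [|K IH] phi tphi e e0.
  have [N hN] := proj_uniform tphi e0; exists N => m s x Nm.
  by rewrite leqn0 size_eq0 => /eqP ->; exact: hN.
have /choice[M hM] : forall i : 'I_n, exists N0, forall N s x, (N0 <= N)%N -> (size s <= K)%N ->
  `|partials s (fun x => partial i phi x - proj N (distr_of (partial i phi)) x) x| <= e.
  by move=> i; apply: IH => //; exact: test_partial.
have [N hN] := proj_uniform tphi e0.
exists (N + \sum_i M i)%N => m s x Nm; case/lastP: s => [_|s i].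
  by apply: hN; rewrite (leq_trans _ Nm)// leq_addr.
rewrite size_rcons ltnS partials_rcons => sK.
rewrite (_ : partial i _ = (fun x => partial i phi x - proj m (distr_of (partial i phi)) x)).
  by apply: hM => //; rewrite (leq_trans _ Nm)// (bigD1 i)//= addnCA leq_addr.
have tpj : test_fun (proj m (distr_of phi)) by exact: tp_test.
rewrite -partial_proj//.
transitivity (partial i (fun x => phi x + (-1) * proj m (distr_of phi) x)).
  by congr partial; apply/funext => y; rewrite mulN1r.
rewrite partialD ?partialZ//; try exact: test_derivable.
  by apply/funext => y; rewrite mulN1r.
by apply: test_derivable; exact: testZ.
Qed.

Lemma pd_fourier g phi : is_pdistr g -> test_fun phi ->
  (fun N => \sum_(p <- modes N) distr_of phi (trp p) * g (trp p)) @ \oo --> g phi.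
Proof.
move=> pg tphi; have [_ [C [K hg]]] := pg.
apply/cvgrPdist_le => e e0.
(* The constant in the definition of a distribution may be 0 or negative, hence [|C| + 1]. *)
have e1 : 0 < e / (`|C| + 1) by rewrite divr_gt0// ltr_wpDl.
have [N0 hN] := proj_uniform_partials K tphi e1.
exists N0 => // N /= NN.
have tpj : test_fun (proj N (distr_of phi)) by exact: tp_test.
rewrite -pd_tp// -/(proj N (distr_of phi)).
have -> : g phi - g (proj N (distr_of phi)) = g (fun x => phi x - proj N (distr_of phi) x).
  rewrite -[LHS]addrC -mulN1r -pdZ// -pdD//; last exact: testZ.
  by congr g; apply/funext => x; rewrite mulN1r addrC.
have td : test_fun (fun x => phi x - proj N (distr_of phi) x).
  have := testD tphi (testZ (-1) tpj); congr test_fun; apply/funext => x; by rewrite mulN1r.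
apply: le_trans (hg _ _ td (fun s x => hN N s x NN)) _.
apply: (@le_trans _ _ ((`|C| + 1) * (e / (`|C| + 1)))).
  by rewrite ler_wpM2r ?ltW//; have := ler_norm C; lra.
by rewrite mulrCA divff ?mulr1// gt_eqF// ltr_wpDl.
Qed.

Lemma pd_eq g h : is_pdistr g -> is_pdistr h -> (forall p, g (trp p) = h (trp p)) -> eq_distr g h.
Proof.
move=> pg ph gh phi tphi.
have c1 := pd_fourier pg tphi; have c2 := pd_fourier ph tphi.
rewrite -(cvg_lim _ c1)// -(cvg_lim _ c2)//; congr (lim (_ @ \oo)); apply/funext => N.
by apply: eq_bigr => p _; rewrite gh.
Qed.

(** Square summable coefficients ensure that the choice in [L2fun] is a genuine representative and
    not the default: Riesz-Fischer supplies a function, and distributions with equal coefficients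
    are equal. *)
Lemma L2funP g (K : R) : is_pdistr g -> (forall N, \sum_(p <- modes N) g (trp p) ^+ 2 <= K) ->
  L2per (L2fun g) /\ eq_distr g (distr_of (L2fun g)).
Proof.
move=> pg hK; have [b [pb Lb cb _]] := riesz_fischer (symc_pd pg) hK.
apply: (@xgetPex _ (fun=> 0) [set b | L2per b /\ eq_distr g (distr_of b)]).
exists b; split; first exact: tL2_L2per.
apply: pd_eq => //; apply: is_pdistr_distr_of; exact: tL2_L1.
Qed.

Lemma L2fun_tL2 g (K : R) : is_pdistr g -> (forall N, \sum_(p <- modes N) g (trp p) ^+ 2 <= K) ->
  tL2 (L2fun g).
Proof. by move=> pg hK; apply: L2per_tL2; have [] := L2funP pg hK. Qed.

Lemma L2fun_coef g (K : R) p : is_pdistr g -> (forall N, \sum_(p <- modes N) g (trp p) ^+ 2 <= K) ->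
  distr_of (L2fun g) (trp p) = g (trp p).
Proof. by move=> pg hK; have [_ ->//] := L2funP pg hK; exact: trp_test. Qed.

(** For bounded [k] the limit exists, because the coefficients of a test function are summable. This
    builds the Leray projection from its symbol. *)
Definition series_distr k : pdistr R n := fun phi =>
  limn (fun N => \sum_(p <- modes N) k p * distr_of phi (trp p)).

Lemma series_distr_cvg k (K : R) phi : (forall p, `|k p| <= K) -> test_fun phi ->
  (fun N => \sum_(p <- modes N) k p * distr_of phi (trp p)) @ \oo --> series_distr k phi.
Proof.
move=> kK tphi; have [M hM] := partials_bounded n.+1 tphi.
have K0 : 0 <= K by exact: le_trans (normr_ge0 _) (kK (0, false)).
pose C := K * (2 ^+ n.+2 * @lattC R n * M).
have bd N : \sum_(xi <- box N) `|k (xi, false) * distr_of phi (trp (xi, false)) +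
   k (xi, true) * distr_of phi (trp (xi, true))| <= C.
  apply: (@le_trans _ _ (\sum_(p <- modes N) K * `|distr_of phi (trp p)|)).
    rewrite modes_sum; apply: ler_sum => xi _; apply: le_trans (ler_normD _ _) _.
    by rewrite !normrM; apply: lerD; apply: ler_wpM2r.
  by rewrite -mulr_sumr; apply: ler_wpM2l => //; exact: coef_summable.
have hc := zsum_cvg bd.
have hc' : (fun N => \sum_(p <- modes N) k p * distr_of phi (trp p)) @ \oo -->
   zsum (fun xi => k (xi, false) * distr_of phi (trp (xi, false)) + k (xi, true) * distr_of phi (trp (xi, true))).
  by apply: cvg_ext hc => N; rewrite modes_sum.
by rewrite /series_distr; apply/cvg_ex; eexists; exact: hc'.
Qed.

Lemma is_pdistr_series k (K : R) : (forall p, `|k p| <= K) -> is_pdistr (series_distr k).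
Proof.
move=> kK; have K0 : 0 <= K by exact: le_trans (normr_ge0 _) (kK (0, false)).
split.
  move=> c phi psi t1 t2.
  have h1 := series_distr_cvg kK t1; have h2 := series_distr_cvg kK t2.
  have h3 : (fun N => c * (\sum_(p <- modes N) k p * distr_of phi (trp p)) +
      \sum_(p <- modes N) k p * distr_of psi (trp p)) @ \oo --> c * series_distr k phi + series_distr k psi.
    by exact: (cvgD (cvgM (cvg_cst _) h1) h2).
  apply/cvg_lim => //; apply: cvg_ext h3 => N.
  rewrite mulr_sumr -big_split/=; apply: eq_bigr => p _.
  rewrite (_ : distr_of (fun x => c * phi x + psi x) (trp p) = c * distr_of phi (trp p) + distr_of psi (trp p)).
    by ring.
  have tt : test_fun (trp p : 'rV[R]_n -> R) := trp_test p.
  have I1 := tL1_testM (tL1_test t1) tt; have I2 := tL1_testM (tL1_test t2) tt.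
  rewrite /distr_of -torus_intZ// -torus_intD//; last exact: tL1Z.
  by congr torus_int; apply/funext => x; ring.
exists (K * (2 ^+ n.+2 * @lattC R n)), n.+1 => phi M tphi hM.
have hc : (fun N => `|\sum_(p <- modes N) k p * distr_of phi (trp p)|) @ \oo --> `|series_distr k phi|.
  by exact: (cvg_norm (series_distr_cvg kK tphi)).
rewrite -(cvg_lim _ hc)//; apply: limr_le; first by apply/cvg_ex; eexists; exact: hc.
apply: nearW => N; rewrite -mulrA; apply: le_trans (ler_norm_sum _ _ _) _.
apply: (@le_trans _ _ (\sum_(p <- modes N) K * `|distr_of phi (trp p)|)).
  by apply: ler_sum => p _; rewrite normrM ler_wpM2r.
by rewrite -mulr_sumr ler_wpM2l//; exact: coef_summable.
Qed.

Lemma series_coef k (K : R) q : (forall p, `|k p| <= K) -> symc k -> series_distr k (trp q) = k q.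
Proof.
move=> kK sk; have h := series_distr_cvg kK (trp_test q).
rewrite -(cvg_lim _ h)//; apply/cvg_lim => //.
apply: (@cvg_trans _ (cst (k q) @ \oo)); last exact: cvg_cst.
apply: near_eq_cvg; exists (xnorm q.1) => // N /= pN.
have tt : test_fun (trp q : 'rV[R]_n -> R) := trp_test q.
have := coef_tp N q sk; rewrite mem_modes pN => <-.
rewrite {1}/distr_of -(distr_tp N k (tL1_test tt)).
by congr torus_int; apply/funext => x; rewrite mulrC.
Qed.

End Distributions.

(** * Sobolev norms *)

Section Sobolev.
Context {R : realType} {n : nat}.
Local Notation mode := ('rV[int]_n * bool)%type.
Implicit Types (p q : mode) (xi : 'rV[int]_n) (g h : pdistr R n) (u v w F G : vdistr R n).
Implicit Types (W : 'rV[int]_n -> R).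

Definition pdv u := forall i, is_pdistr (u i).

Definition hsum W w (N : nat) : R := \sum_(i < n) \sum_(p <- modes N) W p.1 * w i (trp p) ^+ 2.

Definition hw (s : R) : 'rV[int]_n -> R := fun xi => rho xi `^ (2 * s).

Lemma hw_ge0 s xi : 0 <= hw s xi.
Proof. exact: powR_ge0. Qed.

Lemma hw_gt0 s xi : 0 < hw s xi.
Proof. by apply: powR_gt0; exact: rho_gt0. Qed.

Lemma hw0 xi : hw 0 xi = 1.
Proof. by rewrite /hw mulr0 powRr0. Qed.

Lemma hw1 xi : hw 1 xi = rho xi ^+ 2.
Proof. by rewrite /hw mulr1 powR_mulrn// ltW// rho_gt0. Qed.

Lemma hwN1 xi : hw (-1) xi = rho xi ^- 2.
Proof. by rewrite /hw mulrN1 powRN powR_mulrn// ltW// rho_gt0. Qed.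

Lemma hwn2 xi : hw (n%:R / 2) xi = rho xi ^+ n.
Proof. by rewrite /hw mulrC divfK ?pnatr_eq0// powR_mulrn// ltW// rho_gt0. Qed.

Lemma normc_fourier g xi :
  Normc.normc (fourier g xi) ^+ 2 = g (trp (xi, false)) ^+ 2 + g (trp (xi, true)) ^+ 2.
Proof. by rewrite /fourier /= sqr_sqrtr ?sqrrN// addr_ge0// sqr_ge0. Qed.

Lemma hnorm2E s w : hnorm2 s w = (\sum_(i < n) \esum_(xi in [set: 'rV[int]_n])
  (hw s xi * (w i (trp (xi, false)) ^+ 2 + w i (trp (xi, true)) ^+ 2))%:E)%E.
Proof.
apply: eq_bigr => i _; apply: eq_esum => xi _.
by rewrite -normc_fourier.
Qed.

Lemma hterm_ge0 s w i xi : 0 <= hw s xi * (w i (trp (xi, false)) ^+ 2 + w i (trp (xi, true)) ^+ 2).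
Proof. by rewrite mulr_ge0 ?hw_ge0 ?addr_ge0 ?sqr_ge0. Qed.

Lemma hsumE s w N : hsum (hw s) w N = \sum_(i < n) \sum_(xi <- box N)
  hw s xi * (w i (trp (xi, false)) ^+ 2 + w i (trp (xi, true)) ^+ 2).
Proof.
by apply: eq_bigr => i _; rewrite modes_sum; apply: eq_bigr => xi _; rewrite mulrDr.
Qed.

Lemma hnorm2_cvg s w : (fun N => (hsum (hw s) w N)%:E) @ \oo --> hnorm2 s w.
Proof.
rewrite hnorm2E; under eq_fun do rewrite hsumE -sumEFin.
apply: cvg_nnesum => [i _|i _]; first by apply: nearW => N; rewrite lee_fin sumr_ge0// => xi _; exact: hterm_ge0.
exact: (box_sum_cvg (hterm_ge0 s w i)).
Qed.

Lemma hsum_ge0 W w N : (forall xi, 0 <= W xi) -> 0 <= hsum W w N.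
Proof. by move=> W0; apply: sumr_ge0 => i _; apply: sumr_ge0 => p _; rewrite mulr_ge0 ?sqr_ge0. Qed.

Lemma hsum_le W w N M : (forall xi, 0 <= W xi) -> (N <= M)%N -> hsum W w N <= hsum W w M.
Proof.
move=> W0 NM; apply: ler_sum => i _; apply: modes_sum_le => // p.
by rewrite mulr_ge0 ?sqr_ge0.
Qed.

Lemma hnorm2_ge0 s w : (0 <= hnorm2 s w)%E.
Proof.
rewrite hnorm2E; apply: sume_ge0 => i _; apply: esum_ge0 => xi _; rewrite lee_fin; exact: hterm_ge0.
Qed.

Lemma hsum_le_hnorm2 s w N : ((hsum (hw s) w N)%:E <= hnorm2 s w)%E.
Proof.
have h := @hnorm2_cvg s w; rewrite -(cvg_lim _ h)//.
apply: lime_ge; first by apply/cvg_ex; eexists; exact: h.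
by exists N => // M /= NM; rewrite lee_fin; apply: hsum_le => // xi; exact: hw_ge0.
Qed.

(** This is the squared norm; the norm itself is [snrm] below. *)
Definition nrm (s : R) w : R := fine (hnorm2 s w).

Lemma nrm_ge0 s w : 0 <= nrm s w.
Proof. by apply: fine_ge0; exact: hnorm2_ge0. Qed.

Lemma nrm_EFin s w : (hnorm2 s w < +oo)%E -> (nrm s w)%:E = hnorm2 s w.
Proof. by move=> h; rewrite /nrm fineK// ge0_fin_numE// hnorm2_ge0. Qed.

Lemma nrm_cvg s w : (hnorm2 s w < +oo)%E -> (fun N => hsum (hw s) w N) @ \oo --> nrm s w.
Proof.
move=> h; have := @hnorm2_cvg s w; rewrite -(nrm_EFin h) => hc.
exact: (fine_cvg hc).
Qed.

Lemma hsum_le_nrm s w N : (hnorm2 s w < +oo)%E -> hsum (hw s) w N <= nrm s w.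
Proof. by move=> h; rewrite -lee_fin (nrm_EFin h); exact: hsum_le_hnorm2. Qed.

Lemma hnorm2_le_bound s w (K : R) : (forall N, hsum (hw s) w N <= K) -> (hnorm2 s w <= K%:E)%E.
Proof.
move=> hK; have h := @hnorm2_cvg s w; rewrite -(cvg_lim _ h)//.
apply: lime_le; first by apply/cvg_ex; eexists; exact: h.
by apply: nearW => N; rewrite lee_fin.
Qed.

Lemma comp_le_hsum W w N i : (forall xi, 0 <= W xi) ->
  \sum_(p <- modes N) W p.1 * w i (trp p) ^+ 2 <= hsum W w N.
Proof.
move=> W0; rewrite /hsum (bigD1 i)//= lerDl; apply: sumr_ge0 => j _; apply: sumr_ge0 => p _.
by rewrite mulr_ge0 ?sqr_ge0.
Qed.

Lemma hw_mono s t xi : s <= t -> hw s xi <= hw t xi.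
Proof. by move=> st; apply: ler_powR; [exact: rho_ge1|lra]. Qed.

Lemma hsum_mono s t w N : s <= t -> hsum (hw s) w N <= hsum (hw t) w N.
Proof.
move=> st; apply: ler_sum => i _; apply: ler_sum => p _.
by apply: ler_wpM2r; [exact: sqr_ge0|exact: hw_mono].
Qed.

Lemma hnorm2_mono s t w : s <= t -> (hnorm2 t w < +oo)%E -> (hnorm2 s w < +oo)%E /\ nrm s w <= nrm t w.
Proof.
move=> st h; have : (hnorm2 s w <= (nrm t w)%:E)%E.
  apply: hnorm2_le_bound => N; apply: le_trans (hsum_mono w N st) _; exact: hsum_le_nrm.
move=> h2; have h3 := le_lt_trans h2 (ltry _); split => //.
by rewrite -lee_fin nrm_EFin.
Qed.

Lemma coef0_bound w i (K : R) N : (forall M, hsum (hw 0) w M <= K) ->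
  \sum_(p <- modes N) w i (trp p) ^+ 2 <= K.
Proof.
move=> hK; apply: le_trans (hK N); apply: le_trans (comp_le_hsum w N i (hw_ge0 0)).
by apply: ler_sum => p _; rewrite hw0 mul1r.
Qed.

Lemma freq_le_rho xi (j : 'I_n) : (2 * pi * (xi 0 j)%:~R) ^+ 2 <= rho xi ^+ 2 :> R.
Proof.
rewrite rho_sq exprMn; apply: ler_wpM2l; first exact: sqr_ge0.
rewrite (bigD1 j)//= addrCA lerDl addr_ge0// sumr_ge0// => i _; exact: sqr_ge0.
Qed.

Lemma sgb_sq (s : bool) : sgb s ^+ 2 = 1 :> R.
Proof. by case: s; rewrite /sgb ?expr1n ?sqrrN ?expr1n. Qed.

Lemma dpartial_sum_sq (f : 'rV[int]_n -> R) g j N : is_pdistr g ->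
  \sum_(p <- modes N) f p.1 * dpartial j g (trp p) ^+ 2 =
  \sum_(p <- modes N) f p.1 * ((2 * pi * (p.1 0 j)%:~R) ^+ 2 * g (trp p) ^+ 2).
Proof.
move=> pg; rewrite !modes_sum; apply: eq_bigr => xi _ /=.
have E s : dpartial j g (trp (xi, s)) ^+ 2 = (2 * pi * (xi 0 j)%:~R) ^+ 2 * g (trp (xi, ~~ s)) ^+ 2.
  by rewrite dpartial_coef//; case: s; rewrite /sgb /=; ring.
by rewrite !E /= addrC.
Qed.

Lemma dpartial_bound w j i (K : R) N : pdv w -> (forall M, hsum (hw 1) w M <= K) ->
  \sum_(p <- modes N) dpartial j (w i) (trp p) ^+ 2 <= K.
Proof.
move=> pw hK; apply: le_trans (hK N); apply: le_trans (comp_le_hsum w N i (hw_ge0 1)).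
have := dpartial_sum_sq (fun=> 1) j N (pw i).
rewrite (eq_bigr (fun p => dpartial j (w i) (trp p) ^+ 2)); last by move=> p _; rewrite mul1r.
move=> ->; apply: ler_sum => p _; rewrite mul1r hw1.
by apply: ler_wpM2r; [exact: sqr_ge0|exact: freq_le_rho].
Qed.

Lemma partial_projg i N g : is_pdistr g -> partial i (proj N g) = proj N (dpartial i g).
Proof.
move=> pg; rewrite /proj /tp partial_sum; last by move=> p; apply: testZ; exact: trp_test.
apply/funext => x; rewrite !modes_sum; apply: eq_bigr => xi _.
have E s : partial i (fun x => g (trp (xi, s)) * trp (xi, s) x) x =
   dpartial i g (trp (xi, ~~ s)) * trp (xi, ~~ s) x.
  rewrite partialZ; last by apply: test_derivable; exact: trp_test.
  rewrite dpartial_coef// negbK {2}/trp /= partial_tr /trp /=.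
  by case: s; rewrite /sgb /=; ring.
by rewrite !E addrC.
Qed.

Definition vtp (N : nat) (k : 'I_n -> mode -> R) : vdistr R n := fun i => distr_of (tp N (k i)).

(** Reality, zero mean and zero divergence of a field, read off its coefficients. In this form they
    visibly survive truncation and multiplication by even functions of the frequency. *)
Definition solenoidal (k : 'I_n -> mode -> R) := [/\ forall i, symc (k i),
  forall i b, k i (0, b) = 0 & forall xi b, \sum_i (xi 0 i)%:~R * k i (xi, b) = 0].

Lemma div_free_coef w xi s : pdv w -> div_free w -> \sum_i (xi 0 i)%:~R * w i (trp (xi, s)) = 0.
Proof.
move=> pw dw; have := dw _ (trp_test (xi, ~~ s)).
rewrite (eq_bigr (fun i => - (sgb (~~ s) * (2 * pi)) * ((xi 0 i)%:~R * w i (trp (xi, s))))).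
  rewrite -mulr_sumr => /eqP; rewrite mulf_eq0 oppr_eq0 => /orP[|/eqP//].
  have p0 := @pi_gt0 R.
  by case: s; rewrite /sgb /= ?mul1r ?mulN1r ?oppr_eq0 mulf_eq0 pnatr_eq0 /= gt_eqF.
by move=> i _; rewrite dpartial_coef// negbK; ring.
Qed.

Lemma fourier0_coef g b : fourier g 0 = 0 -> g (trp (0, b)) = 0.
Proof.
by move=> /eqP; rewrite eq_complex /= => /andP[/eqP h1 /eqP h2]; case: b => //;
  apply/eqP; rewrite -oppr_eq0; apply/eqP.
Qed.

Lemma Hdot_sigma_solenoidal s w : Hdot_sigma s w -> solenoidal (fun i p => w i (trp p)).
Proof.
move=> [[[pw _] w0] dw]; split.
- by move=> i; exact: symc_pd.
- by move=> i b; exact: fourier0_coef.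
- by move=> xi b; exact: div_free_coef.
Qed.

Lemma solenoidalZ (f : 'rV[int]_n -> R) k : (forall xi, f (- xi) = f xi) -> solenoidal k ->
  solenoidal (fun i p => f p.1 * k i p).
Proof.
move=> fs [sk k0 dk]; split.
- by move=> i p; rewrite sk /= fs mulrCA.
- by move=> i b /=; rewrite k0 mulr0.
- move=> xi b /=; rewrite (eq_bigr (fun i => f xi * ((xi 0 i)%:~R * k i (xi, b)))).
    by rewrite -mulr_sumr dk mulr0.
  by move=> i _; rewrite mulrCA.
Qed.

Lemma pd_tpdistr N k : is_pdistr (distr_of (tp N k) : pdistr R n).
Proof. by apply: is_pdistr_distr_of; apply: tL1_test; exact: tp_test. Qed.

Lemma modes_sum_supp N M (f : mode -> R) : (N <= M)%N -> (forall p, p \notin modes N -> f p = 0) ->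
  \sum_(p <- modes M) f p = \sum_(p <- modes N) f p.
Proof.
move=> NM f0.
have h : perm_eq (modes M : seq mode) (modes N ++ [seq p <- modes M | p \notin modes N]).
  apply: uniq_perm; first exact: modes_uniq.
    rewrite cat_uniq modes_uniq filter_uniq ?modes_uniq// andbT; apply/hasPn => p.
    by rewrite mem_filter => /andP[].
  move=> p; rewrite mem_cat mem_filter; case pN : (p \in modes N) => //=.
  by move: pN; rewrite !mem_modes => /leq_trans; apply.
rewrite (perm_big _ h)/= big_cat/= [X in _ + X]big1_seq ?addr0// => p /andP[_].
by rewrite mem_filter => /andP[/f0].
Qed.

Lemma modes_sum_supp_le N M (f : mode -> R) : (forall p, 0 <= f p) -> (forall p, p \notin modes N -> f p = 0) ->
  \sum_(p <- modes M) f p <= \sum_(p <- modes N) f p.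
Proof.
move=> f_ge0 f0; apply: le_trans (modes_sum_le f_ge0 (leq_maxr N M)) _.
by rewrite (modes_sum_supp (leq_maxl N M))//.
Qed.

Lemma vtp_coef N k i p : solenoidal k -> vtp N k i (trp p) = if p \in modes N then k i p else 0.
Proof. by move=> [sk _ _]; exact: coef_tp. Qed.

(** The truncations are thus admissible test fields in every weak identity, whatever its order
    [s]. *)
Lemma vtp_Hdot_sigma s N k : solenoidal k -> Hdot_sigma s (vtp N k).
Proof.
move=> hk; have [sk k0 dk] := hk; split; first split; first split.
- by move=> i; exact: pd_tpdistr.
- apply: le_lt_trans (ltry (hsum (hw s) (vtp N k) N)); apply: hnorm2_le_bound => M.
  apply: ler_sum => i _; apply: modes_sum_supp_le.
    by move=> p; rewrite mulr_ge0 ?hw_ge0 ?sqr_ge0.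
  by move=> p pN; rewrite vtp_coef// (negbTE pN) expr0n mulr0.
- move=> i; apply/eqP; rewrite eq_complex /= oppr_eq0.
  have h b : vtp N k i (trp (0, b)) = 0 by rewrite vtp_coef// k0; case: ifP.
  by apply/andP; split; apply/eqP; [exact: (h false)|exact: (h true)].
- move=> phi tphi.
  transitivity (\sum_i - \sum_(p <- modes N) k i p * distr_of (partial i phi) (trp p)).
    apply: eq_bigr => i _; rewrite /dpartial /vtp; congr (- _).
    rewrite -distr_tp; last by apply: tL1_test; exact: test_partial.
    by rewrite /distr_of; congr torus_int; apply/funext => x; rewrite mulrC.
  rewrite sumrN exchange_big/= big1 ?oppr0// => -[xi b] _.
  rewrite (eq_bigr (fun i => - (sgb b * (2 * pi)) * distr_of phi (trp (xi, ~~ b)) * ((xi 0 i)%:~R * k i (xi, b)))).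
    by rewrite -mulr_sumr dk mulr0.
  by move=> i _; rewrite partial_coef//; ring.
Qed.

Lemma zsum_supp N (c : 'rV[int]_n -> R) : (forall xi, xi \notin box N -> c xi = 0) ->
  zsum c = \sum_(xi <- box N) c xi.
Proof.
move=> c0.
have S (f : 'rV[int]_n -> R) M : (N <= M)%N -> (forall xi, xi \notin box N -> f xi = 0) ->
    \sum_(xi <- box M) f xi = \sum_(xi <- box N) f xi.
  move=> NM f0.
  have h : perm_eq (box M : seq 'rV[int]_n) (box N ++ [seq xi <- box M | xi \notin box N]).
    apply: uniq_perm; first exact: box_uniq.
      rewrite cat_uniq box_uniq filter_uniq ?box_uniq// andbT; apply/hasPn => p.
      by rewrite mem_filter => /andP[].
    move=> p; rewrite mem_cat mem_filter; case pN : (p \in box N) => //=.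
    exact: (box_le NM pN).
  rewrite (perm_big _ h)/= big_cat/= [X in _ + X]big1_seq ?addr0// => p /andP[_].
  by rewrite mem_filter => /andP[/f0].
have bd M : \sum_(xi <- box M) `|c xi| <= \sum_(xi <- box N) `|c xi|.
  apply: le_trans (box_sum_le (fun xi => normr_ge0 (c xi)) (leq_maxr N M)) _.
  by rewrite (S (fun xi => `|c xi|) _ (leq_maxl N M))// => xi /c0 ->; rewrite normr0.
have h := zsum_cvg bd; rewrite -(cvg_lim _ h)//; apply/cvg_lim => //.
by apply: cvg_near_cst; exists N => // M /= NM; rewrite (S c).
Qed.

(** For a real distribution, reflecting the frequency conjugates the coefficient, so the cosine and
    the sine parts enter with the same sign. *)
Lemma dual_termE g h xi : symc (fun p => h (trp p)) ->
  complex.Re (fourier g xi * fourier h (- xi)) =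
  g (trp (xi, false)) * h (trp (xi, false)) + g (trp (xi, true)) * h (trp (xi, true)).
Proof.
move=> sh; rewrite /fourier /=.
have h1 : h (fun x => cos (phase (- xi) x)) = h (trp (xi, false)).
  by have := sh (xi, false); rewrite mul1r.
have h2 : h (fun x => sin (phase (- xi) x)) = - h (trp (xi, true)).
  by have := sh (xi, true); rewrite mulN1r.
by rewrite h1 h2 opprK mulNr opprK.
Qed.

Lemma hinner_termE g h xi : complex.Re (fourier g xi * conjc (fourier h xi)) =
  g (trp (xi, false)) * h (trp (xi, false)) + g (trp (xi, true)) * h (trp (xi, true)).
Proof. by rewrite /fourier /= opprK mulNr opprK. Qed.

Lemma dual_cvg g h (K : R) : symc (fun p => h (trp p)) ->
  (forall N, \sum_(p <- modes N) `|g (trp p) * h (trp p)| <= K) ->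
  (fun N => \sum_(p <- modes N) g (trp p) * h (trp p)) @ \oo --> dual g h.
Proof.
move=> sh hK.
have bd N : \sum_(xi <- box N) `|complex.Re (fourier g xi * fourier h (- xi))| <= K.
  apply: le_trans (hK N); rewrite modes_sum; apply: ler_sum => xi _.
  by rewrite dual_termE//; exact: ler_normD.
apply: cvg_ext (zsum_cvg bd) => N; rewrite modes_sum; apply: eq_bigr => xi _.
by rewrite dual_termE.
Qed.

Lemma vdual_vtp u N k : solenoidal k ->
  vdual u (vtp N k) = \sum_i \sum_(p <- modes N) u i (trp p) * k i p.
Proof.
move=> hk; have [sk _ _] := hk; apply: eq_bigr => i _.
have sv : symc (fun p => vtp N k i (trp p)) by apply: symc_pd; exact: pd_tpdistr.
rewrite /dual (@zsum_supp N).
  rewrite modes_sum big_seq [RHS]big_seq; apply: eq_bigr => xi.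
  by rewrite mem_box => hxi; rewrite dual_termE// !vtp_coef// !mem_modes /= hxi.
move=> xi xiN; rewrite dual_termE// !vtp_coef// !mem_modes /= -mem_box (negbTE xiN).
by rewrite !mulr0 addr0.
Qed.

End Sobolev.

(** * The Leray projection *)

Section Leray.
Context {R : realType} {n : nat}.
Local Notation mode := ('rV[int]_n * bool)%type.
Implicit Types (p q : mode) (xi : 'rV[int]_n) (g h : pdistr R n) (u v w F G : vdistr R n).

Lemma div_free_of_coef w : (0 < n)%N -> pdv w -> (forall xi s, \sum_i (xi 0 i)%:~R * w i (trp (xi, s)) = 0) -> div_free w.
Proof.
move=> n0 pw dw phi tphi.
have h i : (fun N => \sum_(p <- modes N) distr_of (partial i phi) (trp p) * w i (trp p)) @ \oo --> w i (partial i phi).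
  by exact: (pd_fourier n0 (pw i) (test_partial _ tphi)).
have h2 : (fun N => \sum_(i <- index_enum 'I_n) \sum_(p <- modes N) distr_of (partial i phi) (trp p) * w i (trp p)) @ \oo
    --> \sum_(i <- index_enum 'I_n) w i (partial i phi).
  by apply: cvg_sumr.
have -> : \sum_i dpartial i (w i) phi = - \sum_i w i (partial i phi) by rewrite -sumrN.
rewrite -(cvg_lim _ h2)//; apply/eqP; rewrite oppr_eq0; apply/eqP; apply/cvg_lim => //.
apply: cvg_near_cst; apply: nearW => N.
rewrite exchange_big/= big1// => -[xi b] _.
rewrite (eq_bigr (fun i => - (sgb b * (2 * pi)) * distr_of phi (trp (xi, ~~ b)) * ((xi 0 i)%:~R * w i (trp (xi, b))))).
  by rewrite -mulr_sumr dw mulr0.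
by move=> i _; rewrite partial_coef//; ring.
Qed.

Definition sqn xi : R := \sum_i ((xi 0 i)%:~R : R) ^+ 2.

(** The symbol delta_ij - xi_i xi_j / |xi|^2. At xi = 0 the subtracted term is 0, so the mean is
    left alone. *)
Definition lerayk F (i : 'I_n) p : R :=
  F i (trp p) - (p.1 0 i)%:~R / sqn p.1 * \sum_j (p.1 0 j)%:~R * F j (trp p).

Lemma sqn_ge xi i : ((xi 0 i)%:~R : R) ^+ 2 <= sqn xi.
Proof. by rewrite /sqn (bigD1 i)//= lerDl sumr_ge0// => j _; exact: sqr_ge0. Qed.

Lemma sqn_eq0 xi i : sqn xi = 0 -> (xi 0 i)%:~R = 0 :> R.
Proof. by move=> s0; have := sqn_ge xi i; rewrite s0 exprn_even_le0// => /eqP. Qed.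

Lemma sqn_frac xi i j : `|(xi 0 i)%:~R / sqn xi * (xi 0 j)%:~R| <= 1 :> R.
Proof.
have [s0|s0] := eqVneq (sqn xi) 0; first by rewrite s0 invr0 mulr0 mul0r normr0.
have sp : 0 < sqn xi by rewrite lt_neqAle eq_sym s0/= sumr_ge0// => k _; exact: sqr_ge0.
rewrite mulrAC normrM normrV ?unitfE// (gtr0_norm sp) ler_pdivrMr// mul1r normrM.
have hi := sqn_ge xi i; have hj := sqn_ge xi j.
have ai : `|(xi 0 i)%:~R : R| ^+ 2 = (xi 0 i)%:~R ^+ 2 by rewrite real_normK ?num_real.
have aj : `|(xi 0 j)%:~R : R| ^+ 2 = (xi 0 j)%:~R ^+ 2 by rewrite real_normK ?num_real.
have := sqr_ge0 (`|(xi 0 i)%:~R : R| - `|(xi 0 j)%:~R|); nra.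
Qed.

Lemma lerayk_bound F (K : R) i p : (forall j q, `|F j (trp q)| <= K) -> `|lerayk F i p| <= K + n%:R * K.
Proof.
move=> hK; apply: le_trans (ler_normB _ _) _; apply: lerD => //.
rewrite mulr_sumr; apply: le_trans (ler_norm_sum _ _ _) _.
apply: (@le_trans _ _ (\sum_(j < n) K)); last by rewrite sumr_const card_ord mulr_natl.
apply: ler_sum => j _; rewrite mulrA normrM.
rewrite -[leRHS]mul1r; apply: ler_pM => //; exact: sqn_frac.
Qed.

Lemma lerayk_symc F i : pdv F -> symc (lerayk F i).
Proof.
move=> pF [xi s]; rewrite /lerayk /=.
have E j : F j (trp (- xi, s)) = sgs s * F j (trp (xi, s)) by exact: (symc_pd (pF j) (xi, s)).
have -> : sqn (- xi) = sqn xi by apply: eq_bigr => j _; rewrite mxE rmorphN sqrrN.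
rewrite mulrBr -!E mulr_sumr; congr (_ - _).
rewrite mxE rmorphN !mulr_sumr; apply: eq_bigr => j _.
by rewrite E mxE rmorphN; ring.
Qed.

Lemma lerayk_div F xi s : \sum_i (xi 0 i)%:~R * lerayk F i (xi, s) = 0.
Proof.
rewrite /lerayk /=; set S := \sum_j (xi 0 j)%:~R * F j (trp (xi, s)).
have -> : \sum_i (xi 0 i)%:~R * (F i (trp (xi, s)) - (xi 0 i)%:~R / sqn xi * S) = S - sqn xi / sqn xi * S.
  rewrite /sqn -/(sqn xi) !mulr_suml -sumrB; apply: eq_bigr => i _; ring.
have [s0|s0] := eqVneq (sqn xi) 0; last by rewrite divff// mul1r subrr.
rewrite s0 mul0r mul0r subr0; apply: big1 => i _; by rewrite sqn_eq0// mul0r.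
Qed.

Definition lerayV F : vdistr R n := fun i => series_distr (lerayk F i).

(** The weight [rho ^- n.+1] is summable over the lattice, so bounded coefficients place a
    distribution in the space of order -(n+1)/2. The convective term is projected there, its
    coefficients being merely bounded. *)
Lemma hsum_decay (s : R) w (K : R) N : (2 <= n)%N -> s = - (n.+1%:R / 2) ->
  (forall i p, `|w i (trp p)| <= K) -> hsum (hw s) w N <= n%:R * (K ^+ 2 * (2 * @lattC R n)).
Proof.
move=> n2 -> hK; rewrite (_ : n%:R * _ = \sum_(i < n) (K ^+ 2 * (2 * @lattC R n))); last first.
  by rewrite sumr_const card_ord mulr_natl.
apply: ler_sum => i _.
apply: (@le_trans _ _ (\sum_(p <- modes N) K ^+ 2 * ((1 + (xnorm p.1)%:R) ^- n.+1))).
  apply: ler_sum => p _; rewrite mulrC; apply: ler_pM; rewrite ?sqr_ge0 ?hw_ge0//.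
    by rewrite -real_normK ?num_real// ler_sqr ?nnegrE// (le_trans _ (hK i p)).
  rewrite /hw mulrN mulrC divfK ?pnatr_eq0// powRN powR_mulrn; last exact/ltW/rho_gt0.
  have x0 : 0 < 1 + (xnorm p.1)%:R :> R by rewrite ltr_wpDr.
  rewrite lef_pV2 ?posrE ?exprn_gt0 ?rho_gt0//.
  by apply: lerXn2r; rewrite ?nnegrE; [exact/ltW|exact/ltW/rho_gt0|exact: rho_ge].
rewrite -mulr_sumr; apply: ler_wpM2l; first exact: sqr_ge0.
rewrite modes_sum big_split/= mulr_natl mulr2n; apply: lerD; apply: box_sum_decay; exact: leq_trans n2.
Qed.

Lemma hinner_cvg s u w : (hnorm2 s u < +oo)%E -> (hnorm2 s w < +oo)%E ->
  (fun N => \sum_i \sum_(p <- modes N) hw s p.1 * (u i (trp p) * w i (trp p))) @ \oo --> hinner s u w.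
Proof.
move=> hu hw_; rewrite /hinner; apply: cvg_sumr => i.
have bd N : \sum_(xi <- box N) `|rho xi `^ (2 * s) *
    complex.Re (fourier (u i) xi * conjc (fourier (w i) xi))| <= nrm s u + nrm s w.
  apply: (@le_trans _ _ (\sum_(p <- modes N) hw s p.1 * u i (trp p) ^+ 2 + \sum_(p <- modes N) hw s p.1 * w i (trp p) ^+ 2)).
    rewrite !modes_sum -big_split/=; apply: ler_sum => xi _.
    rewrite [X in `|_ * X|]hinner_termE.
    rewrite -/(hw s xi) normrM (ger0_norm (hw_ge0 _ _)) -!mulrDr; apply: ler_wpM2l; first exact: hw_ge0.
    apply: le_trans (ler_normD _ _) _.
    have amgm (x y : R) : `|x * y| <= x ^+ 2 + y ^+ 2.
      rewrite normrM -[x ^+ 2]real_normK ?num_real// -[y ^+ 2]real_normK ?num_real//.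
      have := sqr_ge0 (`|x| - `|y|); have := normr_ge0 x; have := normr_ge0 y; nra.
    have := amgm (u i (trp (xi, false))) (w i (trp (xi, false))).
    have := amgm (u i (trp (xi, true))) (w i (trp (xi, true))); lra.
  apply: lerD.
    by apply: le_trans (comp_le_hsum u N i (hw_ge0 s)) _; exact: hsum_le_nrm.
  by apply: le_trans (comp_le_hsum w N i (hw_ge0 s)) _; exact: hsum_le_nrm.
apply: cvg_ext (zsum_cvg bd) => N; rewrite modes_sum; apply: eq_bigr => xi _.
by rewrite hinner_termE -/(hw s xi) mulrDr.
Qed.

Lemma hnorm2B s u w : (hnorm2 s u < +oo)%E -> (hnorm2 s w < +oo)%E ->
  (hnorm2 s (vsub u w) < +oo)%E /\ nrm s (vsub u w) <= 2 * (nrm s u + nrm s w).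
Proof.
move=> hu hw_.
have h : (hnorm2 s (vsub u w) <= (2 * (nrm s u + nrm s w))%:E)%E.
  apply: hnorm2_le_bound => N.
  apply: (@le_trans _ _ (2 * (hsum (hw s) u N + hsum (hw s) w N))); last first.
    by apply: ler_wpM2l => //; apply: lerD; exact: hsum_le_nrm.
  rewrite -big_split/= mulr_sumr; apply: ler_sum => i _.
  rewrite -big_split/= mulr_sumr; apply: ler_sum => p _; rewrite /vsub.
  rewrite -mulrDr [leRHS]mulrCA; apply: ler_wpM2l; first exact: hw_ge0.
  have := sqr_ge0 (u i (trp p) + w i (trp p)); nra.
have h2 := le_lt_trans h (ltry _); split => //.
by rewrite -lee_fin nrm_EFin.
Qed.

(** [leray] is a choice with a default, so a projection has to be exhibited. At each frequency xi
    the difference of [F] and [lerayV F] is parallel to xi, hence orthogonal to every divergence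
    free field. *)
Lemma leray_exists F (K : R) : (2 <= n)%N -> pdv F -> (forall i p, `|F i (trp p)| <= K) ->
  (forall i b, F i (trp (0, b)) = 0) -> is_leray F (leray F).
Proof.
move=> n2 pF hK F0; apply: (@xgetPex _ (fun _ _ => 0) [set G | is_leray F G]).
have n0 : (0 < n)%N by exact: leq_trans n2.
have hb i p := lerayk_bound i p hK.
have cG i p : lerayV F i (trp p) = lerayk F i p.
  by apply: (series_coef n0 _ (hb i)); exact: lerayk_symc.
have pG : pdv (lerayV F) by move=> i; exact: (is_pdistr_series n0 (hb i)).
pose s : R := - (n.+1%:R / 2).
have hF : (hnorm2 s F < +oo)%E.
  apply: le_lt_trans (ltry _); apply: hnorm2_le_bound => N; exact: (hsum_decay N n2 erefl hK).
have hG : (hnorm2 s (lerayV F) < +oo)%E.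
  apply: le_lt_trans (ltry _); apply: hnorm2_le_bound => N.
  by apply: (hsum_decay N n2 erefl) => i p; rewrite cG; exact: hb.
have z0 g : (forall b, g (trp (0, b)) = 0) -> fourier g 0 = 0 :> R[i].
  move=> h; apply/eqP; rewrite eq_complex /= oppr_eq0.
  by apply/andP; split; apply/eqP; [exact: (h false)|exact: (h true)].
exists (lerayV F), s; split.
- by split; [split|move=> i; apply: z0 => b; exact: F0].
- split; first split; first by split.
    move=> i; apply: z0 => b; rewrite cG /lerayk /= F0 mxE mul0r mul0r subr0//.
  apply: div_free_of_coef => // xi b; rewrite -[RHS](lerayk_div F xi b).
  by apply: eq_bigr => i _; rewrite cG.
- move=> w [[[pw hw_] w0] dw].
  have h := hinner_cvg (hnorm2B hF hG).1 hw_; rewrite -(cvg_lim _ h)//; apply/cvg_lim => //.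
  apply: cvg_near_cst; apply: nearW => N; rewrite exchange_big/= big1// => -[xi b] _.
  set S := \sum_j (xi 0 j)%:~R * F j (trp (xi, b)).
  rewrite (eq_bigr (fun i => hw s xi * (S / sqn xi) * ((xi 0 i)%:~R * w i (trp (xi, b))))).
    by rewrite -mulr_sumr div_free_coef// mulr0.
  by move=> i _; rewrite /vsub cG /lerayk /= -/S; ring.
Qed.

(** The order [s] inside [is_leray] is unknown. Testing with coefficients divided by the weight of
    order [s] cancels it and turns the inner product into the plain pairing. *)
Lemma leray_pair F G N k : is_leray F G -> solenoidal k ->
  \sum_i \sum_(p <- modes N) G i (trp p) * k i p = \sum_i \sum_(p <- modes N) F i (trp p) * k i p.
Proof.
move=> [s [hF hG orth]] hk.
pose k' i p := (hw s p.1)^-1 * k i p.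
have hwN xi : hw s (- xi) = hw s xi :> R.
  rewrite /hw /rho; congr ((_ * Num.sqrt (1 + _)) `^ _).
  by apply: eq_bigr => j _; rewrite mxE rmorphN sqrrN.
have hk' : solenoidal k'.
  by apply: (@solenoidalZ R n (fun xi => (hw s xi)^-1) k _ hk) => xi; rewrite hwN.
have := orth _ (vtp_Hdot_sigma s N hk').
have -> : hinner s (vsub F G) (vtp N k') = \sum_i \sum_(p <- modes N) (F i (trp p) - G i (trp p)) * k i p.
  apply: eq_bigr => i _; rewrite (@zsum_supp R n N).
    rewrite modes_sum big_seq [RHS]big_seq; apply: eq_bigr => xi; rewrite mem_box => hxi.
    rewrite hinner_termE !vtp_coef// !mem_modes /= hxi /k' /= -/(hw s xi) /vsub.
    by field; rewrite gt_eqF// hw_gt0.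
  move=> xi xiN; rewrite hinner_termE !vtp_coef// !mem_modes /= -mem_box (negbTE xiN).
  by rewrite !mulr0 addr0 mulr0.
move=> h; apply/esym/subr0_eq; rewrite -sumrB -[RHS]h; apply: eq_bigr => i _.
by rewrite -sumrB; apply: eq_bigr => p _; rewrite mulrBl.
Qed.

End Leray.

(** * The convective term *)

Section Convection.
Context {R : realType} {n : nat}.
Local Notation mode := ('rV[int]_n * bool)%type.
Implicit Types (p q : mode) (xi : 'rV[int]_n) (g h : pdistr R n) (u v w : vdistr R n).
Local Notation fn := ('rV[R]_n -> R).
Local Notation TT := (n.-tuple (measurableTypeR R)).

Definition grad u (j k : 'I_n) : fn := L2fun (dpartial j (u k)).
Definition vfun u (j : 'I_n) : fn := L2fun (u j).

Section Sobolev1.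
Variable u : vdistr R n.
Hypotheses (n0 : (0 < n)%N) (pu : pdv u) (fu : (hnorm2 1 u < +oo)%E).

Lemma hsum0_le_nrm1 N : hsum (hw 0) u N <= nrm 1 u.
Proof. by apply: le_trans (hsum_le_nrm N fu); apply: hsum_mono; exact: ler01. Qed.

Lemma vfun_tL2 j : tL2 (vfun u j).
Proof. by apply: (L2fun_tL2 n0 (pu j)) => N; exact: (coef0_bound j N hsum0_le_nrm1). Qed.

Lemma vfun_distr j : eq_distr (u j) (distr_of (vfun u j)).
Proof. by have [] := L2funP n0 (pu j) (fun N => coef0_bound j N hsum0_le_nrm1). Qed.

Lemma vfun_coef j p : distr_of (vfun u j) (trp p) = u j (trp p).
Proof. by rewrite vfun_distr//; exact: trp_test. Qed.

Lemma grad_tL2 j k : tL2 (grad u j k).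
Proof.
apply: (L2fun_tL2 n0 (is_pdistr_dpartial j (pu k))) => N.
by apply: (dpartial_bound j k N pu) => M; exact: hsum_le_nrm.
Qed.

Lemma grad_coef j k p : distr_of (grad u j k) (trp p) = dpartial j (u k) (trp p).
Proof.
apply: (L2fun_coef n0 p (is_pdistr_dpartial j (pu k))) => N.
by apply: (dpartial_bound j k N pu) => M; exact: hsum_le_nrm.
Qed.

Lemma proj_vfun N j : proj N (distr_of (vfun u j)) = proj N (u j).
Proof. by apply/funext => x; apply: eq_bigr => p _; rewrite vfun_coef. Qed.

Lemma proj_grad N j k : proj N (distr_of (grad u j k)) = partial j (proj N (u k)).
Proof.
by rewrite partial_projg//; apply/funext => x; apply: eq_bigr => p _; rewrite grad_coef.
Qed.

End Sobolev1.

(** The form b(U, V, P) with the gradient [V j k], standing for d_j V_k, as an independent argument;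
    exact and truncated fields can then be mixed. *)
Definition tri (U : 'I_n -> fn) (V : 'I_n -> 'I_n -> fn) (P : 'I_n -> fn) : R :=
  \sum_k \sum_j torus_int (fun x => U j x * V j k x * P k x).

Definition tri_ok (U : 'I_n -> fn) (V : 'I_n -> 'I_n -> fn) (P : 'I_n -> fn) :=
  forall j k, tL1 (fun x => U j x * V j k x * P k x).

Lemma triBl U U' V P : tri_ok U V P -> tri_ok U' V P ->
  tri (fun j x => U j x - U' j x) V P = tri U V P - tri U' V P.
Proof.
move=> h h'; rewrite -sumrB; apply: eq_bigr => k _; rewrite -sumrB; apply: eq_bigr => j _.
rewrite -torus_intB; [|exact: h|exact: h']; congr torus_int; apply/funext => x; ring.
Qed.

Lemma triBm U V V' P : tri_ok U V P -> tri_ok U V' P ->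
  tri U (fun j k x => V j k x - V' j k x) P = tri U V P - tri U V' P.
Proof.
move=> h h'; rewrite -sumrB; apply: eq_bigr => k _; rewrite -sumrB; apply: eq_bigr => j _.
rewrite -torus_intB; [|exact: h|exact: h']; congr torus_int; apply/funext => x; ring.
Qed.

Lemma triBr U V P P' : tri_ok U V P -> tri_ok U V P' ->
  tri U V (fun k x => P k x - P' k x) = tri U V P - tri U V P'.
Proof.
move=> h h'; rewrite -sumrB; apply: eq_bigr => k _; rewrite -sumrB; apply: eq_bigr => j _.
rewrite -torus_intB; [|exact: h|exact: h']; congr torus_int; apply/funext => x; ring.
Qed.

Lemma tri_ok_r U V P : (forall j, tL2 (U j)) -> (forall j k, tL2 (V j k)) ->
  (forall k, test_fun (P k)) -> tri_ok U V P.
Proof. by move=> hU hV hP j k; apply: tL1_testM => //; exact: tL2M. Qed.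

Lemma tri_ok_m U V P : (forall j, tL2 (U j)) -> (forall j k, test_fun (V j k)) ->
  (forall k, tL2 (P k)) -> tri_ok U V P.
Proof.
move=> hU hV hP j k.
have h : tL1 (fun x => U j x * P k x * V j k x) by apply: tL1_testM => //; exact: tL2M.
by rewrite (_ : (fun x => _) = fun x => U j x * P k x * V j k x)//; apply/funext => x; rewrite mulrAC.
Qed.

Lemma conv_tL1 u k : (0 < n)%N -> pdv u -> (hnorm2 1 u < +oo)%E ->
  tL1 (fun x => \sum_j vfun u j x * grad u j k x).
Proof.
move=> n0 pu fu; apply: tL1_sum => j; apply: tL2M; [exact: vfun_tL2|exact: grad_tL2].
Qed.

Lemma conv_tri u N k : (0 < n)%N -> pdv u -> (hnorm2 1 u < +oo)%E ->
  \sum_i \sum_(p <- modes N) convection u i (trp p) * k i p =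
  tri (vfun u) (grad u) (fun i => tp N (k i)).
Proof.
move=> n0 pu fu; apply: eq_bigr => i _.
rewrite -torus_int_sum; last first.
  by move=> j; apply: tL1_testM; [apply: tL2M; [exact: vfun_tL2|exact: grad_tL2]|exact: tp_test].
rewrite (eq_bigr (fun p => k i p * convection u i (trp p))); last by move=> p _; rewrite mulrC.
rewrite -distr_tp; last exact: conv_tL1.
by congr torus_int; apply/funext => x; rewrite mulr_suml.
Qed.

(** Integration by parts is carried out for the truncations of [u], which are again divergence free,
    and passes to the limit because [P] and its derivatives are bounded. *)
Lemma grad_antisym u P : (0 < n)%N -> Hdot_sigma 1 u -> (forall k, test_fun (P k)) ->
  tri (vfun u) (grad u) P = - tri (vfun u) (fun j k => partial j (P k)) (vfun u).
Proof.
move=> n0 hu tP; have [[[pu fu] u0] du] := hu.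
have pc j : (fun N => torus_int (fun x => (proj N (u j) x - vfun u j x) ^+ 2)) @ \oo --> 0.
  by under eq_fun do rewrite -(proj_vfun n0 pu fu); apply: proj_cvg; exact: vfun_tL2.
have gc j k : (fun N => torus_int (fun x => (partial j (proj N (u k)) x - grad u j k x) ^+ 2)) @ \oo --> 0.
  by under eq_fun do rewrite -(proj_grad n0 pu fu); apply: proj_cvg; exact: grad_tL2.
have tp_ N j : test_fun (proj N (u j)) by exact: tp_test.
have h1 : (fun N => tri (fun j => proj N (u j)) (fun j k => partial j (proj N (u k))) P) @ \oo -->
    tri (vfun u) (grad u) P.
  apply: cvg_sumr => k; apply: cvg_sumr => j; have [M hM] := test_bounded (tP k).
  apply: (torus_int_cvgM _ _ _ _ _ hM (pc j) (gc j k)).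
  - by move=> N; exact: tL2_test.
  - by move=> N; apply: tL2_test; exact: test_partial.
  - exact: vfun_tL2.
  - exact: grad_tL2.
  - exact: test_measurable.
have h2 : (fun N => tri (fun j => proj N (u j)) (fun j k => partial j (P k)) (fun k => proj N (u k))) @ \oo -->
    tri (vfun u) (fun j k => partial j (P k)) (vfun u).
  apply: cvg_sumr => k; apply: cvg_sumr => j; have [M hM] := test_bounded (test_partial j (tP k)).
  have -> : (fun x => vfun u j x * partial j (P k) x * vfun u k x) = fun x => vfun u j x * vfun u k x * partial j (P k) x.
    by apply/funext => x; rewrite mulrAC.
  have -> : (fun N => torus_int (fun x => proj N (u j) x * partial j (P k) x * proj N (u k) x)) =
    fun N => torus_int (fun x => proj N (u j) x * proj N (u k) x * partial j (P k) x).
    by apply/funext => N; congr torus_int; apply/funext => x; rewrite mulrAC.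
  apply: (torus_int_cvgM _ _ _ _ _ hM (pc j) (pc k)).
  - by move=> N; exact: tL2_test.
  - by move=> N; exact: tL2_test.
  - exact: vfun_tL2.
  - exact: vfun_tL2.
  - by apply: test_measurable; exact: test_partial.
have h3 : (fun N => - tri (fun j => proj N (u j)) (fun j k => partial j (P k)) (fun k => proj N (u k))) @ \oo -->
    - tri (vfun u) (fun j k => partial j (P k)) (vfun u) by exact: (cvgN h2).
rewrite -(cvg_lim _ h1)// -(cvg_lim _ h3)//; congr (lim (_ @ \oo)); apply/funext => N.
rewrite -sumrN; apply: eq_bigr => k _.
apply/eqP; rewrite -addr_eq0; apply/eqP.
pose Q := proj N (u k).
have I1 j : tL1 (fun x => proj N (u j) x * partial j Q x * P k x).
  by apply: tL1_test; exact: (testM (testM (tp_ N j) (test_partial j (tp_ N k))) (tP k)).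
have I2 j : tL1 (fun x => proj N (u j) x * partial j (P k) x * Q x).
  by apply: tL1_test; exact: (testM (testM (tp_ N j) (test_partial j (tP k))) (tp_ N k)).
have I3 j : test_fun (fun x => proj N (u j) x * (Q x * P k x)).
  by exact: (testM (tp_ N j) (testM (tp_ N k) (tP k))).
have I4 j : tL1 (fun x => partial j (proj N (u j)) x * (Q x * P k x)).
  by apply: tL1_test; exact: (testM (test_partial j (tp_ N j)) (testM (tp_ N k) (tP k))).
have I5 : \sum_j torus_int (fun x => partial j (proj N (u j)) x * (Q x * P k x)) = 0.
  rewrite -torus_int_sum// -[RHS](@torus_int0 R n); congr torus_int; apply/funext => x.
  rewrite -mulr_suml (_ : \sum_j _ = 0) ?mul0r//.
  rewrite (eq_bigr (fun j => \sum_(p <- modes N) dpartial j (u j) (trp p) * trp p x)); last first.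
    by move=> j _; rewrite partial_projg.
  rewrite exchange_big/= big1// => p _.
  by rewrite -mulr_suml (du _ (trp_test p)) mul0r.
transitivity (- (\sum_j torus_int (fun x => partial j (proj N (u j)) x * (Q x * P k x)))); last by rewrite I5 oppr0.
rewrite -big_split/= -sumrN; apply: eq_bigr => j _.
rewrite -torus_intD//; apply/eqP; rewrite -addr_eq0; apply/eqP.
rewrite -torus_intD//; last exact: tL1D.
rewrite -[RHS](test_int_partial j (I3 j)); congr torus_int; apply/funext => x.
have dQ x0 : derivable Q x0 (delta_mx 0 j) by apply: test_derivable; exact: tp_.
have dP x0 : derivable (P k) x0 (delta_mx 0 j) by exact: test_derivable.
have dj x0 : derivable (proj N (u j)) x0 (delta_mx 0 j) by apply: test_derivable; exact: tp_.
have dQP x0 : derivable (fun y => Q y * P k y) x0 (delta_mx 0 j).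
  by apply: test_derivable; exact: (testM (tp_ N k) (tP k)).
rewrite (partialM dj dQP) (partialM dQ dP).
rewrite -/Q; ring.
Qed.

(** For each component, twice the sum is the integral of u . grad (P_k^2), and P_k^2 is a test
    function. *)
Lemma tri_partial_self u P : (0 < n)%N -> Hdot_sigma 1 u -> (forall k, test_fun (P k)) ->
  tri (vfun u) (fun j k => partial j (P k)) P = 0.
Proof.
move=> n0 [[[pu fu] u0] du] tP; rewrite /tri big1// => k _.
have tPP : test_fun (fun x => P k x * P k x) by exact: testM.
have := du _ tPP => /(congr1 (fun y => - y)); rewrite oppr0 -sumrN => h.
suff : (\sum_j torus_int (fun x => vfun u j x * partial j (P k) x * P k x)) *+ 2 = 0.
  by move=> /eqP; rewrite mulrn_eq0 => /eqP.
rewrite -sumrMnl -[RHS]h; apply: eq_bigr => j _.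
rewrite opprK (vfun_distr n0 pu fu); last exact: test_partial.
have t1 : tL1 (fun x => vfun u j x * partial j (P k) x * P k x).
  apply: tL1_testM => //; apply: tL1_testM; last exact: test_partial.
  by apply: tL2_L1; exact: vfun_tL2.
rewrite mulr2n -torus_intD//; congr torus_int; apply/funext => x.
rewrite partialM; try exact: test_derivable.
ring.
Qed.

(** The components are integrable, so their coefficients are bounded by L_1 norms; it remains to see
    that their mean vanishes. *)
Lemma convection_leray u : (2 <= n)%N -> Hdot_sigma 1 u ->
  is_leray (convection u) (leray (convection u)).
Proof.
move=> n2 hu; have n0 : (0 < n)%N by exact: leq_trans n2.
have [[[pu fu] u0] du] := hu.
pose K := \sum_k torus_int (fun x => `|\sum_j vfun u j x * grad u j k x|).
have cL k := conv_tL1 k n0 pu fu.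
apply: (@leray_exists R n _ K) => //.
- by move=> k; exact: (is_pdistr_distr_of (cL k)).
- move=> k p; apply: (@le_trans _ _ (torus_int (fun x => `|\sum_j vfun u j x * grad u j k x|))); last first.
    by rewrite /K (bigD1 k)//= lerDl sumr_ge0// => i _; exact: torus_int_ge0.
  have tt : test_fun (trp p : fn) := trp_test p.
  have hi := tL1_testM (cL k) tt.
  apply: le_trans (RI_norm measurableT hi) _; apply: RI_le => //.
  + exact: (integrable_abse hi).
  + exact: (integrable_abse (cL k)).
  + by move=> y _; rewrite normrM -[leRHS]mulr1; apply: ler_wpM2l => //; exact: trp_bound.
- move=> k b.
  (* The coefficient at frequency 0 is a trilinear form with a constant test field, whose gradient
     vanishes after integration by parts. *)
  have E : convection u k (trp (0, b)) = tri (vfun u) (grad u) (fun i x => (i == k)%:R * trp (0, b) x).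
    rewrite /tri (bigD1 k)//= [X in _ + X]big1 ?addr0; last first.
      move=> i ik; apply: big1 => j _; rewrite -[RHS](@torus_int0 R n); congr torus_int.
      by apply/funext => x; rewrite (negbTE ik) mul0r mulr0.
    rewrite -torus_int_sum; last first.
      move=> j; apply: tL1_testM; first by apply: tL2M; [exact: vfun_tL2|exact: grad_tL2].
      by apply: testZ; exact: trp_test.
    by congr torus_int; apply/funext => x; rewrite eqxx mul1r mulr_suml.
  rewrite E grad_antisym//; last by move=> i; apply: testZ; exact: trp_test.
  rewrite /tri big1 ?oppr0// => i _; apply: big1 => j _; rewrite -[RHS](@torus_int0 R n).
  congr torus_int; apply/funext => x; rewrite partialZ; last by apply: test_derivable; exact: trp_test.
  by rewrite {1}/trp /= partial_tr mxE !mulr0 mul0r !mulr0 mul0r.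
Qed.

(* Formally this is -b(w, u, w) with w = v - u; the four other terms measure
   the truncation error. *)
Lemma convection_identity u v N : (0 < n)%N -> Hdot_sigma 1 u -> Hdot_sigma 1 v ->
  let U := vfun u in let V := vfun v in let W := fun j x => vfun v j x - vfun u j x in
  let P := fun k => proj N (u k) in let Q := fun k => proj N (v k) in
  let DP := fun j k => partial j (P k) in
  \sum_i \sum_(p <- modes N) convection u i (trp p) * v i (trp p) +
  \sum_i \sum_(p <- modes N) convection v i (trp p) * u i (trp p) -
  \sum_i \sum_(p <- modes N) convection u i (trp p) * u i (trp p) =
  tri U (fun j k x => grad u j k x - DP j k x) (fun k x => Q k x - P k x)
  + tri U DP (fun k x => (Q k x - P k x) - W k x)
  - tri U DP (fun k x => U k x - P k x) - tri W DP (fun k x => U k x - P k x)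
  - tri W DP W.
Proof.
move=> n0 hu hv U V W P Q DP.
have [[[pu fu] _] _] := hu; have [[[pv fv] _] _] := hv.
rewrite (conv_tri N (fun i p => v i (trp p)) n0 pu fu) (conv_tri N (fun i p => u i (trp p)) n0 pv fv)
  (conv_tri N (fun i p => u i (trp p)) n0 pu fu).
rewrite -/(proj N _) -/P -/Q.
have tP k : test_fun (P k) by exact: tp_test.
have tQ k : test_fun (Q k) by exact: tp_test.
have tD j k : test_fun (DP j k) by exact: test_partial.
have LU j : tL2 (U j) by exact: vfun_tL2.
have LV j : tL2 (V j) by exact: vfun_tL2.
have LP k : tL2 (P k) by exact: tL2_test.
have LQ k : tL2 (Q k) by exact: tL2_test.
have LD j k : tL2 (DP j k) by exact: tL2_test.
have LG j k : tL2 (grad u j k) by exact: grad_tL2.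
have LW j : tL2 (W j) by exact: tL2B.
have tQP k : test_fun (fun x => Q k x - P k x).
  have := testD (tQ k) (testZ (-1) (tP k)); congr test_fun; apply/funext => x; by rewrite mulN1r.
have LQP k : tL2 (fun x => Q k x - P k x) by exact: tL2_test.
have LUP k : tL2 (fun x => U k x - P k x) by exact: tL2B.
rewrite (grad_antisym n0 hv tP) -/V -/DP.
(* These two cancellations and the antisymmetry just used are the only analytic input; the rest is
   multilinear expansion. *)
have Z1 : tri U DP P = 0 := tri_partial_self n0 hu tP.
have Z2 : tri V DP P = 0 := tri_partial_self n0 hv tP.
have m := @tri_ok_m; have r := @tri_ok_r.
rewrite (triBm (r _ _ _ LU LG tQP) (r _ _ _ LU LD tQP)).
rewrite (triBr (r _ _ _ LU LG tQ) (r _ _ _ LU LG tP)).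
rewrite (triBr (r _ _ _ LU LD tQ) (r _ _ _ LU LD tP)).
rewrite (triBr (m _ _ _ LU tD LQP) (m _ _ _ LU tD LW)).
rewrite (triBr (r _ _ _ LU LD tQ) (r _ _ _ LU LD tP)).
rewrite (triBr (m _ _ _ LU tD LV) (m _ _ _ LU tD LU)).
rewrite (triBr (m _ _ _ LU tD LU) (m _ _ _ LU tD LP)).
rewrite (triBl (m _ _ _ LV tD LUP) (m _ _ _ LU tD LUP)).
rewrite (triBr (m _ _ _ LU tD LU) (m _ _ _ LU tD LP)).
rewrite (triBr (m _ _ _ LV tD LU) (m _ _ _ LV tD LP)).
rewrite (triBl (m _ _ _ LV tD LW) (m _ _ _ LU tD LW)).
rewrite (triBr (m _ _ _ LV tD LV) (m _ _ _ LV tD LU)).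
rewrite (triBr (m _ _ _ LU tD LV) (m _ _ _ LU tD LU)).
rewrite Z1 Z2; ring.
Qed.

End Convection.

(** * The trilinear estimate *)

Section Trilinear.
Context {R : realType} {n : nat}.
Local Notation mode := ('rV[int]_n * bool)%type.
Implicit Types (p q r : mode) (xi eta zeta : 'rV[int]_n) (F G H : 'rV[int]_n -> R).
Local Notation fn := ('rV[R]_n -> R).
Local Notation TT := (n.-tuple (measurableTypeR R)).

Lemma fsum_CS I (s : seq I) (a b : I -> R) :
  (\sum_(i <- s) a i * b i) ^+ 2 <= (\sum_(i <- s) a i ^+ 2) * (\sum_(i <- s) b i ^+ 2).
Proof.
set A := \sum_(i <- s) a i ^+ 2; set B := \sum_(i <- s) b i ^+ 2; set C := \sum_(i <- s) _.
have h x y : 0 <= x ^+ 2 * A + 2 * (x * y * C) + y ^+ 2 * B.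
  rewrite /A /B /C !mulr_sumr -!big_split/=; apply: sumr_ge0 => i _.
  rewrite (_ : _ + _ = (x * a i + y * b i) ^+ 2) ?sqr_ge0//; ring.
have A0 : 0 <= A by apply: sumr_ge0 => i _; exact: sqr_ge0.
have [A_0|A_n0] := eqVneq A 0.
  have [->|C0] := eqVneq C 0; first by rewrite expr0n A_0 mul0r.
  have := h (- (B + 1) / C) 1; rewrite A_0 mulr0 add0r mulr1 divfK// expr1n mul1r.
  have B0 : 0 <= B by apply: sumr_ge0 => i _; exact: sqr_ge0.
  by move=> hh; exfalso; move: hh; rewrite leNgt => /negP; apply; lra.
have := h (- C) A; have Ap : 0 < A by rewrite lt_neqAle eq_sym A_n0.
move=> hh; have : 0 <= A * (A * B - C ^+ 2) by apply: le_trans hh _; rewrite le_eqVlt; apply/orP; left; apply/eqP; ring.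
by rewrite pmulr_rge0// subr_ge0.
Qed.

Lemma fsum_CS_le I (s : seq I) (a b : I -> R) (A B : R) : 0 <= A -> 0 <= B ->
  \sum_(i <- s) a i ^+ 2 <= A ^+ 2 -> \sum_(i <- s) b i ^+ 2 <= B ^+ 2 ->
  \sum_(i <- s) a i * b i <= A * B.
Proof.
move=> A0 B0 hA hB; apply: le_trans (ler_norm _) _.
rewrite -(@ler_pXn2r _ 2)// ?nnegrE// ?mulr_ge0// real_normK ?num_real//.
apply: le_trans (fsum_CS s a b) _; rewrite exprMn; apply: ler_pM => //.
- by apply: sumr_ge0 => i _; exact: sqr_ge0.
- by apply: sumr_ge0 => i _; exact: sqr_ge0.
Qed.

Lemma shift_sum xi (s t : seq 'rV[int]_n) F : uniq s -> uniq t -> (forall zeta, 0 <= F zeta) ->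
  (forall zeta, zeta \notin t -> F zeta = 0) ->
  \sum_(eta <- s) F (xi + eta) <= \sum_(zeta <- t) F zeta.
Proof.
move=> us ut F0 Ft.
rewrite -(big_map (fun eta => xi + eta) xpredT F).
rewrite (bigID (mem t))/= [X in _ + X]big1 ?addr0; last by move=> i /Ft.
rewrite -big_filter; apply: ler_sum_subset => //.
  by rewrite filter_uniq// map_inj_uniq//; exact: addrI.
by move=> z; rewrite mem_filter => /andP[].
Qed.

Local Notation m xi := (1 + (xnorm xi)%:R : R).
Local Notation cw xi := ((1 + (xnorm xi)%:R : R) ^+ (n - 2)).

Lemma m_gt0 xi : 0 < m xi.
Proof. by rewrite ltr_wpDr. Qed.

Lemma cw_gt0 xi : 0 < cw xi.
Proof. by rewrite exprn_gt0// m_gt0. Qed.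

(** One summand for each alternative in [near_le] below: the growth of the weighted lattice sum and
    the number of points of a box. *)
Definition triC : R := lattC (n := n) + 2 ^+ n.

(* A convolution sum of F(xi) G(eta) H(xi + eta) is split according to which of
   F and H carries the larger frequency, and one derivative is put there. *)
Definition near_le xi eta := ((xnorm eta <= xnorm xi) || (xnorm (xi + eta) <= xnorm xi))%N.

(** The frequencies with |eta| <= |xi| are covered by [box_sum_growth]. For the others 1 / cw eta <=
    1 / cw xi, and O(m^n) values of eta bring xi + eta into the box, which leaves m^n / m^(n-2) =
    m^2. *)
Lemma near_sum N xi : (2 <= n)%N ->
  \sum_(eta <- box N) (near_le xi eta)%:R / cw eta <= triC * m xi ^+ 2.
Proof.
move=> n2.
apply: (@le_trans _ _ (\sum_(eta <- (box N : seq 'rV[int]_n)) (xnorm eta <= xnorm xi)%N%:R / cw eta +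
   \sum_(eta <- (box N : seq 'rV[int]_n)) (xnorm (xi + eta)%R <= xnorm xi)%N%:R / cw xi)).
  rewrite -big_split/=; apply: ler_sum => eta _; rewrite /near_le.
  have h1 := cw_gt0 eta; have h2 := cw_gt0 xi.
  case: leqP => h /=; first by rewrite mul1r lerDl divr_ge0// ltW.
  rewrite mul0r add0r; apply: ler_wpM2l => //.
  rewrite lef_pV2 ?posrE//; apply: lerXn2r; rewrite ?nnegrE; [exact/ltW/m_gt0|exact/ltW/m_gt0|].
  by rewrite lerD2l ler_nat ltnW.
rewrite /triC mulrDl; apply: lerD.
  apply: le_trans (box_sum_growth (xnorm xi) n2).
  rewrite (bigID (fun eta => xnorm eta <= xnorm xi)%N)/= [X in _ + X]big1 ?addr0; last first.
    by move=> eta /negbTE ->; rewrite mul0r.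
  rewrite -big_filter (eq_big_seq (fun eta => (cw eta)^-1)); last first.
    by move=> eta; rewrite mem_filter => /andP[-> _]; rewrite mul1r.
  apply: ler_sum_subset.
  - by rewrite filter_uniq// box_uniq.
  - exact: box_uniq.
  - by move=> eta; rewrite mem_filter [in X in _ -> X]mem_box => /andP[].
  - by move=> eta; rewrite invr_ge0 ltW// cw_gt0.
rewrite -mulr_suml ler_pdivrMr ?cw_gt0//.
apply: (@le_trans _ _ (\sum_(zeta <- box (xnorm xi)) (xnorm (zeta : 'rV[int]_n) <= xnorm xi)%N%:R)).
  apply: (@shift_sum xi (box N) (box (xnorm xi)) (fun z => (xnorm z <= xnorm xi)%N%:R)) => //; try exact: box_uniq.
  by move=> z; rewrite mem_box => /negbTE ->.
rewrite (eq_big_seq (fun=> 1)); last by move=> z; rewrite mem_box => ->.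
rewrite big_const_seq count_predT iter_addr_0 -mulrA -exprD.
have -> : (2 + (n - 2) = n)%N by lia.
exact: box_count.
Qed.

(** One of |xi| and |xi + eta| is the larger; viewed from - (xi + eta), adding eta leads to - xi, so
    the second case has the form of the first. *)
Lemma near_or xi eta : near_le xi eta || near_le (- (xi + eta)) eta.
Proof.
rewrite /near_le xnormN (_ : - (xi + eta) + eta = - xi) ?xnormN; last by rewrite opprD addrNK.
lia.
Qed.

(** Cauchy-Schwarz on each of the two regions, with sqrt (cw eta) put on [G] and taken from the
    partner. The partner's sum over eta is [near_sum], whose m^2 is one derivative on [F] in the
    first region and on [H] in the second. *)
Lemma convolution_bound N F G H (f0 f1 g h0 h1 : R) : (2 <= n)%N ->
  0 <= f0 -> 0 <= f1 -> 0 <= g -> 0 <= h0 -> 0 <= h1 ->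
  (forall xi, 0 <= F xi) -> (forall xi, 0 <= G xi) -> (forall xi, 0 <= H xi) ->
  (forall xi, xi \notin box N -> H xi = 0) ->
  \sum_(xi <- box N) F xi ^+ 2 <= f0 ^+ 2 ->
  \sum_(xi <- box N) m xi ^+ 2 * F xi ^+ 2 <= f1 ^+ 2 ->
  \sum_(xi <- box N) cw xi * G xi ^+ 2 <= g ^+ 2 ->
  \sum_(xi <- box N) H xi ^+ 2 <= h0 ^+ 2 ->
  \sum_(xi <- box N) m xi ^+ 2 * H xi ^+ 2 <= h1 ^+ 2 ->
  \sum_(xi <- box N) \sum_(eta <- box N) F xi * G eta * H (xi + eta) <=
  Num.sqrt triC * g * (f1 * h0 + f0 * h1).
Proof.
move=> n2 f00 f10 g0 h00 h10 F0 G0 H0 HN bF0 bF1 bG bH0 bH1.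
have C0 : 0 <= triC by rewrite /triC addr_ge0 ?exprn_ge0//; exact: le_trans (lattC_ge1).
pose s := [seq (xi, eta) | xi <- (box N : seq 'rV[int]_n), eta <- (box N : seq 'rV[int]_n)].
have E (f : 'rV[int]_n -> 'rV[int]_n -> R) :
    \sum_(xi <- box N) \sum_(eta <- box N) f xi eta = \sum_(z <- s) f z.1 z.2.
  by rewrite /s big_allpairs.
have sw xi : Num.sqrt (cw xi) != 0 by rewrite gt_eqF// sqrtr_gt0 cw_gt0.
have sw2 xi : Num.sqrt (cw xi) ^+ 2 = cw xi by rewrite sqr_sqrtr// ltW// cw_gt0.
have sC : Num.sqrt triC ^+ 2 = triC by rewrite sqr_sqrtr.
have T1 : \sum_(z <- s) (Num.sqrt (cw z.2) * G z.2 * H (z.1 + z.2)) *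
     ((near_le z.1 z.2)%:R * F z.1 / Num.sqrt (cw z.2)) <= (g * h0) * (Num.sqrt triC * f1).
  apply: fsum_CS_le; rewrite ?mulr_ge0// ?sqrtr_ge0//.
    rewrite -(E (fun xi eta => (Num.sqrt (cw eta) * G eta * H (xi + eta)) ^+ 2)) exchange_big/= exprMn.
    apply: (@le_trans _ _ (\sum_(eta <- box N) cw eta * G eta ^+ 2 * h0 ^+ 2)); last first.
      by rewrite -mulr_suml; apply: ler_wpM2r => //; exact: sqr_ge0.
    apply: ler_sum => eta _.
    rewrite (eq_bigr (fun xi => cw eta * G eta ^+ 2 * H (eta + xi) ^+ 2)); last first.
      by move=> xi _; rewrite !exprMn sw2 [eta + xi]addrC.
    rewrite -mulr_sumr; apply: ler_wpM2l; first by rewrite mulr_ge0 ?sqr_ge0// ltW// cw_gt0.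
    apply: le_trans _ bH0; apply: (@shift_sum eta _ _ (fun z => H z ^+ 2)); try exact: box_uniq.
      by move=> z; exact: sqr_ge0.
    by move=> z /HN ->; rewrite expr0n.
  rewrite -(E (fun xi eta => ((near_le xi eta)%:R * F xi / Num.sqrt (cw eta)) ^+ 2)) exprMn sC.
  apply: (@le_trans _ _ (\sum_(xi <- box N) triC * (m xi ^+ 2 * F xi ^+ 2))); last first.
    by rewrite -mulr_sumr; apply: ler_wpM2l.
  apply: ler_sum => xi _.
  rewrite (eq_bigr (fun eta => F xi ^+ 2 * ((near_le xi eta)%:R / cw eta))); last first.
    move=> eta _; rewrite !exprMn exprVn sw2; case: near_le; rewrite ?expr1n ?expr0n /=; ring.
  rewrite -mulr_sumr mulrA [leRHS]mulrC; apply: ler_wpM2l; [exact: sqr_ge0|exact: near_sum].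
have T2 : \sum_(z <- s) (Num.sqrt (cw z.2) * G z.2 * F z.1) *
     ((near_le (- (z.1 + z.2)) z.2)%:R * H (z.1 + z.2) / Num.sqrt (cw z.2)) <= (g * f0) * (Num.sqrt triC * h1).
  apply: fsum_CS_le; rewrite ?mulr_ge0// ?sqrtr_ge0//.
    rewrite -(E (fun xi eta => (Num.sqrt (cw eta) * G eta * F xi) ^+ 2)) exchange_big/= exprMn.
    apply: (@le_trans _ _ (\sum_(eta <- box N) cw eta * G eta ^+ 2 * f0 ^+ 2)); last first.
      by rewrite -mulr_suml; apply: ler_wpM2r => //; exact: sqr_ge0.
    apply: ler_sum => eta _.
    rewrite (eq_bigr (fun xi => cw eta * G eta ^+ 2 * F xi ^+ 2)); last first.
      by move=> xi _; rewrite !exprMn sw2.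
    by rewrite -mulr_sumr; apply: ler_wpM2l => //; rewrite mulr_ge0 ?sqr_ge0// ltW// cw_gt0.
  rewrite -(E (fun xi eta => ((near_le (- (xi + eta)) eta)%:R * H (xi + eta) / Num.sqrt (cw eta)) ^+ 2)) exchange_big/=.
  rewrite exprMn sC.
  apply: (@le_trans _ _ (\sum_(zeta <- box N) triC * (m zeta ^+ 2 * H zeta ^+ 2))); last first.
    by rewrite -mulr_sumr; apply: ler_wpM2l.
  apply: (@le_trans _ _ (\sum_(eta <- box N) \sum_(zeta <- box N)
      H zeta ^+ 2 * ((near_le (- zeta) eta)%:R / cw eta))).
    apply: ler_sum => eta _.
    pose Phi (z : 'rV[int]_n) := H z ^+ 2 * ((near_le (- z) eta)%:R / cw eta).
    rewrite (eq_bigr (fun xi => Phi (eta + xi))); last first.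
      move=> xi _; rewrite /Phi [eta + xi]addrC !exprMn exprVn sw2.
      by case: near_le; rewrite ?expr1n ?expr0n /=; ring.
    apply: (@shift_sum eta _ _ Phi); try exact: box_uniq.
      by move=> z; rewrite /Phi mulr_ge0 ?sqr_ge0// divr_ge0// ltW// cw_gt0.
    by move=> z /HN hz; rewrite /Phi hz expr0n mul0r.
  rewrite exchange_big/=; apply: ler_sum => z _.
  rewrite -mulr_sumr mulrA [leRHS]mulrC; apply: ler_wpM2l; first exact: sqr_ge0.
  by rewrite -(xnormN z); exact: near_sum.
rewrite E; apply: (@le_trans _ _ (g * h0 * (Num.sqrt triC * f1) + g * f0 * (Num.sqrt triC * h1))); last first.
  by rewrite le_eqVlt; apply/orP; left; apply/eqP; ring.
apply: le_trans (lerD T1 T2); rewrite -big_split/=; apply: ler_sum => -[xi eta] _ /=.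
have := near_or xi eta.
have P0 : 0 <= F xi * G eta * H (xi + eta) by rewrite !mulr_ge0.
have -> : Num.sqrt (cw eta) * G eta * H (xi + eta) * ((near_le xi eta)%:R * F xi / Num.sqrt (cw eta)) =
  (near_le xi eta)%:R * (F xi * G eta * H (xi + eta)) by have := sw eta => ?; field.
have -> : Num.sqrt (cw eta) * G eta * F xi * ((near_le (- (xi + eta)) eta)%:R * H (xi + eta) / Num.sqrt (cw eta)) =
  (near_le (- (xi + eta)) eta)%:R * (F xi * G eta * H (xi + eta)) by have := sw eta => ?; field.
by case: near_le; case: near_le => //= _; rewrite ?mul1r ?mul0r ?addr0 ?add0r// lerDl.
Qed.

(** Only the four frequencies +-p +-q of the product of the first two modes can meet the third, each
    with a coefficient of modulus at most 1. *)
Lemma torus_int_trp3 p q r : `|torus_int (fun x => trp p x * trp q x * trp r x)| <=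
  (r.1 == p.1 + q.1)%:R + (r.1 == - (p.1 + q.1))%:R + (r.1 == p.1 - q.1)%:R + (r.1 == - (p.1 - q.1))%:R :> R.
Proof.
have B (p' q' : mode) : `|torus_int (fun x => trp p' x * trp q' x)| <= (q'.1 == p'.1)%:R + (q'.1 == - p'.1)%:R :> R.
  rewrite torus_int_trp2 normrM ger0_norm ?invr_ge0//.
  have h1 : (p' == q')%:R <= (q'.1 == p'.1)%:R :> R.
    by rewrite ler_nat; case: eqP => // ->; rewrite eqxx.
  have h2 : (p' == negm q')%:R <= (q'.1 == - p'.1)%:R :> R.
    by rewrite ler_nat; case: eqP => // ->; rewrite /negm /= opprK eqxx.
  have n1 : 0 <= (p' == q')%:R :> R by [].
  have n2 : 0 <= (p' == negm q')%:R :> R by [].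
  have h3 : `|(p' == q')%:R + sgs p'.2 * (p' == negm q')%:R| <= (q'.1 == p'.1)%:R + (q'.1 == - p'.1)%:R :> R.
    apply: le_trans (ler_normD _ _) _; rewrite (ger0_norm n1); apply: lerD => //.
    by rewrite normrM (ger0_norm n2) /sgs; case: (p'.2); rewrite ?normrN normr1 mul1r.
  have n3 : 0 <= (q'.1 == p'.1)%:R :> R by [].
  have n4 : 0 <= (q'.1 == - p'.1)%:R :> R by [].
  lra.
have I (p' q' : mode) : tL1 (fun x => trp p' x * trp q' x : R).
  by apply: tL1_test; exact: (testM (trp_test p') (trp_test q')).
have -> : (fun x => trp p x * trp q x * trp r x) = fun x =>
  (2^-1 * (if p.2 && q.2 then -1 else 1)) * (trp (p.1 + q.1, p.2 (+) q.2) x * trp r x) +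
  (2^-1 * (if ~~ p.2 && q.2 then -1 else 1)) * (trp (p.1 - q.1, p.2 (+) q.2) x * trp r x) :> R.
  by apply/funext => x; rewrite (trp_mul p q x) mulrDr mulrDl !mulrA.
rewrite torus_intD; [|exact: tL1Z|exact: tL1Z].
rewrite !torus_intZ//; apply: le_trans (ler_normD _ _) _; rewrite -addrA.
have s1 (b : bool) : `|2^-1 * (if b then -1 else 1)| <= 1 :> R.
  by case: b; rewrite ?mulrN1 ?mulr1 ?normrN ger0_norm//; lra.
apply: lerD; rewrite normrM -[leRHS]mul1r; apply: ler_pM => //.
Qed.

(** The phase of a frequency is forgotten: trilinear integrals are bounded by convolutions of these
    amplitudes, and the signs of the frequencies are absorbed by symmetrising two of the three
    factors. *)
Definition amp (N : nat) (k : mode -> R) xi : R :=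
  if xi \in box N then `|k (xi, false)| + `|k (xi, true)| else 0.

Lemma amp_ge0 N k xi : 0 <= amp N k xi.
Proof. by rewrite /amp; case: ifP => // _; exact: addr_ge0. Qed.

Lemma amp_sum N (W : 'rV[int]_n -> R) k : (forall xi, 0 <= W xi) ->
  \sum_(xi <- box N) W xi * amp N k xi ^+ 2 <= 2 * \sum_(p <- modes N) W p.1 * k p ^+ 2.
Proof.
move=> W0; rewrite modes_sum mulr_sumr; apply: ler_sum => xi _.
rewrite -mulrDr [leRHS]mulrCA; apply: ler_wpM2l => //; rewrite /amp; case: ifP => _.
  rewrite -[k (xi, false) ^+ 2]real_normK ?num_real// -[k (xi, true) ^+ 2]real_normK ?num_real//.
  have := sqr_ge0 (`|k (xi, false)| - `|k (xi, true)|); nra.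
by rewrite expr0n /= mulr_ge0// addr_ge0 ?sqr_ge0.
Qed.

Lemma sym_sum N (W : 'rV[int]_n -> R) F : (forall xi, 0 <= W xi) -> (forall xi, W (- xi) = W xi) ->
  \sum_(xi <- box N) W xi * (F xi + F (- xi)) ^+ 2 <= 4 * \sum_(xi <- box N) W xi * F xi ^+ 2.
Proof.
move=> W0 Ws.
have h : \sum_(xi <- box N) W xi * F (- xi) ^+ 2 = \sum_(xi <- box N) W xi * F xi ^+ 2.
  rewrite -[RHS]box_sum_neg; apply: eq_bigr => xi _; by rewrite Ws.
apply: (@le_trans _ _ (2 * (\sum_(xi <- box N) W xi * F xi ^+ 2 + \sum_(xi <- box N) W xi * F (- xi) ^+ 2))).
  rewrite -big_split/= mulr_sumr; apply: ler_sum => xi _.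
  rewrite -mulrDr [leRHS]mulrCA; apply: ler_wpM2l => //.
  have := sqr_ge0 (F xi - F (- xi)); nra.
by rewrite h; lra.
Qed.

Definition wsum (W : 'rV[int]_n -> R) (k : mode -> R) N := \sum_(p <- modes N) W p.1 * k p ^+ 2.

(** 16 bounds sqrt 8 * sqrt 2 * sqrt 8: passing to amplitudes costs sqrt 2 for each factor,
    symmetrising in the frequency a further 2 for two of them. *)
Definition trilC : R := Num.sqrt triC * 16.

Lemma torus_int_tp3 N (kf kg kh : mode -> R) :
  torus_int (fun x => tp N kf x * tp N kg x * tp N kh x) =
  \sum_(p <- modes N) \sum_(q <- modes N) \sum_(r <- modes N)
    kf p * kg q * kh r * torus_int (fun x => trp p x * trp q x * trp r x).
Proof.
have I p q r : tL1 (fun x => trp p x * trp q x * trp r x : R).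
  by apply: tL1_test; exact: (testM (testM (trp_test p) (trp_test q)) (trp_test r)).
transitivity (torus_int (fun x => \sum_(p <- modes N) \sum_(q <- modes N) \sum_(r <- modes N)
    kf p * kg q * kh r * (trp p x * trp q x * trp r x))).
  congr torus_int; apply/funext => x; rewrite /tp big_distrlr/= mulr_suml; apply: eq_bigr => p _.
  rewrite mulr_suml; apply: eq_bigr => q _; rewrite mulr_sumr; apply: eq_bigr => r _; ring.
rewrite torus_int_sum; last by move=> p; apply: tL1_sum => q; apply: tL1_sum => r; exact: tL1Z.
apply: eq_bigr => p _; rewrite torus_int_sum; last by move=> q; apply: tL1_sum => r; exact: tL1Z.
apply: eq_bigr => q _; rewrite torus_int_sum; last by move=> r; exact: tL1Z.
by apply: eq_bigr => r _; rewrite torus_intZ.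
Qed.

Lemma amp_sumE N k zeta : \sum_(r <- modes N) `|k r| * (r.1 == zeta)%:R = amp N k zeta.
Proof.
rewrite modes_sum (eq_bigr (fun xi => if xi == zeta then `|k (xi, false)| + `|k (xi, true)| else 0)); last first.
  by move=> xi _ /=; case: eqP => _; rewrite ?mulr1// !mulr0 addr0.
rewrite /amp; case: ifP => hz.
  by rewrite (bigD1_seq zeta)//= ?box_uniq// eqxx big1 ?addr0// => i /negbTE ->.
by rewrite big1_seq// => i /andP[_ hi]; case: eqP => // e; rewrite -e hi in hz.
Qed.

Lemma modes_amp N k (X : 'rV[int]_n -> R) (Y : mode -> R) : (forall p, Y p = `|k p| * X p.1) ->
  \sum_(p <- modes N) Y p = \sum_(xi <- box N) amp N k xi * X xi.
Proof.
move=> YE; rewrite modes_sum big_seq [RHS]big_seq; apply: eq_bigr => xi hxi.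
by rewrite !YE /amp hxi mulrDl.
Qed.

Lemma trilinear_tp N (kf kg kh : mode -> R) (f0 f1 g h0 h1 : R) : (2 <= n)%N ->
  0 <= f0 -> 0 <= f1 -> 0 <= g -> 0 <= h0 -> 0 <= h1 ->
  wsum (fun=> 1) kf N <= f0 ^+ 2 -> wsum (fun xi => m xi ^+ 2) kf N <= f1 ^+ 2 ->
  wsum (fun xi => cw xi) kg N <= g ^+ 2 ->
  wsum (fun=> 1) kh N <= h0 ^+ 2 -> wsum (fun xi => m xi ^+ 2) kh N <= h1 ^+ 2 ->
  `|torus_int (fun x => tp N kf x * tp N kg x * tp N kh x)| <= trilC * g * (f1 * h0 + f0 * h1).
Proof.
move=> n2 f00 f10 g0 h00 h10 bf0 bf1 bg bh0 bh1.
pose F := amp N kf.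
pose G xi := amp N kg xi + amp N kg (- xi).
pose H xi := amp N kh xi + amp N kh (- xi).
have m20 xi : 0 <= m xi ^+ 2 by exact: sqr_ge0.
have mN xi : m (- xi) = m xi by rewrite xnormN.
have cw0 xi : 0 <= cw xi by exact/ltW/cw_gt0.
have H1 : `|torus_int (fun x => tp N kf x * tp N kg x * tp N kh x)| <=
    \sum_(xi <- box N) \sum_(eta <- box N) F xi * G eta * H (xi + eta).
  pose A := amp N kg.
  apply: (@le_trans _ _ (\sum_(p <- modes N) \sum_(q <- modes N) `|kf p| * (`|kg q| * (H (p.1 + q.1) + H (p.1 - q.1))))).
    rewrite torus_int_tp3; apply: le_trans (ler_norm_sum _ _ _) _; apply: ler_sum => p _.
    apply: le_trans (ler_norm_sum _ _ _) _; apply: ler_sum => q _.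
    apply: le_trans (ler_norm_sum _ _ _) _.
    rewrite /H -!amp_sumE -!big_split/= mulrA mulr_sumr; apply: ler_sum => r _.
    rewrite !normrM -mulrA; apply: ler_wpM2l; first by rewrite mulr_ge0.
    rewrite -!mulrDr; apply: ler_wpM2l => //.
    by apply: le_trans (torus_int_trp3 p q r) _; rewrite !addrA.
  apply: (@le_trans _ _ (\sum_(xi <- box N) \sum_(eta <- box N) F xi * (A eta * (H (xi + eta) + H (xi - eta))))).
    rewrite le_eqVlt; apply/orP; left; apply/eqP.
    rewrite (@modes_amp N kf (fun xi => \sum_(q <- modes N) `|kg q| * (H (xi + q.1) + H (xi - q.1)))); last first.
      by move=> p; rewrite mulr_sumr.
    apply: eq_bigr => xi _; rewrite (@modes_amp N kg (fun eta => H (xi + eta) + H (xi - eta)))//.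
    by rewrite mulr_sumr.
  apply: ler_sum => xi _.
  (* Reflecting eta carries the terms in xi - eta to xi + eta, which replaces [A] by its
     symmetrisation [G]. *)
  have := box_sum_neg N (fun eta => F xi * (A eta * H (xi - eta))).
  rewrite (eq_bigr (fun eta => F xi * (A (- eta) * H (xi + eta)))); last by move=> eta _; rewrite opprK.
  move=> E.
  rewrite (eq_bigr (fun eta => F xi * (A eta * H (xi + eta)) + F xi * (A eta * H (xi - eta)))); last first.
    by move=> eta _; rewrite -!mulrDr.
  rewrite big_split/= -E; rewrite -big_split/=; apply: ler_sum => eta _.
  by rewrite /G -/A le_eqVlt; apply/orP; left; apply/eqP; ring.
apply: le_trans H1 _.
have s2 : Num.sqrt 2 ^+ 2 = 2 :> R by rewrite sqr_sqrtr.
have s8 : Num.sqrt 8 ^+ 2 = 8 :> R by rewrite sqr_sqrtr.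
have s16 : Num.sqrt 8 * Num.sqrt 2 * Num.sqrt 8 <= 16 :> R.
  have -> : Num.sqrt 8 * Num.sqrt 2 * Num.sqrt 8 = Num.sqrt 8 ^+ 2 * Num.sqrt 2 :> R by rewrite mulrAC -expr2.
  rewrite s8; have h : Num.sqrt 2 <= 2 :> R.
    by rewrite -(@ler_pXn2r _ 2)// ?nnegrE ?sqrtr_ge0// s2; lra.
  lra.
apply: (@le_trans _ _ (Num.sqrt triC * (Num.sqrt 8 * g) *
   ((Num.sqrt 2 * f1) * (Num.sqrt 8 * h0) + (Num.sqrt 2 * f0) * (Num.sqrt 8 * h1)))).
  have a2 (W : 'rV[int]_n -> R) k (c : R) : (forall xi, 0 <= W xi) -> wsum W k N <= c ^+ 2 ->
      \sum_(xi <- box N) W xi * amp N k xi ^+ 2 <= (Num.sqrt 2 * c) ^+ 2.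
    by move=> W0 h; apply: le_trans (amp_sum N k W0) _; rewrite exprMn s2; apply: ler_wpM2l.
  have a8 (W : 'rV[int]_n -> R) k (c : R) : (forall xi, 0 <= W xi) -> (forall xi, W (- xi) = W xi) -> wsum W k N <= c ^+ 2 ->
      \sum_(xi <- box N) W xi * (amp N k xi + amp N k (- xi)) ^+ 2 <= (Num.sqrt 8 * c) ^+ 2.
    move=> W0 Ws h; apply: le_trans (sym_sum N _ W0 Ws) _; rewrite exprMn s8.
    have := amp_sum N k W0; rewrite -/(wsum _ _ _); lra.
  apply: (@convolution_bound N F G H) => //; rewrite ?mulr_ge0 ?sqrtr_ge0//.
  - by move=> xi; exact: amp_ge0.
  - by move=> xi; rewrite addr_ge0 ?amp_ge0.
  - by move=> xi; rewrite addr_ge0 ?amp_ge0.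
  - move=> xi xiN; rewrite /H /amp (negbTE xiN) mem_box xnormN -mem_box (negbTE xiN) addr0//.
  - rewrite (eq_bigr (fun xi => 1 * F xi ^+ 2)); last by move=> *; rewrite mul1r.
    exact: (a2 (fun=> 1)).
  - exact: (a2 (fun xi => m xi ^+ 2)).
  - by apply: (a8 (fun xi => cw xi)) => // xi; rewrite mN.
  - rewrite (eq_bigr (fun xi => 1 * H xi ^+ 2)); last by move=> *; rewrite mul1r.
    exact: (a8 (fun=> 1)).
  - by apply: (a8 (fun xi => m xi ^+ 2)) => // xi; rewrite mN.
rewrite (_ : _ * _ = (Num.sqrt triC * (g * (f1 * h0 + f0 * h1))) * (Num.sqrt 8 * Num.sqrt 2 * Num.sqrt 8)); last by ring.
rewrite /trilC (_ : Num.sqrt triC * 16 * g * _ = (Num.sqrt triC * (g * (f1 * h0 + f0 * h1))) * 16); last by ring.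
by apply: ler_wpM2l => //; rewrite !mulr_ge0 ?sqrtr_ge0// addr_ge0// mulr_ge0.
Qed.

Lemma proj_tp N L k : symc k -> (L <= N)%N -> proj N (distr_of (tp L k : fn)) = tp L k.
Proof.
move=> sk LN; apply/funext => x; rewrite /proj /tp (@modes_sum_supp R n L N _ LN) => [|p pL]; last first.
  by rewrite coef_tp// (negbTE pL) mul0r.
by rewrite !big_seq; apply: eq_bigr => p pL; rewrite coef_tp// pL.
Qed.

Definition is_tp (d : fn) := exists L k, symc k /\ d = tp L k.

(** The factor that is a trigonometric polynomial is bounded and eventually equal to its own
    truncation, so only the product of two L_2 limits is left when the truncated estimate passes to
    the limit. *)
Lemma trilinear_L2 (b c d : fn) (f0 f1 g h0 h1 : R) : (2 <= n)%N ->
  0 <= f0 -> 0 <= f1 -> 0 <= g -> 0 <= h0 -> 0 <= h1 ->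
  tL2 b -> tL2 c -> tL2 d -> is_tp c \/ is_tp d ->
  (forall N, wsum (fun=> 1) (fun p => distr_of b (trp p)) N <= f0 ^+ 2) ->
  (forall N, wsum (fun xi => m xi ^+ 2) (fun p => distr_of b (trp p)) N <= f1 ^+ 2) ->
  (forall N, wsum (fun xi => cw xi) (fun p => distr_of c (trp p)) N <= g ^+ 2) ->
  (forall N, wsum (fun=> 1) (fun p => distr_of d (trp p)) N <= h0 ^+ 2) ->
  (forall N, wsum (fun xi => m xi ^+ 2) (fun p => distr_of d (trp p)) N <= h1 ^+ 2) ->
  `|torus_int (fun x => b x * c x * d x)| <= trilC * g * (f1 * h0 + f0 * h1).
Proof.
move=> n2 f00 f10 g0 h00 h10 Lb Lc Ld tcd bf0 bf1 bg bh0 bh1.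
have tpL (e : fn) : is_tp e -> [/\ tL2 e, measurable_fun setT (fun y : TT => e (row_of y)),
    (exists M, forall x, `|e x| <= M) & \forall N \near \oo, proj N (distr_of e) = e].
  move=> [L [k [sk ->]]]; have t := @tp_test R n L k; split.
  - exact: tL2_test.
  - exact: test_measurable.
  - exact: test_bounded.
  - by exists L => // N /= LN; exact: proj_tp.
suff h : (fun N => torus_int (fun x => proj N (distr_of b) x * proj N (distr_of c) x * proj N (distr_of d) x)) @ \oo
    --> torus_int (fun x => b x * c x * d x).
  have h2 : (fun N => `|torus_int (fun x => proj N (distr_of b) x * proj N (distr_of c) x * proj N (distr_of d) x)|) @ \oo
    --> `|torus_int (fun x => b x * c x * d x)| by exact: (cvg_norm h).
  rewrite -(cvg_lim _ h2)//; apply: limr_le; first by apply/cvg_ex; eexists; exact: h2.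
  by apply: nearW => N; apply: trilinear_tp.
case: tcd => /tpL[Le me [M eM] en].
  have -> : (fun x => b x * c x * d x) = fun x => b x * d x * c x by apply/funext => x; rewrite mulrAC.
  apply: (@cvg_trans _ ((fun N => torus_int (fun x => proj N (distr_of b) x * proj N (distr_of d) x * c x)) @ \oo)).
    apply: near_eq_cvg; apply: filterS en => N ->; congr torus_int; apply/funext => x; by rewrite mulrAC.
  apply: (torus_int_cvgM _ _ Lb Ld me eM (proj_cvg Lb) (proj_cvg Ld)) => N; apply: tL2_test; exact: tp_test.
apply: (@cvg_trans _ ((fun N => torus_int (fun x => proj N (distr_of b) x * proj N (distr_of c) x * d x)) @ \oo)).
  by apply: near_eq_cvg; apply: filterS en => N ->.
apply: (torus_int_cvgM _ _ Lb Lc me eM (proj_cvg Lb) (proj_cvg Lc)) => N; apply: tL2_test; exact: tp_test.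
Qed.

End Trilinear.

(** * The viscous form *)

Section Viscous.
Context {R : realType} {n : nat}.
Local Notation mode := ('rV[int]_n * bool)%type.
Implicit Types (p q : mode) (xi : 'rV[int]_n) (g h : pdistr R n) (u v w : vdistr R n).
Local Notation fn := ('rV[R]_n -> R).
Local Notation TT := (n.-tuple (measurableTypeR R)).
Local Notation tensor := ('I_n -> 'I_n -> 'I_n -> 'I_n -> fn).
Implicit Types (b c : fn) (A : tensor).

Lemma torus_int_ae_le b c : tL1 b -> tL1 c -> {ae torus n, forall y : TT, b (row_of y) <= c (row_of y)} ->
  torus_int b <= torus_int c.
Proof.
move=> Ib Ic bc.
(* The pointwise maximum: above [b] everywhere and equal to [c] almost everywhere. *)
pose d x := 2^-1 * (b x + c x + `|b x - c x|).
have Id : tL1 d by apply: tL1Z; apply: tL1D; [exact: tL1D|exact: (integrable_abse (tL1B Ib Ic))].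
apply: (@le_trans _ _ (torus_int d)).
  by apply: RI_le => // y _; rewrite /d; have := ler_norm (b (row_of y) - c (row_of y)); lra.
rewrite (@torus_int_eqae R n d c)//; apply: filterS bc => y h; rewrite /d distrC ger0_norm ?subr_ge0//.
by field.
Qed.

Definition ae_bounded c (M : R) := measurable_fun setT (fun y : TT => c (row_of y)) /\
  {ae torus n, forall y : TT, `|c (row_of y)| <= M}.

Lemma tL2_aeM c b (M : R) : ae_bounded c M -> tL2 b -> tL2 (fun x => c x * b x) /\
  torus_int (fun x => (c x * b x) ^+ 2) <= M ^+ 2 * torus_int (fun x => b x ^+ 2).
Proof.
move=> [mc cM] Lb.
have ae_sq : {ae torus n, forall y : TT, (c (row_of y) * b (row_of y)) ^+ 2 <= M ^+ 2 * b (row_of y) ^+ 2}.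
  apply: filterS cM => y h; rewrite exprMn; apply: ler_wpM2r; first exact: sqr_ge0.
  by rewrite -real_normK ?num_real// ler_sqr ?nnegrE// (le_trans _ h).
have L2 : tL2 (fun x => M * b x) by exact: tL2Z.
have L : tL2 (fun x => c x * b x).
  apply: sqi_ltP; first by apply: measurable_funM => //; exact: Lb.1.
  apply: le_lt_trans (sqi_lt measurableT L2).
  apply: ae_ge0_le_integral => //.
  - by move=> y _; rewrite lee_fin sqr_ge0.
  - by apply/measurable_EFinP; apply: measurable_funX; apply: measurable_funM => //; exact: Lb.1.
  - by move=> y _; rewrite lee_fin sqr_ge0.
  - by apply/measurable_EFinP; apply: measurable_funX; exact: L2.1.
  - by apply: filterS ae_sq => y h _; rewrite lee_fin [leRHS]exprMn.
split => //; rewrite -torus_intZ; last exact: Lb.2.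
by apply: torus_int_ae_le => //; [exact: L.2|apply: tL1Z; exact: Lb.2].
Qed.

Definition tensor_int A (E E' : 'I_n -> 'I_n -> fn) : R :=
  \sum_i \sum_j \sum_al \sum_be torus_int (fun x => A i j al be x * E j be x * E' i al x).

Definition sq2 (E : 'I_n -> 'I_n -> fn) : R := \sum_i \sum_j torus_int (fun x => E i j x ^+ 2).

Lemma sq2_ge E i j : torus_int (fun x => E i j x ^+ 2) <= sq2 E.
Proof.
have p i' j' : 0 <= torus_int (fun x => E i' j' x ^+ 2) by apply: torus_int_ge0 => x; exact: sqr_ge0.
rewrite /sq2 (bigD1 i)//= (bigD1 j)//= -addrA lerDl addr_ge0// sumr_ge0// => i' _.
by apply: sumr_ge0.
Qed.

Lemma tensor_int_bound A M E E' (e e' : R) : 0 <= M -> 0 <= e -> 0 <= e' ->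
  (forall i j al be, ae_bounded (A i j al be) M) ->
  (forall i j, tL2 (E i j)) -> (forall i j, tL2 (E' i j)) -> sq2 E <= e ^+ 2 -> sq2 E' <= e' ^+ 2 ->
  `|tensor_int A E E'| <= (n ^ 4)%:R * M * e * e'.
Proof.
move=> M0 e0 e0' hA hE hE' be be'.
have C (c : R) : (n ^ 4)%:R * c = \sum_(i < n) \sum_(j < n) \sum_(al < n) \sum_(be < n) c.
  rewrite !sumr_const !card_ord -!mulrnA mulr_natl; congr (_ *+ _); rewrite !expnS expn0; lia.
rewrite -!mulrA C.
apply: le_trans (ler_norm_sum _ _ _) _; apply: ler_sum => i _.
apply: le_trans (ler_norm_sum _ _ _) _; apply: ler_sum => j _.
apply: le_trans (ler_norm_sum _ _ _) _; apply: ler_sum => al _.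
apply: le_trans (ler_norm_sum _ _ _) _; apply: ler_sum => bt _.
have [L hL] := tL2_aeM (hA i j al bt) (hE j bt).
have CSt := torus_CS L (hE' i al).
have h1 := le_trans (sq2_ge E j bt) be; have h2 := le_trans (sq2_ge E' i al) be'.
rewrite -(@ler_pXn2r _ 2)// ?nnegrE ?mulr_ge0// real_normK ?num_real//.
apply: le_trans CSt _; rewrite mulrA exprMn; apply: ler_pM.
- by apply: torus_int_ge0 => x; exact: sqr_ge0.
- by apply: torus_int_ge0 => x; exact: sqr_ge0.
- by apply: le_trans hL _; rewrite exprMn; apply: ler_wpM2l => //; exact: sqr_ge0.
- exact: h2.
Qed.

Lemma tensor_intBl A M E F E' : (forall i j al be, ae_bounded (A i j al be) M) ->
  (forall i j, tL2 (E i j)) -> (forall i j, tL2 (F i j)) -> (forall i j, tL2 (E' i j)) ->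
  tensor_int A (fun i j x => E i j x - F i j x) E' = tensor_int A E E' - tensor_int A F E'.
Proof.
move=> hA hE hF hE'; do 4 (rewrite -sumrB; apply: eq_bigr => ? _).
rewrite -torus_intB.
- by congr torus_int; apply/funext => x; ring.
- by apply: tL2M => //; exact: (tL2_aeM (hA _ _ _ _) (hE _ _)).1.
- by apply: tL2M => //; exact: (tL2_aeM (hA _ _ _ _) (hF _ _)).1.
Qed.

Lemma tensor_intBr A M E E' F : (forall i j al be, ae_bounded (A i j al be) M) ->
  (forall i j, tL2 (E i j)) -> (forall i j, tL2 (F i j)) -> (forall i j, tL2 (E' i j)) ->
  tensor_int A E (fun i j x => E' i j x - F i j x) = tensor_int A E E' - tensor_int A E F.
Proof.
move=> hA hE hF hE'; do 4 (rewrite -sumrB; apply: eq_bigr => ? _).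
rewrite -torus_intB.
- by congr torus_int; apply/funext => x; ring.
- by apply: tL2M => //; exact: (tL2_aeM (hA _ _ _ _) (hE _ _)).1.
- by apply: tL2M => //; exact: (tL2_aeM (hA _ _ _ _) (hE _ _)).1.
Qed.

Definition elliptic A (C : R) := {ae torus n, forall y : TT, forall z : 'M[R]_n, z^T = z -> \tr z = 0 ->
    \sum_k \sum_al z k al ^+ 2 <=
    C * \sum_k \sum_j \sum_al \sum_be A k j al be (row_of y) * z k al * z j be}.

(** The relaxed ellipticity condition is integrated over the values of [E], which are symmetric and,
    almost everywhere, trace-free; for a strain the latter is solenoidality. *)
Lemma tensor_int_coercive A M C E : 0 < C -> (forall i j al be, ae_bounded (A i j al be) M) ->
  elliptic A C -> (forall i j, tL2 (E i j)) -> (forall i j x, E i j x = E j i x) ->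
  {ae torus n, forall y : TT, \sum_i E i i (row_of y) = 0} ->
  sq2 E <= C * tensor_int A E E.
Proof.
move=> C0 hA hC hE sE trE.
have I1 : forall i j, tL1 (fun x => E i j x ^+ 2) by move=> i j; exact: (hE i j).2.
have I2 i j al be : tL1 (fun x => A i j al be x * E j be x * E i al x).
  by apply: tL2M => //; exact: (tL2_aeM (hA i j al be) (hE j be)).1.
have -> : sq2 E = torus_int (fun x => \sum_i \sum_j E i j x ^+ 2).
  rewrite torus_int_sum; last by move=> i; exact: tL1_sum.
  by apply: eq_bigr => i _; rewrite torus_int_sum.
have -> : tensor_int A E E = torus_int (fun x => \sum_i \sum_j \sum_al \sum_be A i j al be x * E j be x * E i al x).
  rewrite torus_int_sum; last by move=> i; do 2 (apply: tL1_sum => ?); exact: tL1_sum.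
  apply: eq_bigr => i _; rewrite torus_int_sum; last by move=> j; apply: tL1_sum => ?; exact: tL1_sum.
  apply: eq_bigr => j _; rewrite torus_int_sum; last by move=> al; exact: tL1_sum.
  by apply: eq_bigr => al _; rewrite torus_int_sum.
rewrite -torus_intZ; last by do 3 (apply: tL1_sum => ?); exact: tL1_sum.
apply: torus_int_ae_le.
- by apply: tL1_sum => i; exact: tL1_sum.
- by apply: tL1Z; do 3 (apply: tL1_sum => ?); exact: tL1_sum.
apply: filterS2 hC trE => y hz tr0.
have := hz (\matrix_(i, j) E i j (row_of y)).
have -> : (\matrix_(i, j) E i j (row_of y))^T = (\matrix_(i, j) E i j (row_of y)) :> 'M[R]_n.
  by apply/matrixP => i j; rewrite !mxE sE.
have -> : \tr (\matrix_(i, j) E i j (row_of y)) = 0.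
  by rewrite -[RHS]tr0; apply: eq_bigr => i _; rewrite mxE.
move=> /(_ erefl erefl).
have -> : \sum_k \sum_al ((\matrix_(i, j) E i j (row_of y)) : 'M[R]_n) k al ^+ 2 = \sum_i \sum_j E i j (row_of y) ^+ 2.
  by apply: eq_bigr => i _; apply: eq_bigr => j _; rewrite mxE.
congr (is_true (_ <= C * _)); do 4 (apply: eq_bigr => ? _).
by rewrite !mxE mulrAC.
Qed.

Definition sgrad u (j be : 'I_n) : fn := fun x => 2^-1 * (grad u j be x + grad u be j x).

Lemma sgrad_sym u i j x : sgrad u i j x = sgrad u j i x.
Proof. exact (congr1 (fun y => 2^-1 * y) (addrC (grad u i j x) (grad u j i x))). Qed.

Lemma strain_pd u j be : pdv u -> is_pdistr (strain j be u).
Proof. by move=> pu; apply: is_pdistrZ; apply: is_pdistrD; exact: is_pdistr_dpartial. Qed.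

Lemma strain_coef u j be xi s : pdv u -> strain j be u (trp (xi, s)) =
  - (sgb s * pi) * ((xi 0 j)%:~R * u be (trp (xi, ~~ s)) + (xi 0 be)%:~R * u j (trp (xi, ~~ s))).
Proof. by move=> pu; rewrite /strain !dpartial_coef//; field. Qed.

(** When the squares are expanded, the mixed terms sum to a multiple of (xi . u)^2 = 0. What remains
    is 2 pi^2 |xi|^2 |u|^2, compared with the weight 4 pi^2 (1 + |xi|^2); the lower bound uses |xi|
    >= 1, the frequency 0 being absent. *)
Lemma korn_coef u xi s : pdv u -> div_free u -> (forall i (s' : bool), u i (trp (0, s')) = 0) ->
  4^-1 * (hw 1 xi * \sum_i u i (trp (xi, ~~ s)) ^+ 2) <= \sum_j \sum_be strain j be u (trp (xi, s)) ^+ 2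
  <= hw 1 xi * \sum_i u i (trp (xi, ~~ s)) ^+ 2.
Proof.
move=> pu du u0.
pose X (i : 'I_n) : R := (xi 0 i)%:~R; pose Y i := u i (trp (xi, ~~ s)).
have XY : \sum_i X i * Y i = 0 by exact: div_free_coef.
pose S := \sum_i Y i ^+ 2; pose Q := \sum_i X i ^+ 2.
have S0 : 0 <= S by apply: sumr_ge0 => i _; exact: sqr_ge0.
have Q0 : 0 <= Q by apply: sumr_ge0 => i _; exact: sqr_ge0.
have -> : \sum_j \sum_be strain j be u (trp (xi, s)) ^+ 2 = 2 * pi ^+ 2 * (Q * S).
  transitivity (\sum_j \sum_be pi ^+ 2 * (X j ^+ 2 * Y be ^+ 2 + Y j ^+ 2 * X be ^+ 2 + 2 * (X j * Y j) * (X be * Y be))).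
    apply: eq_bigr => j _; apply: eq_bigr => be _; rewrite strain_coef// -/(X j) -/(X be) -/(Y j) -/(Y be).
    by rewrite exprMn sqrrN exprMn sgb_sq; ring.
  transitivity (\sum_j pi ^+ 2 * (X j ^+ 2 * S + Y j ^+ 2 * Q)).
    apply: eq_bigr => j _; rewrite -mulr_sumr !big_split/= -!mulr_sumr -/S -/Q XY mulr0 addr0//.
  by rewrite -mulr_sumr big_split/= -!mulr_suml -/S -/Q; ring.
rewrite -/S; have -> : hw 1 xi = (2 * pi) ^+ 2 * (1 + Q) :> R by rewrite hw1 rho_sq.
have p0 : 0 < pi ^+ 2 :> R by rewrite exprn_gt0// pi_gt0.
have Q1 : xi != 0 -> 1 <= Q.
  move=> xi0; have [i hi] : exists i, xi 0 i != 0.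
    apply: contrapT => h; move/eqP: xi0; apply; apply/rowP => i; rewrite mxE.
    by apply/eqP; apply: contrapT => /negP hi; apply: h; exists i.
  rewrite /Q (bigD1 i)//= -[leLHS]addr0 lerD ?sumr_ge0//; last by move=> j _; exact: sqr_ge0.
  rewrite -(real_normK (num_real _)) -[leLHS](expr1n _ 2) lerXn2r ?nnegrE// -intr_norm.
  by rewrite -[1]/((1%:Z)%:~R) ler_int; lia.
have [x0|/Q1 {}Q1] := eqVneq xi 0.
  have S_0 : S = 0 by apply: big1 => i _; rewrite /Y x0 u0 expr0n.
  rewrite S_0.
  by rewrite !mulr0 lexx.
rewrite exprMn; set P := pi ^+ 2 in p0 *.
have PS : 0 <= P * S by rewrite mulr_ge0// ltW.
apply/andP; split.
  rewrite (_ : 4^-1 * _ = (1 + Q) * (P * S)); last by field.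
  rewrite (_ : 2 * P * _ = (2 * Q) * (P * S)); last by ring.
  by apply: ler_wpM2r => //; lra.
rewrite (_ : 2 * P * _ = (2 * Q) * (P * S)); last by ring.
rewrite (_ : 2 ^+ 2 * P * _ * _ = (4 * (1 + Q)) * (P * S)); last by ring.
by apply: ler_wpM2r => //; lra.
Qed.

Lemma sgrad_tL2 u i j : (0 < n)%N -> pdv u -> (hnorm2 1 u < +oo)%E -> tL2 (sgrad u i j).
Proof. by move=> n0 pu fu; apply: tL2Z; apply: tL2D; exact: grad_tL2. Qed.

Lemma distrZ (r : R) b phi : tL1 b -> test_fun phi ->
  distr_of (fun x => r * b x) phi = r * distr_of b phi.
Proof.
move=> Ib tphi; rewrite /distr_of -torus_intZ; last exact: tL1_testM.
by congr torus_int; apply/funext => x; rewrite mulrA.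
Qed.

Lemma distrD b c phi : tL1 b -> tL1 c -> test_fun phi ->
  distr_of (fun x => b x + c x) phi = distr_of b phi + distr_of c phi.
Proof.
move=> Ib Ic tphi; rewrite /distr_of -torus_intD; [|exact: tL1_testM|exact: tL1_testM].
by congr torus_int; apply/funext => x; rewrite mulrDl.
Qed.

Lemma distrB b c phi : tL1 b -> tL1 c -> test_fun phi ->
  distr_of (fun x => b x - c x) phi = distr_of b phi - distr_of c phi.
Proof.
move=> Ib Ic tphi; rewrite /distr_of -torus_intB; [|exact: tL1_testM|exact: tL1_testM].
by congr torus_int; apply/funext => x; rewrite mulrBl.
Qed.

Lemma sgrad_coef u i j p : (0 < n)%N -> pdv u -> (hnorm2 1 u < +oo)%E ->
  distr_of (sgrad u i j) (trp p) = strain i j u (trp p).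
Proof.
move=> n0 pu fu; have tt : test_fun (trp p : fn) := trp_test p.
have L1 k l : tL1 (grad u k l) by apply: tL2_L1; exact: grad_tL2.
have -> : distr_of (sgrad u i j) (trp p) = 2^-1 * distr_of (fun x => grad u i j x + grad u j i x) (trp p).
  by apply: distrZ => //; exact: tL1D.
have e1 := grad_coef n0 pu fu i j p; have e2 := grad_coef n0 pu fu j i p.
exact (congr1 (fun y => 2^-1 * y) (etrans (distrD (L1 i j) (L1 j i) tt) (congr2 +%R e1 e2))).
Qed.

Definition strain_sum u N : R := \sum_j \sum_be \sum_(p <- modes N) strain j be u (trp p) ^+ 2.

Definition hterm u xi : R := hw 1 xi * \sum_i u i (trp (xi, true)) ^+ 2 + hw 1 xi * \sum_i u i (trp (xi, false)) ^+ 2.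
Definition sterm u xi : R := \sum_j \sum_be strain j be u (trp (xi, false)) ^+ 2 +
  \sum_j \sum_be strain j be u (trp (xi, true)) ^+ 2.

Lemma strain_sumE u N : strain_sum u N = \sum_(xi <- box N) sterm u xi.
Proof.
rewrite /strain_sum (eq_bigr (fun j => \sum_(xi <- box N) \sum_be (strain j be u (trp (xi, false)) ^+ 2 +
   strain j be u (trp (xi, true)) ^+ 2))).
  rewrite exchange_big/=; apply: eq_bigr => xi _; rewrite /sterm -big_split/=.
  by apply: eq_bigr => j _; rewrite -big_split.
by move=> j _; rewrite [RHS]exchange_big/=; apply: eq_bigr => be _; rewrite modes_sum.
Qed.

Lemma hsum1E u N : hsum (hw 1) u N = \sum_(xi <- box N) hterm u xi.
Proof.
rewrite hsumE exchange_big/=; apply: eq_bigr => xi _; rewrite /hterm -mulrDr -big_split/= mulr_sumr.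
by apply: eq_bigr => i _; rewrite [X in _ * X]addrC.
Qed.

Definition tail (s : R) u N : R := nrm s u - hsum (hw s) u N.

Lemma tail_ge0 s u N : (hnorm2 s u < +oo)%E -> 0 <= tail s u N.
Proof. by move=> h; rewrite subr_ge0; exact: hsum_le_nrm. Qed.

(** * Korn's inequality summed over frequencies *)

Section Korn.
Variable u : vdistr R n.
Hypotheses (n0 : (0 < n)%N) (hu : Hdot_sigma 1 u).

Let pu : pdv u. Proof. by case: hu => [[[]]]. Qed.
Let fu : (hnorm2 1 u < +oo)%E. Proof. by case: hu => [[[]]]. Qed.

Lemma sterm_bounds xi : 4^-1 * hterm u xi <= sterm u xi <= hterm u xi.
Proof.
have z i (b : bool) : u i (trp (0, b)) = 0 by case: hu => [[_ z0] _]; exact: fourier0_coef.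
have [_ du] := hu.
have /andP[a1 a2] := korn_coef xi false pu du z; have /andP[b1 b2] := korn_coef xi true pu du z.
by rewrite /sterm /hterm; apply/andP; split; [rewrite mulrDr; exact: lerD|exact: lerD].
Qed.

Lemma strain_sum_bounds N : 4^-1 * hsum (hw 1) u N <= strain_sum u N <= hsum (hw 1) u N.
Proof.
rewrite strain_sumE hsum1E mulr_sumr; apply/andP; split; apply: ler_sum => xi _;
  by have /andP[] := sterm_bounds xi.
Qed.

(** The comparison [sterm <= hterm] holds frequency by frequency, hence also for the sum over the
    frequencies between the two boxes. *)
Lemma strain_sum_tail N M : (N <= M)%N -> strain_sum u M - strain_sum u N <= tail 1 u N.
Proof.
move=> NM; rewrite /tail; apply: (@le_trans _ _ (hsum (hw 1) u M - hsum (hw 1) u N)); last first.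
  by rewrite lerD2r; exact: hsum_le_nrm.
rewrite !strain_sumE !hsum1E -subr_ge0.
rewrite (_ : _ - _ = \sum_(xi <- box M) (hterm u xi - sterm u xi) - \sum_(xi <- box N) (hterm u xi - sterm u xi)); last first.
  by rewrite !sumrB; ring.
rewrite subr_ge0; apply: box_sum_le => // xi; rewrite subr_ge0; by have /andP[] := sterm_bounds xi.
Qed.

Lemma strain_coef_sq2 E : (forall i j, tL2 (E i j)) ->
  (forall i j p, distr_of (E i j) (trp p) = strain i j u (trp p)) ->
  (fun N => strain_sum u N) @ \oo --> sq2 E.
Proof.
move=> LE cE; apply: cvg_sumr => i; apply: cvg_sumr => j.
by under eq_fun do (under eq_bigr do rewrite -cE); exact: parseval_cvg.
Qed.

Lemma sq2_le_nrm E : (forall i j, tL2 (E i j)) ->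
  (forall i j p, distr_of (E i j) (trp p) = strain i j u (trp p)) -> sq2 E <= nrm 1 u.
Proof.
move=> LE cE; have h := strain_coef_sq2 LE cE; rewrite -(cvg_lim _ h)//.
apply: limr_le; first by apply/cvg_ex; eexists; exact: h.
apply: nearW => N; have /andP[_ h2] := strain_sum_bounds N; apply: le_trans h2 _; exact: hsum_le_nrm.
Qed.

Lemma nrm_le_sq2 E : (forall i j, tL2 (E i j)) ->
  (forall i j p, distr_of (E i j) (trp p) = strain i j u (trp p)) -> nrm 1 u <= 4 * sq2 E.
Proof.
move=> LE cE; have h := strain_coef_sq2 LE cE.
have h2 : (fun N => 4 * strain_sum u N) @ \oo --> 4 * sq2 E by exact: (cvgM (cvg_cst _) h).
have h3 := nrm_cvg fu.
apply: (ler_cvg_to h3 h2); apply: nearW => N; have /andP[h4 _] := strain_sum_bounds N; lra.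
Qed.

Lemma sq2_tail E N : (forall i j, tL2 (E i j)) ->
  (forall i j p, distr_of (E i j) (trp p) = strain i j u (trp p)) ->
  sq2 (fun i j x => E i j x - proj N (distr_of (E i j)) x) <= tail 1 u N.
Proof.
move=> LE cE; have h := strain_coef_sq2 LE cE.
have -> : sq2 (fun i j x => E i j x - proj N (distr_of (E i j)) x) = sq2 E - strain_sum u N.
  rewrite /sq2 /strain_sum -sumrB; apply: eq_bigr => i _; rewrite -sumrB; apply: eq_bigr => j _.
  by rewrite proj_sqB//; congr (_ - _); apply: eq_bigr => p _; rewrite cE.
have h2 : (fun M => strain_sum u M - strain_sum u N) @ \oo --> sq2 E - strain_sum u N.
  by exact: (cvgB h (cvg_cst _)).
rewrite -(cvg_lim _ h2)//; apply: limr_le; first by apply/cvg_ex; eexists; exact: h2.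
by exists N => // M /= NM; exact: strain_sum_tail.
Qed.

Lemma tr_sgrad : {ae torus n, forall y : TT, \sum_i sgrad u i i (row_of y) = 0}.
Proof.
have L1 i : tL1 (sgrad u i i) by apply: tL2_L1; exact: sgrad_tL2.
apply: (@torus_uniqueness R n (fun x => \sum_i sgrad u i i x)); first exact: tL1_sum.
move=> p; have tt : test_fun (trp p : fn) := trp_test p.
have -> : distr_of (fun x => \sum_i sgrad u i i x) (trp p) = \sum_i distr_of (sgrad u i i) (trp p).
  rewrite /distr_of -torus_int_sum; last by move=> i; exact: tL1_testM.
  by congr torus_int; apply/funext => x; rewrite mulr_suml.
have [_ du] := hu; rewrite -[RHS](du _ tt); apply: eq_bigr => i _.
by rewrite sgrad_coef// /strain; field.
Qed.

End Korn.

(** The function that [L2fun] chooses for the strain agrees almost everywhere with [sgrad u], and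
    Parseval's identity turns [dual] into an integral. Any L_2 representative [E'] is allowed in the
    second slot, so exact and truncated fields are both covered. *)
Lemma a_form_rep (a : viscosity R n) t u w M (E' : 'I_n -> 'I_n -> fn) : (0 < n)%N -> Hdot_sigma 1 u -> pdv w ->
  (forall i j al be, ae_bounded (fun x => a i j al be x t) M) -> (forall i j, tL2 (E' i j)) ->
  (forall i j p, distr_of (E' i j) (trp p) = strain i j w (trp p)) ->
  a_form a t u w = tensor_int (fun i j al be x => a i j al be x t) (sgrad u) E'.
Proof.
move=> n0 hu pw ha LE cE; have [[[pu fu] _] _] := hu.
apply: eq_bigr => i _; apply: eq_bigr => j _; apply: eq_bigr => al _; apply: eq_bigr => be _.
have Ls : tL2 (sgrad u j be) by exact: sgrad_tL2.
have ps := strain_pd j be pu.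
have bs N : \sum_(p <- modes N) strain j be u (trp p) ^+ 2 <= torus_int (fun x => sgrad u j be x ^+ 2).
  by rewrite (eq_bigr (fun p => distr_of (sgrad u j be) (trp p) ^+ 2)) ?bessel// => p _; rewrite sgrad_coef.
pose b x := a i j al be x t * L2fun (strain j be u) x.
have LF := L2fun_tL2 n0 ps bs.
have Lb : tL2 b by exact: (tL2_aeM (ha i j al be) LF).1.
have sE : symc (fun p => strain i al w (trp p)) by apply: symc_pd; exact: strain_pd.
have bd N : \sum_(p <- modes N) `|distr_of b (trp p) * strain i al w (trp p)| <=
   torus_int (fun x => b x ^+ 2) + torus_int (fun x => E' i al x ^+ 2).
  apply: le_trans (lerD (bessel N Lb) (bessel N (LE i al))); rewrite -big_split/=; apply: ler_sum => p _.
  rewrite cE normrM -[distr_of b _ ^+ 2]real_normK ?num_real// -[strain _ _ _ _ ^+ 2]real_normK ?num_real//.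
  have := sqr_ge0 (`|distr_of b (trp p)| - `|strain i al w (trp p)|).
  have := normr_ge0 (distr_of b (trp p)); have := normr_ge0 (strain i al w (trp p)); nra.
have c1 := dual_cvg sE bd.
have c2 := parseval2 Lb (LE i al).
have -> : dual (distr_of b) (strain i al w) = torus_int (fun x => b x * E' i al x).
  rewrite -(cvg_lim _ c1)// -(cvg_lim _ c2)//; congr (lim (_ @ \oo)); apply/funext => N.
  by apply: eq_bigr => p _; rewrite cE.
apply: torus_int_eqae.
- exact: tL2M.
- by apply: tL2M => //; exact: (tL2_aeM (ha i j al be) Ls).1.
have : {ae torus n, forall y : TT, L2fun (strain j be u) (row_of y) - sgrad u j be (row_of y) = 0}.
  apply: (@torus_uniqueness R n (fun x => L2fun (strain j be u) x - sgrad u j be x)).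
    by apply: tL1B; exact: tL2_L1.
  move=> p; rewrite distrB; [|exact: tL2_L1|exact: tL2_L1|exact: trp_test].
  by rewrite (L2fun_coef n0 p ps bs) sgrad_coef// subrr.
by apply: filterS => y /subr0_eq h; rewrite /b h.
Qed.

Lemma strain_vtp v N i j p : pdv v -> solenoidal (fun i p => v i (trp p)) ->
  strain i j (vtp N (fun i p => v i (trp p))) (trp p) = if p \in modes N then strain i j v (trp p) else 0.
Proof.
move=> pv sv; case: p => xi s; rewrite !strain_coef//; last by move=> k; exact: pd_tpdistr.
rewrite !vtp_coef// !mem_modes /=; case: ifP => // _; by rewrite !mulr0 addr0 mulr0.
Qed.

Lemma a_form_vtp (a : viscosity R n) t u v M N : (0 < n)%N -> Hdot_sigma 1 u -> Hdot_sigma 1 v ->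
  (forall i j al be, ae_bounded (fun x => a i j al be x t) M) ->
  a_form a t u (vtp N (fun i p => v i (trp p))) =
  tensor_int (fun i j al be x => a i j al be x t) (sgrad u) (fun i j => proj N (distr_of (sgrad v i j))).
Proof.
move=> n0 hu hv ha; have [[[pv fv] _] _] := hv.
apply: (a_form_rep n0 hu) => //.
- by move=> i; exact: pd_tpdistr.
- by move=> i j; apply: tL2_test; exact: tp_test.
- move=> i j p; rewrite strain_vtp//; last exact: Hdot_sigma_solenoidal hv.
  rewrite coef_tp; last by apply: symc_distr; apply: tL2_L1; exact: sgrad_tL2.
  by rewrite sgrad_coef.
Qed.

Lemma strainB u v i j phi : strain i j (vsub v u) phi = strain i j v phi - strain i j u phi.
Proof.
have E (x y z w : R) : 2^-1 * (- (x - y) - (z - w)) = 2^-1 * (- x - z) - 2^-1 * (- y - w) by field.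
exact: E.
Qed.

Lemma viscous_arith (C c d dd uu vv uv vu upv vpu upu x1 x2 y1 y2 s : R) :
  0 < C -> 0 <= c -> 0 <= x1 -> 0 <= x2 -> 0 <= y1 -> 0 <= y2 ->
  dd = vv - uv - vu + uu -> d <= 4 * s -> s <= C * dd ->
  `|uv - upv| <= c * x1 * y2 -> `|vu - vpu| <= c * x2 * y1 -> `|uu - upu| <= c * x1 * y1 ->
  - vv + upv + vpu - upu <= - (4 * C)^-1 * d + c * (x1 + x2) * (2 * (y1 + y2)).
Proof.
move=> C0 c0 x10 x20 y10 y20 E K2 K1.
rewrite !ler_norml => /andP[B2 _] /andP[B3 _] /andP[_ B4].
have K3 : (4 * C)^-1 * d <= dd by rewrite ler_pdivrMl ?mulr_gt0//; lra.
have m1 : 0 <= c * x1 * y1 by rewrite !mulr_ge0.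
have m2 : 0 <= c * x1 * y2 by rewrite !mulr_ge0.
have m3 : 0 <= c * x2 * y1 by rewrite !mulr_ge0.
have m4 : 0 <= c * x2 * y2 by rewrite !mulr_ge0.
lra.
Qed.

(** Without truncation the left-hand side would be - a(v - u, v - u). Ellipticity contributes C and
    Korn's inequality 4 to the constant (4 C)^-1; each truncation costs a tail of the strain. *)
Lemma viscous_estimate (a : viscosity R n) t u v M C N : (0 < n)%N -> 0 <= M -> 0 < C ->
  Hdot_sigma 1 u -> Hdot_sigma 1 v -> Hdot_sigma 1 (vsub v u) ->
  (forall i j al be, ae_bounded (fun x => a i j al be x t) M) -> elliptic (fun i j al be x => a i j al be x t) C ->
  - a_form a t v v + a_form a t u (vtp N (fun i p => v i (trp p)))
  + a_form a t v (vtp N (fun i p => u i (trp p))) - a_form a t u (vtp N (fun i p => u i (trp p)))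
  <= - (4 * C)^-1 * nrm 1 (vsub v u) +
   (n ^ 4)%:R * M * (Num.sqrt (nrm 1 u) + Num.sqrt (nrm 1 v)) *
     (2 * (Num.sqrt (tail 1 u N) + Num.sqrt (tail 1 v N))).
Proof.
move=> n0 M0 C0 hu hv hw ha hC; have [[[pu fu] _] du] := hu; have [[[pv fv] _] dv] := hv.
rewrite !(a_form_vtp N n0 _ _ ha)//.
have LU i j : tL2 (sgrad u i j) by exact: sgrad_tL2.
have LV i j : tL2 (sgrad v i j) by exact: sgrad_tL2.
have cU i j p := sgrad_coef i j p n0 pu fu; have cV i j p := sgrad_coef i j p n0 pv fv.
rewrite (a_form_rep n0 hv pv ha LV cV).
have LPU i j : tL2 (proj N (distr_of (sgrad u i j))) by apply: tL2_test; exact: tp_test.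
have LPV i j : tL2 (proj N (distr_of (sgrad v i j))) by apply: tL2_test; exact: tp_test.
pose RU i j x := sgrad u i j x - proj N (distr_of (sgrad u i j)) x.
pose RV i j x := sgrad v i j x - proj N (distr_of (sgrad v i j)) x.
pose D i j x := sgrad v i j x - sgrad u i j x.
have LRU i j : tL2 (RU i j) by exact: tL2B.
have LRV i j : tL2 (RV i j) by exact: tL2B.
have LD i j : tL2 (D i j) by exact: tL2B.
set A := fun i j al be x => a i j al be x t.
have E1 : tensor_int A D D = tensor_int A (sgrad v) (sgrad v) - tensor_int A (sgrad u) (sgrad v)
   - tensor_int A (sgrad v) (sgrad u) + tensor_int A (sgrad u) (sgrad u).
  by rewrite (tensor_intBr ha LD LU LV) (tensor_intBl ha LV LU LV) (tensor_intBl ha LV LU LU); ring.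
have E2 := tensor_intBr ha LU LPV LV; have E3 := tensor_intBr ha LV LPU LU.
have E4 := tensor_intBr ha LU LPU LU.
rewrite -/A -/RU -/RV in E1 E2 E3 E4.
have tU := tail_ge0 N fu; have tV := tail_ge0 N fv.
have sq (x : R) : 0 <= x -> x <= Num.sqrt x ^+ 2 by move=> x0; rewrite sqr_sqrtr.
have qU := le_trans (sq2_le_nrm hu LU cU) (sq _ (nrm_ge0 1 u)).
have qV := le_trans (sq2_le_nrm hv LV cV) (sq _ (nrm_ge0 1 v)).
have qRU := le_trans (sq2_tail hu N LU cU) (sq _ tU).
have qRV := le_trans (sq2_tail hv N LV cV) (sq _ tV).
have s0 (x : R) : 0 <= Num.sqrt x by exact: sqrtr_ge0.
have B2 := tensor_int_bound M0 (s0 _) (s0 _) ha LU LRV qU qRV.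
have B3 := tensor_int_bound M0 (s0 _) (s0 _) ha LV LRU qV qRU.
have B4 := tensor_int_bound M0 (s0 _) (s0 _) ha LU LRU qU qRU.
have cD i j p : distr_of (D i j) (trp p) = strain i j (vsub v u) (trp p).
  rewrite distrB; [|exact: tL2_L1|exact: tL2_L1|exact: trp_test].
  by rewrite cU cV strainB.
have sD i j x : D i j x = D j i x by rewrite /D (sgrad_sym u) (sgrad_sym v).
have tD : {ae torus n, forall y : TT, \sum_i D i i (row_of y) = 0}.
  by apply: filterS2 (tr_sgrad n0 hu) (tr_sgrad n0 hv) => y h1 h2; rewrite sumrB h1 h2 subrr.
have K1 := tensor_int_coercive C0 ha hC LD sD tD; have K2 := nrm_le_sq2 hw LD cD.
rewrite -/A in B2 B3 B4 K1.
rewrite E2 in B2; rewrite E3 in B3; rewrite E4 in B4.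
have n4 : 0 <= (n ^ 4)%:R * M by rewrite mulr_ge0.
exact: (viscous_arith C0 n4 (s0 _) (s0 _) (s0 _) (s0 _) E1 K2 K1 B2 B3 B4).
Qed.

End Viscous.

(** * The truncated energy balance *)

Section Convective.
Context {R : realType} {n : nat}.
Local Notation mode := ('rV[int]_n * bool)%type.
Implicit Types (p q : mode) (xi : 'rV[int]_n) (g h : pdistr R n) (u v w f : vdistr R n).
Implicit Types (W : 'rV[int]_n -> R) (N M : nat).
Local Notation fn := ('rV[R]_n -> R).

Definition trw N W xi : R := if (xnorm xi <= N)%N then 0 else W xi.

Lemma trw_ge0 N W xi : (forall xi, 0 <= W xi) -> 0 <= trw N W xi.
Proof. by move=> W0; rewrite /trw; case: ifP. Qed.

Lemma hsum_trw N L W w : (N <= L)%N -> hsum (trw N W) w L = hsum W w L - hsum W w N.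
Proof.
move=> NL; rewrite /hsum -sumrB; apply: eq_bigr => i _.
have h : \sum_(p <- modes N) W p.1 * w i (trp p) ^+ 2 = \sum_(p <- modes L) (W p.1 - trw N W p.1) * w i (trp p) ^+ 2.
  rewrite (modes_sum_supp (f := fun p => (W p.1 - trw N W p.1) * w i (trp p) ^+ 2) NL); last first.
    by move=> p; rewrite mem_modes /trw => /negbTE ->; rewrite subrr mul0r.
  by rewrite !big_seq; apply: eq_bigr => p; rewrite mem_modes /trw => ->; rewrite subr0.
by rewrite h -sumrB; apply: eq_bigr => p _; ring.
Qed.

Lemma hsum_trw_tail N M s w : (hnorm2 s w < +oo)%E -> hsum (trw N (hw s)) w M <= tail s w N.
Proof.
move=> hf; have t0 xi : 0 <= trw N (hw s) xi by apply: trw_ge0 => ?; exact: hw_ge0.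
apply: le_trans (hsum_le w t0 (leq_maxl M N)) _.
by rewrite hsum_trw ?leq_maxr// lerD2r; exact: hsum_le_nrm.
Qed.

Lemma tail_le s N w : tail s w N <= nrm s w.
Proof. by rewrite /tail gerDl oppr_le0; apply: hsum_ge0 => xi; exact: hw_ge0. Qed.

Lemma tail_cvg s w : (hnorm2 s w < +oo)%E -> (fun N => tail s w N) @ \oo --> 0.
Proof.
move=> hf; have h := nrm_cvg hf; rewrite -(subrr (nrm s w)).
by exact: (cvgB (cvg_cst _) h).
Qed.

Lemma sqm_le xi : (1 + (xnorm xi)%:R) ^+ 2 <= hw 1 xi :> R.
Proof. by rewrite hw1; apply: lerXn2r; rewrite ?nnegrE ?addr_ge0//; [exact/ltW/rho_gt0|exact: rho_ge]. Qed.

Lemma freq_weight xi (j : 'I_n) : (2 <= n)%N ->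
  (1 + (xnorm xi)%:R) ^+ (n - 2) * (2 * pi * (xi 0 j)%:~R) ^+ 2 <= hw (n%:R / 2) xi :> R.
Proof.
move=> n2; rewrite hwn2 (_ : rho xi ^+ n = rho xi ^+ (n - 2) * rho xi ^+ 2); last by rewrite -exprD subnK.
apply: ler_pM; rewrite ?sqr_ge0 ?exprn_ge0 ?addr_ge0//.
  by apply: lerXn2r; rewrite ?nnegrE ?addr_ge0//; [exact/ltW/rho_gt0|exact: rho_ge].
exact: freq_le_rho.
Qed.

(* [k] agrees up to sign with component [j] of [w] on the frequencies selected by [X]. *)
Definition coefs_of (X : nat -> bool) w j (k : mode -> R) :=
  forall p, k p ^+ 2 = (X (xnorm p.1))%:R * w j (trp p) ^+ 2.

Definition selw (X : nat -> bool) W xi : R := (X (xnorm xi))%:R * W xi.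

Lemma wsum_coefs X w j k W W' M : coefs_of X w j k -> (forall xi, 0 <= W xi) -> (forall xi, W xi <= W' xi) ->
  wsum W k M <= hsum (selw X W') w M.
Proof.
move=> kX W0 WW; have W'0 xi : 0 <= W' xi by exact: le_trans (WW xi).
apply: le_trans (comp_le_hsum w M j _); last by move=> xi; rewrite /selw mulr_ge0.
apply: ler_sum => p _; rewrite kX /selw mulrCA -mulrA; apply: ler_wpM2l => //.
by apply: ler_wpM2r => //; exact: sqr_ge0.
Qed.

Lemma wsum_dcoefs (X : nat -> bool) w j i k M : (2 <= n)%N -> pdv w ->
  (forall p, k p ^+ 2 = (X (xnorm p.1))%:R * dpartial j (w i) (trp p) ^+ 2) ->
  wsum (fun xi => (1 + (xnorm xi)%:R) ^+ (n - 2)) k M <= hsum (selw X (hw (n%:R / 2))) w M.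
Proof.
move=> n2 pw kX.
apply: le_trans (comp_le_hsum w M i _); last by move=> xi; rewrite /selw mulr_ge0 ?hw_ge0.
rewrite /wsum (eq_bigr (fun p => ((1 + (xnorm p.1)%:R) ^+ (n - 2) * (X (xnorm p.1))%:R) * dpartial j (w i) (trp p) ^+ 2)); last first.
  by move=> p _; rewrite kX mulrA.
rewrite (dpartial_sum_sq (fun xi => (1 + (xnorm xi)%:R) ^+ (n - 2) * (X (xnorm xi))%:R) j M (pw i)).
apply: ler_sum => p _; rewrite /selw mulrA; apply: ler_wpM2r; first exact: sqr_ge0.
by rewrite mulrAC mulrC; apply: ler_wpM2l => //; exact: freq_weight.
Qed.

Lemma selwT W : selw xpredT W = W.
Proof. by apply/funext => xi; rewrite /selw mul1r. Qed.

Lemma selw_out N W : selw (fun l => ~~ (l <= N)%N) W = trw N W.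
Proof. by apply/funext => xi; rewrite /selw /trw; case: leqP; rewrite ?mul0r ?mul1r. Qed.

Lemma selw_le X W xi : (forall xi, 0 <= W xi) -> selw X W xi <= W xi.
Proof. by move=> W0; rewrite /selw; case: X; rewrite ?mul1r ?mul0r. Qed.

Lemma hsum_selw X W w M : (forall xi, 0 <= W xi) -> hsum (selw X W) w M <= hsum W w M.
Proof.
move=> W0; apply: ler_sum => i _; apply: ler_sum => p _.
by apply: ler_wpM2r; [exact: sqr_ge0|exact: selw_le].
Qed.

Definition snrm s w : R := Num.sqrt (nrm s w).
Definition stail s w N : R := Num.sqrt (tail s w N).

Lemma snrm_ge0 s w : 0 <= snrm s w. Proof. exact: sqrtr_ge0. Qed.
Lemma stail_ge0 s w N : 0 <= stail s w N. Proof. exact: sqrtr_ge0. Qed.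

Lemma snrm_sq s w : snrm s w ^+ 2 = nrm s w.
Proof. by rewrite sqr_sqrtr// nrm_ge0. Qed.

Lemma stail_sq s w N : (hnorm2 s w < +oo)%E -> stail s w N ^+ 2 = tail s w N.
Proof. by move=> h; rewrite sqr_sqrtr// tail_ge0. Qed.

Lemma stail_le s w N : stail s w N <= snrm s w.
Proof. by apply: ler_wsqrtr; exact: tail_le. Qed.

Lemma stail_cvg s w : (hnorm2 s w < +oo)%E -> (fun N => stail s w N) @ \oo --> 0.
Proof.
move=> hf; rewrite -[X in _ --> X](@sqrtr0 R).
exact: (continuous_cvg _ (@sqrt_continuous R 0) (tail_cvg hf)).
Qed.

Section Size.
Variables (X : nat -> bool) (w : vdistr R n) (size : R -> R).
Hypothesis sizeP : forall s M, (hnorm2 s w < +oo)%E -> hsum (selw X (hw s)) w M <= size s ^+ 2.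
Hypothesis fw : (hnorm2 1 w < +oo)%E.

(** [size] stands for the full norm or for the tail of a norm. This lemma and the next two give the
    coefficient bounds that the trilinear estimate asks for, without fixing the choice. *)
Lemma size0 j k M : coefs_of X w j k -> wsum (fun=> 1) k M <= size 0 ^+ 2.
Proof.
move=> kX; have [f0 _] := hnorm2_mono (@ler01 R) fw.
apply: le_trans (sizeP M f0); apply: (wsum_coefs M kX) => // xi; by rewrite hw0.
Qed.

Lemma size1 j k M : coefs_of X w j k -> wsum (fun xi => (1 + (xnorm xi)%:R) ^+ 2) k M <= size 1 ^+ 2.
Proof.
move=> kX; apply: le_trans (sizeP M fw); apply: (wsum_coefs M kX) => xi; first exact: sqr_ge0.
exact: sqm_le.
Qed.

Lemma size_grad j i k M : (2 <= n)%N -> pdv w -> (hnorm2 (n%:R / 2) w < +oo)%E ->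
  (forall p, k p ^+ 2 = (X (xnorm p.1))%:R * dpartial j (w i) (trp p) ^+ 2) ->
  wsum (fun xi => (1 + (xnorm xi)%:R) ^+ (n - 2)) k M <= size (n%:R / 2) ^+ 2.
Proof. by move=> n2 pw hf kX; apply: le_trans (sizeP M hf); exact: wsum_dcoefs kX. Qed.

End Size.

Lemma size_nrm X w s M : (hnorm2 s w < +oo)%E -> hsum (selw X (hw s)) w M <= snrm s w ^+ 2.
Proof.
move=> hf; rewrite snrm_sq; apply: le_trans (hsum_selw _ _ _ _) _; first by move=> xi; exact: hw_ge0.
exact: hsum_le_nrm.
Qed.

Lemma size_tail N w s M : (hnorm2 s w < +oo)%E ->
  hsum (selw (fun l => ~~ (l <= N)%N) (hw s)) w M <= stail s w N ^+ 2.
Proof. by move=> hf; rewrite stail_sq// selw_out; exact: hsum_trw_tail. Qed.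

(** The selectors [X], [Y], [Z] tell which frequencies of the three fields appear in the slots (all,
    low or high), so that one statement serves all five terms of [convection_identity]. *)
Lemma tri_bound (U : 'I_n -> fn) (V : 'I_n -> 'I_n -> fn) (P : 'I_n -> fn)
    (X Y Z : nat -> bool) u v w (su sv sw : R -> R) : (2 <= n)%N ->
  (forall s M, (hnorm2 s u < +oo)%E -> hsum (selw X (hw s)) u M <= su s ^+ 2) ->
  (forall s M, (hnorm2 s v < +oo)%E -> hsum (selw Y (hw s)) v M <= sv s ^+ 2) ->
  (forall s M, (hnorm2 s w < +oo)%E -> hsum (selw Z (hw s)) w M <= sw s ^+ 2) ->
  (forall s, 0 <= su s) -> (forall s, 0 <= sv s) -> (forall s, 0 <= sw s) ->
  (hnorm2 1 u < +oo)%E -> (hnorm2 (n%:R / 2) v < +oo)%E -> (hnorm2 1 w < +oo)%E -> pdv v ->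
  (forall j, tL2 (U j)) -> (forall j k, tL2 (V j k)) -> (forall k, tL2 (P k)) ->
  (forall j k, is_tp (V j k) \/ is_tp (P k)) ->
  (forall j, coefs_of X u j (fun p => distr_of (U j) (trp p))) ->
  (forall j k p, distr_of (V j k) (trp p) ^+ 2 = (Y (xnorm p.1))%:R * dpartial j (v k) (trp p) ^+ 2) ->
  (forall k, coefs_of Z w k (fun p => distr_of (P k) (trp p))) ->
  `|tri U V P| <= (n ^ 2)%:R * (trilC (R := R) (n := n) * sv (n%:R / 2) * (su 1 * sw 0 + su 0 * sw 1)).
Proof.
move=> n2 hu hv hw_ su0 sv0 sw0 fu fv fw pv LU LV LP tpVP cU cV cP.
set c := trilC * _ * _.
have -> : (n ^ 2)%:R * c = \sum_(k < n) \sum_(j < n) c.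
  by rewrite !sumr_const !card_ord -!mulrnA mulr_natl; congr (_ *+ _); rewrite expnS expn1.
apply: le_trans (ler_norm_sum _ _ _) _; apply: ler_sum => k _.
apply: le_trans (ler_norm_sum _ _ _) _; apply: ler_sum => j _.
apply: trilinear_L2 => // M.
- exact: (size0 hu fu M (cU j)).
- exact: (size1 hu fu M (cU j)).
- exact: (size_grad hv M n2 pv fv (cV j k)).
- exact: (size0 hw_ fw M (cP k)).
- exact: (size1 hw_ fw M (cP k)).
Qed.

Lemma is_tp_proj N g : is_pdistr g -> is_tp (proj N g).
Proof. by move=> pg; exists N, (fun p => g (trp p)); split => //; exact: symc_pd. Qed.

Lemma pdv_sub u v : pdv u -> pdv v -> pdv (vsub v u).
Proof. by move=> pu pv i; exact: is_pdistrB. Qed.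

Lemma proj_sub N u v k x : proj N (vsub v u k) x = proj N (v k) x - proj N (u k) x.
Proof. by rewrite /proj /tp -sumrB; apply: eq_bigr => p _; rewrite /vsub mulrBl. Qed.

Lemma proj_coef N g p : is_pdistr g -> distr_of (proj N g) (trp p) = if p \in modes N then g (trp p) else 0.
Proof. by move=> pg; apply: coef_tp; exact: symc_pd. Qed.

Lemma ler_norm5 (x1 x2 x3 x4 x5 y1 y2 y3 y4 y5 : R) :
  `|x1| <= y1 -> `|x2| <= y2 -> `|x3| <= y3 -> `|x4| <= y4 -> `|x5| <= y5 ->
  x1 + x2 - x3 - x4 - x5 <= y1 + y2 + y3 + y4 + y5.
Proof.
by rewrite !ler_norml => /andP[? ?] /andP[? ?] /andP[? ?] /andP[? ?] /andP[? ?]; lra.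
Qed.

(** Each of the first four lines of the bound carries a tail and vanishes as N grows; the last one
    does not and has to be absorbed by the viscosity. *)
Lemma convective_estimate u v N (w := vsub v u) (hn : R := n%:R / 2) : (2 <= n)%N -> Hdot_sigma 1 u -> Hdot_sigma 1 v ->
  (hnorm2 (n%:R / 2) u < +oo)%E -> (hnorm2 1 (vsub v u) < +oo)%E ->
  \sum_i \sum_(p <- modes N) convection u i (trp p) * v i (trp p) +
  \sum_i \sum_(p <- modes N) convection v i (trp p) * u i (trp p) -
  \sum_i \sum_(p <- modes N) convection u i (trp p) * u i (trp p) <=
  (n ^ 2)%:R * (trilC (R := R) (n := n) * stail hn u N * (snrm 1 u * snrm 0 w + snrm 0 u * snrm 1 w)) +
  (n ^ 2)%:R * (trilC (R := R) (n := n) * snrm hn u * (snrm 1 u * stail 0 w N + snrm 0 u * stail 1 w N)) +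
  (n ^ 2)%:R * (trilC (R := R) (n := n) * snrm hn u * (snrm 1 u * stail 0 u N + snrm 0 u * stail 1 u N)) +
  (n ^ 2)%:R * (trilC (R := R) (n := n) * snrm hn u * (snrm 1 w * stail 0 u N + snrm 0 w * stail 1 u N)) +
  (n ^ 2)%:R * (trilC (R := R) (n := n) * snrm hn u * (snrm 1 w * snrm 0 w + snrm 0 w * snrm 1 w)).
Proof.
move=> n2 hu hv fhn fw; have n0 : (0 < n)%N by exact: leq_trans n2.
have [[[pu fu] _] _] := hu; have [[[pv fv] _] _] := hv.
have pw : pdv w by exact: pdv_sub.
have /= -> := convection_identity N n0 hu hv.
have LU j : tL2 (vfun u j) by exact: vfun_tL2.
have LV j : tL2 (vfun v j) by exact: vfun_tL2.
have LP k : tL2 (proj N (u k)) by apply: tL2_test; exact: tp_test.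
have LQ k : tL2 (proj N (v k)) by apply: tL2_test; exact: tp_test.
have LD j k : tL2 (partial j (proj N (u k))) by apply: tL2_test; apply: test_partial; exact: tp_test.
have LG j k : tL2 (grad u j k) by exact: grad_tL2.
have L1 (b : fn) : tL2 b -> tL1 b by exact: tL2_L1.
have cB (b c : fn) p : tL2 b -> tL2 c ->
    distr_of (fun x => b x - c x) (trp p) = distr_of b (trp p) - distr_of c (trp p).
  by move=> Lb Lc; apply: distrB; [exact: L1|exact: L1|exact: trp_test].
have Tu : forall j k, is_tp (partial j (proj N (u k))).
  by move=> j k; rewrite partial_projg//; apply: is_tp_proj; exact: is_pdistr_dpartial.
have cU j : coefs_of xpredT u j (fun p => distr_of (vfun u j) (trp p)).
  by move=> p; rewrite vfun_coef// mul1r.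
have cW j : coefs_of xpredT w j (fun p => distr_of (fun x => vfun v j x - vfun u j x) (trp p)).
  by move=> p; rewrite cB// !vfun_coef// mul1r.
have cUP k : coefs_of (fun l => ~~ (l <= N)%N) u k (fun p => distr_of (fun x => vfun u k x - proj N (u k) x) (trp p)).
  move=> p; rewrite cB// vfun_coef// proj_coef// mem_modes.
  by case: leqP; rewrite ?subrr ?subr0 ?mul1r ?expr0n ?mul0r.
have cDP j k p : distr_of (partial j (proj N (u k))) (trp p) = if p \in modes N then dpartial j (u k) (trp p) else 0.
  by rewrite partial_projg// proj_coef//; exact: is_pdistr_dpartial.
have LW j : tL2 (fun x => vfun v j x - vfun u j x) by exact: tL2B.
have LQP k : tL2 (fun x => proj N (v k) x - proj N (u k) x) by exact: tL2B.
have LUP k : tL2 (fun x => vfun u k x - proj N (u k) x) by exact: tL2B.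
have LR k : tL2 (fun x => (proj N (v k) x - proj N (u k) x) - (vfun v k x - vfun u k x)) by exact: tL2B.
have LGD j k : tL2 (fun x => grad u j k x - partial j (proj N (u k)) x) by exact: tL2B.
have B1 := @tri_bound (vfun u) (fun j k x => grad u j k x - partial j (proj N (u k)) x)
  (fun k x => proj N (v k) x - proj N (u k) x) xpredT (fun l => ~~ (l <= N)%N) (fun l => (l <= N)%N) u u w
  (snrm^~ u) (fun s => stail s u N) (snrm^~ w) n2.
have B2 Z (P : 'I_n -> fn) (y : vdistr R n) sy := @tri_bound (vfun u) (fun j k => partial j (proj N (u k)))
  P xpredT (fun l => (l <= N)%N) Z u u y (snrm^~ u) (snrm^~ u) sy n2.
have B3 Z (P : 'I_n -> fn) (y : vdistr R n) sy := @tri_bound (fun j x => vfun v j x - vfun u j x) (fun j k => partial j (proj N (u k)))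
  P xpredT (fun l => (l <= N)%N) Z w u y (snrm^~ w) (snrm^~ u) sy n2.
have cDPsq j k p : distr_of (partial j (proj N (u k))) (trp p) ^+ 2 = ((xnorm p.1 <= N)%N)%:R * dpartial j (u k) (trp p) ^+ 2.
  by rewrite cDP mem_modes; case: ifP => _; rewrite ?mul1r// mul0r expr0n.
have sn := @size_nrm; have st := @size_tail.
have T1 : `|tri (vfun u) (fun j k x => grad u j k x - partial j (proj N (u k)) x) (fun k x => proj N (v k) x - proj N (u k) x)| <=
   (n ^ 2)%:R * (trilC (R := R) (n := n) * stail hn u N * (snrm 1 u * snrm 0 w + snrm 0 u * snrm 1 w)).
  apply: B1 => //.
  - by move=> s M; exact: size_nrm.
  - by move=> s M; exact: size_tail.
  - by move=> s M; exact: size_nrm.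
  - by move=> s; exact: snrm_ge0.
  - by move=> s; exact: stail_ge0.
  - by move=> s; exact: snrm_ge0.
  - move=> j k; right; rewrite (_ : (fun x => _) = proj N (w k)); first exact: is_tp_proj.
    by apply/funext => x; rewrite proj_sub.
  - move=> j k p; rewrite cB// cDP grad_coef// mem_modes.
    by case: leqP; rewrite ?subrr ?subr0 ?mul1r ?expr0n ?mul0r.
  - move=> k p; rewrite cB// !proj_coef// mem_modes.
    by case: leqP; rewrite ?mul1r// subr0 expr0n mul0r.
have T2 : `|tri (vfun u) (fun j k => partial j (proj N (u k))) (fun k x => (proj N (v k) x - proj N (u k) x) - (vfun v k x - vfun u k x))| <=
   (n ^ 2)%:R * (trilC (R := R) (n := n) * snrm hn u * (snrm 1 u * stail 0 w N + snrm 0 u * stail 1 w N)).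
  apply: (B2 (fun l => ~~ (l <= N)%N) _ w (fun s => stail s w N)) => //.
  - by move=> s M; exact: size_nrm.
  - by move=> s M; exact: size_nrm.
  - by move=> s M; exact: size_tail.
  - by move=> s; exact: snrm_ge0.
  - by move=> s; exact: snrm_ge0.
  - by move=> s; exact: stail_ge0.
  - by move=> j k; left; exact: Tu.
  - move=> k p; rewrite !cB// !vfun_coef// !proj_coef// mem_modes /w /vsub.
    by case: leqP => _; [rewrite subrr expr0n mul0r|rewrite mul1r subrr sub0r sqrrN].
have T3 : `|tri (vfun u) (fun j k => partial j (proj N (u k))) (fun k x => vfun u k x - proj N (u k) x)| <=
   (n ^ 2)%:R * (trilC (R := R) (n := n) * snrm hn u * (snrm 1 u * stail 0 u N + snrm 0 u * stail 1 u N)).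
  apply: (B2 (fun l => ~~ (l <= N)%N) _ u (fun s => stail s u N)) => //.
  - by move=> s M; exact: size_nrm.
  - by move=> s M; exact: size_nrm.
  - by move=> s M; exact: size_tail.
  - by move=> s; exact: snrm_ge0.
  - by move=> s; exact: snrm_ge0.
  - by move=> s; exact: stail_ge0.
  - by move=> j k; left; exact: Tu.
have T4 : `|tri (fun j x => vfun v j x - vfun u j x) (fun j k => partial j (proj N (u k))) (fun k x => vfun u k x - proj N (u k) x)| <=
   (n ^ 2)%:R * (trilC (R := R) (n := n) * snrm hn u * (snrm 1 w * stail 0 u N + snrm 0 w * stail 1 u N)).
  apply: (B3 (fun l => ~~ (l <= N)%N) _ u (fun s => stail s u N)) => //.
  - by move=> s M; exact: size_nrm.
  - by move=> s M; exact: size_nrm.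
  - by move=> s M; exact: size_tail.
  - by move=> s; exact: snrm_ge0.
  - by move=> s; exact: snrm_ge0.
  - by move=> s; exact: stail_ge0.
  - by move=> j k; left; exact: Tu.
have T5 : `|tri (fun j x => vfun v j x - vfun u j x) (fun j k => partial j (proj N (u k))) (fun j x => vfun v j x - vfun u j x)| <=
   (n ^ 2)%:R * (trilC (R := R) (n := n) * snrm hn u * (snrm 1 w * snrm 0 w + snrm 0 w * snrm 1 w)).
  apply: (B3 xpredT _ w (snrm^~ w)) => //.
  - by move=> s M; exact: size_nrm.
  - by move=> s M; exact: size_nrm.
  - by move=> s M; exact: size_nrm.
  - by move=> s; exact: snrm_ge0.
  - by move=> s; exact: snrm_ge0.
  - by move=> s; exact: snrm_ge0.
  - by move=> j k; left; exact: Tu.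
exact: ler_norm5.
Qed.

(** Cauchy-Schwarz with the weights rho^-1 and rho; only frequencies beyond N contribute, hence the
    tail of [v]. *)
Lemma forcing_estimate f v N : pdv v -> (hnorm2 (-1) f < +oo)%E -> (hnorm2 1 v < +oo)%E ->
  `|vdual f v - \sum_i \sum_(p <- modes N) f i (trp p) * v i (trp p)| <= n%:R * (snrm (-1) f * stail 1 v N).
Proof.
move=> pv ff fv.
have rho0 xi : rho xi != 0 :> R by rewrite gt_eqF// rho_gt0.
have CSi i M (X : nat -> bool) : \sum_(p <- modes M) (X (xnorm p.1))%:R * `|f i (trp p) * v i (trp p)| <=
    snrm (-1) f * Num.sqrt (hsum (selw X (hw 1)) v M).
  have X0 xi : 0 <= selw X (hw 1) xi :> R by rewrite /selw mulr_ge0// hw_ge0.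
  rewrite (eq_bigr (fun p => ((rho p.1)^-1 * `|f i (trp p)|) * ((X (xnorm p.1))%:R * (rho p.1 * `|v i (trp p)|)))); last first.
    by move=> p _; rewrite normrM; field.
  apply: fsum_CS_le; [exact: snrm_ge0|exact: sqrtr_ge0| |].
    rewrite snrm_sq; apply: le_trans (hsum_le_nrm M ff); apply: le_trans (comp_le_hsum f M i (hw_ge0 _)).
    by apply: ler_sum => p _; rewrite hwN1 exprMn exprVn real_normK ?num_real.
  rewrite sqr_sqrtr; last exact: hsum_ge0.
  apply: le_trans (comp_le_hsum v M i X0).
  apply: ler_sum => p _; rewrite /selw hw1 [(_ * (_ * _)) ^+ 2]exprMn [(rho _ * _) ^+ 2]exprMn real_normK ?num_real// mulrA.
  by case: (X _); rewrite ?expr1n ?expr0n ?mul0r ?mul1r.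
have bd i M : \sum_(p <- modes M) `|f i (trp p) * v i (trp p)| <= snrm (-1) f * snrm 1 v.
  apply: le_trans (le_trans _ (CSi i M xpredT)) _; first by apply: ler_sum => p _; rewrite mul1r.
  rewrite selwT; apply: ler_wpM2l; first exact: snrm_ge0.
  by apply: ler_wsqrtr; exact: hsum_le_nrm.
have h : (fun M => \sum_i \sum_(p <- modes M) f i (trp p) * v i (trp p)) @ \oo --> vdual f v.
  by apply: cvg_sumr => i; exact: (dual_cvg (symc_pd (pv i)) (bd i)).
set S := \sum_i _.
have h2 : (fun M => `|\sum_i \sum_(p <- modes M) f i (trp p) * v i (trp p) - S|) @ \oo --> `|vdual f v - S|.
  by exact: (cvg_norm (cvgB h (cvg_cst _))).
rewrite -(cvg_lim _ h2)//; apply: limr_le; first by apply/cvg_ex; eexists; exact: h2.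
exists N => // M /= NM; rewrite -sumrB.
have -> : n%:R * (snrm (-1) f * stail 1 v N) = \sum_(i < n) snrm (-1) f * stail 1 v N.
  by rewrite sumr_const card_ord mulr_natl.
apply: le_trans (ler_norm_sum _ _ _) _; apply: ler_sum => i _.
have -> : \sum_(p <- modes M) f i (trp p) * v i (trp p) - \sum_(p <- modes N) f i (trp p) * v i (trp p) =
    \sum_(p <- modes M) (~~ (xnorm p.1 <= N)%N)%:R * (f i (trp p) * v i (trp p)).
  have e : \sum_(p <- modes N) f i (trp p) * v i (trp p) =
      \sum_(p <- modes M) ((xnorm p.1 <= N)%N)%:R * (f i (trp p) * v i (trp p)).
    rewrite (modes_sum_supp (f := fun p => (xnorm p.1 <= N)%N%:R * (f i (trp p) * v i (trp p))) NM); last first.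
      by move=> p; rewrite mem_modes => /negbTE ->; rewrite mul0r.
    by rewrite !big_seq; apply: eq_bigr => p; rewrite mem_modes => ->; rewrite mul1r.
  rewrite e -sumrB; apply: eq_bigr => p _; case: leqP; rewrite ?mul1r ?mul0r ?subr0 ?subrr//.
apply: le_trans (ler_norm_sum _ _ _) _.
apply: le_trans (le_trans _ (CSi i M (fun l => ~~ (l <= N)%N))) _.
  by apply: ler_sum => p _; rewrite normrM; case: leqP; rewrite ?normr0 ?normr1.
apply: ler_wpM2l; first exact: snrm_ge0.
by apply: ler_wsqrtr; rewrite selw_out; exact: hsum_trw_tail.
Qed.

Definition pairing N (F : vdistr R n) v : R := \sum_i \sum_(p <- modes N) F i (trp p) * v i (trp p).

(** The value of <u', P_N v> given by the equation for [u]. The Leray projection has disappeared,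
    because the truncated test field is solenoidal. *)
Definition galerkin (a : viscosity R n) t f u v N : R :=
  pairing N f v - a_form a t u (vtp N (fun i p => v i (trp p))) - pairing N (convection u) v.

(* The truncation errors in [remainder] vanish as N grows and are dominated by
   [total_size ^+ 2], which is integrable in time as long as [energy_size] is bounded. *)
Definition total_size f u v : R :=
  snrm 1 u + snrm (n%:R / 2) u + snrm 1 (vsub v u) + snrm 1 v + snrm (-1) f.
Definition energy_size u v : R := snrm 0 u + snrm 0 (vsub v u).
Definition tail1 u v N : R :=
  stail (n%:R / 2) u N + stail 1 (vsub v u) N + stail 1 u N + stail 1 v N.
Definition tail0 u v N : R := stail 0 (vsub v u) N + stail 0 u N.
Definition remainder f u v N : R :=
  total_size f u v * (1 + energy_size u v) * tail1 u v N + total_size f u v ^+ 2 * tail0 u v N.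

(** The maximum of 2 k S W0 W1 - W1^2 / (4 C) over W1 is 4 C k^2 S^2 W0^2, with k = n^2 [trilC]. *)
Definition stabC (C : R) : R := 4 * C * ((n ^ 2)%:R * trilC (R := R) (n := n)) ^+ 2.
Definition remC (M : R) : R := n%:R + 4 * ((n ^ 4)%:R * M) + 5 * ((n ^ 2)%:R * trilC (R := R) (n := n)).

Lemma balance_arith (C m c k F A0 A1 S W0 W1 V1 sg t1w t1u t1v t0w t0u eF eA eC : R) :
  0 < C -> 0 <= m -> 0 <= c -> 0 <= k -> 0 <= F -> 0 <= A0 -> 0 <= A1 -> 0 <= S -> 0 <= W0 -> 0 <= W1 ->
  0 <= V1 -> 0 <= sg -> 0 <= t1w -> 0 <= t1u -> 0 <= t1v -> 0 <= t0w -> 0 <= t0u ->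
  eF <= m * (F * t1v) -> eA <= - (4 * C)^-1 * W1 ^+ 2 + c * (A1 + V1) * (2 * (t1u + t1v)) ->
  eC <= k * sg * (A1 * W0 + A0 * W1) + k * S * (A1 * t0w + A0 * t1w) + k * S * (A1 * t0u + A0 * t1u) +
    k * S * (W1 * t0u + W0 * t1u) + k * S * (W1 * W0 + W0 * W1) ->
  eF + eA + eC <= 4 * C * k ^+ 2 * S ^+ 2 * W0 ^+ 2 +
   (m + 4 * c + 5 * k) * ((A1 + S + W1 + V1 + F) * (1 + (A0 + W0)) * (sg + t1w + t1u + t1v) +
      (A1 + S + W1 + V1 + F) ^+ 2 * (t0w + t0u)).
Proof.
move=> C0 m0 c0 k0 F0 A00 A10 S0 W00 W10 V10 sg0 t1w0 t1u0 t1v0 t0w0 t0u0 hF hA hC.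
pose X := A1 + S + W1 + V1 + F; pose m1 := 1 + (A0 + W0); pose d1 := sg + t1w + t1u + t1v; pose d0 := t0w + t0u.
have X0 : 0 <= X by rewrite /X; lra.
have d10 : 0 <= d1 by rewrite /d1; lra.
have d00 : 0 <= d0 by rewrite /d0; lra.
have p2 (x y x' y' : R) : 0 <= x -> 0 <= y -> x <= x' -> y <= y' -> x * y <= x' * y' by exact: ler_pM.
(* Every error term is either a size times a factor of the form [m1] times a tail in [d1], or two
   sizes times a tail of order 0; [Y1] and [Y2] treat the two types. *)
have Y1 (x y z : R) : 0 <= x -> 0 <= y -> 0 <= z -> x <= X -> y <= m1 -> z <= d1 -> x * y * z <= X * m1 * d1.
  by move=> *; apply: ler_pM => //; [exact: mulr_ge0|exact: ler_pM].
have Y2 (x y z : R) : 0 <= x -> 0 <= y -> 0 <= z -> x <= X -> y <= X -> z <= d0 -> x * y * z <= X ^+ 2 * d0.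
  by move=> *; apply: ler_pM => //; [exact: mulr_ge0|rewrite expr2; exact: ler_pM].
have q1 : F * 1 * t1v <= X * m1 * d1 by apply: Y1 => //; rewrite /X /m1 /d1; lra.
have q2 : (A1 + V1) * 1 * (t1u + t1v) <= X * m1 * d1 by apply: Y1 => //; rewrite /X /m1 /d1; lra.
have q3 : A1 * W0 * sg <= X * m1 * d1 by apply: Y1 => //; rewrite /X /m1 /d1; lra.
have q4 : W1 * A0 * sg <= X * m1 * d1 by apply: Y1 => //; rewrite /X /m1 /d1; lra.
have q5 : S * A0 * t1w <= X * m1 * d1 by apply: Y1 => //; rewrite /X /m1 /d1; lra.
have q6 : S * A0 * t1u <= X * m1 * d1 by apply: Y1 => //; rewrite /X /m1 /d1; lra.
have q7 : S * W0 * t1u <= X * m1 * d1 by apply: Y1 => //; rewrite /X /m1 /d1; lra.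
have r1 : S * A1 * t0w <= X ^+ 2 * d0 by apply: Y2 => //; rewrite /X /d0; lra.
have r2 : S * A1 * t0u <= X ^+ 2 * d0 by apply: Y2 => //; rewrite /X /d0; lra.
have r3 : S * W1 * t0u <= X ^+ 2 * d0 by apply: Y2 => //; rewrite /X /d0; lra.
have E0 : 0 <= X ^+ 2 * d0 by rewrite mulr_ge0// sqr_ge0.
rewrite -/X -/m1 -/d1 -/d0.
set P := X * m1 * d1 in q1 q2 q3 q4 q5 q6 q7 *; set Q := X ^+ 2 * d0 in r1 r2 r3 E0 *.
(* Young's inequality, as a completed square. *)
have sqr_est : - (4 * C)^-1 * W1 ^+ 2 + k * S * (W1 * W0 + W0 * W1) <= 4 * C * k ^+ 2 * S ^+ 2 * W0 ^+ 2.
  rewrite -subr_ge0.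
  have -> : 4 * C * k ^+ 2 * S ^+ 2 * W0 ^+ 2 - (- (4 * C)^-1 * W1 ^+ 2 + k * S * (W1 * W0 + W0 * W1)) =
     (4 * C)^-1 * (W1 - 4 * C * (k * S * W0)) ^+ 2 by field; rewrite gt_eqF.
  by rewrite mulr_ge0 ?sqr_ge0// invr_ge0 mulr_ge0// ltW.
have hF' : eF <= m * P by apply: le_trans hF _; apply: ler_wpM2l => //; move: q1; rewrite mulr1.
have hA' : eA <= - (4 * C)^-1 * W1 ^+ 2 + 2 * (c * P).
  apply: le_trans hA _; rewrite lerD2l mulrCA -mulrA; apply: ler_wpM2l => //; apply: ler_wpM2l => //.
  by move: q2; rewrite mulr1.
have hC' : eC <= k * (5 * P) + k * (3 * Q) + k * S * (W1 * W0 + W0 * W1).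
  apply: le_trans hC _; rewrite lerD2r -mulrDr.
  rewrite (_ : _ + _ = k * (A1 * W0 * sg + W1 * A0 * sg + S * A0 * t1w + S * A0 * t1u + S * W0 * t1u +
     (S * A1 * t0w + S * A1 * t0u + S * W1 * t0u))); last by ring.
  by apply: ler_wpM2l => //; lra.
have P0 : 0 <= P by rewrite /P !mulr_ge0//; rewrite /m1; lra.
have cP : 0 <= c * P by exact: mulr_ge0.
have cQ : 0 <= c * Q by exact: mulr_ge0.
have mQ : 0 <= m * Q by exact: mulr_ge0.
have kQ : 0 <= k * Q by exact: mulr_ge0.
clear q1 q2 q3 q4 q5 q6 q7 r1 r2 r3 hF hA hC Y1 Y2 p2.
lra.
Qed.

Lemma balance_rearrange (vd avv fu auu cuu fv auv cuv avu cvu : R) :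
  vd - avv + (fu - auu - cuu) - (fv - auv - cuv) - (fu - avu - cvu) =
  (vd - fv) + (- avv + auv + avu - auu) + (cuv + cvu - cuu).
Proof. ring. Qed.

(** The left-hand side collects the integrands from the energy inequality for [v] and from the
    product rules for half of <P_N u, P_N u> and for <P_N u, P_N v>. *)
Lemma balance_estimate (a : viscosity R n) t f u v (M C : R) N : (2 <= n)%N -> 0 <= M -> 0 < C ->
  Hdot_sigma 1 u -> Hdot_sigma 1 v -> Hdot_sigma 1 (vsub v u) -> (hnorm2 (n%:R / 2) u < +oo)%E ->
  (hnorm2 (-1) f < +oo)%E ->
  (forall i j al be, ae_bounded (fun x => a i j al be x t) M) -> elliptic (fun i j al be x => a i j al be x t) C ->
  vdual f v - a_form a t v v + galerkin a t f u u N - galerkin a t f u v N - galerkin a t f v u N <=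
  stabC C * nrm (n%:R / 2) u * nrm 0 (vsub v u) + remC M * remainder f u v N.
Proof.
move=> n2 M0 C0 hu hv hw fhn ff ha hC; have n0 : (0 < n)%N by exact: leq_trans n2.
have [[[pu fu] _] _] := hu; have [[[pv fv] _] _] := hv; have [[[pw fw] _] _] := hw.
have eA := viscous_estimate N n0 M0 C0 hu hv hw ha hC.
have eC := convective_estimate N n2 hu hv fhn fw.
have := forcing_estimate N pv ff fv; rewrite ler_norml => /andP[_ eF].
have k0 : 0 <= (n ^ 2)%:R * trilC (R := R) (n := n) by rewrite mulr_ge0// /trilC mulr_ge0 ?sqrtr_ge0.
have c0 : 0 <= (n ^ 4)%:R * M by exact: mulr_ge0.
rewrite -snrm_sq -/(snrm 1 u) -/(snrm 1 v) -/(stail 1 u N) -/(stail 1 v N) in eA; rewrite !(mulrA _ (trilC * _)) !(mulrA _ trilC) in eC.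
have sn s w : 0 <= snrm s w := snrm_ge0 s w; have st s w L : 0 <= stail s w L := stail_ge0 s w L.
have := balance_arith C0 (ler0n R n) c0 k0 (sn (-1) f) (sn 0 u) (sn 1 u) (sn (n%:R / 2) u) (sn 0 (vsub v u))
  (sn 1 (vsub v u)) (sn 1 v) (st (n%:R / 2) u N) (st 1 (vsub v u) N) (st 1 u N) (st 1 v N) (st 0 (vsub v u) N) (st 0 u N)
  eF eA eC.
rewrite !snrm_sq; apply: le_trans; rewrite /galerkin /pairing.
by rewrite le_eqVlt; apply/orP; left; apply/eqP; exact: balance_rearrange.
Qed.

End Convective.

(** * Integration in time *)

Section Conull.
Local Open Scope ereal_scope.
Context d (T : measurableType d) (R : realType) (mu : {measure set T -> \bar R}).
Implicit Types (D E : set T).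
Import HBNNSimple.

Lemma ge0_integral_mono (f g : T -> \bar R) : (forall x, 0 <= f x) -> (forall x, f x <= g x) ->
  \int[mu]_x f x <= \int[mu]_x g x.
Proof.
move=> f0 fg; have g0 x : 0 <= g x by exact: le_trans (fg x).
rewrite !ge0_integralTE//; apply: ereal_sup_le => _ [h hf <-]; exists h => //= x.
exact: le_trans (fg x).
Qed.

(* No measurability is assumed: the integral is a supremum over the simple
   functions below [f], and these can be cut off to [E]. *)
Lemma ge0_integral_conull D E (f : T -> \bar R) : measurable D -> measurable E -> E `<=` D -> mu (D `\` E) = 0 ->
  (forall x, 0 <= f x) -> \int[mu]_(x in D) f x = \int[mu]_(x in E) f x.
Proof.
move=> mD mE ED DE0 f0; rewrite integral_mkcond [RHS]integral_mkcond.
have p0 A x : 0 <= (f \_ A) x by rewrite /patch; case: ifP.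
apply/eqP; rewrite eq_le; apply/andP; split; last first.
  apply: ge0_integral_mono => // x; rewrite /patch; case: ifPn => // xE.
    by rewrite ifT//; move: xE; rewrite !inE => /ED.
  by case: ifP.
rewrite !ge0_integralTE//; apply: ge_ereal_sup => _ [h hf <-].
pose k := mul_nnsfun h (indic_nnsfun R mE).
apply: (@le_trans _ _ (sintegral mu k)); last first.
  apply: ereal_sup_ubound; exists k => //= x.
  rewrite /k /= mindicE /patch; case: ifPn => xE.
    rewrite mulr1; apply: le_trans (hf x) _; rewrite /patch ifT//.
    by move: xE; rewrite !inE => /ED.
  by rewrite mulr0.
have E1 (h' : {nnsfun T >-> R}) : sintegral mu h' = \int[mu]_x (h' x)%:E.
  rewrite integral_nnsfun//; apply: eq_sintegral => x; by rewrite patch_setT.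
rewrite !E1 le_eqVlt; apply/orP; left; apply/eqP.
apply: ae_eq_integral => //.
- by apply/measurable_EFinP; exact: measurable_funPT.
- by apply/measurable_EFinP; exact: measurable_funPT.
exists (D `\` E); split => //; first exact: measurableD.
move=> x /= hx; split; last first.
  move=> xE; apply: hx => _; by rewrite /k /= mindicE mem_set// mulr1.
apply: contrapT => xD; apply: hx => _; have := hf x; rewrite /patch ifF ?lee_fin => [h0|]; last first.
  by apply/negbTE/negP; rewrite inE.
have -> : h x = 0%R by apply/eqP; rewrite eq_le h0/=; exact: fun_ge0.
by rewrite /k /= mul0r.
Qed.

(** The time integrals of the problem run over intervals on which the integrands are not known to be
    measurable; this moves them to a conull set where they are. *)
Lemma integral_conull D E (f : T -> \bar R) : measurable D -> measurable E -> E `<=` D -> mu (D `\` E) = 0 ->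
  \int[mu]_(x in D) f x = \int[mu]_(x in E) f x.
Proof.
move=> mD mE ED DE0; rewrite integralE [RHS]integralE.
by congr (_ - _); apply: ge0_integral_conull => // x; rewrite ?funepos_ge0 ?funeneg_ge0.
Qed.

Lemma Rintegral_conull D E (f : T -> R) : measurable D -> measurable E -> E `<=` D -> mu (D `\` E) = 0 ->
  Rintegral mu D f = Rintegral mu E f.
Proof. by move=> *; rewrite /Rintegral (@integral_conull D E). Qed.

End Conull.

(** * Bochner spaces through Fourier coefficients *)

Section TimeSpaces.
Context {R : realType} {n : nat}.
Local Notation mode := ('rV[int]_n * bool)%type.
Local Notation mu := (@lebesgue_measure R).
Local Notation RR := (measurableTypeR R).
Implicit Types (T : R) (u : R -> vdistr R n) (E : set RR).

(** A measurable set in place of an almost everywhere quantifier: functions of time can then be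
    measurable and integrable on it. *)
Definition full T E := [/\ measurable E, E `<=` `]0, T[ & mu (`]0, T[ `\` E) = 0].

Lemma full_ae T (P : R -> Prop) : {ae mu, forall t, t \in `]0, T[ -> P t} ->
  exists E, full T E /\ forall t, E t -> P t.
Proof.
move=> [Z [mZ Z0 hZ]]; exists (`]0, T[ `\` Z); split.
  split; first by apply: measurableD => //; exact: measurable_itv.
    by move=> t [].
  apply/eqP; rewrite eq_le measure_ge0 andbT -Z0; apply: le_measure; rewrite ?inE//.
    apply: measurableD; first exact: measurable_itv.
    by apply: measurableD => //; exact: measurable_itv.
  by move=> t [tT] /not_andP[//|/contrapT].
move=> t [tT nZ]; apply: contrapT => nP; apply: nZ; apply: hZ => /= h; apply: nP; exact: h.
Qed.

Lemma fullI T E F : full T E -> full T F -> full T (E `&` F).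
Proof.
move=> [mE sE E0] [mF sF F0]; split; first exact: measurableI.
  by move=> t [/sE].
apply/eqP; rewrite eq_le measure_ge0 andbT.
have mI : measurable (`]0, T[ : set RR) by exact: measurable_itv.
apply: (@le_trans _ _ (mu ((`]0, T[ `\` E) `|` (`]0, T[ `\` F)))).
  apply: le_measure; rewrite ?inE.
  - by apply: measurableD => //; exact: measurableI.
  - by apply: measurableU; exact: measurableD.
  - by move=> t [tT] /not_andP[h|h]; [left|right].
by rewrite null_set_setU//; exact: measurableD.
Qed.

(** Convergence in norm thus implies convergence of each coefficient, which carries strong
    measurability and integrability from the Bochner space to single coefficients. *)
Lemma coef_le_hnorm (s : R) (w : vdistr R n) i (p : mode) :
  ((`|w i (trp p)| * Num.sqrt (hw s p.1))%:E <= hnorm s w)%E.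
Proof.
have h : (((`|w i (trp p)| * Num.sqrt (hw s p.1)) ^+ 2)%:E <= hnorm2 s w)%E.
  apply: le_trans (@hsum_le_hnorm2 _ _ s w (xnorm p.1)); rewrite lee_fin.
  apply: le_trans (comp_le_hsum w _ i (hw_ge0 s)).
  rewrite (bigD1_seq p)/= ?modes_uniq// ?mem_modes// exprMn real_normK ?num_real// sqr_sqrtr ?hw_ge0// mulrC lerDl.
  by apply: sumr_ge0 => q _; rewrite mulr_ge0 ?hw_ge0 ?sqr_ge0.
have x0 : 0 <= `|w i (trp p)| * Num.sqrt (hw s p.1) by rewrite mulr_ge0 ?sqrtr_ge0.
rewrite /hnorm; move: h; have := hnorm2_ge0 s w; case: (hnorm2 s w) => [r|//|//].
  move=> r0; rewrite lee_fin => h; rewrite poweR12_sqrt//= lee_fin.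
  by rewrite -[leLHS]ger0_norm// -sqrtr_sqr; apply: ler_wsqrtr.
by move=> _ _; rewrite poweRyr ?leey.
Qed.

Lemma simple_measurable (X : set (vdistr R n)) (S : R -> vdistr R n) i phi : simple_in X S ->
  measurable_fun [set: RR] (fun t => S t i phi).
Proof.
move=> [m [A [c [hA hS]]]].
rewrite (_ : (fun t => _) = fun t => \sum_l \1_(A l) t * c l i phi); last by apply/funext => t; rewrite hS.
apply: measurable_sum => l; apply: measurable_funM => //.
by apply: measurable_indic; have [] := hA l.
Qed.

Definition time_measurable E u := forall i p, measurable_fun E (fun t => u t i (trp p)).

Lemma time_measurableS E F u : measurable E -> F `<=` E -> time_measurable E u -> time_measurable F u.
Proof. by move=> mE FE h i p; exact: (measurable_funS mE FE (h i p)). Qed.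

Lemma Lq_measurable q T (s : R) (X : set (vdistr R n)) u : Lq_time q T s X u ->
  exists E, [/\ full T E, forall t, E t -> X (u t) & time_measurable E u].
Proof.
move=> [aX [S [hS aS]] _].
have [E1 [f1 h1]] := full_ae aX; have [E2 [f2 h2]] := full_ae aS.
exists (E1 `&` E2); split; [exact: fullI|by move=> t [/h1]|] => i p.
have [mE _ _] := fullI f1 f2.
apply: (@measurable_fun_cvg _ _ _ _ (fun k t => S k t i (trp p))).
  by move=> k; apply: measurable_funTS; exact: simple_measurable (hS k).
move=> t [_ /h2 c].
have r0 : 0 < Num.sqrt (hw s p.1) :> R by rewrite sqrtr_gt0 hw_gt0.
apply/cvgrPdist_lt => e e0.
have : nbhs (0 : \bar R)%E [set y | (y < (e * Num.sqrt (hw s p.1))%:E)%E].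
  apply: open_nbhs_nbhs; split; first exact: open_ereal_lt_ereal.
  by rewrite /= lte_fin mulr_gt0.
move=> hN; have : \forall k \near \oo, (hnorm s (vsub (S k t) (u t)) < (e * Num.sqrt (hw s p.1))%:E)%E.
  by exact: (c _ hN).
apply: filterS => k hk; have := le_lt_trans (coef_le_hnorm s (vsub (S k t) (u t)) i p) hk.
by rewrite lte_fin ltr_pM2r// distrC.
Qed.

Lemma hnormE (s : R) (w : vdistr R n) : (hnorm2 s w < +oo)%E -> hnorm s w = (snrm s w)%:E.
Proof. by move=> h; rewrite /hnorm -(nrm_EFin h) poweR12_sqrt ?lee_fin ?nrm_ge0. Qed.

Lemma pairing_measurable E u v N : measurable E -> time_measurable E u -> time_measurable E v ->
  measurable_fun E (fun t => pairing N (u t) (v t)).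
Proof.
move=> mE hu hv; apply: measurable_sum => i; apply: measurable_sum => p; apply: measurable_funM => //.
Qed.

Lemma hsum_measurable E u W N : measurable E -> time_measurable E u ->
  measurable_fun E (fun t => hsum W (u t) N).
Proof.
move=> mE hu; apply: measurable_sum => i; apply: measurable_sum => p; apply: measurable_funM => //.
exact: measurable_funX.
Qed.

Lemma nrm_measurable E u (s : R) : measurable E -> time_measurable E u ->
  (forall t, E t -> (hnorm2 s (u t) < +oo)%E) -> measurable_fun E (fun t => nrm s (u t)).
Proof.
move=> mE hu fu; apply: (@measurable_fun_cvg _ _ _ _ (fun N t => hsum (hw s) (u t) N)).
  by move=> N; exact: hsum_measurable.
by move=> t Et; apply: nrm_cvg; exact: fu.
Qed.

Lemma snrm_measurable E u (s : R) : measurable E -> time_measurable E u ->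
  (forall t, E t -> (hnorm2 s (u t) < +oo)%E) -> measurable_fun E (fun t => snrm s (u t)).
Proof.
move=> mE hu fu; apply: (measurableT_comp (continuous_measurable_fun (@sqrt_continuous R))); exact: nrm_measurable.
Qed.

(** The integrand inside [Lnorm] may fail to be measurable off [E], so the passage to [E] uses only
    that integrals of nonnegative functions are monotone. *)
Lemma Lnorm_integrable T (s : R) u E (g : R -> R) (q : R) : 0 < q -> full T E ->
  (Lnorm mu q%:E ((fun t => hnorm s (u t)) \_ `]0%R, T[) < +oo)%E ->
  measurable_fun E g -> (forall t, E t -> 0 <= g t) -> (forall t, E t -> (g t)%:E = (hnorm s (u t) `^ q)%E) ->
  mu.-integrable E (EFin \o g).
Proof.
move=> q0 [mE sE _]; rewrite unlock => /lty_poweRy h mg g0 gE.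
have {}h := h (invr_neq0 (lt0r_neq0 q0)).
apply/integrableP; split; first exact/measurable_EFinP.
apply: le_lt_trans h; rewrite [leLHS]integral_mkcond; apply: ge0_integral_mono => t.
  by rewrite /patch; case: ifP => // _; rewrite abse_ge0.
rewrite {1}/patch; case: ifPn => [|_]; last exact: poweR_ge0.
rewrite inE => Et; rewrite /= ger0_norm ?g0// gE// /patch ifT; last by rewrite inE; exact: sE.
by rewrite gee0_abs// /hnorm poweR_ge0.
Qed.

Lemma Lq2_integrable T (s : R) (X : set (vdistr R n)) u : (forall w, X w -> (hnorm2 s w < +oo)%E) ->
  Lq_time 2%:E T s X u ->
  exists E, [/\ full T E, forall t, E t -> X (u t), time_measurable E u &
    mu.-integrable E (EFin \o (fun t => nrm s (u t)))].
Proof.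
move=> XP h; have [E [fE XE mu_]] := Lq_measurable h; exists E; split => //.
have [mE _ _] := fE; have [_ _ hL] := h.
apply: (Lnorm_integrable (q := 2) _ fE hL) => //.
- by apply: nrm_measurable => // t /XE/XP.
- by move=> t _; exact: nrm_ge0.
- move=> t /XE/XP ft; rewrite hnormE// poweR_EFin powR_mulrn ?snrm_ge0//.
  by rewrite snrm_sq.
Qed.

Lemma Lq1_integrable T (s : R) (X : set (vdistr R n)) u : (forall w, X w -> (hnorm2 s w < +oo)%E) ->
  Lq_time 1%:E T s X u ->
  exists E, [/\ full T E, forall t, E t -> X (u t), time_measurable E u &
    forall i p, mu.-integrable E (EFin \o (fun t => u t i (trp p)))].
Proof.
move=> XP h; have [E [fE XE mu_]] := Lq_measurable h; exists E; split => // i p.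
have [mE _ _] := fE; have [_ _ hL] := h.
have I : mu.-integrable E (EFin \o (fun t => snrm s (u t))).
  apply: (Lnorm_integrable (q := 1) _ fE hL) => //.
  - by apply: snrm_measurable => // t /XE/XP.
  - by move=> t _; exact: snrm_ge0.
  - by move=> t /XE/XP ft; rewrite hnormE// poweR_EFin powRr1 ?snrm_ge0.
have r0 : 0 < Num.sqrt (hw s p.1) :> R by rewrite sqrtr_gt0 hw_gt0.
apply: (@itg_le _ _ _ mu E mE _ (fun t => (Num.sqrt (hw s p.1))^-1 * snrm s (u t))).
- exact: mu_.
- move=> t Et; have := coef_le_hnorm s (u t) i p; rewrite hnormE; last exact/XP/XE.
  rewrite lee_fin => hl; rewrite mulrC ler_pdivlMr//.
- exact: itgZl.
Qed.

Lemma Lqoo_bounded T (s : R) (X : set (vdistr R n)) u : (forall w, X w -> (hnorm2 s w < +oo)%E) ->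
  Lq_time +oo%E T s X u ->
  exists E (K : R), [/\ full T E, 0 <= K & forall t, E t -> nrm s (u t) <= K].
Proof.
move=> XP h; have [E1 [fE1 XE1 _]] := Lq_measurable h; have [_ _ hL] := h.
(* At exponent infinity [Lnorm] is the essential supremum provided the whole space has positive
   measure; the unit interval shows that it does. *)
move: hL; rewrite unlock; case: ifPn => [_ hL|]; last first.
  move=> /negP[]; apply: (@lt_le_trans _ _ (mu `[0, 1])).
    by rewrite lebesgue_measure_itv/= lte_fin ltr01 oppr0 adde0 lte_fin.
  by apply: le_measure; rewrite ?inE//; exact: measurable_itv.
have [K [K0 hK]] : exists K : R, 0 <= K /\ (ess_sup mu (abse \o ((fun t => hnorm s (u t)) \_ `]0%R, T[)) <= K%:E)%E.
  move: hL; case: ess_sup => [r _|//|_]; last by exists 0; rewrite leNye.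
  by exists `|r|; rewrite normr_ge0 lee_fin ler_norm.
have ae : {ae mu, forall t, t \in `]0, T[ -> (hnorm s (u t) <= K%:E)%E}.
  move/ess_supP : hK; apply: filterS => t /= ht tT; move: ht; rewrite /patch ifT ?inE//.
  by apply: le_trans; rewrite gee0_abs// poweR_ge0.
have [E2 [fE2 hE2]] := full_ae ae.
exists (E1 `&` E2), (K ^+ 2); split; [exact: fullI|exact: sqr_ge0|] => t [/XE1/XP ft /hE2].
rewrite hnormE// lee_fin -snrm_sq => hl.
by rewrite ler_sqr ?nnegrE ?snrm_ge0.
Qed.

End TimeSpaces.

(** * Smooth cutoffs in time *)

Section Bumps.
Context {R : realType}.
Implicit Types (x s t k : R) (m l : nat).

(* Up to linear combinations this family is closed under differentiation. *)
Definition flat m x : R := if 0 < x then x ^- m * expR (- x^-1) else 0.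

Lemma flat_ge0 m x : 0 <= flat m x.
Proof. by rewrite /flat; case: ifP => // x0; rewrite mulr_ge0 ?expR_ge0// invr_ge0 exprn_ge0// ltW. Qed.

Lemma flat_le0 m x : x <= 0 -> flat m x = 0.
Proof. by rewrite /flat ltNge => ->. Qed.

(** For x > 0, exp(1/x) exceeds the term x^-(m+2) / (m+2)! of its series. *)
Lemma flat_bound m x : `|flat m x| <= (m.+2)`!%:R * x ^+ 2.
Proof.
rewrite ger0_norm ?flat_ge0// /flat; case: ifP => [x0|_]; last by rewrite mulr_ge0// sqr_ge0.
have xi0 : 0 <= x^-1 by rewrite invr_ge0 ltW.
have := expR_ge1Dxn m.+1 xi0.
set F := (m.+2)`!%:R; have F0 : 0 < F by rewrite ltr0n fact_gt0.
move=> h; have {}h : x ^- m.+2 / F <= expR x^-1 by apply: le_trans h; rewrite exprVn; lra.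
have xm j : 0 < x ^+ j by rewrite exprn_gt0.
have q : 0 < F * x ^+ m.+2 by exact: mulr_gt0.
have h2 : expR (- x^-1) <= F * x ^+ m.+2.
  rewrite expRN -[leRHS]invrK lef_pV2 ?posrE ?expR_gt0 ?invr_gt0//.
  by apply: le_trans h; rewrite invfM mulrC.
apply: (@le_trans _ _ (x ^- m * (F * x ^+ m.+2))).
  by apply: ler_wpM2l => //; rewrite invr_ge0 ltW.
have -> : x ^+ m.+2 = x ^+ m * x ^+ 2 by rewrite -exprD addn2.
by rewrite mulrCA mulKf// gt_eqF.
Qed.

(** So the difference quotient of [flat m] at 0 is [flat m.+1], and differentiability at 0 becomes
    the limit [flat_cvg0]. *)
Lemma flat_quotient m h : h != 0 -> h^-1 * flat m h = flat m.+1 h.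
Proof.
move=> h0; rewrite /flat; case: ifP => [hp|_]; last by rewrite mulr0.
by rewrite mulrA -invfM -exprS.
Qed.

Lemma flat_cvg0 m : flat m x @[x --> (0 : R)] --> (0 : R).
Proof.
have c : (fun x : R => (m.+2)`!%:R * x ^+ 2) @ (0 : R) --> (0 : R).
  rewrite -[X in _ --> X](_ : (m.+2)`!%:R * 0 ^+ 2 = 0); last by rewrite expr0n mulr0.
  by apply: cvgM; [exact: cvg_cst|exact: exprn_continuous].
apply/cvgrPdist_le => e e0; move/cvgrPdist_le : c => /(_ e e0).
apply: filterS => x; rewrite !sub0r !normrN => h; apply: le_trans h.
by apply: le_trans (flat_bound m x) _; exact: ler_norm.
Qed.

Lemma is_derive_flat m x : is_derive x 1 (flat m) (flat m.+2 x - m%:R * flat m.+1 x).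
Proof.
have [x0|x0|->] := ltgtP x 0.
- have -> : flat m.+2 x - m%:R * flat m.+1 x = 0 by rewrite !flat_le0 ?mulr0 ?subr0// ltW.
  apply: (@near_eq_is_derive _ _ _ (cst (0 : R)) (flat m) x 1 0 _ (is_derive_cst (0 : R) x 1)).
  by near=> y; rewrite /= flat_le0// ltW//; near: y; exact: lt_nbhsl.
- have D : is_derive x 1 (fun y : R => (y ^+ m)^-1 * expR (- y^-1)) (flat m.+2 x - m%:R * flat m.+1 x).
    have xn : x != 0 by rewrite gt_eqF.
    have d1 : is_derive x 1 (fun y : R => y ^+ m) (m%:R * x ^+ m.-1).
      have -> : (fun y : R => y ^+ m) = (id : R -> R) ^+ m by apply/funext => y; rewrite exprfctE.
      move: (is_deriveX m (is_derive_id x 1)) => D; apply: (is_derive_eq D).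
      by rewrite /GRing.scale /= mulr1.
    have d2 : is_derive x 1 (fun y : R => (y ^+ m)^-1) (- (x ^+ m) ^- 2 *: (m%:R * x ^+ m.-1)).
      by apply: is_deriveV => //; rewrite expf_neq0.
    have d3 : is_derive x 1 (fun y : R => - y^-1) (x ^- 2).
      by have := is_deriveN (is_deriveV xn (is_derive_id x 1)); rewrite scaler1 opprK.
    have d4 : is_derive x 1 (fun y : R => expR (- y^-1)) (expR (- x^-1) * x ^- 2).
      by apply: (@is_derive1_comp _ expR (fun y => - y^-1)).
    move: (is_deriveM d2 d4) => D; apply: (is_derive_eq D).
    rewrite /flat x0 /GRing.scale /=.
    case: m {d1 d2 D} => [|m] /=.
      by rewrite !mul0r !expr0 invr1 !mulr0 mul1r addr0 subr0 mulrC.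
    rewrite !exprS; field; by rewrite xn expf_neq0.
  apply: near_eq_is_derive D; near=> y; rewrite /flat ifT//.
  by near: y; exact: lt_nbhsr.
- have -> : flat m.+2 0 - m%:R * flat m.+1 0 = 0 by rewrite !flat_le0 ?mulr0 ?subr0.
  have c : h^-1 *: ((flat m \o shift 0) (h *: 1) - flat m 0) @[h --> (0 : R)^'] --> (0 : R).
    apply: (@cvg_trans _ (flat m.+1 @ (0 : R)^')).
      apply: near_eq_cvg; near=> h.
      rewrite /= addr0 [h *: 1]mulr1 (flat_le0 m (lexx 0)) subr0 [_ *: _]flat_quotient//.
      by near: h; exact: nbhs_dnbhs_neq.
    exact: (cvg_trans (cvg_app _ (@nbhs_dnbhs _ (0 : R))) (@flat_cvg0 m.+1)).
  by apply: DeriveDef; [apply/cvg_ex; exists 0; exact: c|exact: (cvg_lim _ c)].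
Unshelve. all: by end_near. Qed.

Variables (s t k : R).

(** A product of one-sided cutoffs at [s] and at [t]; [k] is the steepness, and the triple holds a
    coefficient and the two orders of [flat]. *)
Definition bump_term (c : R * nat * nat) (x : R) : R :=
  c.1.1 * (flat c.1.2 (k * (x - s)) * flat c.2 (k * (t - x))).

Definition bump_sum (L : seq (R * nat * nat)) (x : R) : R := \sum_(c <- L) bump_term c x.

Definition bump_deriv1 (c : R * nat * nat) : seq (R * nat * nat) :=
  [:: (c.1.1 * k, c.1.2.+2, c.2); (- (c.1.1 * k * c.1.2%:R), c.1.2.+1, c.2);
      (- (c.1.1 * k), c.1.2, c.2.+2); (c.1.1 * k * c.2%:R, c.1.2, c.2.+1)].

Definition bump_deriv L := flatten [seq bump_deriv1 c | c <- L].

Lemma is_derive_bump_term c x : is_derive x 1 (bump_term c) (bump_sum (bump_deriv1 c) x).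
Proof.
case: c => [[c m] l].
have d1 : is_derive x 1 (fun y : R => k * (y - s)) k.
  have := is_deriveZ k (is_deriveB (is_derive_id x 1) (is_derive_cst s x 1)).
  by rewrite subr0 /GRing.scale /= mulr1.
have d2 : is_derive x 1 (fun y : R => k * (t - y)) (- k).
  have := is_deriveZ k (is_deriveB (is_derive_cst t x 1) (is_derive_id x 1)).
  by rewrite sub0r /GRing.scale /= mulrN1.
have e1 : is_derive x 1 (fun y : R => flat m (k * (y - s))) ((flat m.+2 (k * (x - s)) - m%:R * flat m.+1 (k * (x - s))) * k).
  by apply: (@is_derive1_comp _ (flat m) (fun y => k * (y - s))); exact: is_derive_flat.
have e2 : is_derive x 1 (fun y : R => flat l (k * (t - y))) ((flat l.+2 (k * (t - x)) - l%:R * flat l.+1 (k * (t - x))) * (- k)).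
  by apply: (@is_derive1_comp _ (flat l) (fun y => k * (t - y))); exact: is_derive_flat.
move: (is_deriveZ c (is_deriveM e1 e2)) => D; apply: (is_derive_eq D).
rewrite /bump_sum /bump_deriv1 !big_cons big_nil /bump_term /= /GRing.scale /=; ring.
Qed.

Lemma is_derive_bump_sum L x : is_derive x 1 (bump_sum L) (bump_sum (bump_deriv L) x).
Proof.
elim: L => [|c L IH].
  rewrite /bump_deriv /= (_ : bump_sum [::] = cst 0) /=; first exact: is_derive_cst.
  by apply/funext => y; rewrite /bump_sum big_nil.
move: (is_deriveD (is_derive_bump_term c x) IH).
rewrite (_ : bump_term c + bump_sum L = bump_sum (c :: L)); last first.
  by apply/funext => y; rewrite /bump_sum big_cons.
by move=> D; apply: (is_derive_eq D); rewrite /bump_sum [bump_deriv (c :: L)](_ : _ = bump_deriv1 c ++ bump_deriv L)// big_cat.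
Qed.

Lemma derive1_bump_sum L : derive1 (bump_sum L) = bump_sum (bump_deriv L).
Proof. by apply/funext => x; rewrite derive1E; have d := is_derive_bump_sum L x; exact: derive_val. Qed.

Lemma bump_sum_smooth L j x : derivable (derive1n j (bump_sum L)) x 1.
Proof.
elim: j L => [|j IH] L; first by have d := is_derive_bump_sum L x; exact: ex_derive.
by rewrite derive1Sn derive1_bump_sum.
Qed.

Lemma bump_sum_continuous L : continuous (bump_sum L).
Proof.
by move=> x; apply: differentiable_continuous; apply/derivable1_diffP; exact: (@bump_sum_smooth L 0%N x).
Qed.

Definition bump : R -> R := bump_sum [:: (1, 0%N, 0%N)].
Definition bump' : R -> R := bump_sum (bump_deriv [:: (1, 0%N, 0%N)]).

Lemma bumpE x : bump x = flat 0 (k * (x - s)) * flat 0 (k * (t - x)).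
Proof. by rewrite /bump /bump_sum big_seq1 /bump_term mul1r. Qed.

Lemma bump'E x : bump' x = k * (flat 2 (k * (x - s)) * flat 0 (k * (t - x)) - flat 0 (k * (x - s)) * flat 2 (k * (t - x))).
Proof.
rewrite /bump' /bump_deriv /bump_deriv1 /= /bump_sum !big_cons big_nil /bump_term /=; ring.
Qed.

Hypothesis k0 : 0 < k.

Lemma bump_out x : ~~ (s < x < t) -> bump x = 0.
Proof.
rewrite negb_and -!leNgt bumpE => /orP[h|h].
  by rewrite flat_le0 ?mul0r// pmulr_rle0// subr_le0.
by rewrite (@flat_le0 _ (k * (t - x))) ?mulr0// pmulr_rle0// subr_le0.
Qed.

Lemma bump'_out x : ~~ (s < x < t) -> bump' x = 0.
Proof.
rewrite negb_and -!leNgt bump'E => /orP[h|h].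
  have h' : k * (x - s) <= 0 by rewrite pmulr_rle0// subr_le0.
  by rewrite !(flat_le0 _ h') !mul0r subrr mulr0.
have h' : k * (t - x) <= 0 by rewrite pmulr_rle0// subr_le0.
by rewrite !(flat_le0 _ h') !mulr0 subrr mulr0.
Qed.

Lemma bump_in x : s < x < t -> bump x = expR (- (k^-1 * ((x - s)^-1 + (t - x)^-1))).
Proof.
move=> /andP[sx xt]; rewrite bumpE /flat !pmulr_rgt0// !subr_gt0 sx xt !expr0 invr1 !mul1r -expRD !invfM.
by congr expR; ring.
Qed.

Lemma flat2 y : flat 2 y = y ^- 2 * flat 0 y.
Proof. by rewrite /flat; case: ifP => _; rewrite ?mulr0// expr0 invr1 mul1r. Qed.

Lemma bump'_factor x : bump' x = k^-1 * ((x - s) ^- 2 - (t - x) ^- 2) * bump x.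
Proof.
rewrite bump'E bumpE !flat2 !exprMn ![(k ^+ 2 * _)^-1]invfM.
set a := flat 0 _; set b := flat 0 _; set u := (x - s) ^- 2; set v := (t - x) ^- 2.
by field; rewrite gt_eqF.
Qed.

Lemma bump_ge0 x : 0 <= bump x.
Proof. by rewrite bumpE mulr_ge0 ?flat_ge0. Qed.

Lemma bump_le1 x : bump x <= 1.
Proof.
have [h|h] := boolP (s < x < t); last by rewrite bump_out.
rewrite bump_in// -expR0 ler_expR oppr_le0; move: h => /andP[sx xt].
by rewrite mulr_ge0 ?invr_ge0 ?addr_ge0 ?invr_ge0 ?subr_ge0 ?ltW.
Qed.

(** With a sign change only at the midpoint, the integral of the modulus of the derivative over a
    part of either half is an increment of the bump. *)
Lemma bump'_sign x : (x <= (s + t) / 2 -> 0 <= bump' x) /\ ((s + t) / 2 <= x -> bump' x <= 0).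
Proof.
have [h|h] := boolP (s < x < t); last by rewrite bump'_out.
rewrite bump'_factor; have b0 := bump_ge0 x; move: h => /andP[sx xt].
have a0 : 0 < x - s by lra.
have c0 : 0 < t - x by lra.
have ki : 0 <= k^-1 by rewrite invr_ge0 ltW.
split => hx.
  apply: mulr_ge0 => //; apply: mulr_ge0 => //.
  rewrite subr_ge0 lef_pV2 ?posrE ?exprn_gt0//; apply: lerXn2r; rewrite ?nnegrE; [exact/ltW|exact/ltW|lra].
apply: mulr_le0_ge0 => //; apply: mulr_ge0_le0 => //.
rewrite subr_le0 lef_pV2 ?posrE ?exprn_gt0//; apply: lerXn2r; rewrite ?nnegrE; [exact/ltW|exact/ltW|lra].
Qed.

Lemma bump_time_test T : 0 < s -> t < T -> time_test T bump.
Proof.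
move=> s0 tT; split; first by move=> j x; exact: bump_sum_smooth.
exists s, t; split => // x; rewrite in_itv/= => h; apply: bump_out; apply: contra h => /andP[a b].
by rewrite !ltW.
Qed.

Lemma is_derive_bump x : is_derive x 1 bump (bump' x).
Proof. exact: is_derive_bump_sum. Qed.

End Bumps.

Lemma bump_cvg {R : realType} (s t x : R) :
  (fun j => bump s t j.+1%:R x) @ \oo --> ((s < x < t)%R%:R : R).
Proof.
have [h|h] := boolP (s < x < t); last first.
  rewrite (_ : (fun j => _) = cst 0); first exact: cvg_cst.
  by apply/funext => j; rewrite bump_out// ltr0n.
rewrite (_ : (fun j => _) = fun j => expR (- (j.+1%:R^-1 * ((x - s)^-1 + (t - x)^-1)))); last first.
  by apply/funext => j; rewrite bump_in// ltr0n.
have c : (fun j => - (j.+1%:R^-1 * ((x - s)^-1 + (t - x)^-1))) @ \oo --> (0 : R).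
  have -> : 0 = - (0 * ((x - s)^-1 + (t - x)^-1)) :> R by rewrite mul0r oppr0.
  exact: (cvgN (cvgM (@cvg_harmonic R) (cvg_cst _))).
rewrite -[X in _ --> X](@expR0 R).
exact: (continuous_cvg _ (@continuous_expR R 0) c).
Qed.

(** * Derivatives of cutoffs as approximate Dirac masses *)

Section AbsoluteContinuity.
Context {R : realType}.
Local Notation mu := (@lebesgue_measure R).
Local Notation RR := (measurableTypeR R).
Implicit Types (a b x s t : R) (c f g : R -> R).

Lemma itv_integrable c a b : {within `[a, b], continuous c} -> mu.-integrable `[a, b] (EFin \o c).
Proof. by move=> h; apply: continuous_compact_integrable => //; exact: segment_compact. Qed.

Lemma Rintegral_split f a b x : a <= x -> x <= b -> mu.-integrable `[a, b] (EFin \o f) ->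
  \int[mu]_(y in `[a, b]) f y = \int[mu]_(y in `[a, x]) f y + \int[mu]_(y in `[x, b]) f y.
Proof.
move=> ax xb If.
have := @Rintegral_itvB R f (BLeft a) (BRight b) x If; rewrite !bnd_simp => /(_ ax xb).
rewrite Rintegral_itv_obnd_cbnd; first by move=> <-; rewrite addrC subrK.
apply: integrableS If => //.
by apply: subset_itv; rewrite bnd_simp.
Qed.

Lemma FTC_continuous (f F : R -> R) a b : a < b -> continuous f -> (forall x, is_derive x 1 F (f x)) ->
  \int[mu]_(x in `[a, b]) f x = F b - F a.
Proof.
move=> ab cf dF; have cF : continuous F.
  by move=> x; apply: differentiable_continuous; apply/derivable1_diffP; have d := dF x; exact: ex_derive.
rewrite /Rintegral (@continuous_FTC2 R f F a b)//.
- exact: continuous_subspaceT.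
- split; first by move=> x _; have d := dF x; exact: ex_derive.
    by apply: cvg_at_right_filter; exact: cF.
  by apply: cvg_at_left_filter; exact: cF.
- by move=> x _; rewrite derive1E; have d := dF x; exact: derive_val.
Qed.

(** [sg] is the constant sign of [f] on the piece, so [sg * (F b - F a)] is the integral of its
    modulus. *)
Lemma mono_piece c f F a b (c0 w sg : R) : a < b -> {within `[a, b], continuous c} -> continuous f ->
  (forall x, is_derive x 1 F (f x)) -> sg * sg = 1 -> (forall x, a <= x <= b -> 0 <= sg * f x) ->
  (forall x, a <= x <= b -> `|c x - c0| <= w) ->
  `|\int[mu]_(x in `[a, b]) (c x * f x) - c0 * (F b - F a)| <= w * (sg * (F b - F a)).
Proof.
move=> ab cc cf dF sg2 fs cw.
have mI : measurable (`[a, b] : set RR) by exact: measurable_itv.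
have Wf : {within `[a, b], continuous f} by exact: continuous_subspaceT.
have If := itv_integrable Wf.
have Icf : mu.-integrable `[a, b] (EFin \o (fun x => c x * f x)).
  apply: itv_integrable; move=> x; apply: cvgM; [exact: cc|exact: Wf].
rewrite -(FTC_continuous ab cf dF) -(RIZl mI c0 If) -(RIZl mI sg If).
rewrite -RIB//; last exact: itgZl.
have Isf : mu.-integrable `[a, b] (EFin \o (fun x => sg * f x)) by exact: itgZl.
rewrite -(RIZl mI w Isf).
have Id : mu.-integrable `[a, b] (EFin \o (fun x => c x * f x - c0 * f x)) by apply: itgB => //; exact: itgZl.
apply: le_trans (RI_norm mI Id) _; apply: RI_le => //.
- exact: (integrable_abse Id).
- exact: itgZl.
move=> x; rewrite /= in_itv/= => xab; rewrite -mulrBl normrM; apply: ler_pM => //; first exact: cw.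
have s1 : `|sg| = 1.
  have n0 := normr_ge0 sg; have : `|sg| * `|sg| = 1 by rewrite -normrM sg2 normr1.
  nra.
by rewrite -[leLHS]mul1r -s1 -normrM ger0_norm ?fs.
Qed.

(** [q1], [m], [q2] are the heights of the bump at the left cut, the midpoint and the right cut; the
    four estimates come from its monotone pieces. *)
Lemma concentrate_arith (M e m q1 q2 i1 i2 i3 i4 cs ct : R) :
  0 <= M -> 0 <= e -> q1 <= 1 -> q2 <= 1 -> m <= 1 ->
  `|i1 - cs * (q1 - 0)| <= e * (1 * (q1 - 0)) -> `|i2 - cs * (m - q1)| <= 2 * M * (1 * (m - q1)) ->
  `|i3 - ct * (q2 - m)| <= 2 * M * (-1 * (q2 - m)) -> `|i4 - ct * (0 - q2)| <= e * (-1 * (0 - q2)) ->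
  `|i1 + i2 + (i3 + i4) - (cs - ct) * m| <= 2 * e + 2 * M * (2 - q1 - q2).
Proof.
move=> M0 e0 h1 h2 h3; rewrite !ler_norml => /andP[a1 a2] /andP[b1 b2] /andP[c1 c2] /andP[d1 d2].
have : 0 <= e * (1 - q1) by rewrite mulr_ge0// subr_ge0.
have : 0 <= e * (1 - q2) by rewrite mulr_ge0// subr_ge0.
have : 0 <= M * (1 - m) by rewrite mulr_ge0// subr_ge0.
by move=> *; apply/andP; split; lra.
Qed.

Lemma concentrate_limit_arith (e M d m q1 q2 i : R) : 0 <= e -> m <= 1 -> `|i - d * m| <= 2 * (e / 8) + 2 * M * (2 - q1 - q2) ->
  `| `|d| * (1 - 1) + 2 * (e / 8) + 2 * M * (2 - 1 - 1) - (`|d| * (1 - m) + 2 * (e / 8) + 2 * M * (2 - q1 - q2))| <= e / 8 ->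
  `|d - i| <= e.
Proof.
move=> e0 m1 h; rewrite ler_norml => /andP[a1 a2].
have hd : `|d * (1 - m)| = `|d| * (1 - m) by rewrite normrM [X in _ * X]ger0_norm// subr_ge0.
have -> : d - i = d * (1 - m) - (i - d * m) by ring.
by apply: le_trans (ler_normB _ _) _; rewrite hd; lra.
Qed.

Section Limit.
Variables (c : R -> R) (s t : R).
Hypotheses (st : s < t) (cc : {within `[s, t], continuous c}).

(* The bumps tend to the indicator of ]s, t[, so their derivatives tend to the
   difference of the Dirac masses at s and at t. *)
Lemma bump'_concentrate :
  (fun j => \int[mu]_(x in `[s, t]) (c x * bump' s t j.+1%:R x)) @ \oo --> c s - c t.
Proof.
pose mid := (s + t) / 2.
have smid : s < mid by rewrite midf_lt.
have midt : mid < t by rewrite midf_lt.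
have [M hM] : exists M, forall x, s <= x <= t -> `|c x| <= M.
  have cn : {within `[s, t], continuous (fun x => `|c x|)} by move=> x; apply: cvg_norm; exact: cc.
  have [y _ hy] := EVT_max (ltW st) cn; exists `|c y| => x h; apply: hy; by rewrite in_itv.
have M0 : 0 <= M by apply: le_trans (hM s _) => //; rewrite lexx ltW.
have M2 z x : s <= z <= t -> s <= x <= t -> `|c x - c z| <= 2 * M.
  move=> h1 h2; apply: le_trans (ler_normB _ _) _; have := hM _ h1; have := hM _ h2; lra.
have [cx cs ct] := (continuous_within_itvP c st).1 cc.
apply/cvgrPdist_le => e e0.
pose e1 := e / 8; have e10 : 0 < e1 by rewrite /e1; lra.
(* Up to the cut [q1], and beyond [q2], the function is close to its end value. Between them only
   its boundedness is used: there a steep bump is nearly 1, so its derivative has little mass. *)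
have [q1 [sq1 q1m hq1]] : exists q1, [/\ s < q1, q1 < mid & forall x, s <= x <= q1 -> `|c x - c s| <= e1].
  move/cvgrPdist_le : cs => /(_ e1 e10); rewrite near_withinE => -[d /= d0 hd].
  exists (s + Num.min (d / 2) ((mid - s) / 2)).
  have m1 : Num.min (d / 2) ((mid - s) / 2) <= d / 2 by rewrite ge_min lexx.
  have m2 : Num.min (d / 2) ((mid - s) / 2) <= (mid - s) / 2 by rewrite ge_min lexx orbT.
  have m3 : 0 < Num.min (d / 2) ((mid - s) / 2) by rewrite lt_min; apply/andP; split; lra.
  split; [lra|lra|] => x /andP[sx xq]; have [->|xs] := eqVneq x s; first by rewrite subrr normr0 ltW.
  rewrite distrC; apply: hd; last by rewrite lt_neqAle eq_sym xs.
  by rewrite /ball /= distrC ger0_norm; lra.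
have [q2 [mq2 q2t hq2]] : exists q2, [/\ mid < q2, q2 < t & forall x, q2 <= x <= t -> `|c x - c t| <= e1].
  move/cvgrPdist_le : ct => /(_ e1 e10); rewrite near_withinE => -[d /= d0 hd].
  exists (t - Num.min (d / 2) ((t - mid) / 2)).
  have m1 : Num.min (d / 2) ((t - mid) / 2) <= d / 2 by rewrite ge_min lexx.
  have m2 : Num.min (d / 2) ((t - mid) / 2) <= (t - mid) / 2 by rewrite ge_min lexx orbT.
  have m3 : 0 < Num.min (d / 2) ((t - mid) / 2) by rewrite lt_min; apply/andP; split; lra.
  split; [lra|lra|] => x /andP[qx xt]; have [->|xs] := eqVneq x t; first by rewrite subrr normr0 ltW.
  rewrite distrC; apply: hd; last by rewrite lt_neqAle xs.
  by rewrite /ball /= ger0_norm; lra.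
have sub a b : s <= a -> b <= t -> {within `[a, b], continuous c}.
  move=> sa bt; apply: continuous_subspaceW cc => x; rewrite /= !in_itv/= => /andP[h1 h2].
  by rewrite (le_trans sa h1) (le_trans h2 bt).
have B k (k0 : 0 < k) : `|\int[mu]_(x in `[s, t]) (c x * bump' s t k x) - (c s - c t) * bump s t k mid| <=
   2 * e1 + 2 * M * (2 - bump s t k q1 - bump s t k q2).
  have cb : continuous (bump' s t k) by exact: bump_sum_continuous.
  have db x : is_derive x 1 (bump s t k) (bump' s t k x) by exact: is_derive_bump.
  have Ib : mu.-integrable `[s, t] (EFin \o (fun x => c x * bump' s t k x)).
    by apply: itv_integrable => x; apply: cvgM; [exact: cc|apply: continuous_subspaceT].
  have Is a b : s <= a -> b <= t -> mu.-integrable `[a, b] (EFin \o (fun x => c x * bump' s t k x)).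
    move=> sa bt; apply: integrableS Ib; [exact: measurable_itv|exact: measurable_itv|].
    by apply: subset_itv; rewrite bnd_simp.
  have p1 x : s <= x <= q1 -> 0 <= 1 * bump' s t k x.
    by rewrite mul1r => /andP[_ h]; apply: (bump'_sign s t k0 x).1; rewrite -/mid; lra.
  have p2 x : q1 <= x <= mid -> 0 <= 1 * bump' s t k x.
    by rewrite mul1r => /andP[_ h]; apply: (bump'_sign s t k0 x).1.
  have p3 x : mid <= x <= q2 -> 0 <= -1 * bump' s t k x.
    by rewrite mulN1r oppr_ge0 => /andP[h _]; apply: (bump'_sign s t k0 x).2.
  have p4 x : q2 <= x <= t -> 0 <= -1 * bump' s t k x.
    by rewrite mulN1r oppr_ge0 => /andP[h _]; apply: (bump'_sign s t k0 x).2; rewrite -/mid; lra.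
  have N1 : -1 * -1 = 1 :> R by rewrite mulrNN mulr1.
  have s_in : s <= s <= t by rewrite lexx ltW.
  have t_in : s <= t <= t by rewrite lexx ltW.
  have tq1 : q1 <= t by lra.
  have tm : mid <= t by lra.
  have sq1' : s <= q1 by lra.
  have sm : s <= mid by lra.
  have sq2 : s <= q2 by lra.
  have tq2 : q2 <= t by lra.
  have m1 x : q1 <= x <= mid -> `|c x - c s| <= 2 * M by move=> /andP[h1 h2]; apply: M2 => //; apply/andP; split; lra.
  have m2 x : mid <= x <= q2 -> `|c x - c t| <= 2 * M by move=> /andP[h1 h2]; apply: M2 => //; apply/andP; split; lra.
  have b1 := mono_piece sq1 (sub _ _ (lexx s) tq1) cb db (mul1r 1) p1 hq1.
  have b2 := mono_piece q1m (sub _ _ sq1' tm) cb db (mul1r 1) p2 m1.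
  have b3 := mono_piece mq2 (sub _ _ sm tq2) cb db N1 p3 m2.
  have b4 := mono_piece q2t (sub _ _ sq2 (lexx t)) cb db N1 p4 hq2.
  rewrite (Rintegral_split sm tm Ib) (Rintegral_split sq1' (ltW q1m) (Is _ _ (lexx s) tm)).
  rewrite (Rintegral_split (ltW mq2) tq2 (Is _ _ sm (lexx t))).
  have z1 : bump s t k s = 0 by apply: bump_out => //; rewrite ltxx.
  have z2 : bump s t k t = 0 by apply: bump_out => //; rewrite ltxx andbF.
  have l1 := bump_le1 s t k0 q1; have l2 := bump_le1 s t k0 q2; have l3 := bump_le1 s t k0 mid.
  rewrite z1 in b1; rewrite z2 in b4.
  apply: (concentrate_arith M0 (ltW e10) l1 l2 l3 b1 b2 b3 b4).
have lim : (fun j => `|c s - c t| * (1 - bump s t j.+1%:R mid) + 2 * e1 +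
     2 * M * (2 - bump s t j.+1%:R q1 - bump s t j.+1%:R q2)) @ \oo --> `|c s - c t| * (1 - 1) + 2 * e1 + 2 * M * (2 - 1 - 1).
  have L x : s < x -> x < t -> (fun j => bump s t j.+1%:R x) @ \oo --> (1 : R).
    by move=> h1 h2; have := @bump_cvg R s t x; rewrite h1 h2.
  have L1 := L mid smid midt.
  have L2 : (fun j => bump s t j.+1%:R q1) @ \oo --> (1 : R) by apply: L => //; lra.
  have L3 : (fun j => bump s t j.+1%:R q2) @ \oo --> (1 : R) by apply: L => //; lra.
  apply: cvgD; first apply: cvgD; [|exact: cvg_cst|].
    by apply: cvgM; [exact: cvg_cst|apply: cvgB => //; exact: cvg_cst].
  by apply: cvgM; [exact: cvg_cst|apply: cvgB => //; apply: cvgB => //; exact: cvg_cst].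
move/cvgrPdist_le : lim => /(_ e1 e10); apply: filterS => j.
have := B j.+1%:R; rewrite ltr0n => /(_ isT).
by apply: concentrate_limit_arith; [exact: ltW|apply: bump_le1; rewrite ltr0n].
Qed.

End Limit.
End AbsoluteContinuity.

(** * Absolutely continuous functions *)

Section ProductRule.
Context {R : realType}.
Local Notation mu := (@lebesgue_measure R).
Local Notation RR := (measurableTypeR R).
Implicit Types (x y : R) (A B : R -> R).

Definition before y x : R := (y < x)%R%:R.

Lemma before_measurable : measurable_fun setT (fun z : RR * RR => before z.2 z.1).
Proof.
have h : measurable_fun setT (fun z : RR * RR => z.2 < z.1).
  by apply: measurable_fun_ltr; [exact: measurable_snd|exact: measurable_fst].
rewrite (_ : (fun z => _) = \1_[set z : RR * RR | z.2 < z.1]).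
  apply: measurable_indic; rewrite -[X in measurable X]setTI.
  rewrite (_ : [set z | _] = (fun z : RR * RR => z.2 < z.1) @^-1` [set true]); first exact: h.
  by apply/seteqP; split => z /=.
apply/funext => z; rewrite indicE /before; congr ((nat_of_bool _)%:R).
by apply/idP/idP; rewrite inE.
Qed.

Lemma before_measurable1 x : measurable_fun [set: RR] (fun y => before y x).
Proof.
apply: (measurableT_comp before_measurable (g := fun y : RR => (x, y))).
exact: pair1_measurable.
Qed.

Lemma before_measurable2 y : measurable_fun [set: RR] (fun x => before y x).
Proof.
apply: (measurableT_comp before_measurable (g := fun x : RR => (x, y))).
exact: pair2_measurable.
Qed.

Lemma before_le1 y x : `|before y x| <= 1.
Proof. by rewrite /before; case: (_ < _); rewrite ?normr1 ?normr0. Qed.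

Lemma between_measurable (s t : R) : measurable_fun [set: RR] (fun x : RR => (s < x < t)%R%:R : R).
Proof.
rewrite (_ : (fun x => _) = \1_(`]s, t[)); first by apply: measurable_indic; exact: measurable_itv.
by apply/funext => x; rewrite indicE; congr ((nat_of_bool _)%:R); rewrite mem_setE in_itv.
Qed.

Lemma itg_before (f g : R -> R) : mu.-integrable setT (EFin \o f) ->
  measurable_fun [set: RR] g -> (forall x, `|g x| <= 1) -> mu.-integrable setT (EFin \o (fun x => f x * g x)).
Proof.
move=> If mg g1; have := itg_bddM measurableT If mg (fun x _ => g1 x).
by apply: itg_eq => // x _; rewrite mulrC.
Qed.

Lemma itg_before_le A : mu.-integrable setT (EFin \o A) -> forall y,
  mu.-integrable setT (EFin \o (fun x => A x * before x y)).
Proof. by move=> h y; apply: itg_before => //; [exact: before_measurable1|move=> x; exact: before_le1]. Qed.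

Lemma itg_before_ge A : mu.-integrable setT (EFin \o A) -> forall y,
  mu.-integrable setT (EFin \o (fun x => A x * before y x)).
Proof. by move=> h y; apply: itg_before => //; [exact: before_measurable2|move=> x; exact: before_le1]. Qed.

Lemma itg_before_product A B : mu.-integrable setT (EFin \o A) -> mu.-integrable setT (EFin \o B) ->
  (mu \x mu)%E.-integrable setT (EFin \o (fun z : RR * RR => A z.1 * (B z.2 * before z.2 z.1))).
Proof.
move=> hA hB.
have mA : measurable_fun [set: RR] A by apply/measurable_EFinP; exact: (measurable_int _ hA).
have mB : measurable_fun [set: RR] B by apply/measurable_EFinP; exact: (measurable_int _ hB).
set f := fun z : RR * RR => _.
have mf : measurable_fun setT (EFin \o f).
  apply/measurable_EFinP; apply: measurable_funM; first exact: (measurableT_comp mA).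
  by apply: measurable_funM; [exact: (measurableT_comp mB)|exact: before_measurable].
apply/integrable12ltyP => //.
pose K := \int[mu]_y `|B y|.
have IAK : mu.-integrable setT (EFin \o (fun x => K * `|A x|)).
  by apply: itgZl => //; exact: (integrable_abse hA).
have /integrableP[_ hAK] := IAK.
apply: le_lt_trans hAK; apply: ge0_integral_mono => x; first by apply: integral_ge0.
have I1 := itg_before_le hB x.
have nI : mu.-integrable setT (EFin \o (fun y => `|A x| * `|B y * before y x|)).
  by apply: itgZl => //; exact: (integrable_abse I1).
rewrite (_ : (fun y => _) = (fun y => (`|A x| * `|B y * before y x|)%:E)); last first.
  by apply/funext => y; rewrite /f /= normrM.
rewrite -(RI_EFin measurableT nI) lee_fin /= RIZl//; last exact: (integrable_abse I1).
have K0 : 0 <= K by apply: RI_ge0.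
rewrite mulrC (ger0_norm (mulr_ge0 K0 (normr_ge0 _))); apply: ler_wpM2r => //.
apply: RI_le => //; [exact: (integrable_abse I1)|exact: (integrable_abse hB)|].
by move=> y _; rewrite normrM -[leRHS]mulr1; apply: ler_wpM2l => //; exact: before_le1.
Qed.

Lemma itg_before_int A B : mu.-integrable setT (EFin \o A) -> mu.-integrable setT (EFin \o B) ->
  mu.-integrable setT (EFin \o (fun x => A x * \int[mu]_y (B y * before y x))).
Proof.
move=> hA hB; have := integrable_fubini_F (itg_before_product hA hB).
apply: eq_integrable => // x _; rewrite /fubini_F /=.
have I1 := itg_before_le hB x.
by rewrite -RIZl// RI_EFin//; exact: itgZl.
Qed.

(* Fubini on the two triangles y < x and x < y of the plane. *)
Lemma product_rule_line A B : mu.-integrable setT (EFin \o A) -> mu.-integrable setT (EFin \o B) ->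
  (\int[mu]_x A x) * (\int[mu]_x B x) =
  \int[mu]_x (A x * \int[mu]_y (B y * before y x)) + \int[mu]_y (B y * \int[mu]_x (A x * before x y)).
Proof.
move=> hA hB; set IA := \int[mu]_x A x; set IB := \int[mu]_x B x.
have F := Fubini (itg_before_product hA hB).
have E1 x : (\int[mu]_y (A x * (B y * before y x))%:E)%E = (A x * \int[mu]_y (B y * before y x))%:E.
  have I := itg_before_le hB x.
  by rewrite -(RIZl measurableT (A x) I) (RI_EFin measurableT (itgZl measurableT (A x) I)).
have E2 y : (\int[mu]_x (A x * (B y * before y x))%:E)%E = (B y * \int[mu]_x (A x * before y x))%:E.
  have I := itg_before_ge hA y.
  rewrite -(RIZl measurableT (B y) I) (RI_EFin measurableT (itgZl measurableT (B y) I)).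
  by apply: eq_integral => x _; rewrite mulrCA.
have -> : \int[mu]_x (A x * \int[mu]_y (B y * before y x)) = \int[mu]_y (B y * \int[mu]_x (A x * before y x)).
  rewrite /Rintegral; congr fine; move: F => /=.
  under eq_integral do rewrite E1; under [X in _ = X -> _]eq_integral do rewrite E2.
  by [].
have E3 y : \int[mu]_x (A x * before y x) = IA - \int[mu]_x (A x * before x y).
  rewrite -(RIB measurableT hA (itg_before_le hA y)).
  have cn (h : R -> R) : \int[mu]_x h x = \int[mu]_(x in [set: RR] `\ y) h x.
    apply: Rintegral_conull; [exact: measurableT|by apply: measurableD|by []|].
    by rewrite setDD setTI; exact: lebesgue_measure_set1.
  rewrite cn [RHS]cn; apply: eq_Rintegral => x; rewrite inE => -[_ /= xy]; rewrite /before.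
  by case: (ltgtP y x) => [_|_|e]; [rewrite mulr0 mulr1 subr0|rewrite mulr1 mulr0 subrr|case: xy].
have IBB := itg_before_int hB hA.
have hBI : mu.-integrable setT (EFin \o (fun y => IA * B y)) by exact: itgZl.
have -> : \int[mu]_y (B y * \int[mu]_x (A x * before y x)) =
    \int[mu]_y (IA * B y - B y * \int[mu]_x (A x * before x y)).
  by apply: eq_Rintegral => y _; rewrite E3 mulrBr mulrC.
by rewrite (RIB measurableT hBI IBB) (RIZl measurableT IA hB) subrK.
Qed.

(** Integration by parts for two primitives. Extension by zero off [F] reduces it to the line, and
    the initial values enter linearly. *)
Lemma product_rule (F : set RR) A B (p q : R -> R) (p0 q0 : R) : measurable F ->
  mu.-integrable F (EFin \o A) -> mu.-integrable F (EFin \o B) ->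
  (forall x, F x -> p x = p0 + \int[mu]_(y in F) (A y * before y x)) ->
  (forall x, F x -> q x = q0 + \int[mu]_(y in F) (B y * before y x)) ->
  mu.-integrable F (EFin \o (fun x => A x * q x + p x * B x)) /\
  (p0 + \int[mu]_(x in F) A x) * (q0 + \int[mu]_(x in F) B x) =
  p0 * q0 + \int[mu]_(x in F) (A x * q x + p x * B x).
Proof.
move=> mF hA hB hp hq.
have res (g : R -> R) : mu.-integrable F (EFin \o g) <-> mu.-integrable setT (EFin \o (g \_ F)).
  rewrite integrable_mkcond//; split; apply: eq_integrable => // x _; rewrite /= /patch; case: ifP => //.
have resI (g : R -> R) : \int[mu]_(x in F) g x = \int[mu]_x (g \_ F) x by rewrite Rintegral_mkcond.
have resb (g : R -> R) x : \int[mu]_(y in F) (g y * before y x) = \int[mu]_y ((g \_ F) y * before y x).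
  by rewrite resI; apply: eq_Rintegral => y _; rewrite /patch; case: ifP; rewrite ?mul0r.
have hA' := (res A).1 hA; have hB' := (res B).1 hB.
have J (C D : R -> R) : mu.-integrable F (EFin \o C) -> mu.-integrable F (EFin \o D) ->
    mu.-integrable F (EFin \o (fun x => C x * \int[mu]_(y in F) (D y * before y x))).
  move=> hC hD; apply/res; have := itg_before_int ((res C).1 hC) ((res D).1 hD).
  by apply: eq_integrable => // x _; rewrite /= /patch; case: ifP => _; rewrite ?mul0r// resb.
have J1 := J A B hA hB; have J2 := J B A hB hA.
have K1 : mu.-integrable F (EFin \o (fun x => q0 * A x)) by exact: itgZl.
have K2 : mu.-integrable F (EFin \o (fun x => p0 * B x)) by exact: itgZl.
have K12 := itgD mF K1 K2; have J12 := itgD mF J1 J2.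
have e x : F x -> A x * q x + p x * B x = q0 * A x + p0 * B x +
    (A x * \int[mu]_(y in F) (B y * before y x) + B x * \int[mu]_(y in F) (A y * before y x)).
  by move=> Fx; rewrite hp// hq//; ring.
split.
  by apply: (itg_eq mF _ (itgD mF K12 J12)) => x Fx; rewrite e.
have -> : \int[mu]_(x in F) (A x * q x + p x * B x) = \int[mu]_(x in F) (q0 * A x + p0 * B x +
    (A x * \int[mu]_(y in F) (B y * before y x) + B x * \int[mu]_(y in F) (A y * before y x))).
  by apply: eq_Rintegral => x; rewrite inE; exact: e.
rewrite (RID mF K12 J12) (RID mF K1 K2) (RID mF J1 J2) !RIZl//.
have := product_rule_line hA' hB'.
rewrite -!resI => hP.
have e1 (C D : R -> R) : \int[mu]_(x in F) (C x * \int[mu]_(y in F) (D y * before y x)) =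
    \int[mu]_x ((C \_ F) x * \int[mu]_y ((D \_ F) y * before y x)).
  rewrite resI; apply: eq_Rintegral => x _; rewrite /patch; case: ifP; rewrite ?mul0r// resb//.
rewrite !e1 -hP; ring.
Qed.

Variables (T : R) (E : set RR) (c d : R -> R).
Hypotheses (fE : full T E) (cc : {within `[0, T], continuous c}) (Id : mu.-integrable E (EFin \o d)).
Hypothesis wd : forall psi, time_test T psi ->
  \int[mu]_(t in `]0, T[) (d t * psi t) = - \int[mu]_(t in `]0, T[) (c t * derive1 psi t).

(** The weak identity is tested with bumps of growing steepness: against [d] they converge to an
    indicator by domination, against [c] their derivatives concentrate at [s] and [t]. *)
Lemma weak_derivative_between s t : 0 < s -> s < t -> t < T ->
  c t - c s = \int[mu]_(x in E) (d x * (s < x < t)%R%:R).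
Proof.
move=> s0 st tT; have [mE sE E0] := fE.
have md : measurable_fun E d := itg_measurable Id.
have ind_cvg x : (fun j => d x * bump s t j.+1%:R x) @ \oo --> d x * (s < x < t)%R%:R.
  by apply: cvgM; [exact: cvg_cst|exact: bump_cvg].
have mb j : measurable_fun E (fun x => d x * bump s t j.+1%:R x).
  apply: measurable_funM => //; apply: measurable_funTS.
  by apply: continuous_measurable_fun; exact: bump_sum_continuous.
have [] := @RI_dct _ _ _ mu E mE (fun j x => d x * bump s t j.+1%:R x) (fun x => d x * (s < x < t)%R%:R) (fun x => `|d x|).
- exact: mb.
- by apply: (@measurable_fun_cvg _ _ _ _ (fun j x => d x * bump s t j.+1%:R x)) => // x _; exact: ind_cvg.
- by apply: aeW => x _; exact: ind_cvg.
- exact: (integrable_abse Id).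
- apply: aeW => x j _; rewrite normrM -[leRHS]mulr1; apply: ler_wpM2l => //.
  by rewrite ger0_norm ?bump_ge0 ?bump_le1 ?ltr0n.
move=> _ ind.
have L2 := bump'_concentrate st (continuous_subspaceW _ cc).
have {}L2 : (fun j => \int[mu]_(x in `[s, t]) (c x * bump' s t j.+1%:R x)) @ \oo --> c s - c t.
  apply: L2 => x /=; rewrite !in_itv/= => /andP[a b].
  by rewrite (le_trans (ltW s0) a) (le_trans b (ltW tT)).
have e j : \int[mu]_(x in E) (d x * bump s t j.+1%:R x) = - \int[mu]_(x in `[s, t]) (c x * bump' s t j.+1%:R x).
  have -> : \int[mu]_(x in E) (d x * bump s t j.+1%:R x) = \int[mu]_(x in `]0, T[) (d x * bump s t j.+1%:R x).
    by apply/esym/Rintegral_conull => //; exact: measurable_itv.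
  rewrite wd; last by apply: bump_time_test => //; rewrite ltr0n.
  congr (- _); rewrite derive1_bump_sum -/(bump' s t j.+1%:R).
  rewrite Rintegral_mkcond [RHS]Rintegral_mkcond; apply: eq_Rintegral => x _.
  rewrite /patch !mem_setE !in_itv/=.
  case: ifPn => hx; case: ifPn => hy //.
    rewrite bump'_out ?mulr0 ?ltr0n//; apply: contra hy => /andP[a b]; by rewrite !ltW.
  move: hy => /andP[a b]; case/negP: hx; by rewrite (lt_le_trans s0 a) (le_lt_trans b tT).
have L1 : (fun j => \int[mu]_(x in E) (d x * bump s t j.+1%:R x)) @ \oo --> - (c s - c t).
  by rewrite (funext e); exact: (cvgN L2).
by have := cvg_unique _ L1 ind => <-//; rewrite opprB.
Qed.

Lemma weak_derivative_AC t : 0 < t -> t < T ->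
  c t = c 0 + \int[mu]_(x in E) (d x * before x t).
Proof.
move=> t0 tT; have [mE sE E0] := fE.
have md : measurable_fun E d := itg_measurable Id.
(* Left end points strictly between 0 and [t] that tend to 0, where right continuity of [c] supplies
   the initial value; the shift by 2 keeps them below [t]. *)
pose s (j : nat) : R := t * (j.+2%:R^-1).
have sp j : 0 < s j by rewrite mulr_gt0// invr_gt0 ltr0n.
have st j : s j < t by rewrite /s gtr_pMr// invf_lt1 ?ltr0n// ltr1n.
have sc : s @ \oo --> 0.
  rewrite -(mulr0 t); apply: cvgM; first exact: cvg_cst.
  by have := @cvg_harmonic R; rewrite -cvg_shiftS.
have [_ c0 _] := (continuous_within_itvP c (lt_trans t0 tT)).1 cc.
have L1 : (fun j => c t - c (s j)) @ \oo --> c t - c 0.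
  apply: cvgB; first exact: cvg_cst.
  by move/cvg_at_rightP : c0; apply.
have ind_cvg x : 0 < x -> (fun j => d x * (s j < x < t)%R%:R) @ \oo --> d x * before x t.
  move=> x0; apply: cvgM; first exact: cvg_cst.
  apply: cvg_near_cst; have : \forall j \near \oo, s j < x by apply: (cvgr_lt _ sc).
  by apply: filterS => j hj; rewrite hj.
have [] := @RI_dct _ _ _ mu E mE (fun j x => d x * (s j < x < t)%R%:R) (fun x => d x * before x t) (fun x => `|d x|).
- by move=> j; apply: measurable_funM => //; apply: measurable_funTS; exact: between_measurable.
- by apply: measurable_funM => //; apply: measurable_funTS; exact: before_measurable1.
- by apply: aeW => x /sE; rewrite /= in_itv/= => /andP[x0 _]; exact: ind_cvg.
- exact: (integrable_abse Id).
- apply: aeW => x j _; rewrite normrM -[leRHS]mulr1; apply: ler_wpM2l => //.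
  by case: (_ && _); rewrite ?normr1 ?normr0.
move=> _ L2; move: L1.
rewrite (_ : (fun j => c t - c (s j)) = fun j => \int[mu]_(x in E) (d x * (s j < x < t)%R%:R)); last first.
  by apply/funext => j; exact: weak_derivative_between.
move=> L1; have := cvg_unique _ L1 L2 => <-//; by rewrite addrC subrK.
Qed.

End ProductRule.

(** * The viscosity tensor at a fixed time *)

Section Sections.
Context d1 d2 (T1 : measurableType d1) (T2 : measurableType d2) (R : realType).
Variables (m1 : {sigma_finite_measure set T1 -> \bar R}) (m2 : {sigma_finite_measure set T2 -> \bar R}).

(** By Tonelli the measures of the sections of a null set integrate to 0, so almost all of them
    vanish. *)
Lemma ae_section (P : T1 * T2 -> Prop) : {ae (m1 \x m2)%E, forall z, P z} ->
  {ae m2, forall t, {ae m1, forall y, P (y, t)}}.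
Proof.
move=> [Z [mZ Z0 hZ]].
pose f (z : T1 * T2) : \bar R := (\1_Z z)%:E.
have mf : measurable_fun setT f by apply/measurable_EFinP; exact: measurable_indic.
have f0 z : (0 <= f z)%E by rewrite lee_fin.
have mS : measurable_fun [set: T2] (m1 \o ysection Z) by exact: measurable_fun_ysection.
have I0 : (\int[m2]_t `|(m1 \o ysection Z) t| = 0)%E.
  under eq_integral do rewrite gee0_abs//.
  rewrite -(indic_fubini_tonelli_GE m1 mZ).
  have <- := fubini_tonelli2 (m1 := m1) (m2 := m2) f mf f0.
  rewrite /f integral_indic//; rewrite setIT; exact: Z0.
have := (ae_eq_integral_abs m2 measurableT mS).1 I0.
apply: filterS => t /(_ I) /= h; exists (ysection Z t); split => //; first exact: measurable_ysection.
by move=> y /= hy; rewrite /ysection /= inE; exact: hZ.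
Qed.

End Sections.

Section Tensor.
Context {R : realType} {n : nat}.
Local Notation mu := (@lebesgue_measure R).
Local Notation RR := (measurableTypeR R).
Local Notation TT := (n.-tuple (measurableTypeR R)).
Implicit Types (T : R) (E : set RR).

Lemma full_all T (I : finType) (P : I -> R -> Prop) :
  (forall i, exists E, full T E /\ forall t, E t -> P i t) ->
  exists E, full T E /\ forall t, E t -> forall i, P i t.
Proof.
move=> h.
suff [E [fE hE]] : exists E, full T E /\ forall t, E t -> forall i, i \in enum I -> P i t.
  by exists E; split => // t Et i; apply: hE => //; rewrite mem_enum.
elim: (enum I) => [|i s [E [fE hE]]].
  have [E [fE _]] := @full_ae R T (fun=> True) (aeW _ (fun _ _ => Logic.I)).
  by exists E; split.
have [F [fF hF]] := h i; exists (E `&` F); split; first exact: fullI.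
by move=> t [Et Ft] j; rewrite inE => /orP[/eqP -> | js]; [exact: hF|exact: hE].
Qed.

Lemma full_ae_xt T (P : 'rV[R]_n -> R -> Prop) : ae_xt T P ->
  exists E, full T E /\ forall t, E t -> {ae torus n, forall y : TT, P (row_of y) t}.
Proof.
move=> h; have hs := @ae_section _ _ TT RR R (torus n) mu _ h.
have [E [fE hE]] : exists E, full T E /\ forall t, E t -> {ae torus n, forall y : TT, t \in `]0, T[ -> P (row_of y) t}.
  by apply: full_ae; apply: filterS hs.
exists E; split => // t Et; have [_ sE _] := fE.
by apply: filterS (hE t Et) => y; apply; exact: sE.
Qed.

(** The entries are finitely many, so their exceptional sets of times can be joined and their bounds
    summed into one [M]; sections of jointly measurable functions are measurable. *)
Lemma tensor_full T (a : viscosity R n) : visc_Linf T a -> relaxed_elliptic T a ->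
  exists E (M C : R), [/\ full T E, 0 <= M, 0 < C & forall t, E t ->
    (forall i j al be, ae_bounded (fun x => a i j al be x t) M) /\
    elliptic (fun i j al be x => a i j al be x t) C].
Proof.
move=> hL [C C0 hC].
pose I4 := ('I_n * 'I_n * 'I_n * 'I_n)%type.
pose aa (i : I4) := a i.1.1.1 i.1.1.2 i.1.2 i.2.
have hB (i : I4) : exists M : R, ae_xt T (fun x t => `|aa i x t| <= M).
  by have [_ _ ?] := hL i.1.1.1 i.1.1.2 i.1.2 i.2.
have [Mf hM] := choice hB.
pose M := \sum_i `|Mf i|.
have MM i : Mf i <= M.
  apply: le_trans (ler_norm _) _; rewrite /M (bigD1 i)//= lerDl; exact: sumr_ge0.
have [E1 [f1 h1]] : exists E, full T E /\ forall t, E t -> forall i, {ae torus n, forall y : TT, `|aa i (row_of y) t| <= Mf i}.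
  by apply: (full_all (P := fun i t => {ae torus n, forall y : TT, `|aa i (row_of y) t| <= Mf i})) => i; exact: (full_ae_xt (hM i)).
have [E2 [f2 h2]] := full_ae_xt hC.
exists (E1 `&` E2), M, C; split => //; [exact: fullI|exact: sumr_ge0|].
move=> t [t1 t2]; split; last exact: h2.
move=> i j al be; split; last first.
  by apply: filterS (h1 t t1 (i, j, al, be)) => y /le_trans; apply; exact: MM.
have [_ mA _] := hL i j al be.
move=> _ Y mY.
have mD : measurable ([set: TT] `*` (`]0, T[%classic : set RR)) by apply: measurableX => //; exact: measurable_itv.
have := measurable_ysection t (mA mD Y mY); congr measurable.
have tT : `]0, T[%classic t by have [_ sE _] := f1; exact: sE.
by apply/seteqP; split => y; rewrite /ysection /= inE /=; [move=> [_]|move=> [_ ?]; split].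
Qed.

End Tensor.

(** * The equation tested with truncated fields *)

Section Dynamics.
Context {R : realType} {n : nat}.
Local Notation mode := ('rV[int]_n * bool)%type.
Local Notation fn := ('rV[R]_n -> R).
Local Notation mu := (@lebesgue_measure R).
Local Notation RR := (measurableTypeR R).
Implicit Types (p q : mode) (xi : 'rV[int]_n) (u v w f : vdistr R n) (N : nat).

(** A Dirac family at [q], symmetrised because the coefficients of a real function must satisfy
    [symc]. *)
Definition pure_mode q : mode -> R := fun p => (p == q)%:R + sgs q.2 * (p == negm q)%:R.

Lemma pure_mode_symc q : symc (pure_mode q).
Proof.
move=> p; rewrite /pure_mode (inj_eq (can_inj (@negmK n))).
have -> : (negm p == q) = (p == negm q) by rewrite -(inj_eq (can_inj (@negmK n))) negmK.
have [->|h1] := eqVneq p q; first by rewrite mulrDr mulrA sgs_sq; case: (q == _); rewrite /= ?mulr1 ?mulr0 ?mul1r ?mul0r ?add0r ?addr0 1?addrC.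
have [->|h2] := eqVneq p (negm q); first by rewrite -[sgs (negm q).2]/(sgs q.2) mulr0 addr0 add0r mulr1 sgs_sq.
by rewrite !mulr0 !addr0 mulr0.
Qed.

(* Testing against the Leray projection of a single mode isolates one Fourier
   coefficient of a solenoidal field. *)
Lemma solenoidal_test i q : (2 <= n)%N -> q.1 != 0 -> exists N (k : 'I_n -> mode -> R), solenoidal k /\
  forall w, solenoidal (fun j p => w j (trp p)) -> vdual w (vtp N k) = 2 * w i (trp q).
Proof.
move=> n2 q0; pose N := xnorm q.1.
have qN : q \in modes N by rewrite mem_modes.
pose F : vdistr R n := fun j => if j == i then distr_of (tp N (pure_mode q)) else distr_of (fun=> 0).
have Fc j p : F j (trp p) = if j == i then (if p \in modes N then pure_mode q p else 0) else 0.
  rewrite /F; case: eqP => _; first by rewrite coef_tp//; exact: pure_mode_symc.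
  by rewrite /distr_of; under [X in torus_int X]funext do rewrite mul0r; exact: torus_int0.
have Fpd : pdv F.
  move=> j; rewrite /F; case: eqP => _; first exact: pd_tpdistr.
  by apply: is_pdistr_distr_of; exact: itg0.
have FK j p : `|F j (trp p)| <= 2.
  rewrite Fc; case: (j == i); rewrite ?normr0//; case: ifP => _; rewrite ?normr0//.
  rewrite /pure_mode; apply: le_trans (ler_normD _ _) _; rewrite -[leRHS]/(1 + 1).
  apply: lerD; first by case: (p == q); rewrite ?normr1 ?normr0.
  by rewrite /sgs; case: q.2; case: (p == _); rewrite ?mulr1 ?mulr0 ?normrN ?normr1 ?normr0.
have F0 j b : F j (trp (0, b)) = 0.
  rewrite Fc; case: (j == i) => //; case: ifP => // _; rewrite /pure_mode.
  have -> : ((0, b) == q) = false by apply/negbTE; apply: contraNneq q0 => <-.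
  have -> : ((0, b) == negm q) = false.
    by apply/negbTE; apply: contraNneq q0 => /(congr1 fst) /= /esym/eqP; rewrite oppr_eq0 => /eqP ->.
  by rewrite mulr0 addr0.
have hL := leray_exists n2 Fpd FK F0.
have [s [_ hs _]] := hL; have sG := Hdot_sigma_solenoidal hs.
exists N, (fun j p => leray F j (trp p)); split => // w sw.
rewrite vdual_vtp//.
transitivity (\sum_j \sum_(p <- modes N) leray F j (trp p) * w j (trp p)).
  by apply: eq_bigr => j _; apply: eq_bigr => p _; rewrite mulrC.
rewrite (leray_pair N hL sw) (bigD1 i)//= [X in _ + X]big1 ?addr0; last first.
  by move=> j /negbTE ji; apply: big1 => p _; rewrite Fc ji mul0r.
have [sy _ _] := sw.
(* By the symmetry of the coefficients of [w], the modes [q] and [negm q] contribute equally; hence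
   the factor 2. *)
transitivity (\sum_(p <- modes N) (w i (trp p) * (p == q)%:R + sgs q.2 * (w i (trp p) * (p == negm q)%:R))).
  rewrite big_seq [RHS]big_seq; apply: eq_bigr => p pN; rewrite Fc eqxx pN /pure_mode; ring.
rewrite big_split/= -mulr_sumr !sum_modes_eq negm_in qN (sy i q) mulrA sgs_sq; ring.
Qed.

Lemma Hdot_sigma_sub (s : R) u v : (0 < n)%N -> Hdot_sigma s u -> Hdot_sigma s v -> Hdot_sigma s (vsub v u).
Proof.
move=> n0 hu hv; have [[[pu fu] u0] du] := hu; have [[[pv fv] v0] dv] := hv.
have pw := pdv_sub pu pv; split; first split; first split => //.
- exact: (hnorm2B fv fu).1.
- move=> i; apply/eqP; rewrite eq_complex /=; have h (b : bool) : vsub v u i (trp (0, b)) = 0.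
    by rewrite /vsub !fourier0_coef// subrr.
  by rewrite oppr_eq0; apply/andP; split; apply/eqP; [exact: (h false)|exact: (h true)].
- apply: div_free_of_coef => // xi b; rewrite /vsub.
  under eq_bigr do rewrite mulrBr.
  by rewrite sumrB !div_free_coef// subrr.
Qed.

Lemma galerkin_eq (a : viscosity R n) t f u v (D : vdistr R n) N : (2 <= n)%N -> Hdot_sigma 1 u -> Hdot_sigma 1 v ->
  (forall w, Hdot_sigma 1 w -> vdual (vadd D (leray (convection u))) w + a_form a t u w = vdual f w) ->
  pairing N D v = galerkin a t f u v N.
Proof.
move=> n2 hu hv h; have sv := Hdot_sigma_solenoidal hv.
have := h _ (vtp_Hdot_sigma 1 N sv); rewrite !vdual_vtp// /galerkin => e.
have lp := leray_pair N (convection_leray n2 hu) sv.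
have e2 : \sum_i \sum_(p <- modes N) vadd D (leray (convection u)) i (trp p) * v i (trp p) =
    pairing N D v + pairing N (convection u) v.
  rewrite /pairing -lp -big_split; apply: eq_bigr => i _; rewrite -big_split; apply: eq_bigr => p _.
  by rewrite /vadd mulrDl.
rewrite e2 in e; move: e; rewrite -/(pairing N f v).
set x := pairing N D v; set y := pairing N _ v; set z := a_form _ _ _ _; set g := pairing N f v.
by move=> <-; ring.
Qed.

Lemma a_form_bound (a : viscosity R n) t v (M : R) : (0 < n)%N -> 0 <= M -> Hdot_sigma 1 v ->
  (forall i j al be, ae_bounded (fun x => a i j al be x t) M) ->
  `|a_form a t v v| <= (n ^ 4)%:R * M * nrm 1 v.
Proof.
move=> n0 M0 hv ha; have [[[pv fv] _] dv] := hv.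
have LV i j : tL2 (sgrad v i j) by exact: sgrad_tL2.
have cV i j p := sgrad_coef i j p n0 pv fv.
rewrite (a_form_rep n0 hv pv ha LV cV).
have qV : sq2 (sgrad v) <= snrm 1 v ^+ 2 by rewrite snrm_sq; exact: sq2_le_nrm.
have := tensor_int_bound M0 (snrm_ge0 1 v) (snrm_ge0 1 v) ha LV LV qV qV.
by rewrite -[_ * snrm 1 v * _]mulrA -expr2 snrm_sq.
Qed.

Lemma a_form_cvg (a : viscosity R n) t v (M : R) : (0 < n)%N -> 0 <= M -> Hdot_sigma 1 v ->
  (forall i j al be, ae_bounded (fun x => a i j al be x t) M) ->
  (fun N => a_form a t v (vtp N (fun i p => v i (trp p)))) @ \oo --> a_form a t v v.
Proof.
move=> n0 M0 hv ha; have [[[pv fv] _] dv] := hv.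
have LV i j : tL2 (sgrad v i j) by exact: sgrad_tL2.
have cV i j p := sgrad_coef i j p n0 pv fv.
have c0 : (fun N => a_form a t v v - a_form a t v (vtp N (fun i p => v i (trp p)))) @ \oo --> 0.
  apply: (@squeeze0 _ _ (fun N => (n ^ 4)%:R * M * snrm 1 v * stail 1 v N)); last first.
    rewrite -(mulr0 ((n ^ 4)%:R * M * snrm 1 v)); apply: cvgM; [exact: cvg_cst|exact: stail_cvg].
  move=> N; rewrite (a_form_vtp N n0 hv hv ha) (a_form_rep n0 hv pv ha LV cV).
  have LP i j : tL2 (proj N (distr_of (sgrad v i j))) by apply: tL2_test; exact: tp_test.
  have e := tensor_intBr ha LV LP LV; rewrite -e.
  have qV : sq2 (sgrad v) <= snrm 1 v ^+ 2 by rewrite snrm_sq; exact: sq2_le_nrm.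
  have qR : sq2 (fun i j x => sgrad v i j x - proj N (distr_of (sgrad v i j)) x) <= stail 1 v N ^+ 2.
    by rewrite stail_sq//; exact: sq2_tail.
  apply: tensor_int_bound => //; [exact: snrm_ge0|exact: stail_ge0|].
  by move=> i j; exact: tL2B.
have c1 : (fun N => a_form a t v v - (a_form a t v v - a_form a t v (vtp N (fun i p => v i (trp p))))) @ \oo -->
    a_form a t v v - 0 by exact: (cvgB (cvg_cst _) c0).
by rewrite subr0 in c1; apply: (cvg_ext _ c1) => N; rewrite subKr.
Qed.

Lemma pairing_cvg f v : pdv v -> (hnorm2 (-1) f < +oo)%E -> (hnorm2 1 v < +oo)%E ->
  (fun N => pairing N f v) @ \oo --> vdual f v.
Proof.
move=> pv ff fv.
have c0 : (fun N => vdual f v - pairing N f v) @ \oo --> 0.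
  apply: (@squeeze0 _ _ (fun N => n%:R * (snrm (-1) f * stail 1 v N))); first by move=> N; exact: forcing_estimate.
  rewrite -(mulr0 n%:R); apply: cvgM; first exact: cvg_cst.
  rewrite -(mulr0 (snrm (-1) f)); apply: cvgM; [exact: cvg_cst|exact: stail_cvg].
have c1 : (fun N => vdual f v - (vdual f v - pairing N f v)) @ \oo --> vdual f v - 0.
  exact: (cvgB (cvg_cst _) c0).
by rewrite subr0 in c1; apply: (cvg_ext _ c1) => N; rewrite subKr.
Qed.

(** The forcing estimate at truncation level 0, where the truncated pairing sees only the mean of
    [v] and vanishes. *)
Lemma pairing_bound f v N : pdv v -> (hnorm2 (-1) f < +oo)%E -> (hnorm2 1 v < +oo)%E ->
  (forall i b, v i (trp (0, b)) = 0) -> `|vdual f v| <= n%:R * (snrm (-1) f * snrm 1 v).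
Proof.
move=> pv ff fv v0; have := forcing_estimate 0 pv ff fv.
have -> : \sum_i \sum_(p <- modes 0) f i (trp p) * v i (trp p) = 0.
  apply: big1 => i _; rewrite big_seq; apply: big1 => -[xi b]; rewrite mem_modes /= leqn0 => /eqP x0.
  suff -> : xi = 0 by rewrite v0 mulr0.
  apply/rowP => j; rewrite mxE; apply/eqP; rewrite -absz_eq0 -leqn0.
  by have := leq_bigmax (F := fun j => absz (xi 0 j)) j; rewrite -/(xnorm xi) x0.
rewrite subr0 => /le_trans; apply; apply: ler_wpM2l => //; apply: ler_wpM2l; first exact: snrm_ge0.
exact: stail_le.
Qed.

(** A coefficient of the convective term becomes a limit of finite sums of products of coefficients
    of [v]; its measurability in time follows. *)
Lemma convection_coef_cvg v i p : (0 < n)%N -> pdv v -> (hnorm2 1 v < +oo)%E ->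
  (fun M => \sum_j \sum_(q <- modes M) \sum_(r <- modes M)
     v j (trp q) * dpartial j (v i) (trp r) * torus_int (fun x : 'rV[R]_n => trp q x * trp r x * trp p x)) @ \oo -->
  convection v i (trp p).
Proof.
move=> n0 pv fv.
have -> : convection v i (trp p) = \sum_j torus_int (fun x => vfun v j x * grad v j i x * trp p x).
  rewrite -torus_int_sum; last first.
    by move=> j; apply: tL1_testM; [apply: tL2M; [exact: vfun_tL2|exact: grad_tL2]|exact: trp_test].
  by congr torus_int; apply/funext => x; rewrite mulr_suml.
apply: cvg_sumr => j.
have LV := vfun_tL2 n0 pv fv j; have LG := grad_tL2 n0 pv fv j i.
have tt : test_fun (trp p : fn) := trp_test p.
have mt : measurable_fun setT (fun y : n.-tuple RR => (trp p : fn) (row_of y)) by exact: (tL2_test tt).1.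
have := torus_int_cvgM (fun M => tL2_test (tp_test M (fun q => distr_of (vfun v j) (trp q))))
  (fun M => tL2_test (tp_test M (fun q => distr_of (grad v j i) (trp q)))) LV LG mt (trp_bound p) (proj_cvg LV) (proj_cvg LG).
apply: cvg_ext => M.
have tq (q r : mode) : tL1 (fun x : 'rV[R]_n => trp q x * trp r x * trp p x).
  by apply: tL1_testM => //; apply: tL2M; apply: tL2_test; exact: trp_test.
transitivity (torus_int (fun x => \sum_(q <- modes M) \sum_(r <- modes M)
    (v j (trp q) * dpartial j (v i) (trp r)) * (trp q x * trp r x * trp p x))); last first.
  rewrite torus_int_sum; last by move=> q; apply: tL1_sum => r; exact: tL1Z.
  apply: eq_bigr => q _; rewrite torus_int_sum; last by move=> r; exact: tL1Z.
  by apply: eq_bigr => r _; rewrite torus_intZ.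
congr torus_int; apply/funext => x; rewrite /tp mulr_suml mulr_suml; apply: eq_bigr => q _.
rewrite mulr_sumr mulr_suml; apply: eq_bigr => r _.
by rewrite vfun_coef// grad_coef//; ring.
Qed.

End Dynamics.

(** * Gronwall's lemma *)

Section Gronwall.
Context {R : realType}.
Local Notation mu := (@lebesgue_measure R).
Local Notation RR := (measurableTypeR R).
Implicit Types (T : R) (E : set RR).

Definition upto E t : set RR := E `&` `]0, t[.

Lemma upto_measurable E t : measurable E -> measurable (upto E t).
Proof. by move=> mE; apply: measurableI => //; exact: measurable_itv. Qed.

Lemma uptoS E t : upto E t `<=` E. Proof. by move=> x []. Qed.

Lemma itg_upto E t (g : R -> R) : measurable E -> mu.-integrable E (EFin \o g) -> mu.-integrable (upto E t) (EFin \o g).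
Proof. by move=> mE; apply: integrableS => //; [exact: upto_measurable|exact: uptoS]. Qed.

Lemma RI_upto T E t (g : R -> R) x : full T E -> x <= t ->
  \int[mu]_(y in E) (g y * before y x) = \int[mu]_(y in upto E t) (g y * before y x).
Proof.
move=> [mE sE _] xt; rewrite Rintegral_mkcond [RHS]Rintegral_mkcond; apply: eq_Rintegral => y _.
rewrite /patch /before; case: ifPn => [yE|yE]; case: ifPn => // yF.
  have [/lt_le_trans/(_ xt) yt|_] := ltP y x; last by rewrite mulr0.
  move: yE; rewrite inE => yE; have := sE y yE; rewrite /= in_itv/= => /andP[y0 _].
  by case/negP: yF; rewrite inE; split => //=; rewrite in_itv/= y0.
by move: yF; rewrite inE => -[/mem_set]; rewrite (negbTE yE).
Qed.

Lemma RI_upto_end T E t (g : R -> R) : full T E ->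
  \int[mu]_(y in E) (g y * before y t) = \int[mu]_(y in upto E t) g y.
Proof.
move=> fE; rewrite (RI_upto _ fE (lexx t)); apply: eq_Rintegral => y; rewrite inE => -[_].
by rewrite /= in_itv/= /before => /andP[_ ->]; rewrite mulr1.
Qed.

Lemma upto_conull T E t : full T E -> 0 < t -> t < T -> mu (`[0, t] `\` upto E t) = 0.
Proof.
move=> [mE sE E0] t0 tT.
have mI : measurable (`]0, T[ : set RR) by exact: measurable_itv.
have mt : measurable (`[0, t] : set RR) by exact: measurable_itv.
have m1 x : measurable ([set x] : set RR) by exact: measurable_set1.
have n1 x : mu [set x] = 0 by exact: lebesgue_measure_set1.
have m2 : measurable ([set 0] `|` [set t] : set RR) by exact: measurableU.
have n2 : mu ([set 0] `|` [set t]) = 0 by apply: null_set_setU; [exact: m1|exact: m1|exact: n1|exact: n1].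
have m3 : measurable (`]0, T[ `\` E : set RR) by exact: measurableD.
apply/eqP; rewrite eq_le measure_ge0 andbT.
apply: (@le_trans _ _ (mu ((`]0, T[ `\` E) `|` ([set 0] `|` [set t])))); last by rewrite null_set_setU.
apply: le_measure; rewrite ?inE.
- by apply: measurableD => //; exact: upto_measurable.
- exact: measurableU.
- move=> x [] /=; rewrite in_itv/= => /andP[x0 xt] nF.
  have [->|xn0] := eqVneq x 0; first by right; left.
  have [->|xnt] := eqVneq x t; first by right; right.
  have x0' : 0 < x by rewrite lt_def xn0.
  have xt' : x < t by rewrite lt_neqAle xnt.
  left; split; first by rewrite /= in_itv/= x0' (lt_trans xt').
  by move=> Ex; apply: nF; split => //=; rewrite in_itv/= x0'.
Qed.

(* Just after the last time up to which [y] vanishes, the integral of [k] is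
   less than 1/2, so that any bound on [y] can be halved. *)
Lemma gronwall_zero T E (k y : R -> R) (B : R) : full T E -> 0 < T -> mu.-integrable E (EFin \o k) ->
  (forall t, E t -> 0 <= k t) -> measurable_fun E y ->
  (forall t, 0 < t -> t < T -> 0 <= y t <= B) ->
  (forall t, 0 < t -> t < T -> y t <= \int[mu]_(s in upto E t) (k s * y s)) ->
  forall t, 0 < t -> t < T -> y t = 0.
Proof.
move=> fE T0 Ik k0 my yB hy; have [mE sE _] := fE.
have Et t : E t -> 0 < t /\ t < T by move=> /sE /=; rewrite in_itv/= => /andP[].
have Iky : mu.-integrable E (EFin \o (fun s => k s * y s)).
  have := @itg_bddM _ _ _ mu E mE k y B Ik my.
  move=> h; have h2 : forall x, E x -> `|y x| <= B.
    by move=> x /Et[x0 xT]; have /andP[a b] := yB x x0 xT; rewrite ger0_norm.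
  by apply: (itg_eq mE _ (h h2)) => x _; rewrite mulrC.
pose S := [set s : R | 0 <= s <= T /\ forall t, 0 < t -> t < s -> y t = 0].
have S0 : S 0.
  split; first by rewrite lexx ltW.
  by move=> t t0 /(lt_trans t0); rewrite ltxx.
have ubS : has_ubound S by exists T => s [/andP[_ ->]].
have hS : has_sup S by split => //; exists 0.
set s0 := sup S.
have s00 : 0 <= s0 by exact: ub_le_sup.
have s0T : s0 <= T by apply: ge_sup; [exists 0|move=> s [/andP[_ ->]]].
have ybelow t : 0 < t -> t < s0 -> y t = 0.
  move=> t0 ts; have [s [_ h] st] := sup_adherent (eps := s0 - t) (ltac:(by rewrite subr_gt0)) hS.
  by apply: h => //; move: st; rewrite -/s0 subKr.
have [->|s0nT] := eqVneq T s0; first exact: ybelow.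
have {s0nT} s0T' : s0 < T by rewrite lt_neqAle eq_sym s0nT.
exfalso.
(* At [s0] itself the integral inequality involves only earlier times, so [y] vanishes there as
   well. *)
have yle t : 0 < t -> t <= s0 -> y t = 0.
  move=> t0; rewrite le_eqVlt => /orP[/eqP ts|]; last exact: ybelow.
  have tT : t < T by rewrite ts.
  have /andP[y0 _] := yB t t0 tT; apply/eqP; rewrite eq_le y0 andbT.
  apply: le_trans (hy t t0 tT) _; rewrite le_eqVlt; apply/orP; left; apply/eqP.
  rewrite (@RI_eq _ _ _ mu (upto E t) _ (fun=> 0)) ?RI0// => s [_] /=; rewrite in_itv/= => /andP[a b].
  by rewrite ybelow ?mulr0// -ts.
(* Times in ]s0, T[ that tend to [s0], so that the integral of [k] over ]s0, c j[ tends to 0. *)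
pose c (j : nat) : R := s0 + (T - s0) * j.+2%:R^-1.
have d0 : 0 < T - s0 by rewrite subr_gt0.
have c1 j : s0 < c j by rewrite /c ltrDl mulr_gt0// invr_gt0 ltr0n.
have c2 j : c j < T.
  by rewrite /c -ltrBrDl gtr_pMr// invf_lt1 ?ltr0n// ltr1n.
have cc : c @ \oo --> s0.
  have h : (fun j => s0 + (T - s0) * j.+2%:R^-1) @ \oo --> s0 + (T - s0) * 0.
    apply: cvgD; first exact: cvg_cst.
    apply: cvgM; first exact: cvg_cst.
    by have := @cvg_harmonic R; rewrite -cvg_shiftS.
  by rewrite mulr0 addr0 in h.
have mk j : measurable_fun E (fun s => k s * (s0 < s < c j)%R%:R).
  apply: measurable_funM; first exact: itg_measurable Ik.
  by apply: measurable_funTS; exact: between_measurable.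
have [] := @RI_dct _ _ _ mu E mE (fun j s => k s * (s0 < s < c j)%R%:R) (fun=> 0) k mk.
- exact: measurable_cst.
- apply: aeW => s _; apply: cvg_near_cst.
  have [ss|ss] := leP s s0.
    by near=> j; rewrite mulr0.
  have : \forall j \near \oo, c j < s by apply: (cvgr_lt _ cc).
  by apply: filterS => j js; rewrite (ltNge s) (ltW js) andbF mulr0.
- exact: Ik.
- apply: aeW => s j Es; rewrite normrM ger0_norm ?k0// -[leRHS]mulr1; apply: ler_wpM2l; first exact: k0.
  by case: (_ && _); rewrite ?normr1 ?normr0.
move=> _; rewrite RI0 => cI.
have [j hj] : exists j, \int[mu]_(s in E) (k s * (s0 < s < c j)%R%:R) < 2^-1.
  have := cvgr_lt _ cI _ (ltac:(by rewrite invr_gt0) : 0 < 2^-1 :> R).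
  by move=> [j _ h]; exists j; apply: h => /=.
have B0 : 0 <= B.
  have h2 : 0 < T / 2 by rewrite divr_gt0.
  have h3 : T / 2 < T by rewrite ltr_pdivrMr// mulr_natr mulr2n ltrDl.
  by have /andP[a b] := yB _ h2 h3; exact: le_trans b.
(* Since [y] vanishes up to [s0], the integral inequality sees [k] only on ]s0, c j[, and each
   application halves the bound. *)
have decay m t : 0 < t -> t < c j -> y t <= B * 2^-1 ^+ m.
  elim: m t => [|m IH] t t0 tc.
    by rewrite expr0 mulr1; have /andP[] := yB t t0 (lt_trans tc (c2 j)).
  have tT := lt_trans tc (c2 j).
  apply: le_trans (hy t t0 tT) _.
  have Im : mu.-integrable E (EFin \o (fun s => (B * 2^-1 ^+ m) * (k s * (s0 < s < c j)%R%:R))).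
    apply: itgZl => //; apply: (@itg_le _ _ _ mu E mE _ k (mk j) _ Ik) => s Es.
    rewrite normrM ger0_norm ?k0// -[leRHS]mulr1; apply: ler_wpM2l; first exact: k0.
    by case: (_ && _); rewrite ?normr1 ?normr0.
  have Im0 : mu.-integrable E (EFin \o (fun s => k s * (s0 < s < c j)%R%:R)).
    apply: (@itg_le _ _ _ mu E mE _ k (mk j) _ Ik) => s Es.
    rewrite normrM ger0_norm ?k0// -[leRHS]mulr1; apply: ler_wpM2l; first exact: k0.
    by case: (_ && _); rewrite ?normr1 ?normr0.
  have Bm : 0 <= B * 2^-1 ^+ m by rewrite mulr_ge0// exprn_ge0// invr_ge0.
  apply: (@le_trans _ _ (\int[mu]_(s in E) ((B * 2^-1 ^+ m) * (k s * (s0 < s < c j)%R%:R)))); last first.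
    rewrite RIZl// exprSr mulrA; apply: ler_wpM2l => //; exact: ltW.
  rewrite -(RI_upto_end t _ fE); apply: RI_le => //.
    have hb := @itg_bddM _ _ _ mu E mE _ (fun s => before s t) 1 Iky.
    have hb' := hb (measurable_funTS (before_measurable1 t)) (fun x _ => before_le1 x t).
    by apply: (itg_eq mE _ hb') => s _; rewrite mulrC.
  move=> s Es; have [s_0 sT] := Et s Es; rewrite /before.
  have [st|_] := ltP s t; last by rewrite mulr0; do !apply: mulr_ge0 => //; exact: k0.
  rewrite mulr1; have [ss|ss] := leP s s0; first by rewrite yle// mulr0 /= !mulr0.
  rewrite (lt_trans st tc) mulr1 mulrC; apply: ler_wpM2r; first exact: k0.
  by apply: IH => //; exact: lt_trans st tc.
have : S (c j).
  split; first by rewrite (le_trans s00 (ltW (c1 j))) ltW.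
  move=> t t0 tc; have /andP[y0 _] := yB t t0 (lt_trans tc (c2 j)).
  apply/eqP; rewrite eq_le y0 andbT.
  have hg : (fun m => B * 2^-1 ^+ m) @ \oo --> (B * 0 : R).
    apply: cvgM; first exact: cvg_cst.
    by apply: cvg_expr; rewrite ger0_norm ?invr_ge0// invf_lt1 ?ltr1n.
  rewrite mulr0 in hg; apply: (ler_cvg_to (cvg_cst (y t)) hg).
  by near=> m; exact: decay.
by move=> /(ub_le_sup ubS); rewrite leNgt c1.
Unshelve. all: by end_near. Qed.

End Gronwall.

(** * Weak solutions *)

Section Trajectories.
Context {R : realType} {n : nat}.
Local Notation mode := ('rV[int]_n * bool)%type.
Local Notation mu := (@lebesgue_measure R).
Local Notation RR := (measurableTypeR R).
Implicit Types (T K : R) (E : set RR) (u v f D : R -> vdistr R n) (a : viscosity R n) (p : mode).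

(** What the comparison uses of a weak solution, on one conull set [E]: bounds, measurability, the
    truncated equation for the time derivative [D], and each coefficient as a primitive of that of
    [D] starting from the initial datum. *)
Record trajectory T a f (u0 : vdistr R n) u E K D : Prop := Trajectory {
  traj_full : full T E;
  traj_H1 : forall t, E t -> Hdot_sigma 1 (u t);
  traj_measurable : time_measurable E u;
  traj_itg : mu.-integrable E (EFin \o (fun t => nrm 1 (u t)));
  traj_bound : forall t, E t -> nrm 0 (u t) <= K;
  traj_D : forall i p, mu.-integrable E (EFin \o (fun t => D t i (trp p)));
  traj_eq : forall t w N, E t -> Hdot_sigma 1 w -> pairing N (D t) w = galerkin a t (f t) (u t) w N;
  traj_AC : forall t i p, 0 < t -> t < T ->
    u t i (trp p) = u0 i (trp p) + \int[mu]_(x in E) (D x i (trp p) * before x t) }.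

(** Weak continuity speaks of solenoidal test fields; [solenoidal_test] gives one that isolates the
    coefficient. The coefficients at frequency 0 are constantly 0. *)
Lemma weakly_continuous_coef T u i p : (2 <= n)%N -> weakly_continuous T u ->
  {within `[0, T], continuous (fun t => u t i (trp p))}.
Proof.
move=> n2 [hu hc]; have [p0|p0] := eqVneq p.1 0.
  apply: (@subspace_eq_continuous _ _ _ (cst 0)); last exact: cst_continuous.
  move=> t; rewrite mem_setE => tT; have /Hdot_sigma_solenoidal[_ h _] := hu t tT.
  by case: p p0 => [xi b] /= ->; rewrite /from_subspace /= h.
have [N [k [sk hk]]] := @solenoidal_test R n i p n2 p0.
have c := hc _ (vtp_Hdot_sigma 0 N sk).
apply: (@subspace_eq_continuous _ _ _ (fun t => 2^-1 * vdual (u t) (vtp N k))).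
  by move=> t; rewrite mem_setE => tT; rewrite hk ?mulKf//; exact: Hdot_sigma_solenoidal (hu t tT).
by move=> t; apply: cvgM; [exact: cvg_cst|exact: c].
Qed.

Lemma solenoidal_eq (u w : vdistr R n) i p : (2 <= n)%N -> Hdot_sigma 0 u -> Hdot_sigma 0 w ->
  (forall z, Hdot_sigma 0 z -> vdual u z = vdual w z) -> u i (trp p) = w i (trp p).
Proof.
move=> n2 /Hdot_sigma_solenoidal su /Hdot_sigma_solenoidal sw h; have [p0|p0] := eqVneq p.1 0.
  have [_ zu _] := su; have [_ zw _] := sw.
  by case: p p0 => [xi b] /= ->; rewrite zu zw.
have [N [k [sk hk]]] := @solenoidal_test R n i p n2 p0.
have := h _ (vtp_Hdot_sigma 0 N sk); rewrite !hk// => /(congr1 (fun x => 2^-1 * x)).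
by rewrite !mulKf.
Qed.

Lemma trajectory_exists T a f (u0 : vdistr R n) u : (2 <= n)%N -> 0 < T -> Hdot_sigma 0 u0 -> weak_solution T a f u0 u ->
  exists E K D, trajectory T a f u0 u E K D.
Proof.
move=> n2 T0 hu0 [hoo h2 hc [s [D [hD hdD heq]]] hi].
have fin (s' : R) (w : vdistr R n) : Hdot_sigma s' w -> (hnorm2 s' w < +oo)%E by move=> [[[_ ?] _] _].
have finH (s' : R) (w : vdistr R n) : Hs s' w -> (hnorm2 s' w < +oo)%E by case.
have [E1 [K [f1 K0 b1]]] := Lqoo_bounded (fin 0) hoo.
have [E2 [f2 H2 m2 i2]] := Lq2_integrable (fin 1) h2.
have [E3 [f3 H3 m3 i3]] := Lq1_integrable (finH s) hD.
have [E4 [f4 H4]] := full_ae heq.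
pose E := (E1 `&` E2) `&` (E3 `&` E4).
have fE : full T E by do !apply: fullI.
have [mE sE E0] := fE; have [mE2 _ _] := f2; have [mE3 _ _] := f3.
have EE2 : E `<=` E2 by move=> t [[]]. have EE3 : E `<=` E3 by move=> t [_ []].
have cu i p := @weakly_continuous_coef T u i p n2 hc.
have ID i p : mu.-integrable E (EFin \o (fun t => D t i (trp p))) by exact: (integrableS mE3 mE EE3 (i3 i p)).
exists E, K, D; split => //.
- by move=> t /EE2/H2.
- exact: (time_measurableS mE2 EE2 m2).
- exact: (integrableS mE2 mE EE2 i2).
- by move=> t [[/b1]].
- move=> t w N Et hw; apply: galerkin_eq => //; first exact/H2/EE2.
  by move=> z hz; apply: H4 => //; case: Et => _ [].
- move=> t i p t0 tT.
  have := @weak_derivative_AC R T E (fun x => u x i (trp p)) (fun x => D x i (trp p)) fE (cu i p) (ID i p).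
  move=> /(_ _ t t0 tT) -> //.
    congr (_ + _); apply: solenoidal_eq => //; have [h _] := hc; apply: h.
    by rewrite in_itv/= lexx ltW.
  by move=> psi hpsi; apply: hdD => //; exact: trp_test.
Qed.

Lemma trajectory_sub T a f (u0 : vdistr R n) u E F K K' D : full T F -> F `<=` E -> K <= K' ->
  trajectory T a f u0 u E K D -> trajectory T a f u0 u F K' D.
Proof.
move=> fF FE KK [fE H1 mE_ iE bE iD eE AE]; have [mE sE _] := fE; have [mF sF F0] := fF.
split => //.
- by move=> t /FE/H1.
- exact: (time_measurableS mE FE mE_).
- exact: (integrableS mE mF FE iE).
- by move=> t /FE/bE h; exact: le_trans KK.
- by move=> i p; exact: (integrableS mE mF FE (iD i p)).
- by move=> t w N /FE; exact: eE.
- move=> t i p t0 tT; rewrite AE//; congr (_ + _); apply: Rintegral_conull => //.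
  apply/eqP; rewrite eq_le measure_ge0 andbT -F0; apply: le_measure; rewrite ?inE.
  + exact: measurableD.
  + by apply: measurableD => //; exact: measurable_itv.
  + by move=> x [/sE].
Qed.

(** The product rule for each pair of coefficients, summed over finitely many modes; at this level
    no duality between u' and [v] is required. *)
Lemma trajectory_pairing T a f (u0 : vdistr R n) u v E K Du Dv N t :
  trajectory T a f u0 u E K Du -> trajectory T a f u0 v E K Dv -> 0 < t -> t < T ->
  mu.-integrable (upto E t) (EFin \o (fun s => galerkin a s (f s) (u s) (v s) N + galerkin a s (f s) (v s) (u s) N)) /\
  pairing N (u t) (v t) = pairing N u0 u0 +
    \int[mu]_(s in upto E t) (galerkin a s (f s) (u s) (v s) N + galerkin a s (f s) (v s) (u s) N).
Proof.
move=> tu tv t0 tT; have fE := traj_full tu; have [mE sE _] := fE.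
set F := upto E t; have mF : measurable F by exact: upto_measurable.
have Ft x : F x -> [/\ E x, 0 < x, x < t & x < T].
  by move=> [Ex] /=; rewrite in_itv/= => /andP[x0 xt]; split => //; exact: lt_trans tT.
pose g (i : 'I_n) p s := Du s i (trp p) * v s i (trp p) + u s i (trp p) * Dv s i (trp p).
have pr i p : mu.-integrable F (EFin \o g i p) /\
    u t i (trp p) * v t i (trp p) = u0 i (trp p) * u0 i (trp p) + \int[mu]_(s in F) g i p s.
  have := @product_rule R F (fun s => Du s i (trp p)) (fun s => Dv s i (trp p)) (fun s => u s i (trp p))
    (fun s => v s i (trp p)) (u0 i (trp p)) (u0 i (trp p)) mF
    (itg_upto t mE (traj_D tu i p)) (itg_upto t mE (traj_D tv i p)).
  case.
  - by move=> x /Ft[Ex x0 xt xT]; rewrite (traj_AC tu)// (RI_upto _ fE (ltW xt)).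
  - by move=> x /Ft[Ex x0 xt xT]; rewrite (traj_AC tv)// (RI_upto _ fE (ltW xt)).
  move=> Ig e; split => //; rewrite (traj_AC tu)// (traj_AC tv)//.
  by rewrite !(RI_upto_end _ _ fE) e.
have Is : mu.-integrable F (EFin \o (fun s => \sum_i \sum_(p <- modes N) g i p s)).
  by apply: itg_sum => // i _; apply: itg_sum => // p _; have [] := pr i p.
have gE s : F s -> \sum_i \sum_(p <- modes N) g i p s =
    galerkin a s (f s) (u s) (v s) N + galerkin a s (f s) (v s) (u s) N.
  move=> /Ft[Es _ _ _]; rewrite -(traj_eq tu N Es (traj_H1 tv Es)) -(traj_eq tv N Es (traj_H1 tu Es)).
  rewrite /pairing -big_split; apply: eq_bigr => i _; rewrite -big_split; apply: eq_bigr => p _.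
  by rewrite /g [u s i _ * _]mulrC.
split; first exact: (itg_eq mF gE Is).
have -> : \int[mu]_(s in F) (galerkin a s (f s) (u s) (v s) N + galerkin a s (f s) (v s) (u s) N) =
    \int[mu]_(s in F) (\sum_i \sum_(p <- modes N) g i p s).
  by apply: eq_Rintegral => s; rewrite inE => /gE ->.
rewrite RI_sum//; last by move=> i _; apply: itg_sum => // p _; have [] := pr i p.
rewrite /pairing -big_split; apply: eq_bigr => i _.
rewrite RI_sum//; last by move=> p _; have [] := pr i p.
by rewrite -big_split; apply: eq_bigr => p _; have [] := pr i p.
Qed.

Lemma hsum_pairing (u : vdistr R n) N : hsum (hw 0) u N = pairing N u u.
Proof. by apply: eq_bigr => i _; apply: eq_bigr => p _; rewrite hw0 mul1r expr2. Qed.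

Lemma hsum_sub (u v : vdistr R n) N :
  hsum (hw 0) (vsub v u) N = pairing N v v - 2 * pairing N u v + pairing N u u.
Proof.
rewrite hsum_pairing /pairing mulr_sumr -sumrB -big_split; apply: eq_bigr => i _.
rewrite mulr_sumr -sumrB -big_split; apply: eq_bigr => p _; rewrite /vsub /=; ring.
Qed.

End Trajectories.

(** * Weak-strong stability *)

Section Stability.
Context {R : realType} {n : nat}.
Local Notation mode := ('rV[int]_n * bool)%type.
Local Notation mu := (@lebesgue_measure R).
Local Notation RR := (measurableTypeR R).
Implicit Types (g : R -> vdistr R n) (p : mode).

Lemma Hdot_sigma_fin (s : R) (w : vdistr R n) : Hdot_sigma s w -> (hnorm2 s w < +oo)%E.
Proof. by move=> [[[_ ?] _] _]. Qed.

Lemma Hdot_sigma_pd (s : R) (w : vdistr R n) : Hdot_sigma s w -> pdv w.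
Proof. by move=> [[[? _] _] _]. Qed.

Lemma Hdot_sigma_fin0 (w : vdistr R n) : Hdot_sigma 1 w -> (hnorm2 0 w < +oo)%E.
Proof. by move=> h; exact: (hnorm2_mono ler01 (Hdot_sigma_fin h)).1. Qed.

Lemma stail_measurable (E : set RR) (s : R) g N : measurable E -> time_measurable E g ->
  (forall t, E t -> (hnorm2 s (g t) < +oo)%E) -> measurable_fun E (fun t => stail s (g t) N).
Proof.
move=> mE mg fg; apply: (measurableT_comp (continuous_measurable_fun (@sqrt_continuous R))).
by apply: measurable_funB; [exact: nrm_measurable|exact: hsum_measurable].
Qed.

Lemma snrm_sqi (E : set RR) (s : R) g : measurable E -> time_measurable E g ->
  (forall t, E t -> (hnorm2 s (g t) < +oo)%E) -> mu.-integrable E (EFin \o (fun t => nrm s (g t))) ->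
  sqi mu E (fun t => snrm s (g t)).
Proof.
move=> mE mg fg Ig; split; first exact: snrm_measurable.
by apply: (itg_eq mE _ Ig) => t _; rewrite snrm_sq.
Qed.

Variables (T : R) (a : viscosity R n) (f u v : R -> vdistr R n) (u0 : vdistr R n).
Variables (E : set RR) (K M C : R) (Du Dv : R -> vdistr R n).
Hypotheses (n2 : (2 <= n)%N) (M0 : 0 <= M) (C0 : 0 < C).
Hypotheses (tu : trajectory T a f u0 u E K Du) (tv : trajectory T a f u0 v E K Dv).
Hypotheses (hf : forall t, E t -> (hnorm2 (-1) (f t) < +oo)%E) (mf : time_measurable E f).
Hypothesis If : mu.-integrable E (EFin \o (fun t => nrm (-1) (f t))).
Hypothesis hs : forall t, E t -> (hnorm2 (n%:R / 2) (u t) < +oo)%E.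
Hypothesis Is : mu.-integrable E (EFin \o (fun t => nrm (n%:R / 2) (u t))).
Hypothesis ha : forall t, E t -> (forall i j al be, ae_bounded (fun x => a i j al be x t) M) /\
  elliptic (fun i j al be x => a i j al be x t) C.

Let n0 : (0 < n)%N. Proof. exact: leq_trans n2. Qed.
Let fE := traj_full tu.
Let mE : measurable E. Proof. by have [] := fE. Qed.
Let gap t := vsub (v t) (u t).
Let uH t (Et : E t) := traj_H1 tu Et.
Let vH t (Et : E t) := traj_H1 tv Et.
Let gH t (Et : E t) : Hdot_sigma 1 (gap t). Proof. exact: Hdot_sigma_sub (uH Et) (vH Et). Qed.
Let mu_ := traj_measurable tu.
Let mv_ := traj_measurable tv.
Let mg_ : time_measurable E gap.
Proof. by move=> i p; apply: measurable_funB; [exact: mv_|exact: mu_]. Qed.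

Lemma gap_bound t : E t -> nrm 0 (gap t) <= 4 * K.
Proof.
move=> Et; have [_ h] := hnorm2B (Hdot_sigma_fin0 (vH Et)) (Hdot_sigma_fin0 (uH Et)).
by apply: le_trans h _; have := traj_bound tu Et; have := traj_bound tv Et; lra.
Qed.

Lemma gap_itg : mu.-integrable E (EFin \o (fun t => nrm 1 (gap t))).
Proof.
apply: (@itg_le _ _ _ mu E mE _ (fun t => 2 * (nrm 1 (v t) + nrm 1 (u t)))).
- by apply: nrm_measurable => // t /gH; exact: Hdot_sigma_fin.
- move=> t Et; rewrite ger0_norm ?nrm_ge0//.
  by have [] := hnorm2B (Hdot_sigma_fin (vH Et)) (Hdot_sigma_fin (uH Et)).
- by apply: itgZl => //; apply: itgD => //; [exact: traj_itg tv|exact: traj_itg tu].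
Qed.

Let size t := total_size (f t) (u t) (v t).

Lemma size_sqi : sqi mu E size.
Proof.
have uF t (Et : E t) := Hdot_sigma_fin (uH Et); have vF t (Et : E t) := Hdot_sigma_fin (vH Et).
have gF t (Et : E t) := Hdot_sigma_fin (gH Et).
do !apply: sqiD => //.
- exact: (snrm_sqi mE mu_ uF (traj_itg tu)).
- exact: (snrm_sqi mE mu_ hs Is).
- exact: (snrm_sqi mE mg_ gF gap_itg).
- exact: (snrm_sqi mE mv_ vF (traj_itg tv)).
- exact: (snrm_sqi mE mf hf If).
Qed.

Lemma remainder_measurable N : measurable_fun E (fun t => remainder (f t) (u t) (v t) N).
Proof.
have uF t (Et : E t) := Hdot_sigma_fin (uH Et); have vF t (Et : E t) := Hdot_sigma_fin (vH Et).
have gF t (Et : E t) := Hdot_sigma_fin (gH Et).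
have uF0 t (Et : E t) := Hdot_sigma_fin0 (uH Et); have gF0 t (Et : E t) := Hdot_sigma_fin0 (gH Et).
have mS := size_sqi.1.
apply: measurable_funD; apply: measurable_funM.
- apply: measurable_funM => //; apply: measurable_funD; first exact: measurable_cst.
  by apply: measurable_funD; [exact: (snrm_measurable mE mu_ uF0)|exact: (snrm_measurable mE mg_ gF0)].
- apply: measurable_funD; last exact: (stail_measurable N mE mv_ vF).
  apply: measurable_funD; last exact: (stail_measurable N mE mu_ uF).
  by apply: measurable_funD; [exact: (stail_measurable N mE mu_ hs)|exact: (stail_measurable N mE mg_ gF)].
- exact: measurable_funX.
- by apply: measurable_funD; [exact: (stail_measurable N mE mg_ gF0)|exact: (stail_measurable N mE mu_ uF0)].
Qed.

Let e0 : R := Num.sqrt K + Num.sqrt (4 * K).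

(** Tails of positive order are bounded by the size [S], tails of order 0 by the energy, which is at
    most [e0] on [E]; so S^2, integrable in time, dominates all truncation levels at once. *)
Lemma remainder_arith (S e t1 t0 : R) : 0 <= t1 -> t1 <= S -> 0 <= t0 -> t0 <= e -> e <= e0 ->
  `|S * (1 + e) * t1 + S ^+ 2 * t0| <= (1 + 2 * e0) * S ^+ 2.
Proof.
move=> a1 a2 b1 b2 b3; have S0 := le_trans a1 a2; have e_0 := le_trans b1 b2.
have SS : 0 <= S ^+ 2 by exact: sqr_ge0.
have h1 : S * (1 + e) * t1 <= S ^+ 2 * (1 + e0).
  rewrite expr2 -!mulrA; apply: ler_wpM2l => //; rewrite [leRHS]mulrC; apply: ler_pM => //; lra.
have h2 : S ^+ 2 * t0 <= S ^+ 2 * e0 by apply: ler_wpM2l => //; exact: le_trans b3.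
rewrite ger0_norm; first by lra.
by apply: addr_ge0; apply: mulr_ge0 => //; apply: mulr_ge0 => //; lra.
Qed.

Lemma remainder_bound t N : E t -> `|remainder (f t) (u t) (v t) N| <= (1 + 2 * e0) * size t ^+ 2.
Proof.
move=> Et; apply: remainder_arith.
- by do !apply: addr_ge0; exact: stail_ge0.
- have := stail_le (n%:R / 2) (u t) N; have := stail_le 1 (gap t) N; have := stail_le 1 (u t) N.
  have := stail_le 1 (v t) N; have := snrm_ge0 (-1) (f t); rewrite /size /total_size /tail1 -/(gap t).
  lra.
- by apply: addr_ge0; exact: stail_ge0.
- by rewrite /tail0 /energy_size [leRHS]addrC; apply: lerD; exact: stail_le.
- by apply: lerD; apply: ler_wsqrtr; [exact: (traj_bound tu Et)|exact: gap_bound].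
Qed.

Lemma remainder_cvg t : E t -> (fun N => remainder (f t) (u t) (v t) N) @ \oo --> (0 : R).
Proof.
move=> Et; have z (x y : R) : 0 = x * 0 + y * 0 by rewrite !mulr0 addr0.
rewrite (z (total_size (f t) (u t) (v t) * (1 + energy_size (u t) (v t))) (total_size (f t) (u t) (v t) ^+ 2)).
apply: cvgD; apply: cvgM; try exact: cvg_cst.
- have -> : 0 = 0 + 0 + 0 + 0 :> R by rewrite !addr0.
  apply: cvgD; last exact: stail_cvg (Hdot_sigma_fin (vH Et)).
  apply: cvgD; last exact: stail_cvg (Hdot_sigma_fin (uH Et)).
  by apply: cvgD; [exact: stail_cvg (hs Et)|exact: stail_cvg (Hdot_sigma_fin (gH Et))].
- have -> : 0 = 0 + 0 :> R by rewrite addr0.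
  by apply: cvgD; [exact: stail_cvg (Hdot_sigma_fin0 (gH Et))|exact: stail_cvg (Hdot_sigma_fin0 (uH Et))].
Qed.

Lemma remainder_itg N : mu.-integrable E (EFin \o (fun t => remainder (f t) (u t) (v t) N)).
Proof.
apply: (@itg_le _ _ _ mu E mE _ (fun t => (1 + 2 * e0) * size t ^+ 2)).
- exact: remainder_measurable.
- by move=> t Et; exact: remainder_bound.
- by apply: itgZl => //; exact: size_sqi.2.
Qed.

Lemma remainder_int_cvg t : (fun N => \int[mu]_(s in upto E t) remainder (f s) (u s) (v s) N) @ \oo --> (0 : R).
Proof.
have mF := upto_measurable t mE.
have [] := @RI_dct _ _ _ mu (upto E t) mF (fun N s => remainder (f s) (u s) (v s) N) (fun=> 0) (fun s => (1 + 2 * e0) * size s ^+ 2).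
- by move=> N; apply: (measurable_funS mE (@uptoS R E t)); exact: remainder_measurable.
- exact: measurable_cst.
- by apply: aeW => s [Es _]; exact: remainder_cvg.
- by apply: itg_upto => //; apply: itgZl => //; exact: size_sqi.2.
- by apply: aeW => s N [Es _]; exact: remainder_bound.
by move=> _; rewrite RI0.
Qed.

Lemma forcing_itg : mu.-integrable E (EFin \o (fun t => vdual (f t) (v t))).
Proof.
have vF t (Et : E t) := Hdot_sigma_fin (vH Et).
have Lf := snrm_sqi mE mf hf If; have Lv := snrm_sqi mE mv_ vF (traj_itg tv).
apply: (@itg_le _ _ _ mu E mE _ (fun t => n%:R * (snrm (-1) (f t) * snrm 1 (v t)))).
- apply: (@measurable_fun_cvg _ _ _ _ (fun N t => pairing N (f t) (v t))).
    by move=> N; exact: pairing_measurable.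
  by move=> t Et; apply: pairing_cvg; [exact: Hdot_sigma_pd (vH Et)|exact: hf|exact: vF].
- move=> t Et; have [_ v0 _] := Hdot_sigma_solenoidal (vH Et).
  by apply: (pairing_bound 0 (Hdot_sigma_pd (vH Et)) (hf Et) (vF t Et)).
- by apply: itgZl => //; exact: sqiM.
Qed.

Lemma convection_measurable i p : measurable_fun E (fun t => convection (v t) i (trp p)).
Proof.
apply: (@measurable_fun_cvg _ _ _ _ (fun L t => \sum_j \sum_(q <- modes L) \sum_(r <- modes L)
     v t j (trp q) * dpartial j (v t i) (trp r) * torus_int (fun x : 'rV[R]_n => trp q x * trp r x * trp p x))); last first.
  by move=> t Et; apply: convection_coef_cvg => //; [exact: Hdot_sigma_pd (vH Et)|exact: Hdot_sigma_fin (vH Et)].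
move=> L; apply: measurable_sum => j; apply: measurable_sum => q; apply: measurable_sum => -[xi b].
apply: measurable_funM; last exact: measurable_cst.
apply: measurable_funM; first exact: mv_.
apply: (@eq_measurable_fun _ _ _ _ E (fun t => - (sgb b * (2 * pi * (xi 0 j)%:~R)) * v t i (trp (xi, ~~ b)))).
  by move=> t; rewrite inE => Et; rewrite dpartial_coef//; exact: Hdot_sigma_pd (vH Et) i.
by apply: measurable_funM; [exact: measurable_cst|exact: mv_].
Qed.

(* The equation expresses a(v, P_N v) through quantities that are measurable in
   time, which avoids measuring the quadratic form directly. *)
Lemma a_form_itg : mu.-integrable E (EFin \o (fun t => a_form a t (v t) (v t))).
Proof.
apply: (@itg_le _ _ _ mu E mE _ (fun t => (n ^ 4)%:R * M * nrm 1 (v t))); last first.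
- by apply: itgZl => //; exact: traj_itg tv.
- by move=> t Et; apply: a_form_bound => //; [exact: vH|exact: (ha Et).1].
have mD : time_measurable E Dv by move=> i p; exact: itg_measurable (traj_D tv i p).
have mC : time_measurable E (fun t => convection (v t)) by exact: convection_measurable.
apply: (@measurable_fun_cvg _ _ _ _ (fun N t => pairing N (f t) (v t) - pairing N (Dv t) (v t) - pairing N (convection (v t)) (v t))).
  move=> N; apply: measurable_funB; last exact: (pairing_measurable _ mE mC mv_).
  by apply: measurable_funB; [exact: (pairing_measurable _ mE mf mv_)|exact: (pairing_measurable _ mE mD mv_)].
move=> t Et; apply: (cvg_ext _ (a_form_cvg n0 M0 (vH Et) (ha Et).1)) => N.
by rewrite (traj_eq tv N Et (vH Et)) /galerkin; ring.
Qed.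

Let rate s := stabC C (n := n) * nrm (n%:R / 2) (u s).

Lemma rate_itg : mu.-integrable E (EFin \o rate).
Proof. by apply: itgZl. Qed.

Lemma gap0_measurable : measurable_fun E (fun s => nrm 0 (gap s)).
Proof. by apply: nrm_measurable => // t Et; exact: Hdot_sigma_fin0 (gH Et). Qed.

Lemma rate_gap_itg : mu.-integrable E (EFin \o (fun s => rate s * nrm 0 (gap s))).
Proof.
have h := @itg_bddM _ _ _ mu E mE _ (fun s => nrm 0 (gap s)) (4 * K) rate_itg gap0_measurable.
have h2 : forall x, E x -> `|nrm 0 (gap x)| <= 4 * K by move=> x Ex; rewrite ger0_norm ?nrm_ge0//; exact: gap_bound.
by apply: (itg_eq mE _ (h h2)) => s _; rewrite mulrC.
Qed.

(** Since [pv <= nv], the full energy of [v] dominates its truncation, so the untruncated energy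
    inequality can be combined with truncated identities. *)
Lemma energy_arith (hw_ pv pu puv nv nu0 p0 V A X Y Q r : R) :
  hw_ = pv - 2 * puv + pu -> pv <= nv -> 2^-1 * nv + A <= 2^-1 * nu0 + V ->
  puv = p0 + Y -> pu = p0 + X -> V - A + 2^-1 * X - Y <= Q + r ->
  2^-1 * hw_ <= 2^-1 * (nu0 - p0) + Q + r.
Proof. move=> -> h1 h2 -> -> h3; lra. Qed.

(* The energy inequality for v is combined with the product identities for the
   truncations of (u, v) and of (u, u). *)
Lemma gap_growth t N : 0 < t -> t < T -> (hnorm2 0 (v t) < +oo)%E -> energy_inequality T a f u0 v ->
  2^-1 * hsum (hw 0) (gap t) N <= 2^-1 * (nrm 0 u0 - hsum (hw 0) u0 N) +
    \int[mu]_(s in upto E t) (rate s * nrm 0 (gap s)) +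
    remC M (n := n) * \int[mu]_(s in upto E t) remainder (f s) (u s) (v s) N.
Proof.
move=> t0 tT fvt en; set F := upto E t; have mF : measurable F := upto_measurable t mE.
have FE : F `<=` E := @uptoS R E t.
have mI : measurable (`[0, t] : set RR) by exact: measurable_itv.
have FI : F `<=` `[0, t].
  by move=> s [_] /=; rewrite !in_itv/= => /andP[s0 st]; rewrite !ltW.
have cn (h : R -> R) : \int[mu]_(s in `[0, t]) h s = \int[mu]_(s in F) h s.
  by apply: Rintegral_conull => //; exact: (upto_conull fE t0 tT).
have [Iuv Puv] := trajectory_pairing N tu tv t0 tT.
have [Iuu Puu] := trajectory_pairing N tu tu t0 tT.
have tI : t \in `[0, T] by rewrite in_itv/= !ltW.
have en_t := en t tI; rewrite !cn in en_t.
rewrite -/F in Iuv Puv Iuu Puu.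
have Ia := itg_upto t mE a_form_itg; have Iv := itg_upto t mE forcing_itg; rewrite -/F in Ia Iv.
have Ir := itg_upto t mE (remainder_itg N); have Ik := itg_upto t mE rate_gap_itg; rewrite -/F in Ir Ik.
set X := \int[mu]_(s in F) (galerkin a s (f s) (u s) (u s) N + galerkin a s (f s) (u s) (u s) N) in Puu.
set Y := \int[mu]_(s in F) (galerkin a s (f s) (u s) (v s) N + galerkin a s (f s) (v s) (u s) N) in Puv.
have J1 := itgB mF Iv Ia; have J2 := itgZl mF 2^-1 Iuu; have J3 := itgD mF J1 J2; have J4 := itgB mF J3 Iuv.
have J5 := itgZl mF (remC M (n := n)) Ir; have J6 := itgD mF Ik J5.
have main := RI_le mF J4 J6.
rewrite (RIB mF J3 Iuv) (RID mF J1 J2) (RIB mF Iv Ia) (RIZl mF _ Iuu) (RID mF Ik J5) (RIZl mF _ Ir) -/X -/Y in main.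
rewrite (hsum_pairing u0 N).
apply: (energy_arith (hsum_sub (u t) (v t) N) _ en_t Puv Puu); first by rewrite -hsum_pairing; exact: hsum_le_nrm.
apply: main => s /FE Es; have [hb he] := ha Es.
have := balance_estimate (f := f s) N n2 M0 C0 (uH Es) (vH Es) (gH Es) (hs Es) (hf Es) hb he.
apply: le_trans; rewrite /rate -/(gap s).
set x1 := vdual _ _; set x2 := a_form _ _ _ _; set x3 := galerkin _ _ _ (u s) (u s) _.
set x4 := galerkin _ _ _ (u s) (v s) _; set x5 := galerkin _ _ _ (v s) (u s) _.
rewrite le_eqVlt; apply/orP; left; apply/eqP; clearbody x1 x2 x3 x4 x5; by field.
Qed.

(** As N grows, the truncation error of the initial energy vanishes because [u0] has finite norm,
    and the remainder vanishes by [remainder_int_cvg]; the factor 2 clears the halves of the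
    energies. *)
Lemma gap_gronwall t : 0 < t -> t < T -> (hnorm2 0 u0 < +oo)%E -> (hnorm2 0 (u t) < +oo)%E ->
  (hnorm2 0 (v t) < +oo)%E -> energy_inequality T a f u0 v ->
  nrm 0 (gap t) <= \int[mu]_(s in upto E t) (2 * rate s * nrm 0 (gap s)).
Proof.
move=> t0 tT fu0 fut fvt en.
have fg : (hnorm2 0 (gap t) < +oo)%E by exact: (hnorm2B fvt fut).1.
have mF := upto_measurable t mE; have Ik := itg_upto t mE rate_gap_itg.
have l1 : (fun N => 2^-1 * hsum (hw 0) (gap t) N) @ \oo --> 2^-1 * nrm 0 (gap t).
  by apply: cvgM; [exact: cvg_cst|exact: nrm_cvg].
have l2 : (fun N => 2^-1 * (nrm 0 u0 - hsum (hw 0) u0 N) +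
    \int[mu]_(s in upto E t) (rate s * nrm 0 (gap s)) +
    remC M (n := n) * \int[mu]_(s in upto E t) remainder (f s) (u s) (v s) N) @ \oo -->
    2^-1 * (nrm 0 u0 - nrm 0 u0) + \int[mu]_(s in upto E t) (rate s * nrm 0 (gap s)) + remC M (n := n) * 0.
  apply: cvgD; last by apply: cvgM; [exact: cvg_cst|exact: remainder_int_cvg].
  apply: cvgD; last exact: cvg_cst.
  apply: cvgM; first exact: cvg_cst.
  by apply: cvgB; [exact: cvg_cst|exact: nrm_cvg].
have h := ler_cvg_to l1 l2 (nearW _ (fun N => gap_growth N t0 tT fvt en)).
have -> : \int[mu]_(s in upto E t) (2 * rate s * nrm 0 (gap s)) =
    2 * \int[mu]_(s in upto E t) (rate s * nrm 0 (gap s)).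
  by rewrite -(RIZl mF 2 Ik); apply: eq_Rintegral => s _; rewrite mulrA.
move: h; rewrite subrr !mulr0 add0r addr0 -ler_pdivrMl//; exact.
Qed.

Lemma gap_zero : 0 < T -> (hnorm2 0 u0 < +oo)%E -> (forall t, 0 < t -> t < T -> (hnorm2 0 (u t) < +oo)%E) ->
  (forall t, 0 < t -> t < T -> (hnorm2 0 (v t) < +oo)%E) -> energy_inequality T a f u0 v ->
  forall t, 0 < t -> t < T -> nrm 0 (gap t) = 0.
Proof.
move=> T0 fu0 fu fv en; have I2 : mu.-integrable E (EFin \o (fun s => 2 * rate s)) by exact: itgZl rate_itg.
have gr t t0 tT := @gap_gronwall t t0 tT fu0 (fu t t0 tT) (fv t t0 tT) en.
have rate0 s : 0 <= rate s.
  rewrite mulr_ge0 ?nrm_ge0// /stabC; apply: mulr_ge0; last exact: sqr_ge0.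
  by rewrite mulr_ge0// ltW.
(* The bound [4 * K] on the gap is known on [E], while [gronwall_zero] asks for a bound at every
   interior time; inserting it into the integral inequality supplies one. *)
apply: (@gronwall_zero R T E (fun s => 2 * rate s) _ (4 * K * \int[mu]_(s in E) (2 * rate s)) fE T0 I2).
- by move=> s _; rewrite mulr_ge0.
- exact: gap0_measurable.
- move=> t t0 tT; rewrite nrm_ge0/=; apply: le_trans (gr t t0 tT) _.
  have mF := upto_measurable t mE; have IE := itgZl mE (4 * K) I2.
  rewrite -(RIZl mE (4 * K) I2) -(RI_upto_end t _ fE); apply: RI_le => //.
  + have Ig : mu.-integrable E (EFin \o (fun s => 2 * rate s * nrm 0 (gap s))).
      by apply: (itg_eq mE _ (itgZl mE 2 rate_gap_itg)) => s _; rewrite mulrA.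
    have hb := @itg_bddM _ _ _ mu E mE _ (fun s => before s t) 1 Ig.
    have hb' := hb (measurable_funTS (before_measurable1 t)) (fun x _ => before_le1 x t).
    by apply: (itg_eq mE _ hb') => s _; rewrite mulrC.
  + move=> s Es; rewrite [leRHS]mulrC -[leLHS]mulrA; apply: ler_wpM2l; first by rewrite mulr_ge0.
    apply: le_trans (gap_bound Es); rewrite /before; case: (s < t); rewrite ?mulr1 ?mulr0//; exact: nrm_ge0.
- exact: gr.
Qed.

End Stability.

Lemma nrm0_coef (R : realType) (n : nat) (w : vdistr R n) i p : (hnorm2 0 w < +oo)%E -> nrm 0 w = 0 -> w i (trp p) = 0.
Proof.
move=> fw w0; have h := comp_le_hsum w (xnorm p.1) i (hw_ge0 0).
have h2 := le_trans h (hsum_le_nrm (xnorm p.1) fw); rewrite w0 in h2.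
have pN : p \in modes (xnorm p.1) by rewrite mem_modes.
have h0 q : 0 <= hw 0 q.1 * w i (trp q) ^+ 2 :> R by rewrite mulr_ge0 ?hw_ge0 ?sqr_ge0.
have : w i (trp p) ^+ 2 <= 0.
  apply: le_trans h2; rewrite (big_rem p)//= hw0 mul1r lerDl; apply: sumr_ge0 => q _; exact: h0.
by rewrite real_exprn_even_le0 ?num_real//= => /eqP.
Qed.

Lemma continuous_zero_closure (R : realType) (c : R -> R) (T t : R) : 0 < T -> {within `[0, T], continuous c} ->
  (forall s, 0 < s -> s < T -> c s = 0) -> t \in `[0, T] -> c t = 0.
Proof.
move=> T0 cc c0; have [_ h0 hT] := (continuous_within_itvP c T0).1 cc.
rewrite in_itv/= => /andP[t0 tT].
have [->|tn0] := eqVneq t 0.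
  have z : c x @[x --> 0^'+] --> 0.
    apply: cvg_near_cst; near=> x; apply: c0; near: x; [exact: nbhs_right_gt|exact: nbhs_right_lt].
  exact: (cvg_unique _ h0 z).
have [->|tnT] := eqVneq t T.
  have z : c x @[x --> T^'-] --> 0.
    apply: cvg_near_cst; near=> x; apply: c0; near: x; [exact: nbhs_left_gt|exact: nbhs_left_lt].
  exact: (cvg_unique _ hT z).
by apply: c0; rewrite lt_neqAle ?tnT// eq_sym tn0.
Unshelve. all: by end_near. Qed.

Theorem theorem3p6 (R : realType) (n : nat) (T : R) (a : viscosity R n)
    (f : R -> vdistr R n) (u0 : vdistr R n) (u v : R -> vdistr R n) :
  (2 <= n)%N -> 0 < T ->
  visc_Linf T a -> visc_symmetric T a -> relaxed_elliptic T a ->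
  Lq_time 2%:E T (-1) (Hdot (-1)) f ->
  Hdot_sigma 0 u0 ->
  Serrin_solution T a f u0 u ->
  weak_solution T a f u0 v ->
  energy_inequality T a f u0 v ->
  forall t, t \in `[0, T] -> eq_vdistr (u t) (v t).
Proof.
move=> n2 T0 ha _ he hf hu0 [wu su] wv en.
have [E1 [Ku [Du tu]]] := trajectory_exists n2 T0 hu0 wu.
have [E2 [Kv [Dv tv]]] := trajectory_exists n2 T0 hu0 wv.
have finH w : Hdot (-1) w -> (@hnorm2 R n (-1) w < +oo)%E by move=> [[_ ?] _].
have [E3 [f3 H3 m3 i3]] := Lq2_integrable finH hf.
have [E4 [f4 H4 m4 i4]] := Lq2_integrable (@Hdot_sigma_fin R n (n%:R / 2)) su.
have [E5 [M [C [f5 M0 C0 H5]]]] := tensor_full ha he.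
pose E := ((E1 `&` E2) `&` (E3 `&` E4)) `&` E5.
have fE : full T E by do !apply: fullI => //; [exact: traj_full tu|exact: traj_full tv].
have EE1 : E `<=` E1 by move=> t [[[]]].
have EE2 : E `<=` E2 by move=> t [[[]]].
have EE3 : E `<=` E3 by move=> t [[_ []]].
have EE4 : E `<=` E4 by move=> t [[_ []]].
have EE5 : E `<=` E5 by move=> t [].
have [mE _ _] := fE; have [mE3 _ _] := f3; have [mE4 _ _] := f4.
pose K := `|Ku| + `|Kv|.
have KuK : Ku <= K by apply: le_trans (ler_norm _) _; rewrite lerDl.
have KvK : Kv <= K by apply: le_trans (ler_norm _) _; rewrite lerDr.
have tu' := trajectory_sub fE EE1 KuK tu; have tv' := trajectory_sub fE EE2 KvK tv.
have [_ _ [Hu cu] _ _] := wu; have [_ _ [Hv cv] _ _] := wv.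
have fin (w : R -> vdistr R n) (h : forall t, t \in `[0, T] -> Hdot_sigma 0 (w t)) z : 0 < z -> z < T ->
    (hnorm2 0 (w z) < +oo)%E.
  by move=> z0 zT; apply: Hdot_sigma_fin; apply: h; rewrite in_itv/= !ltW.
have zero s : 0 < s -> s < T -> nrm 0 (vsub (v s) (u s)) = 0.
  apply: (gap_zero n2 M0 C0 tu' tv' _ _ _ _ _ _ T0 (Hdot_sigma_fin hu0) (fin u Hu) (fin v Hv) en).
  - by move=> t /EE3/H3/finH.
  - exact: (time_measurableS mE3 EE3 m3).
  - exact: (integrableS mE3 mE EE3 i3).
  - by move=> t /EE4/H4/Hdot_sigma_fin.
  - exact: (integrableS mE4 mE EE4 i4).
  - by move=> t /EE5/H5.
move=> t tT i; apply: pd_eq; [exact: leq_trans n2| | |].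
- exact: Hdot_sigma_pd (Hu t tT) i.
- exact: Hdot_sigma_pd (Hv t tT) i.
move=> p; apply/eqP; rewrite eq_sym -subr_eq0; apply/eqP.
(* The gap vanishes at interior times; weak continuity of both solutions extends this, coefficient
   by coefficient, to 0 and [T]. *)
apply: (@continuous_zero_closure R (fun s => v s i (trp p) - u s i (trp p)) T t T0) => //.
  move=> s; apply: cvgB.
    exact: (@weakly_continuous_coef R n T v i p n2 (conj Hv cv) s).
  exact: (@weakly_continuous_coef R n T u i p n2 (conj Hu cu) s).
move=> s s0 sT; apply: (@nrm0_coef R n (vsub (v s) (u s)) i p _ (zero s s0 sT)).
exact: (hnorm2B (fin v Hv s s0 sT) (fin u Hu s s0 sT)).1.
Qed.
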